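(* Assume that $\Omega$ is an open set in $\mathbb{R}^n$, with $n\ge2$. Let $\Phi$ and $\Psi$ be $n$-dimensional Young functions. Assume that $\Phi$ is non-degenerate and $$\int^\infty\Big(\frac{t}{\Phi_\circ(t)}\Big)^{\frac1{n-1}}dt=\infty .$$ Let $f:\mathbb{R}\to\mathbb{R}$ be a locally Lipschitz continuous function such that $f(0)=0$ and $|f'(t)|\le\kappa E(\kappa|t|)$ for a.e. $t\in\mathbb{R}$, for some constant $\kappa>0$ and some non-decreasing continuous function $E:[0,\infty)\to[0,\infty)$ not identically $0$. Let $\vartheta:\mathbb{R}^n\to[0,\infty)$ be the function implicitly defined by $$\Phi_n(\vartheta(\xi))=\Phi\Big(\frac{\xi}{E(\vartheta(\xi))}\Big)\quad\text{for }\xi\in\mathbb{R}^n .$$ Let $T_f(u)=f\circ u$. (i) Assume that $|\Omega|<\infty$. If there exists a constant $c>0$ such that $$\Psi(\xi)\le c+\Phi\Big(\frac{\xi}{E(\vartheta(\xi))}\Big)\quad\text{for }\xi\in\mathbb{R}^n,$$ then $T_f$ maps $V^{1,\Phi}_0(\Omega)$ into $V^{1,\Psi}_0(\Omega)$ and is continuous in the modular topology. (ii) Assume that $$\int_0\Big(\frac{t}{\Phi_\circ(t)}\Big)^{\frac1{n-1}}dt<\infty .$$ If $$\Psi(\xi)\le\Phi\Big(\frac{\xi}{E(\vartheta(\xi))}\Big)\quad\text{for }\xi\in\mathbb{R}^n,$$ then $T_f$ maps $V^{1,\Phi}_0(\Omega)$ into $V^{1,\Psi}_0(\Omega)$ and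 is continuous in the modular topology.
   Context: An $n$-dimensional Young function is a function $\Phi:\mathbb{R}^n\to[0,\infty]$ which is convex, even, lower semicontinuous, finite in a neighborhood of $0$, with $\Phi(0)=0$ and $\lim_{|\xi|\to\infty}\Phi(\xi)=\infty$. It is non-degenerate if $\Phi(\xi)>0$ for $\xi\ne0$. The function $\Phi_\circ$ on $[0,\infty)$ is the Young function (convex, left-continuous, vanishing at $0$, non-constant) satisfying $|\{\xi\in\mathbb{R}^n:\Phi_\circ(|\xi|)\le t\}|=|\{\xi\in\mathbb{R}^n:\Phi(\xi)\le t\}|$ for $t\ge0$. The symbols $\int^\infty$ and $\int_0$ refer to convergence or divergence of the integral at infinity and at zero, respectively. If $\int_0(t/\Phi_\circ(t))^{1/(n-1)}dt<\infty$, the Sobolev conjugate of $\Phi$ is $\Phi_n(t)=\Phi_\circ(H_\Phi^{-1}(t))$ for $t\ge0$, where $H_\Phi(s)=\Big(\int_0^s\big(\tfrac{t}{\Phi_\circ(t)}\big)^{\frac1{n-1}}dt\Big)^{1/n'}$, $n'=n/(n-1)$, and $H_\Phi^{-1}$ is the (generalized left-continuous) inverse. If this integral diverges at zero (which may occur in part (i)), $\Phi_n$, and hence $\vartheta$, are defined with $\Phi$ modified near zero (i.e. replaced by an $n$-dimensional Young function agreeing with $\Phi$ outside a bounded neighborhood of $0$) in such a way that the integral converges at zero. For every $\xi$, the number $\vartheta(\xi)$ is the unique $t\ge0$ with $\Phi_n(t)=\Phi(\xi/E(t))$: the function $\Phi_n$ is continuous and strictly increasing from $0$ to $\infty$, whereas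 $t\mapsto\Phi(\xi/E(t))$ is (regarded as) continuous and non-increasing; this is automatic when $\Phi$ is finite-valued. Here $\Phi(\xi/0)=\infty$ for $\xi\neq0$, and for $\xi=0$ one has $\vartheta(0)=0$ and the right-hand side is $0$. $L^\Phi(\Omega,\mathbb{R}^n)$ is the space of measurable $U:\Omega\to\mathbb{R}^n$ with $\int_\Omega\Phi(U/\lambda)\,dx<\infty$ for some $\lambda>0$; $U_k\to U$ modularly in it if there is $\lambda>0$ with $\lim_k\int_\Omega\Phi((U_k-U)/\lambda)\,dx=0$. For $u:\Omega\to\mathbb{R}$ let $\widehat u$ be its extension by $0$ to $\mathbb{R}^n$. $V^{1,\Phi}_0(\Omega)$ consists of the measurable $u$ on $\Omega$ such that $\widehat u\in W^{1,1}_{loc}(\mathbb{R}^n)$, $\nabla\widehat u\in L^\Phi(\mathbb{R}^n,\mathbb{R}^n)$ and $|\{x\in\mathbb{R}^n:|\widehat u(x)|>t\}|<\infty$ for every $t>0$; $u_k\to u$ modularly in $V^{1,\Phi}_0(\Omega)$ means $\nabla u_k\to\nabla u$ modularly in $L^\Phi(\Omega,\mathbb{R}^n)$. Continuity of $T_f$ in the modular topology means that modular convergence $u_k\to u$ in the domain space implies modular convergence $f(u_k)\to f(u)$ in the target space. *)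

(* Defs.v *)
From HB Require Import structures.
From mathcomp Require Import all_boot all_order all_algebra.
From mathcomp Require Import all_classical all_reals all_analysis.

Set Implicit Arguments.
Unset Strict Implicit.
Unset Printing Implicit Defensive.

Import Order.TTheory GRing.Theory Num.Theory.
Import numFieldNormedType.Exports.

Local Open Scope classical_set_scope.
Local Open Scope ring_scope.

(* The sigma-algebra on R^n generated by the coordinate maps, i.e. the Borel
   sets; same construction as the library's instance for n.-tuple. *)
Section measurable_rV.
Context {R : realType} (n : nat).

Definition rV_coord (i : 'I_n) (x : 'rV[R]_n) : R := x ord0 i.

Let rV_set0 : g_sigma_preimage rV_coord set0.
Proof. exact: sigma_algebra0. Qed.

Let rV_setC A : g_sigma_preimage rV_coord A -> g_sigma_preimage rV_coord (~` A).
Proof. exact: sigma_algebraC. Qed.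

Let rV_bigcup (F : _^nat) : (forall i, g_sigma_preimage rV_coord (F i)) ->
  g_sigma_preimage rV_coord (\bigcup_i (F i)).
Proof. exact: sigma_algebra_bigcup. Qed.

Definition measure_rV_display : measure_display -> measure_display.
Proof. exact. Qed.

HB.instance Definition _ := @isMeasurable.Build
  (measure_rV_display default_measure_display)
  'rV[R]_n (g_sigma_preimage rV_coord) rV_set0 rV_setC rV_bigcup.

Lemma measurable_rV_coord (i : 'I_n) :
  measurable_fun [set: 'rV[R]_n] (rV_coord i).
Proof.
move=> _ Y mY; rewrite setTI; apply: sub_sigma_algebra => /=.
rewrite -bigcup_seq/=; exists i => /=; first by rewrite mem_index_enum.
by exists Y => //; rewrite setTI.
Qed.

Lemma measurable_fun_rVP d (T : measurableType d) (g : T -> 'rV[R]_n) :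
  (forall i, measurable_fun [set: T] (rV_coord i \o g)) ->
  measurable_fun [set: T] g.
Proof.
move=> mg _ Y; rewrite setTI => mY.
suff : g_sigma_preimage rV_coord `<=` [set A | measurable (g @^-1` A)].
  by apply.
apply: smallest_sub.
  split=> /=.
  - by rewrite preimage_set0.
  - by move=> A mA; rewrite setTD preimage_setC; exact: measurableC.
  - by move=> F mF; rewrite preimage_bigcup; exact: bigcup_measurable.
move=> A; rewrite -bigcup_seq => -[i _ [B mB <-]] /=.
by rewrite setTI -[_ @^-1` _]setTI; exact: mg.
Qed.

End measurable_rV.

Section lebesgue_rV.
Context {R : realType}.

Definition rV_cons n (p : measurableTypeR R * 'rV[R]_n) : 'rV[R]_n.+1 :=
  \row_i if unlift ord0 i is Some j then p.2 ord0 j else p.1.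

Definition rV_uncons n (x : 'rV[R]_n.+1) : measurableTypeR R * 'rV[R]_n :=
  (x ord0 ord0, \row_i x ord0 (lift ord0 i)).

Lemma rV_consK n : cancel (@rV_cons n) (@rV_uncons n).
Proof.
move=> [x v]; rewrite /rV_uncons mxE unlift_none; congr pair.
by apply/rowP => i; rewrite !mxE liftK.
Qed.

Lemma measurable_rV_cons n : measurable_fun setT (@rV_cons n).
Proof.
apply: measurable_fun_rVP => i.
case: (unliftP ord0 i) => [j|] ->.
  rewrite (_ : _ \o _ = rV_coord j \o snd).
    exact: measurableT_comp (measurable_rV_coord j) measurable_snd.
  by apply/funext => p /=; rewrite /rV_coord mxE liftK.
rewrite (_ : _ \o _ = fst); first exact: measurable_fst.
by apply/funext => p /=; rewrite /rV_coord mxE unlift_none.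
Qed.

Lemma measurable_rV_uncons n : measurable_fun setT (@rV_uncons n).
Proof.
apply/measurable_fun_pairP; split => /=.
  exact: measurable_rV_coord.
apply: measurable_fun_rVP => i.
rewrite (_ : _ \o _ = rV_coord (lift ord0 i)); first exact: measurable_rV_coord.
by apply/funext => x /=; rewrite /rV_coord mxE.
Qed.

Section step.
Context n (mu : {sigma_finite_measure set 'rV[R]_n -> \bar R}).

Definition rV_measureS : set 'rV[R]_n.+1 -> \bar R :=
  pushforward (lebesgue_measure \x mu)%E (@rV_cons n).

Let rV_measureS0 : rV_measureS set0 = 0%E.
Proof. by rewrite /rV_measureS /pushforward preimage_set0 measure0. Qed.

Let rV_measureS_ge0 A : (0 <= rV_measureS A)%E.
Proof. by rewrite /rV_measureS /pushforward; exact: measure_ge0. Qed.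

Let rV_measureS_sigma_additive : semi_sigma_additive rV_measureS.
Proof.
move=> F mF tF mUF; rewrite /rV_measureS /pushforward preimage_bigcup.
apply: measure_semi_sigma_additive.
- by move=> k; rewrite -[X in measurable X]setTI; exact: measurable_rV_cons.
- apply/trivIsetP => /= i j _ _ ij; rewrite -preimage_setI.
  by move/trivIsetP : tF => /(_ _ _ _ _ ij) ->//; rewrite preimage_set0.
- rewrite -preimage_bigcup -[X in measurable X]setTI.
  exact: measurable_rV_cons.
Qed.

HB.instance Definition _ := isMeasure.Build _ _ _ rV_measureS
  rV_measureS0 rV_measureS_ge0 rV_measureS_sigma_additive.

Let rV_measureS_sigma_finite : sigma_finite setT rV_measureS.
Proof.
have /sigma_finiteP[F [FT ndF Foo]] := sigma_finiteT (@lebesgue_measure R).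
have /sigma_finiteP[G [GT ndG Goo]] := sigma_finiteT mu.
exists (fun k => @rV_uncons n @^-1` (F k `*` G k)).
  apply/esym/seteqP; split=> // x _.
  have [i _ Fi] : (\bigcup_i F i) (rV_uncons x).1 by rewrite -FT.
  have [j _ Gj] : (\bigcup_i G i) (rV_uncons x).2 by rewrite -GT.
  exists (maxn i j) => //; split.
    by move: (_.1) Fi; exact/subsetPset/ndF/leq_maxl.
  by move: (_.2) Gj; exact/subsetPset/ndG/leq_maxr.
move=> k; have [mF Fk] := Foo k; have [mG Gk] := Goo k; split.
  rewrite -[X in measurable X]setTI; apply: measurable_rV_uncons => //.
  exact: measurableX.
rewrite /rV_measureS /pushforward -comp_preimage.
rewrite (_ : _ \o _ = id); last by apply/funext => p /=; exact: rV_consK.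
rewrite preimage_id product_measure1E//.
by rewrite lte_mul_pinfty// ge0_fin_numE.
Qed.

HB.instance Definition _ := @Measure_isSigmaFinite.Build _ _ _
  rV_measureS rV_measureS_sigma_finite.

End step.

Fixpoint borel_lebesgue n : {sigma_finite_measure set 'rV[R]_n -> \bar R} :=
  if n is n'.+1 then rV_measureS (borel_lebesgue n') else \d_(0 : 'rV[R]_0).

Definition lebesgue_rV (n : nat) :=
  @completed_measure_extension _ _ R (borel_lebesgue n).

HB.instance Definition _ n := Measure.on (@lebesgue_rV n).

End lebesgue_rV.

Arguments lebesgue_rV R n : clear implicits.

Section definitions.
Context {R : realType}.
Implicit Types (A : R -> \bar R) (E f : R -> R).

Definition lebesgue_measurable_fun n (D : set 'rV[R]_n) d
    (T : measurableType d) (g : 'rV[R]_n -> T) :=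
  measurable_fun (D : set (caratheodory_type (@borel_lebesgue R n)^*%mu)) g.

(* Euclidean norm; the library's norm on 'rV[R]_n is the sup norm. *)
Definition enorm n (x : 'rV[R]_n) : R := Num.sqrt (\sum_i x ord0 i ^+ 2).

Record young_rV n (Phi : 'rV[R]_n -> \bar R) : Prop := YoungRV {
  young_rV_ge0 : forall x, (0 <= Phi x)%E ;
  young_rV_convex : forall (t : R) x y, 0 <= t <= 1 ->
    (Phi (t *: x + (1 - t) *: y)%R <= t%:E * Phi x + (1 - t)%:E * Phi y)%E ;
  young_rV_even : forall x, Phi (- x) = Phi x ;
  young_rV_lsc : lower_semicontinuous Phi ;
  young_rV_fin : \forall x \near (0 : 'rV[R]_n), (Phi x < +oo)%E ;
  young_rV_0 : Phi 0 = 0%E ;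
  young_rV_cvgy : forall M : R, exists r : R, forall x,
    r < enorm x -> (M%:E < Phi x)%E }.

Definition nondegenerate_young n (Phi : 'rV[R]_n -> \bar R) :=
  forall x, x != 0 -> (0 < Phi x)%E.

(* Young functions on [0, +oo[; the values at negative reals are irrelevant. *)
Record young A : Prop := Young {
  young_ge0 : forall t, 0 <= t -> (0 <= A t)%E ;
  young_convex : forall t x y : R, 0 <= t <= 1 -> 0 <= x -> 0 <= y ->
    (A (t * x + (1 - t) * y)%R <= t%:E * A x + (1 - t)%:E * A y)%E ;
  young_left_continuous : forall t, 0 < t -> A s @[s --> t^'-] --> A t ;
  young_0 : A 0 = 0%E ;
  young_nonconstant : exists2 t, 0 <= t & A t != A 0 }.

(* [A] is the function written Phi_circ. *)
Definition young_symmetral n (Phi : 'rV[R]_n -> \bar R) A :=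
  young A /\ forall t : R, 0 <= t ->
    lebesgue_rV R n [set x | (A (enorm x) <= t%:E)%E] =
    lebesgue_rV R n [set x | (Phi x <= t%:E)%E].

(* In \bar R, t / 0 = +oo for t > 0 and t / +oo = 0. *)
Definition sobolev_integrand (n : nat) A (t : R) : \bar R :=
  ((t%:E / A t) `^ (n%:R - 1)^-1)%E.

Definition converges_at_0 (n : nat) A :=
  exists2 a : R, 0 < a &
    (\int[@lebesgue_measure R]_(t in [set` `]0, a[%R])
       sobolev_integrand n A t < +oo)%E.

Definition diverges_at_infty (n : nat) A := forall a : R, 0 < a ->
  (\int[@lebesgue_measure R]_(t in [set` `]a, +oo[%R])
     sobolev_integrand n A t = +oo)%E.

(* The exponent (n - 1) / n is 1 / n'. *)
Definition sobolev_H (n : nat) A (s : R) : \bar R :=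
  ((\int[@lebesgue_measure R]_(t in [set` `]0, s[%R]) sobolev_integrand n A t)
    `^ ((n%:R - 1) / n%:R))%E.

Definition sobolev_Hinv (n : nat) A (t : R) : \bar R :=
  ereal_inf
    [set s%:E | s in [set s : R | 0 <= s /\ (t%:E <= sobolev_H n A s)%E]].

(* [A] is extended to +oo by A(+oo) = +oo. *)
Definition sobolev_conjugate (n : nat) A (t : R) : \bar R :=
  if sobolev_Hinv n A t is s%:E then A s else +oo%E.

(* [Phi1], with symmetral [A1], is the function from which the Sobolev conjugate
   of [Phi], with symmetral [A], is built: [Phi] itself if the integral
   converges at zero, and otherwise any modification of [Phi] in a bounded
   neighbourhood of the origin for which it converges. *)
Definition regular_at_0 n (Phi : 'rV[R]_n -> \bar R) A Phi1 A1 :=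
  [/\ young_rV Phi1, young_symmetral Phi1 A1, converges_at_0 n A1,
      exists r : R, forall x, r < enorm x -> Phi1 x = Phi x &
      converges_at_0 n A -> Phi1 = Phi].

(* Phi (x / e) for e >= 0, with the conventions for e = 0. *)
Definition young_quotient n (Phi : 'rV[R]_n -> \bar R) x (e : R) : \bar R :=
  if x == 0 then 0%E else if e == 0 then +oo%E else Phi (e^-1 *: x).

Definition implicit_theta n (Phi : 'rV[R]_n -> \bar R) (Phin : R -> \bar R) E
    (theta : 'rV[R]_n -> R) :=
  forall x, 0 <= theta x /\
    Phin (theta x) = young_quotient Phi x (E (theta x)).

Definition orlicz n (Phi : 'rV[R]_n -> \bar R) (Omega : set 'rV[R]_n)
    (U : 'rV[R]_n -> 'rV[R]_n) :=
  lebesgue_measurable_fun Omega U /\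
  exists2 lambda : R, 0 < lambda &
    (\int[lebesgue_rV R n]_(x in Omega) Phi (lambda^-1 *: U x)%R < +oo)%E.

Definition orlicz_modular_cvg n (Phi : 'rV[R]_n -> \bar R)
    (Omega : set 'rV[R]_n) (U_ : nat -> 'rV[R]_n -> 'rV[R]_n)
    (U : 'rV[R]_n -> 'rV[R]_n) :=
  exists2 lambda : R, 0 < lambda &
    (\int[lebesgue_rV R n]_(x in Omega) Phi (lambda^-1 *: (U_ k x - U x))%R)%E
      @[k --> \oo] --> 0%E.

Definition L1loc n (v : 'rV[R]_n -> R) :=
  lebesgue_measurable_fun setT v /\
  forall K, compact K -> (lebesgue_rV R n).-integrable K (EFin \o v).

Definition partials n (s : seq 'I_n) (phi : 'rV[R]_n -> R) : 'rV[R]_n -> R :=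
  foldr (fun i g => 'D_(delta_mx ord0 i) g) phi s.

Definition test_function n (phi : 'rV[R]_n -> R) :=
  (forall s x, differentiable (partials s phi) x) /\
  exists2 K, compact K & forall x, ~ K x -> phi x = 0.

(* v \in W^{1,1}_loc(R^n), with (a version of the) weak gradient [G]. *)
Definition weak_gradient n (v : 'rV[R]_n -> R) (G : 'rV[R]_n -> 'rV[R]_n) :=
  [/\ L1loc v, forall i, L1loc (fun x => G x ord0 i) &
    forall phi i, test_function phi ->
      (\int[lebesgue_rV R n]_x (v x * 'D_(delta_mx ord0 i) phi x)%:E =
       - \int[lebesgue_rV R n]_x (G x ord0 i * phi x)%:E)%E].

(* [u \_ Omega] is the extension of u by 0 outside Omega. *)
Definition V10 n (Phi : 'rV[R]_n -> \bar R) (Omega : set 'rV[R]_n)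
    (u : 'rV[R]_n -> R) :=
  [/\ lebesgue_measurable_fun Omega u,
      exists2 G, weak_gradient (u \_ Omega) G & orlicz Phi setT G &
      forall t : R, 0 < t ->
        (lebesgue_rV R n [set x | (t < `|(u \_ Omega) x|)%R] < +oo)%E].

(* Weak gradients are unique almost everywhere, so the choice of versions is
   immaterial. *)
Definition V10_modular_cvg n (Phi : 'rV[R]_n -> \bar R)
    (Omega : set 'rV[R]_n) (u_ : nat -> 'rV[R]_n -> R) (u : 'rV[R]_n -> R) :=
  exists G_ G, [/\ forall k, weak_gradient (u_ k \_ Omega) (G_ k),
    weak_gradient (u \_ Omega) G & orlicz_modular_cvg Phi Omega G_ G].

Definition composition_maps n (Omega : set 'rV[R]_n)
    (Phi Psi : 'rV[R]_n -> \bar R) f :=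
  forall u, V10 Phi Omega u -> V10 Psi Omega (f \o u).

Definition composition_modular_continuous n (Omega : set 'rV[R]_n)
    (Phi Psi : 'rV[R]_n -> \bar R) f :=
  forall (u_ : nat -> 'rV[R]_n -> R) u,
    (forall k, V10 Phi Omega (u_ k)) -> V10 Phi Omega u ->
    V10_modular_cvg Phi Omega u_ u ->
    V10_modular_cvg Psi Omega (fun k => f \o u_ k) (f \o u).

End definitions.

(* Main.v *)
(** Write [N] for the Sobolev conjugate. The implicit definition of [theta] yields
    [Psi (E t * xi) <= c + Phi xi + N t] for all [t >= 0], so [Psi] of a multiple of
    the gradient [f'(u) * grad u] is controlled by [c], [Phi (grad u)] and
    [N (kappa * |u|)]. The last term is integrable by an anisotropic Orlicz-Sobolev
    inequality, and its integral tends to 0 along modularly null sequences. This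
    inequality is proved by a truncation argument: translating a superlevel set of
    [u] by vectors of the polar of a sublevel set of [Phi] bounds the decay of the
    distribution function of [u] by the energy between two levels, and a dyadic
    sum over the levels gives the modular inequality.

    The chain rule holds because Sobolev functions are absolutely continuous on
    almost every line. For continuity, pass to subsequences with almost everywhere
    convergence and dominate; as [f'] is only measurable, the convergence
    [f'(u_k) -> f'(u)] almost everywhere on [{grad u <> 0}] is obtained from weak
    convergence of [g(u_k) grad u_k] for bounded measurable [g] and convergence of
    the corresponding squares. *)

Require Import Defs.
From mathcomp Require Import all_boot all_order all_algebra.
From mathcomp Require Import all_classical all_reals all_analysis.
From mathcomp Require Import measurable_realfun.
From mathcomp Require Import ring lra.

Import Order.TTheory GRing.Theory Num.Theory.
Import numFieldNormedType.Exports.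

Set Implicit Arguments.
Unset Strict Implicit.
Unset Printing Implicit Defensive.

Local Open Scope classical_set_scope.
Local Open Scope ring_scope.

(** * Borel sets and Lebesgue measure on row vectors *)

Section borel_rV.
Context {R : realType} {n : nat}.
Local Notation V := 'rV[R]_n.

(** No doubling condition is available, so integrability at one scale says nothing about another
    scale. The estimate on [N (kappa * |u|)] must nevertheless hold for every [kappa], although
    [Phi] of the gradient is integrable at one scale only. It does, because a band of levels whose
    energy is below a threshold depending on [kappa] obeys the modular bound, and the energies of
    disjoint bands are summable; the finitely many other bands have finite volume and bounded [N].
    For continuity the total energy itself falls below the threshold. Divergence of the kernel at
    infinity keeps [N] finite, and nondegeneracy of [Phi] yields almost everywhere convergence of
    gradients along subsequences.

    If the kernel diverges at zero, [N] belongs to a modified function [Phi1], and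
    [Phi1 (xi / 2) <= c + Phi xi]. The constant is charged on [Omega] only, outside of which
    gradients vanish. Requiring that [c] times the measure of [Omega] be finite covers both parts at
    once, with [c = 0] in the second. *)

Lemma measurable_rV_ball (x : V) (e : R) : measurable (ball x e : set 'rV[R]_n).
Proof.
have [e0|e0] := ltP 0 e; last first.
  rewrite (_ : ball x e = set0)//; apply/seteqP; split => // y [].
  by move=> /lt_le_trans /(_ e0); rewrite ltxx.
rewrite (_ : ball x e =
    \bigcap_(i in [set: 'I_n]) (rV_coord i @^-1` ball (x ord0 i) e)).
  apply: fin_bigcap_measurable => // i _.
  rewrite -[X in measurable X]setTI; apply: measurable_rV_coord => //.
  exact: open_measurable (ball_open _ _).
apply/seteqP; split => [y [_ xy] i _|y xy]; first exact: xy.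
by split => // i j; rewrite (ord1 i); exact: xy.
Qed.

(** The sigma-algebra is generated by coordinates, so openness enters through a countable base:
    balls of radius [1 / k.+1] centred at rational points. *)
Lemma open_measurable_rV (A : set V) : open A -> measurable A.
Proof.
move=> oA.
pose B (p : 'rV[rat]_n * nat) : set V :=
  ball (map_mx ratr p.1 : V) (p.2.+1%:R^-1).
rewrite (_ : A = \bigcup_(p in [set p | B p `<=` A]) B p).
  rewrite bigcup_mkcond; apply: countable_bigcupT_measurable => // p.
  by case: ifPn => _; [exact: measurable_rV_ball|exact: measurable0].
apply/seteqP; split => [x Ax|x [p /= BA] /BA//].
have /nbhs_ballP[e /= e0 xeA] : nbhs x A by exact: open_nbhs_nbhs.
have [k ke] : exists k : nat, k.+1%:R^-1 < e / 2.
  have [k _ hk] := near_infty_natSinv_lt (PosNum (divr_gt0 e0 (ltr0n R 2))).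
  by exists k; exact: (hk k (leqnn _)).
have k0 : (0 : R) < k.+1%:R^-1 by rewrite invr_gt0.
have /choice[q hq] : forall i, exists q,
    ball (x ord0 i) (k.+1%:R^-1) (ratr q : R).
  move=> i.
  have [||y [By [q _ qy]]] := @dense_rat R (ball (x ord0 i) k.+1%:R^-1).
  - by exists (x ord0 i); exact: ballxx.
  - exact: ball_open.
  - by exists q; rewrite qy.
exists (\row_i q i, k) => /=.
  apply: subset_trans xeA => y /= By.
  rewrite [e]splitr.
  apply: (@ball_triangle _ _ (map_mx ratr (\row_i q i) : 'rV[R]_n)).
    split=> [|i j]; first exact: divr_gt0.
    rewrite (ord1 i) !mxE.
    by apply: (@le_ball _ _ _ (k.+1%:R^-1)) => //; exact: ltW.
  by apply: le_ball By; exact: ltW.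
by split=> // i j; rewrite (ord1 i) !mxE; exact/ball_sym.
Qed.

Lemma closed_measurable_rV (A : set V) : closed A -> measurable A.
Proof.
move=> cA; rewrite -(setCK A); apply: measurableC.
by apply: open_measurable_rV; exact: closed_openC.
Qed.

Lemma continuous_measurable_rV (f : V -> R) :
  continuous f -> measurable_fun setT f.
Proof.
move=> cf; apply: (measurability _ (RGenOpens.measurableE R)).
move=> _ [_ [a [b ->]] <-]; rewrite setTI; apply: open_measurable_rV.
by apply: open_comp => [x _|]; [exact: cf|exact: interval_open].
Qed.

Lemma lower_semicontinuous_measurable_rV (f : V -> \bar R) :
  lower_semicontinuous f -> measurable_fun setT f.
Proof.
move=> scif; apply: (measurability _ (ErealGenOInfty.measurableE R)).
move=> /= _ [_ [a ->]] <-; apply: measurableI => //; apply: open_measurable_rV.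
by rewrite preimage_itvoy; move/lower_semicontinuousP : scif; exact.
Qed.

Lemma measurable_addrV (a : V) : measurable_fun setT (fun x : V => x + a).
Proof.
apply: measurable_fun_rVP => i.
rewrite (_ : _ \o _ = rV_coord i \+ cst (a ord0 i)); last first.
  by apply/funext => x; rewrite /= /rV_coord mxE.
by apply: measurable_funD => //; exact: measurable_rV_coord.
Qed.

Lemma measurable_scalerV (c : R) : measurable_fun setT (fun x : V => c *: x).
Proof.
apply: measurable_fun_rVP => i.
rewrite (_ : _ \o _ = (fun x => c * rV_coord i x)); last first.
  by apply/funext => x; rewrite /= /rV_coord mxE.
by apply: measurable_funM => //; exact: measurable_rV_coord.
Qed.

Section composition.
Context d (T : measurableType d).

Lemma measurable_funD_rV (f g : T -> V) : measurable_fun setT f ->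
  measurable_fun setT g -> measurable_fun setT (fun x => f x + g x).
Proof.
move=> mf mg; apply: measurable_fun_rVP => i.
rewrite (_ : _ \o _ = (rV_coord i \o f) \+ (rV_coord i \o g)); last first.
  by apply/funext => x; rewrite /= /rV_coord mxE.
by apply: measurable_funD; apply: measurableT_comp => //;
  exact: measurable_rV_coord.
Qed.

Lemma measurable_funZ_rV (c : T -> R) (f : T -> V) : measurable_fun setT c ->
  measurable_fun setT f -> measurable_fun setT (fun x => c x *: f x).
Proof.
move=> mc mf; apply: measurable_fun_rVP => i.
rewrite (_ : _ \o _ = (c \* (rV_coord i \o f))); last first.
  by apply/funext => x; rewrite /= /rV_coord mxE.
apply: measurable_funM => //; apply: measurableT_comp => //.
exact: measurable_rV_coord.
Qed.

Lemma measurable_fun_coord (f : T -> V) i : measurable_fun setT f ->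
  measurable_fun setT (fun x => f x ord0 i).
Proof.
by move=> mf; apply: (measurableT_comp (measurable_rV_coord i)).
Qed.

End composition.
End borel_rV.

(** * Translations and dilations of Lebesgue measure *)

Section lebesgue_affine.
Context {R : realType}.
Local Notation mu1 := (@lebesgue_measure R).

Lemma lebesgue_measure_shift (a : R) (A : set (measurableTypeR R)) : measurable A ->
  mu1 [set x | A (x + a)] = mu1 A.
Proof.
have mf : measurable_fun setT (fun x : measurableTypeR R => x + a : measurableTypeR R).
  exact: measurable_funD.
move=> mA; apply/esym.
rewrite -[RHS]/(pushforward mu1 (fun x : measurableTypeR R => x + a : measurableTypeR R) A).
apply/lebesgue_measure_unique => //= _ [[b c]] _ <-.
rewrite /pushforward (_ : _ @^-1` _ = `]b - a, c - a]%classic).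
  by rewrite !lebesgue_measure_itv/= !lte_fin ltrD2r; case: ifP => // _; congr (_%:E); ring.
by apply/seteqP; split=> x /=; rewrite !in_itv/= ltrBlDr lerBrDr.
Qed.

Lemma lebesgue_measure_scale (r : R) (A : set (measurableTypeR R)) : 0 < r -> measurable A ->
  mu1 [set x | A (r^-1 * x)] = (r%:E * mu1 A)%E.
Proof.
move=> r0 mA; pose r' := NngNum (ltW r0).
have mf : measurable_fun setT (fun x : measurableTypeR R => r^-1 * x : measurableTypeR R).
  exact: measurable_funM.
have ri0 : (0 : R) <= r^-1 by rewrite invr_ge0 ltW.
(* The image measure under [x / r], divided by [r], has the values of Lebesgue measure on half-open
   intervals, and these determine it. *)
have -> : mu1 A = mscale (NngNum ri0) (measure_function_pushforward__canonical__measure_function_Measure lebesgue_measure mf) A.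
  apply: lebesgue_measure_unique => // _ [[b c]] _ <-.
  rewrite [RHS]/((r^-1)%:E * mu1 ((fun x : R => r^-1 * x)%R @^-1` `]b, c]%classic))%E.
  rewrite (_ : _ @^-1` _ = `](r * b), (r * c)]%classic).
    rewrite !lebesgue_measure_itv/= !lte_fin (ltr_pM2l r0); case: ifPn => bc.
      by rewrite /= -mulrBr mulrA mulVf ?mul1r// gt_eqF.
    by rewrite /= mulr0.
  apply/seteqP; split=> x /=; rewrite !in_itv/=;
    by rewrite ltr_pdivlMl// ler_pdivrMl.
rewrite /mscale/= muleA -EFinM mulfV ?gt_eqF// mul1e.
by [].
Qed.

Lemma measurable_shift_R (a : R) :
  measurable_fun setT (fun x : measurableTypeR R => x + a : measurableTypeR R).
Proof. exact: measurable_funD. Qed.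

Lemma ge0_integral_shift_R (a : R) (f : R -> \bar R) :
  measurable_fun setT f -> (forall x, 0 <= f x)%E ->
  (\int[mu1]_x f (x + a)%R = \int[mu1]_x f x)%E.
Proof.
move=> mf f0.
rewrite -[LHS](ge0_integral_pushforward (measurable_shift_R a) mu1 measurableT mf)//.
apply: eq_measure_integral => [|m A mA _].
  exact: measurable_shift_R.
exact: (lebesgue_measure_shift a mA).
Qed.

End lebesgue_affine.

Section borel_lebesgue_affine.
Context {R : realType}.
Local Notation mu n := (@borel_lebesgue R n).

Lemma borel_lebesgueSE n (A : set 'rV[R]_n.+1) :
  mu n.+1 A = (\int[lebesgue_measure]_t mu n [set x | A (rV_cons (t, x))])%E.
Proof.
rewrite /= /rV_measureS /pushforward /product_measure1.
apply: eq_integral => t _; congr (mu n _).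
by apply/seteqP; split => x; rewrite /xsection/= inE.
Qed.

Lemma measurable_rV_section n (A : set 'rV[R]_n.+1) (t : R) : measurable A ->
  measurable [set x | A (rV_cons (t, x))].
Proof.
move=> mA; have : measurable_fun setT (fun x : 'rV[R]_n => rV_cons (t : measurableTypeR R, x)).
  apply: measurableT_comp; first exact: measurable_rV_cons.
  exact: measurable_pair1.
by move=> /(_ measurableT _ mA); rewrite setTI.
Qed.

Lemma measurable_rV_section_measure n (A : set 'rV[R]_n.+1) : measurable A ->
  measurable_fun setT (fun t : measurableTypeR R => mu n [set x | A (rV_cons (t, x))]).
Proof.
move=> mA.
have mB : measurable (@rV_cons R n @^-1` A).
  by rewrite -[X in measurable X]setTI; exact: measurable_rV_cons.
apply: eq_measurable_fun (measurable_fun_xsection (mu n) mB) => t _ /=.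
by congr (mu n _); apply/seteqP; split => x; rewrite /xsection/= inE.
Qed.

Lemma rV_consD n (s t : measurableTypeR R) (x y : 'rV[R]_n) :
  rV_cons (s, x) + rV_cons (t, y) = rV_cons (s + t : measurableTypeR R, x + y).
Proof.
by apply/rowP => i; rewrite !mxE; case: unlift => [j|]//=; rewrite !mxE.
Qed.

Lemma rV_consZ n (c : R) (s : measurableTypeR R) (x : 'rV[R]_n) :
  c *: rV_cons (s, x) = rV_cons (c * s : measurableTypeR R, c *: x).
Proof.
by apply/rowP => i; rewrite !mxE; case: unlift => [j|]//=; rewrite !mxE.
Qed.

Lemma rV_unconsK n (x : 'rV[R]_n.+1) : rV_cons (rV_uncons x) = x.
Proof.
apply/rowP => i; rewrite !mxE.
by case: unliftP => [j ->|->]; rewrite /rV_uncons//= mxE.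
Qed.

Lemma borel_lebesgue_shift n (a : 'rV[R]_n) (A : set 'rV[R]_n) : measurable A ->
  mu n [set x | A (x + a)] = mu n A.
Proof.
elim: n a A => [|n IH] a A mA.
  rewrite (_ : [set x | _] = A)//; apply/seteqP; split => x /=;
    by rewrite (_ : x + a = x)//; apply/rowP; case.
rewrite !borel_lebesgueSE.
rewrite -(rV_unconsK a); case: (rV_uncons a) => s y.
under eq_integral => t _.
  rewrite (_ : [set x | _] =
      [set x | [set z | A (rV_cons (t + s : measurableTypeR R, z))] (x + y)]); last first.
    by apply/seteqP; split => x /=; rewrite rV_consD.
  rewrite IH; last exact: measurable_rV_section.
  over.
apply: (ge0_integral_shift_R s (measurable_rV_section_measure mA)).
by move=> x; exact: measure_ge0.
Qed.

Lemma borel_lebesgue_scale n (r : R) (A : set 'rV[R]_n) : 0 < r -> measurable A ->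
  mu n [set x | A (r^-1 *: x)] = ((r ^+ n)%:E * mu n A)%E.
Proof.
move=> r0; elim: n A => [|n IH] A mA.
  rewrite expr0 mul1e (_ : [set x | _] = A)//; apply/seteqP; split => x /=;
    by rewrite (_ : r^-1 *: x = x)//; apply/rowP; case.
rewrite !borel_lebesgueSE.
under eq_integral => t _.
  rewrite (_ : [set x | _] =
      [set x | [set z | A (rV_cons (r^-1 * t : measurableTypeR R, z))] (r^-1 *: x)]); last first.
    by apply/seteqP; split => x /=; rewrite rV_consZ.
  rewrite IH; last exact: measurable_rV_section.
  over.
have mf : measurable_fun setT (fun x : measurableTypeR R => r^-1 * x : measurableTypeR R).
  exact: measurable_funM.
have mG := measurable_rV_section_measure mA.
rewrite ge0_integralZl_EFin//; last 2 first.
- exact: (measurableT_comp mG mf).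
- by rewrite exprn_ge0// ltW.
rewrite -(ge0_integral_pushforward mf lebesgue_measure measurableT mG)//.
rewrite (@eq_measure_integral _ _ _ _ (mscale (NngNum (ltW r0)) lebesgue_measure)); last first.
  by move=> B mB _; rewrite /pushforward /mscale/=; exact: (lebesgue_measure_scale r0 mB).
rewrite ge0_integral_mscale//= muleA -EFinM exprSr//.
Qed.

Lemma ge0_integral_shift_rV n (a : 'rV[R]_n) (f : 'rV[R]_n -> \bar R) :
  measurable_fun setT f -> (forall x, 0 <= f x)%E ->
  (\int[mu n]_x f (x + a)%R = \int[mu n]_x f x)%E.
Proof.
move=> mf f0.
rewrite -[LHS](ge0_integral_pushforward (measurable_addrV a) (mu n) measurableT mf)//.
apply: eq_measure_integral => [|m A mA _].
  exact: measurable_addrV.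
exact: (borel_lebesgue_shift a mA).
Qed.

Lemma integrable_shift_rV n (a : 'rV[R]_n) (f : 'rV[R]_n -> \bar R) :
  (mu n).-integrable setT f -> (mu n).-integrable setT (fun x => f (x + a)).
Proof.
move=> /integrableP[mf fi]; apply/integrableP; split.
  exact: (measurableT_comp mf (measurable_addrV a)).
rewrite (ge0_integral_shift_rV a (f := fun x => `|f x|%E))//.
exact: measurableT_comp.
Qed.

Lemma integral_shift_rV n (a : 'rV[R]_n) (f : 'rV[R]_n -> \bar R) :
  measurable_fun setT f ->
  (\int[mu n]_x f (x + a)%R = \int[mu n]_x f x)%E.
Proof.
move=> mf; rewrite integralE [RHS]integralE; congr (_ - _)%E.
  rewrite -(ge0_integral_shift_rV a (measurable_funepos mf))//.
  by apply: eq_integral => x _; rewrite (funepos_comp f (fun x => x + a)).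
rewrite -(ge0_integral_shift_rV a (measurable_funeneg mf))//.
by apply: eq_integral => x _; rewrite (funeneg_comp f (fun x => x + a)).
Qed.

(** Cubes replace Euclidean balls in every volume comparison below. This costs dimensional constants
    and spares the volume of the ball. *)
Lemma borel_lebesgue_cube n (r : R) : 0 < r ->
  mu n [set x | forall i, - r <= x ord0 i <= r] = ((2 * r) ^+ n)%:E.
Proof.
move=> r0; elim: n => [|n IH].
  rewrite expr0 /= diracE mem_set//; by case.
rewrite borel_lebesgueSE.
under eq_integral => t _.
  rewrite (_ : mu n _ = ((2 * r) ^+ n * \1_(`[- r, r]%classic) t)%:E); last first.
    have [rt|rt] := boolP (- r <= t <= r).
      rewrite indicE mem_set ?mulr1// -IH; congr (mu n _).
      apply/seteqP; split => x /= H i.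
        by have := H (lift ord0 i); rewrite mxE liftK.
      by rewrite mxE; case: unliftP => [j _|_]; [exact: H|].
    rewrite indicE memNset ?mulr0/=; last by rewrite in_itv/=; exact/negP.
    rewrite (_ : [set x | _] = set0) ?measure0//.
    apply/seteqP; split => // x /= /(_ ord0).
    by rewrite mxE unlift_none/= (negbTE rt).
  over.
under eq_integral do rewrite EFinM.
rewrite ge0_integralZl_EFin//; last 2 first.
- exact/measurable_EFinP/measurable_indic.
- by rewrite exprn_ge0// mulr_ge0// ltW.
rewrite integral_indic// setIT.
rewrite [X in (_ * X)%E](_ : _ = (r - - r)%:E); last first.
  by have := @lebesgue_measure_itv R `[- r, r]%R; rewrite /= lte_fin gtrN.
by rewrite -EFinM exprSr opprK; congr (_ * _)%:E; ring.
Qed.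

End borel_lebesgue_affine.

(** * Borel versions of Lebesgue measurable sets, functions and integrals *)

Section completion.
Context {R : realType} {n : nat}.
Local Notation V := 'rV[R]_n.
Local Notation mu := (@borel_lebesgue R n).
Local Notation lam := (lebesgue_rV R n).
Local Notation LV := (caratheodory_type (@borel_lebesgue R n)^*%mu).
Local Open Scope ereal_scope.

Lemma lebesgue_rVE (A : set V) : measurable A -> lam A = mu A.
Proof. exact: measurable_mu_extE. Qed.

Lemma borel_lebesgue_measurable (A : set V) :
  measurable A -> measurable (A : set LV).
Proof. exact: caratheodory_measurable_mu_ext. Qed.

(** [lam] is an outer measure defined on all sets as an infimum over countable Borel covers:
    intersect covers whose excess is [1 / k.+1]. If the value is infinite, the whole space
    serves. *)
Lemma borel_hull (A : set V) :
  exists B : set V, [/\ measurable B, A `<=` B & mu B <= lam A].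
Proof.
have [->|Afin] := eqVneq (lam A) +oo.
  by exists setT; split => //; exact: leey.
have Af : lam A \is a fin_num.
  by rewrite ge0_fin_numE ?lt_neqAle ?Afin ?leey//; exact: mu_ext_ge0.
have /choice[F hF] : forall k : nat, exists B : set V,
    [/\ measurable B, A `<=` B & mu B <= lam A + (k.+1%:R^-1)%:E].
  move=> k.
  have k0 : (0 < k.+1%:R^-1 :> R)%R by rewrite invr_gt0.
  have [_ [F [mF AF] <-] Flt] := lb_ereal_inf_adherent k0 Af.
  exists (\bigcup_i F i); split => //; first exact: bigcupT_measurable.
  apply: le_trans (ltW Flt).
  by apply: measure_sigma_subadditive => //; exact: bigcupT_measurable.
exists (\bigcap_k F k); split.
- by apply: bigcapT_measurable => k; have [] := hF k.
- by move=> x Ax k _; have [_ + _] := hF k; apply.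
- apply/lee_addgt0Pr => e e0.
  have [k _ hk] := near_infty_natSinv_lt (PosNum e0).
  have [mF _ Fle] := hF k.
  apply: (@le_trans _ _ (mu (F k))).
    apply: le_measure; rewrite ?inE//.
      by apply: bigcapT_measurable => j; have [] := hF j.
    exact: bigcap_inf.
  apply: (le_trans Fle); rewrite leeD2l// lee_fin ltW//.
  exact: (hk k (leqnn _)).
Qed.

(** On a piece of finite measure the hull exceeds the set by a set of measure zero, by additivity;
    the hull of that excess is a Borel null set. Sigma-finiteness supplies the pieces. *)
Lemma lebesgue_borel_set (A : set LV) : measurable A ->
  exists B N : set V,
    [/\ measurable B, measurable N, mu N = 0 & A `\` N = B `\` N].
Proof.
move=> mA; have /sigma_finiteP[S [ST ndS Soo]] := sigma_finiteT mu.
have mS j : measurable (S j : set LV).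
  by apply: borel_lebesgue_measurable; have [] := Soo j.
pose Aj j : set LV := A `&` S j.
have mAj j : measurable (Aj j) by apply: measurableI.
have /choice[B hB] := fun j => borel_hull (Aj j).
have mB j : measurable (B j : set LV).
  by apply: borel_lebesgue_measurable; have [] := hB j.
have Ajoo j : lam (Aj j) < +oo.
  have [mSj Sj] := Soo j; apply: le_lt_trans Sj.
  rewrite -[leRHS](lebesgue_rVE mSj).
  by apply: (@le_measure _ _ _ lam); rewrite ?inE//; exact: subIsetr.
have BA0 j : lam (B j `\` Aj j) = 0.
  have [mBj AB Ble] := hB j.
  have Boo : lam (B j) < +oo by rewrite (lebesgue_rVE mBj); exact: (le_lt_trans Ble).
  have : lam (B j `\` Aj j) = lam (B j) - lam (B j `&` Aj j).
    by apply: (@measureD _ _ _ lam).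
  move=> ->; rewrite (setIidr AB).
  have -> : lam (B j) = lam (Aj j).
    apply/eqP; rewrite eq_le; apply/andP; split.
      by rewrite [leLHS](lebesgue_rVE mBj).
    by apply: (@le_measure _ _ _ lam); rewrite ?inE.
  by rewrite subee// ge0_fin_numE//; exact: measure_ge0.
have /choice[N hN] := fun j => borel_hull (B j `\` Aj j).
have N0 j : mu (N j) = 0.
  have [_ _] := hN j; rewrite BA0 => ?; apply/eqP.
  by rewrite eq_le measure_ge0 andbT.
exists (\bigcup_j B j), (\bigcup_j N j); split.
- by apply: bigcupT_measurable => j; have [] := hB j.
- by apply: bigcupT_measurable => j; have [] := hN j.
- apply/negligibleP; first by apply: bigcupT_measurable => j; have [] := hN j.
  by apply: negligible_bigcup => j; apply/negligibleP; [by have [] := hN j|exact: N0].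
apply/seteqP; split => x [Ax NNx]; split => //.
  have [j _ Sj] : (\bigcup_i S i) x by rewrite -ST.
  by exists j => //; have [_ + _] := hB j; apply; split.
case: Ax => j _ Bjx; apply: contrapT => nAx; apply: NNx; exists j => //.
by have [_ + _] := hN j; apply; split => // -[].
Qed.

(** The sets [{f > q}] with [q] rational are Borel up to null sets. Setting [f] to 0 on the union of
    these null sets makes all of them Borel, and they determine the function. *)
Lemma lebesgue_borel_fun (f : V -> R) : lebesgue_measurable_fun setT f ->
  exists g : V -> R, measurable_fun setT g /\ {ae mu, forall x, f x = g x}.
Proof.
move=> mf.
have mA (q : rat) : measurable ([set x : V | (ratr q < f x)%R] : set LV).
  rewrite (_ : [set x | _] = f @^-1` `]ratr q, +oo[); last first.
    by apply/seteqP; split => x /=; rewrite in_itv/= andbT.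
  by rewrite -[X in measurable X]setTI; apply: mf.
have /choice[p hp] : forall q : rat, exists p : set V * set V,
    [/\ measurable p.1, measurable p.2, mu p.2 = 0 &
      [set x | (ratr q < f x)%R] `\` p.2 = p.1 `\` p.2].
  by move=> q; have [B [N H]] := lebesgue_borel_set (mA q); exists (B, N).
pose N := \bigcup_q (p q).2.
have mN : measurable N.
  by apply: bigcupT_measurable_rat => q; have [] := hp q.
have N0 : mu N = 0.
  apply/negligibleP => //.
  (* Rationals are enumerated by [unpickle]; an integer that codes none is sent to 0, which only
     repeats a set of the family. *)
  have : \bigcup_k (p (odflt 0%R (unpickle k))).2 = N.
    apply/seteqP; split => x [k _ kx]; first by exists (odflt 0%R (unpickle k)).
    by exists (pickle k) => //; rewrite pickleK.
  move=> <-; apply: negligible_bigcup => k; apply/negligibleP.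
    by have [] := hp (odflt 0%R (unpickle k)).
  by have [] := hp (odflt 0%R (unpickle k)).
pose g x := if x \in N then 0%R else f x.
exists g; split; last first.
  exists N; split => // x /= fg; apply: contrapT => Nx; apply: fg.
  by rewrite /g memNset.
have mg (q : rat) : measurable [set x : V | (ratr q < g x)%R].
  have [mB mNq _ E] := hp q.
  rewrite (_ : [set x | _] =
      ((p q).1 `\` N) `|` (N `&` [set x | (ratr q < 0 :> R)%R])).
    apply: measurableU; first exact: measurableD.
    have [q0|q0] := boolP (ratr q < 0 :> R)%R.
      by rewrite (_ : [set _ | _] = setT) ?setIT//; apply/seteqP; split.
    by rewrite (_ : [set _ | _] = set0) ?setI0//; apply/seteqP; split.
  apply/seteqP; split => x /=; rewrite /g.
    case: (boolP (x \in N)) => [/set_mem Nx qg|/negP Nx qf]; first by right.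
    have {}Nx : ~ N x by move=> ?; apply: Nx; exact: mem_set.
    left; split => //.
    have : ([set x | (ratr q < f x)%R] `\` (p q).2) x.
      by split => // ?; apply: Nx; exists q.
    by rewrite E => -[].
  case=> [[px Nx]|[Nx q0]]; last by rewrite mem_set.
  rewrite memNset//; have : ((p q).1 `\` (p q).2) x.
    by split => // ?; apply: Nx; exists q.
  by rewrite -E => -[].
apply: (measurability _ (RGenOInfty.measurableE R)) => //.
move=> /= _ [_ [a ->] <-]; rewrite setTI.
rewrite (_ : _ @^-1` _ = \bigcup_(q in [set q : rat | (a < ratr q)%R])
    [set x | (ratr q < g x)%R]).
  rewrite bigcup_mkcond; apply: bigcupT_measurable_rat => q.
  by case: ifPn.
apply/seteqP; split => x /=; rewrite ?in_itv/= ?andbT.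
  by move=> /rat_in_itvoo[q]; rewrite in_itv/= => /andP[aq qg]; exists q.
by move=> [q /= aq qg]; exact: lt_trans qg.
Qed.

Lemma ae_borel_lebesgue (P : V -> Prop) :
  {ae mu, forall x, P x} -> {ae lam, forall x, P x}.
Proof.
move=> [N [mN N0 PN]]; exists N; split => //.
- exact: borel_lebesgue_measurable.
- by rewrite lebesgue_rVE.
Qed.

Lemma ae_eq_borel_lebesgue T (D : set V) (f g : V -> T) :
  {ae mu, forall x, f x = g x} -> ae_eq lam D f g.
Proof.
move=> /ae_borel_lebesgue[N [mN N0 PN]]; exists N; split => //.
by move=> x fgx; apply: PN => fgx'; apply: fgx => _.
Qed.

Lemma ae_eq_borel_lebesgueC T (D : set V) (f g : V -> T) :
  {ae mu, forall x, f x = g x} -> ae_eq lam D g f.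
Proof. by move=> fg; apply: ae_eq_borel_lebesgue; apply: filterS fg. Qed.

Lemma measurable_borel_lebesgueT d (T : measurableType d) (f : V -> T) :
  measurable_fun setT f -> lebesgue_measurable_fun setT f.
Proof.
by move=> mf _ B mB; apply: borel_lebesgue_measurable; exact: mf.
Qed.

Lemma lebesgue_measurable_ae (f g : V -> R) : measurable_fun setT g ->
  {ae mu, forall x, f x = g x} -> lebesgue_measurable_fun setT f.
Proof.
move=> mg fg; rewrite /lebesgue_measurable_fun; apply/measurable_EFinP.
apply: (ae_measurable_fun (@measure_is_complete_caratheodory _ _ _) (f := EFin \o g)).
  by apply: ae_eq_borel_lebesgueC; apply: filterS fg => x /= ->.
by apply: measurable_borel_lebesgueT; exact/measurable_EFinP.
Qed.

Lemma lebesgue_emeasurable_ae (f g : V -> \bar R) : measurable_fun setT g ->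
  {ae mu, forall x, f x = g x} ->
  measurable_fun setT (f : LV -> \bar R).
Proof.
move=> mg fg.
apply: (ae_measurable_fun (@measure_is_complete_caratheodory _ _ _) (f := g)).
  exact: ae_eq_borel_lebesgueC.
exact: measurable_borel_lebesgueT.
Qed.

(** The identity, from the completed sigma-algebra to the Borel one, is measurable and pushes [lam]
    to [mu]. *)
Lemma ge0_integral_lebesgue_rV (D : set V) (f : V -> \bar R) :
  measurable D -> measurable_fun setT f -> (forall x, 0 <= f x) ->
  \int[lam]_(x in D) f x = \int[mu]_(x in D) f x.
Proof.
move=> mD mf f0.
have mid : measurable_fun setT (id : LV -> V).
  by move=> _ B mB; rewrite setTI; exact: borel_lebesgue_measurable.
rewrite -[LHS](ge0_integral_pushforward mid lam mD)//; last exact: measurable_funTS.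
by apply: eq_measure_integral => A mA _; exact: lebesgue_rVE.
Qed.

Lemma ge0_integral_lebesgue_ae (D : set V) (f g : V -> \bar R) :
  measurable D -> measurable_fun setT g ->
  (forall x, 0 <= f x) -> (forall x, 0 <= g x) ->
  {ae mu, forall x, f x = g x} ->
  \int[lam]_(x in D) f x = \int[mu]_(x in D) g x.
Proof.
move=> mD mg f0 g0 fg; rewrite -ge0_integral_lebesgue_rV//.
apply: ge0_ae_eq_integral => //.
- exact: borel_lebesgue_measurable.
- by apply: measurable_funTS; exact: lebesgue_emeasurable_ae mg fg.
- by apply: measurable_funTS; exact: measurable_borel_lebesgueT.
- exact: ae_eq_borel_lebesgue.
Qed.

Lemma integral_lebesgue_ae (D : set V) (f g : V -> \bar R) :
  measurable D -> measurable_fun setT g ->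
  {ae mu, forall x, f x = g x} ->
  \int[lam]_(x in D) f x = \int[mu]_(x in D) g x.
Proof.
move=> mD mg fg; rewrite integralE [RHS]integralE; congr (_ - _).
  apply: ge0_integral_lebesgue_ae => //; first exact: measurable_funepos.
  by apply: filterS fg => x fgx; rewrite !funeposE fgx.
apply: ge0_integral_lebesgue_ae => //; first exact: measurable_funeneg.
by apply: filterS fg => x fgx; rewrite !funenegE fgx.
Qed.

End completion.

(** * Volume of polar sets *)

Section polar.
Context {R : realType}.
Local Notation mu n := (@borel_lebesgue R n).

Definition dotrV n (x y : 'rV[R]_n) : R := \sum_i x ord0 i * y ord0 i.

Lemma dotrVDl n (x y z : 'rV[R]_n) : dotrV (x + y) z = dotrV x z + dotrV y z.
Proof. by rewrite /dotrV -big_split; apply: eq_bigr => i _; rewrite mxE mulrDl. Qed.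

Lemma dotrVZl n (c : R) (x y : 'rV[R]_n) : dotrV (c *: x) y = c * dotrV x y.
Proof. by rewrite /dotrV mulr_sumr; apply: eq_bigr => i _; rewrite mxE mulrA. Qed.

Lemma dotrVC n (x y : 'rV[R]_n) : dotrV x y = dotrV y x.
Proof. by apply: eq_bigr => i _; rewrite mulrC. Qed.

Lemma dotrVZr n (c : R) (x y : 'rV[R]_n) : dotrV x (c *: y) = c * dotrV x y.
Proof. by rewrite dotrVC dotrVZl dotrVC. Qed.

Lemma dotrVDr n (x y z : 'rV[R]_n) : dotrV x (y + z) = dotrV x y + dotrV x z.
Proof. by rewrite dotrVC dotrVDl !(dotrVC _ x). Qed.

Lemma dotrV_cons n (s t : measurableTypeR R) (x y : 'rV[R]_n) :
  dotrV (rV_cons (s, x)) (rV_cons (t, y)) = s * t + dotrV x y.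
Proof.
rewrite /dotrV big_ord_recl !mxE unlift_none/=; congr (_ + _).
by apply: eq_bigr => i _; rewrite !mxE liftK.
Qed.

Lemma measurable_dotrV d (T : measurableType d) n (f g : T -> 'rV[R]_n) :
  measurable_fun setT f -> measurable_fun setT g ->
  measurable_fun setT (fun x => dotrV (f x) (g x)).
Proof.
move=> mf mg; apply: measurable_sum => i.
by apply: measurable_funM; exact: measurable_fun_coord.
Qed.

(** Boundedness and the neighbourhood of 0 are measured by cubes, which pass to coordinate sections
    directly. Measurability takes the place of closedness: the points chosen in the body are only
    nearly extremal. *)
Record sym_body n (L : set 'rV[R]_n) : Prop := SymBody {
  sym_body_convex : forall t x y, 0 <= t <= 1 -> L x -> L y ->
    L (t *: x + (1 - t) *: y) ;
  sym_body_opp : forall x, L x -> L (- x) ;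
  sym_body_meas : measurable L ;
  sym_body_bounded : exists M : R, forall x, L x -> forall i, `|x ord0 i| <= M ;
  sym_body_nbhs : exists2 r : R, 0 < r &
    forall x : 'rV[R]_n, (forall i, `|x ord0 i| <= r) -> L x }.

Lemma sym_body0 n (L : set 'rV[R]_n) : sym_body L -> L 0.
Proof.
by case=> _ _ _ _ [r r0]; apply => i; rewrite mxE normr0 ltW.
Qed.

Lemma sym_body_scale n (L : set 'rV[R]_n) (t : R) x : sym_body L -> `|t| <= 1 ->
  L x -> L (t *: x).
Proof.
move=> bL; have [t0|t0] := leP 0 t => t1 Lx.
  rewrite -[_ *: _]addr0 -(scaler0 _ (1 - t)); apply: sym_body_convex => //.
    by rewrite t0 -(ger0_norm t0).
  exact: sym_body0.
have -> : t *: x = (- t) *: (- x) + (1 - (- t)) *: 0.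
  by rewrite scaler0 addr0 scalerN scaleNr opprK.
apply: sym_body_convex => //.
- by rewrite oppr_ge0 ltW//= -(ltr0_norm t0).
- exact: sym_body_opp.
- exact: sym_body0.
Qed.

(** Uniqueness of the product measure exchanges the order of integration: here the first coordinate
    is the inner variable, in [borel_lebesgueSE] it is the outer one. *)
Lemma borel_lebesgueSE2 n (A : set 'rV[R]_n.+1) : measurable A ->
  mu n.+1 A = (\int[mu n]_x (@lebesgue_measure R) [set t | A (rV_cons (t, x))])%E.
Proof.
move=> mA; rewrite /= /rV_measureS /pushforward.
have mB : measurable (@rV_cons R n @^-1` A).
  by rewrite -[X in measurable X]setTI; exact: measurable_rV_cons.
rewrite (@product_measure_unique _ _ _ _ _ _ _ (lebesgue_measure \x^ mu n)%E)//; last first.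
  by move=> X Y mX mY; exact: product_measure2E.
rewrite /= /product_measure2; apply: eq_integral => t _.
by congr lebesgue_measure; apply/seteqP; split => x; rewrite /ysection/= inE.
Qed.

Lemma sym_body_section n (L : set 'rV[R]_n.+1) : sym_body L ->
  sym_body [set x : 'rV[R]_n | L (rV_cons (0 : measurableTypeR R, x))].
Proof.
move=> bL; split.
- move=> t x y t01 /= Lx Ly.
  have := sym_body_convex bL t01 Lx Ly.
  by rewrite !rV_consZ rV_consD !mulr0 addr0.
- move=> x /= /(sym_body_opp bL).
  by rewrite -scaleN1r rV_consZ mulr0 scaleN1r.
- exact: measurable_rV_section (sym_body_meas bL).
- have [M hM] := sym_body_bounded bL; exists M => x Lx i.
  by have := hM _ Lx (lift ord0 i); rewrite mxE liftK.
- have [r r0 hr] := sym_body_nbhs bL; exists r => // x xr; apply: hr => i.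
  by rewrite mxE; case: unliftP => [j _|_] /=; rewrite ?normr0 ?xr// ltW.
Qed.

(** The supremum of the first coordinate over [L] need not be attained; a point above half of it is
    enough, whence the factor 2. *)
Lemma sym_body_pivot n (L : set 'rV[R]_n.+1) : sym_body L ->
  exists p, [/\ L p, 0 < p ord0 ord0 &
    forall x, L x -> `|x ord0 ord0| <= 2 * p ord0 ord0].
Proof.
move=> bL; pose S := [set x ord0 ord0 | x in L].
have [M hM] := sym_body_bounded bL; have [r r0 hr] := sym_body_nbhs bL.
have Sne : S !=set0 by exists 0; exists 0; rewrite ?mxE//; exact: sym_body0.
have Sub : has_ubound S.
  by exists M => _ [x Lx <-]; apply: le_trans (hM _ Lx _); exact: ler_norm.
have supS : has_sup S by [].
have Sr : r <= sup S.
  apply: ub_le_sup => //; exists (const_mx r); last by rewrite mxE.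
  by apply: hr => i; rewrite mxE ger0_norm// ltW.
have S0 : 0 < sup S by exact: lt_le_trans Sr.
have S20 : 0 < sup S / 2 by exact: divr_gt0.
have [_ [p Lp <-] pS] := sup_adherent S20 supS.
have pS2 : sup S / 2 < p ord0 ord0 by move: pS; lra.
exists p; split => //; first exact: lt_trans pS2.
move=> x Lx; have H y : L y -> y ord0 ord0 <= 2 * p ord0 ord0.
  by move=> Ly; have : y ord0 ord0 <= sup S by [apply: ub_le_sup => //; exists y|]; lra.
rewrite ler_norml; apply/andP; split; last exact: H.
by have := H _ (sym_body_opp bL Lx); rewrite mxE; lra.
Qed.

Section step.
Variables (n : nat) (L : set 'rV[R]_n.+1) (p : 'rV[R]_n.+1).
Hypothesis bL : sym_body L.
Hypothesis Lp : L p.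
Hypothesis p0 : 0 < p ord0 ord0.
Hypothesis pmax : forall x, L x -> `|x ord0 ord0| <= 2 * p ord0 ord0.

Let L' := [set x : 'rV[R]_n | L (rV_cons (0 : measurableTypeR R, x))].
Let q := (rV_uncons p).2.

Let pE : p = rV_cons (p ord0 ord0 : measurableTypeR R, q).
Proof. by rewrite -[LHS]rV_unconsK. Qed.

(** For [|t| <= p_0 / 2] the point [(2 t / p_0) p] lies in [L]. Its midpoints with the central
    section fill a half-size translate of that section inside the section at height [t]. The
    admissible heights have total length [p_0]. *)
Lemma sym_body_volume_ge :
  ((p ord0 ord0 * (2^-1) ^+ n)%:E * mu n L' <= mu n.+1 L)%E.
Proof.
set b := p ord0 ord0.
have mL := sym_body_meas bL.
have mL' : measurable L' by exact: sym_body_meas (sym_body_section bL).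
rewrite borel_lebesgueSE.
pose I := `[- (b / 2), b / 2]%classic : set R.
have mI : measurable I by exact: measurable_itv.
apply: (@le_trans _ _ (\int[lebesgue_measure]_(t in I)
    mu n [set x | L (rV_cons (t, x))])%E); last first.
  apply: ge0_subset_integral => //.
  exact: measurable_rV_section_measure.
apply: (@le_trans _ _ (\int[lebesgue_measure]_(t in I)
    (((2^-1) ^+ n)%:E * mu n L'))%E).
  have muI : lebesgue_measure I = b%:E.
    rewrite lebesgue_measure_itv/= lte_fin gtrN ?divr_gt0//.
    by rewrite -EFinD; congr (_%:E); rewrite opprK; field.
  rewrite integral_cst// -[X in (_ <= _ * X)%E]/(lebesgue_measure I) muI.
  by rewrite [leRHS]muleC muleA EFinM.
apply: ge0_le_integral => //.
- by move=> t _; exact: mule_ge0.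
- by apply: measurable_funTS; exact: measurable_rV_section_measure.
move=> t; rewrite /I/= in_itv/= => /andP[tb1 tb2].
have h2 : (0 : R) < 2^-1 by [].
rewrite -(borel_lebesgue_scale h2 mL').
have mS : measurable [set x | L' (2^-1^-1 *: x)].
  by rewrite -[X in measurable X]setTI; exact: (measurable_scalerV _ _ mL').
rewrite -(borel_lebesgue_shift (- ((t / b) *: q)) mS).
apply: le_measure; rewrite ?inE.
- by rewrite -[X in measurable X]setTI; apply: (measurable_addrV _ _ mS).
- exact: measurable_rV_section.
move=> x /= Lx.
have -> : rV_cons (t : measurableTypeR R, x) =
    2^-1 *: ((2 * (t / b)) *: p) + (1 - 2^-1) *:
      rV_cons (0 : measurableTypeR R, 2^-1^-1 *: (x - (t / b) *: q)).
  rewrite [in RHS]pE !rV_consZ rV_consD; congr (rV_cons (_, _)).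
    rewrite -/b; field; exact: lt0r_neq0.
  rewrite !scalerA mulrA mulVf// mul1r invrK.
  by rewrite (_ : (1 - 2^-1) * 2 = 1 :> R) ?scale1r; [rewrite addrC subrK|field].
apply: (sym_body_convex bL) => //.
  by apply/andP; split; lra.
apply: sym_body_scale => //.
rewrite ler_norml; apply/andP; split.
  rewrite mulrA ler_pdivlMr//; lra.
rewrite mulrA ler_pdivrMr//; lra.
Qed.

Variables (h : R) (D' : set 'rV[R]_n).
Hypothesis h0 : 0 < h.
Hypothesis mD' : measurable D'.
Hypothesis D'L' : forall y, D' y -> forall x, L' x -> `|dotrV y x| <= h / 6.

Let D := [set y : 'rV[R]_n.+1 | D' (rV_uncons y).2 /\ `|dotrV y p| <= h / 4].

Lemma measurable_polar_step : measurable D.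
Proof.
rewrite (_ : D = ((fun y => (rV_uncons y).2) @^-1` D') `&`
    ((fun y => `|dotrV y p|) @^-1` `]-oo, h / 4])); last first.
  by apply/seteqP; split => y /=; rewrite in_itv.
apply: measurableI.
  rewrite -[X in measurable X]setTI.
  by apply: (measurableT_comp measurable_snd (@measurable_rV_uncons _ _)).
rewrite -[X in measurable X]setTI.
apply: (measurableT_comp (@normr_measurable _ setT)) => //.
by apply: measurable_dotrV => //; exact: measurable_cst.
Qed.

(** Write [x = b p + (0, z)] with [|b| <= 2]. The slab gives [|b| |<y, p>| <= 2 (h / 4)]. Moreover
    [z / 3] lies in the central section, being the combination of [x] and [- (b / 2) p] with weights
    1/3 and 2/3, so the remaining term is at most [3 (h / 6)]. The two halves add up to [h]. *)
Lemma polar_step_sub y : D y -> forall x, L x -> `|dotrV y x| <= h.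
Proof.
move=> [Dy yp] x Lx; set b := x ord0 ord0 / p ord0 ord0.
have b2 : `|b| <= 2.
  by rewrite normrM normfV (gtr0_norm p0) ler_pdivrMr// pmax.
pose z := (rV_uncons x).2 - b *: q.
have xE : x = b *: p + rV_cons (0 : measurableTypeR R, z).
  rewrite -[LHS]rV_unconsK pE rV_consZ rV_consD; congr (rV_cons (_, _)).
    by rewrite addr0 /b divfK// gt_eqF.
  by rewrite /z addrC subrK.
have L'z : L' (3^-1 *: z).
  rewrite /L'/=.
  have -> : rV_cons (0 : measurableTypeR R, 3^-1 *: z) =
      3^-1 *: x + (1 - 3^-1) *: ((- (b / 2)) *: p).
    have -> : (1 - 3^-1) *: (- (b / 2) *: p) = - (3^-1 *: (b *: p)).
      by apply/rowP => i; rewrite !mxE; field.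
    have -> : rV_cons (0 : measurableTypeR R, 3^-1 *: z) =
        3^-1 *: rV_cons (0 : measurableTypeR R, z) by rewrite rV_consZ mulr0.
    by apply/rowP => i; rewrite [in RHS]xE !mxE; ring.
  apply: (sym_body_convex bL) => //.
    by apply/andP; split; lra.
  apply: sym_body_scale => //; rewrite normrN normrM normfV (gtr0_norm (ltr0n _ 2)).
  by rewrite ler_pdivrMr// mul1r.
have := D'L' Dy L'z; rewrite dotrVZr normrM normfV (gtr0_norm (ltr0n _ 3)) => yz.
rewrite xE dotrVDr dotrVZr.
rewrite -{2}[y]rV_unconsK /rV_uncons/= dotrV_cons mulr0 add0r.
apply: le_trans (ler_normD _ _) _; rewrite normrM.
have : `|b| * `|dotrV y p| <= 2 * (h / 4) by apply: ler_pM.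
move: yz; rewrite /rV_uncons/=; lra.
Qed.

(** With the other coordinates fixed, the slab is an interval of length [h / (2 p_0)] in the first
    one. The factor [p_0] cancels against the one in [sym_body_volume_ge]. *)
Lemma polar_step_volume :
  mu n.+1 D = ((h / (2 * p ord0 ord0))%:E * mu n D')%E.
Proof.
set b := p ord0 ord0.
rewrite borel_lebesgueSE2; last exact: measurable_polar_step.
transitivity (\int[mu n]_x ((h / (2 * b))%:E * (\1_D' x)%:E))%E; last first.
  rewrite ge0_integralZl_EFin//; last 2 first.
  - exact/measurable_EFinP/measurable_indic.
  - by rewrite divr_ge0 ?mulr_ge0// ltW.
  by rewrite integral_indic// setIT.
apply: eq_integral => x _; rewrite indicE.
have DE (t : measurableTypeR R) :
    D (rV_cons (t, x)) <-> D' x /\ `|t * b + dotrV x q| <= h / 4.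
  by rewrite /D /mkset rV_consK [X in dotrV _ X]pE dotrV_cons.
have [xD|xD] := boolP (x \in D'); last first.
  rewrite mule0 (_ : [set t | _] = set0) ?measure0//.
  apply/seteqP; split => // t /DE[Dx _].
  by move/negP : xD; rewrite inE.
rewrite mule1 (_ : [set t | _] =
    [set` `[- (h / 4 + dotrV x q) / b, (h / 4 - dotrV x q) / b]%R]); last first.
  apply/seteqP; split => t.
    move=> /DE[_]; rewrite /= in_itv/= ler_norml => /andP[h1 h2].
    by rewrite ler_pdivrMr// ler_pdivlMr//; apply/andP; split; lra.
  rewrite /mkset in_itv/= ler_pdivrMr// ler_pdivlMr// => /andP[h1 h2].
  apply/DE; split; first exact: set_mem.
  by rewrite ler_norml; apply/andP; split; lra.
rewrite lebesgue_measure_itv/= lte_fin ltr_pM2r ?invr_gt0//.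
rewrite ifT; last by rewrite opprD ltrD2r gtrN// divr_gt0.
by rewrite -EFinD; congr (_%:E); field; exact: lt0r_neq0.
Qed.

End step.

(* A weak reverse Blaschke-Santalo inequality, by induction on the dimension
   through the section of [L] by the hyperplane [x_0 = 0]. *)
Lemma polar_volume n : exists2 c : R, 0 < c &
  forall (L : set 'rV[R]_n) (h : R), sym_body L -> 0 < h ->
  exists D, [/\ measurable D,
    forall y, D y -> forall x, L x -> `|dotrV y x| <= h &
    ((c * h ^+ n)%:E <= mu n L * mu n D)%E].
Proof.
elim: n => [|n [c c0 IH]].
  exists 1 => // L h bL h0; exists setT; split => //.
    by move=> y _ x _; rewrite /dotrV big_ord0 normr0 ltW.
  rewrite /= expr0 mulr1 !diracE !mem_set// ?mule1//.
  exact: sym_body0.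
(* The powers come from the halved sections, the factor 1/2 from the length of the slab, and
   [6^-1 ^+ n] from using the induction hypothesis at [h / 6]. *)
exists (c * (2^-1) ^+ n * 2^-1 * 6^-1 ^+ n).
  by rewrite !mulr_gt0// exprn_gt0.
move=> L h bL h0.
have [p [Lp p0 pmax]] := sym_body_pivot bL.
have h60 : 0 < h / 6 by rewrite divr_gt0.
have [D' [mD' D'L' volD']] := IH _ _ (sym_body_section bL) h60.
exists [set y : 'rV[R]_n.+1 | D' (rV_uncons y).2 /\ `|dotrV y p| <= h / 4].
split.
- exact: measurable_polar_step.
- exact: polar_step_sub.
rewrite (polar_step_volume p0 h0 mD').
have hD0 : (0 <= (h / (2 * p ord0 ord0))%:E * mu n D')%E.
  by rewrite mule_ge0// lee_fin divr_ge0 ?mulr_ge0// ltW.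
apply: (le_trans _ (lee_wpmul2r hD0 (sym_body_volume_ge bL Lp p0))).
set m1 := mu n _ in volD' *; set m2 := mu n D' in volD' *.
rewrite (_ : (_ * m1 * _)%E = ((2^-1 ^+ n * 2^-1 * h)%:E * (m1 * m2))%E); last first.
  rewrite -muleA (muleCA m1) !muleA -EFinM; congr ((_)%:E * _ * _)%E.
  by field; exact: lt0r_neq0.
apply: (@le_trans _ _ ((2^-1 ^+ n * 2^-1 * h)%:E * (c * (h / 6) ^+ n)%:E)%E).
  rewrite -EFinM lee_fin exprMn exprSr le_eqVlt; apply/orP; left; apply/eqP; ring.
by apply: lee_wpmul2l => //; rewrite lee_fin !mulr_ge0// ?exprn_ge0// ltW.
Qed.

End polar.

(** * The chain rule in dimension one *)

Section functional_dynkin.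
Context d (T : measurableType d) (R : realType).

Import HBNNSimple.

(** The functional monotone class theorem. Dynkin's argument reaches indicators of measurable sets,
    linearity reaches simple functions, and bounded pointwise limits reach the rest; a constant is
    added first to make the function nonnegative. *)
Lemma bounded_measurable_ind (G : set (set T)) (P : (T -> R) -> Prop) :
  setI_closed G -> (measurable : set (set T)) = <<s G >> ->
  (forall A, G A -> P \1_A) -> P (cst 1) ->
  (forall (a : R) (f g : T -> R), measurable_fun setT f -> measurable_fun setT g ->
    (exists M : R, forall x, `|f x| <= M) ->
    (exists M : R, forall x, `|g x| <= M) ->
    P f -> P g -> P (fun x => a * f x + g x)) ->
  (forall (f_ : nat -> T -> R) (f : T -> R) (M : R),
    (forall k, measurable_fun setT (f_ k)) -> measurable_fun setT f ->
    (forall k x, `|f_ k x| <= M) -> (forall k, P (f_ k)) ->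
    (forall x, f_ k x @[k --> \oo] --> f x) -> P f) ->
  forall (f : T -> R) (M : R), measurable_fun setT f -> (forall x, `|f x| <= M) -> P f.
Proof.
move=> GI GE P1 Pc Plin Plim.
have bind (A : set T) : exists M : R, forall x, `|\1_A x : R| <= M.
  by exists 1 => x; rewrite indicE; case: (_ \in _); rewrite ?normr1 ?normr0.
have P0 : P (cst 0).
  have -> : cst 0 = (fun x : T => -1 * cst 1 x + cst 1 x) :> (T -> R).
    by apply/funext => x /=; rewrite mulr1 addNr.
  by apply: Plin => //; exists 1 => x; rewrite /= normr1.
have Pind A : measurable A -> P \1_A.
  suff : measurable `<=` [set A : set T | measurable A /\ P \1_A].
    by move=> H mA; have [] := H A mA.
  rewrite {1}GE; apply: lambda_system_subset => //; last first.
    by move=> B GB; split; [rewrite GE; exact: sub_sigma_algebra|exact: P1].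
  split => //.
  - split => //; rewrite (_ : \1_setT = cst 1)//; apply/funext => x.
    by rewrite indicE in_setT.
  - move=> C B BA [mC PA] [mB PB]; split; first exact: measurableD.
    have -> : \1_(C `\` B) = (fun x : T => -1 * \1_B x + \1_C x) :> (T -> R).
      apply/funext => x; rewrite !indicE in_setD.
      have [xB|xB] := boolP (x \in B).
        by rewrite mem_set ?andbF ?mulr1 ?addNr//; apply: BA; exact: set_mem.
      by rewrite andbT mulr0 add0r.
    by apply: Plin.
  - move=> F ndF FP; split.
      by apply: bigcupT_measurable => k; have [] := FP k.
    apply: (Plim (fun k => \1_(F k)) _ 1).
    + by move=> k; apply: measurable_indic; have [] := FP k.
    + by apply: measurable_indic; apply: bigcupT_measurable => k; have [] := FP k.
    + by move=> k x; rewrite indicE; case: (_ \in _); rewrite ?normr1 ?normr0.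
    + by move=> k; have [] := FP k.
    + move=> x; rewrite indicE; have [/set_mem[k _ Fkx]|xF] := boolP (x \in _).
        apply: cvg_near_cst; exists k => // j /= kj.
        by rewrite indicE mem_set//; move: Fkx; apply/subsetPset; exact: ndF.
      apply: cvg_near_cst; apply: nearW => k; rewrite indicE memNset// => Fkx.
      by move/negP : xF; apply; rewrite inE; exists k.
have Psum (I : Type) (s : seq I) (c : I -> R) (F : I -> set T) :
    (forall i, measurable (F i)) ->
    P (fun x => \sum_(i <- s) c i * \1_(F i) x).
  move=> mF; suff : [/\ measurable_fun setT (fun x => \sum_(i <- s) c i * \1_(F i) x),
      exists M : R, forall x, `|\sum_(i <- s) c i * \1_(F i) x| <= M &
      P (fun x => \sum_(i <- s) c i * \1_(F i) x)] by case.
  elim: s => [|i s [ms [M sM] Ps]].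
    rewrite (_ : (fun x : T => _) = cst 0); last first.
      by apply/funext => x; rewrite big_nil.
    by split => //; exists 0 => x; rewrite big_nil normr0.
  have E : (fun x => \sum_(j <- i :: s) c j * \1_(F j) x) =
      (fun x => c i * \1_(F i) x + \sum_(j <- s) c j * \1_(F j) x).
    by apply/funext => x; rewrite big_cons.
  rewrite E; split.
  - by apply: measurable_funD => //; apply: measurable_funM => //; exact: measurable_indic.
  - exists (`|c i| + M) => x; rewrite big_cons (le_trans (ler_normD _ _))// lerD//.
    rewrite normrM ler_piMr// indicE; case: (_ \in _); by rewrite ?normr1 ?normr0.
  - by apply: Plin => //; [exists M|exact: Pind].
have Pge0 (f : T -> R) (M : R) : measurable_fun setT f -> (forall x, 0 <= f x <= M) -> P f.
  move=> mf f0M.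
  have mEf : measurable_fun setT (EFin \o f) by exact/measurable_EFinP.
  pose g := nnsfun_approx measurableT mEf.
  have cg x : (g k x)%:E @[k --> \oo] --> (f x)%:E.
    by apply: (cvg_nnsfun_approx measurableT mEf) => // y _; rewrite lee_fin; have /andP[] := f0M y.
  have cgr x : g k x @[k --> \oo] --> f x by have /fine_cvgP[_] := cg x.
  have gf k x : g k x <= f x.
    rewrite -(cvg_lim _ (cgr x))//.
    apply: (@nondecreasing_cvgn_le _ (fun k => g k x)); last first.
      by apply/cvg_ex; eexists; exact: cgr.
    by move=> i j ij; have /lefP := nd_nnsfun_approx measurableT mEf ij; exact.
  apply: (Plim (fun k => g k : T -> R) f M) => //.
  - by move=> k x; rewrite ger0_norm// (le_trans (gf k x))//; have /andP[] := f0M x.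
  - move=> k; rewrite (_ : (g k : T -> R) = (fun x => \sum_(y <- finmap.enum_fset (fset_set (range (g k))))
        y * \1_(g k @^-1` [set y]) x)); first exact: Psum.
    by apply/funext => x; rewrite fimfunE fsbig_finite.
move=> f M mf fM.
have -> : f = (fun x => (- M) * cst 1 x + (f x + M)).
  by apply/funext => x /=; rewrite mulr1 addrC addrK.
apply: Plin => //.
- exact: measurable_funD.
- by exists 1 => x /=; rewrite normr1.
- exists (M + M) => x; rewrite (le_trans (ler_normD _ _))// lerD//.
  by rewrite ger0_norm// (le_trans _ (fM x)).
- apply: (Pge0 _ (M + M)); first exact: measurable_funD.
  by move=> x; have := fM x; rewrite ler_norml; lra.
Qed.

Lemma Rintegral_dominated_cvg (mu : {measure set T -> \bar R}) (D : set T)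
    (f_ : nat -> T -> R) (f g : T -> R) : measurable D ->
  (forall k, measurable_fun D (f_ k)) -> measurable_fun D f ->
  (forall x, D x -> f_ k x @[k --> \oo] --> f x) ->
  mu.-integrable D (EFin \o g) ->
  (forall k x, D x -> `|f_ k x| <= g x) ->
  (\int[mu]_(x in D) f_ k x) @[k --> \oo] --> \int[mu]_(x in D) f x.
Proof.
move=> mD mf_ mf ff ig fg.
have [] := @dominated_convergence _ _ _ mu D mD (fun k => EFin \o f_ k) (EFin \o f) (EFin \o g).
- by move=> k; exact/measurable_EFinP.
- exact/measurable_EFinP.
- by apply: aeW => x Dx; apply: cvg_EFin; [exact: nearW|exact: ff].
- by [].
- by apply: aeW => x k Dx; rewrite lee_fin fg.
move=> iF _ H; rewrite /Rintegral; apply: fine_cvg.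
by rewrite fineK//; exact: integrable_fin_num.
Qed.

End functional_dynkin.

Section chain_1d.
Context {R : realType}.
Local Notation mu := (@lebesgue_measure R).

(** Bisect the increment of [G] rather than the interval, by the intermediate value theorem: each of
    the two halves contributes a quarter of the bound, so every bisection divides the bound by 2. *)
Lemma additive_quadratic_eq0 (D : R -> R -> R) (G : R -> R) (C a b : R) :
  a <= b ->
  (forall x y z, a <= x -> x <= y -> y <= z -> z <= b -> D x z = D x y + D y z) ->
  (forall x y, a <= x -> x <= y -> y <= b -> `|D x y| <= C * (G y - G x) ^+ 2) ->
  {within `[a, b], continuous G} ->
  {in `[a, b] &, {homo G : x y / x <= y}} ->
  D a b = 0.
Proof.
move=> ab Dadd Dquad cG ndG.
have H k : forall x y, a <= x -> x <= y -> y <= b ->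
    `|D x y| <= C * (G y - G x) ^+ 2 / 2 ^+ k.
  elim: k => [|k IH] x y ax xy yb; first by rewrite expr0 divr1 Dquad.
  have Gxy : G x <= G y by apply: ndG => //; rewrite in_itv/=; lra.
  have [||c] := @IVT _ G x y ((G x + G y) / 2) xy.
  - by apply: continuous_subspaceW cG; apply: subset_itv; rewrite bnd_simp.
  - by rewrite (min_idPl _)// (max_idPr _)//; lra.
  rewrite in_itv/= => /andP[xc cy] Gc.
  rewrite (Dadd x c y)//; apply: (le_trans (ler_normD _ _)).
  have H1 := IH x c ax xc (le_trans cy yb).
  have H2 := IH c y (le_trans ax xc) cy yb.
  apply: (le_trans (lerD H1 H2)); rewrite Gc (exprS 2 k) le_eqVlt; apply/orP; left.
  by apply/eqP; field; rewrite expf_neq0.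
apply/eqP; rewrite -normr_le0; apply/ler_addgt0Pr => e e0; rewrite add0r.
set K := C * (G b - G a) ^+ 2 in H.
have cv : K / 2 ^+ k @[k --> \oo] --> K * 0.
  apply: cvgMr; under eq_fun do rewrite -exprVn.
  by apply: cvg_expr; rewrite ger0_norm; lra.
rewrite mulr0 in cv.
have /cvgrPdist_lt /(_ e e0)[k _ /(_ k (leqnn _))] := cv.
rewrite sub0r normrN => Ke; apply: le_trans (H k a b _ _ _) _ => //.
by apply: le_trans (ltW Ke); exact: ler_norm.
Qed.

Lemma measurable_itvR (i : interval R) :
  measurable ([set` i] : set (measurableTypeR R)).
Proof. exact: measurable_itv. Qed.

Lemma measurable_funR d (T : measurableType d) (D : set (measurableTypeR R))
    (f : R -> T) : measurable_fun setT f ->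
  measurable_fun D (f : measurableTypeR R -> T).
Proof. by move=> mf; apply: measurable_funTS; exact: mf. Qed.

Lemma lebesgue_itvcc (x y : R) : x <= y -> (mu `[x, y]%classic = (y - x)%:E)%E.
Proof.
move=> xy; have := @lebesgue_measure_itv R `[x, y]; rewrite /= lte_fin => ->.
by case: ltP => // yx; rewrite (_ : y = x) ?subrr//; apply/eqP; rewrite eq_le yx xy.
Qed.

Lemma lebesgue_itvcc_lty (x y : R) : (mu `[x, y]%classic < +oo)%E.
Proof.
have [xy|yx] := leP x y; first by rewrite [ltLHS]lebesgue_itvcc// ltry.
by rewrite set_itv_ge ?measure0// bnd_simp -ltNge.
Qed.

(** The oriented integral: at most one of the two terms is nonzero. Identities of the form
    [F b - F a = oint f a b] then hold in either order of the endpoints. *)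
Definition oint (f : R -> R) (x y : R) : R :=
  \int[mu]_(t in `[x, y]) f t - \int[mu]_(t in `[y, x]) f t.

Lemma bounded_integrable_itv (f : R -> R) (M x y : R) :
  measurable_fun setT f -> (forall t, `|f t| <= M) ->
  mu.-integrable `[x, y] (EFin \o f).
Proof.
move=> mf fM; apply: measurable_bounded_integrable => //.
- exact: lebesgue_itvcc_lty.
- by apply: measurable_funR; exact: mf.
- by exists M; split; [exact: num_real|move=> z Mz t _; exact: le_trans (fM t) (ltW Mz)].
Qed.

Lemma oint_le (f : R -> R) x y : x <= y -> oint f x y = \int[mu]_(t in `[x, y]) f t.
Proof.
rewrite /oint le_eqVlt => /predU1P[->|xy].
  by rewrite set_itv1 Rintegral_set1 subr0.
by rewrite [X in _ - X](_ : _ = 0) ?subr0// set_itv_ge ?Rintegral_set0// bnd_simp -ltNge.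
Qed.

Lemma ointC (f : R -> R) x y : oint f y x = - oint f x y.
Proof. by rewrite /oint opprB. Qed.

Lemma oint_prim (f : R -> R) (M a x y : R) : measurable_fun setT f ->
  (forall t, `|f t| <= M) -> a <= x -> a <= y ->
  oint f x y = \int[mu]_(t in `[a, y]) f t - \int[mu]_(t in `[a, x]) f t.
Proof.
move=> mf fM.
have key x' y' : a <= x' -> x' <= y' ->
    oint f x' y' = \int[mu]_(t in `[a, y']) f t - \int[mu]_(t in `[a, x']) f t.
  move=> ax xy; rewrite oint_le//.
  have := @Rintegral_itvB R f (BLeft a) (BRight y') x'.
  rewrite !bnd_simp => /(_ (bounded_integrable_itv _ _ mf fM) ax xy) ->.
  rewrite -(Rintegral_itv_obnd_cbnd (r := x'))//.
  apply: integrableS (bounded_integrable_itv x' y' mf fM) => //.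
  by apply: subset_itvr; rewrite bnd_simp.
move=> ax ay; have [xy|/ltW yx] := leP x y; first exact: key.
by rewrite ointC key// opprB.
Qed.

Lemma ointD (f : R -> R) (M x y z : R) : measurable_fun setT f ->
  (forall t, `|f t| <= M) -> oint f x z = oint f x y + oint f y z.
Proof.
move=> mf fM; pose a := Num.min x (Num.min y z).
have ax : a <= x by rewrite ge_min lexx.
have ay : a <= y by rewrite !ge_min lexx orbT.
have az : a <= z by rewrite !ge_min lexx !orbT.
by rewrite !(oint_prim mf fM (a := a))//; ring.
Qed.

Lemma Rintegral_itv_approx (f : R -> R) (M B c x y : R) : measurable_fun setT f ->
  (forall t, `|f t| <= M) -> x <= y ->
  (forall t, x <= t <= y -> `|f t - c| <= B) ->
  `|\int[mu]_(t in `[x, y]) f t - c * (y - x)| <= B * (y - x).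
Proof.
move=> mf fM xy fB.
have cst_int (k : R) : \int[mu]_(t in `[x, y]) (cst k t) = k * (y - x).
  by rewrite Rintegral_cst// [X in fine X]lebesgue_itvcc.
have ci (k : R) : mu.-integrable `[x, y] (EFin \o cst k).
  by apply: (bounded_integrable_itv (M := `|k|)) => //; exact: measurable_cst.
have fi : mu.-integrable `[x, y] (EFin \o f) by exact: bounded_integrable_itv mf fM.
rewrite -(cst_int c) -(RintegralB (measurable_itvR _) fi (ci c))//.
apply: (le_trans (le_normr_Rintegral _ _)) => //.
  by have := integrableB (measurable_itvR _) fi (ci c).
rewrite -(cst_int B); apply: le_Rintegral => //.
apply: integrable_norm.
by have := integrableB (measurable_itvR _) fi (ci c).
Qed.

Lemma oint_approx (f : R -> R) (K M p q : R) : measurable_fun setT f ->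
  (forall t, `|f t| <= M) -> (forall s t, `|f s - f t| <= K * `|s - t|) ->
  `|oint f p q - f p * (q - p)| <= K * (q - p) ^+ 2.
Proof.
move=> mf fM fK.
have K0 : 0 <= K by have := fK 1 0; rewrite subr0 normr1 mulr1; exact: le_trans.
have [pq|/ltW qp] := leP p q.
  rewrite oint_le// expr2 mulrA; apply: (Rintegral_itv_approx mf fM) => // t /andP[pt tq].
  by apply: (le_trans (fK _ _)); rewrite ler_wpM2l// ger0_norm; lra.
rewrite ointC oint_le// -normrN opprD opprK -mulrN opprB.
rewrite -sqrrN opprB expr2 mulrA; apply: (Rintegral_itv_approx mf fM) => // t /andP[qt tp].
by apply: (le_trans (fK _ _)); rewrite ler_wpM2l// distrC ger0_norm; lra.
Qed.

Lemma clip01_lipschitz (x y : R) :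
  `|Num.max 0 (Num.min 1 x) - Num.max 0 (Num.min 1 y)| <= `|x - y|.
Proof.
wlog xy : x y / x <= y.
  by move=> H; have [/H//|/ltW/H] := leP x y; rewrite distrC (distrC x).
rewrite distrC (distrC x) [leRHS]ger0_norm ?subr_ge0//.
rewrite ler_norml.
have [x1|x1] := leP 1 x; have [y1|y1] := leP 1 y; rewrite ?(max_r ler01).
- by apply/andP; split; lra.
- by exfalso; lra.
- by have [x0|x0] := leP 0 x; apply/andP; split; lra.
- by have [x0|x0] := leP 0 x; have [y0|y0] := leP 0 y; apply/andP; split; lra.
Qed.

Section chain.
Variables (h U0 : R) (g : R -> R).
Hypothesis h0 : 0 <= h.
Hypothesis ig : mu.-integrable `[0, h] (EFin \o g).

Let U t := U0 + \int[mu]_(s in `[0, t]) g s.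
Let G t := \int[mu]_(s in `[0, t]) `|g s|.

Let igW (x y : R) : 0 <= x -> y <= h -> mu.-integrable `[x, y] (EFin \o g).
Proof.
move=> x0 yh; apply: integrableS ig => //; apply: subset_itv; by rewrite bnd_simp.
Qed.

Let ign (x y : R) : 0 <= x -> y <= h -> mu.-integrable `[x, y] (EFin \o (fun t => `|g t|)).
Proof. by move=> x0 yh; apply: integrable_norm; exact: igW. Qed.

Let itvB (k : R -> R) (x y : R) : mu.-integrable `[0, h] (EFin \o k) ->
  0 <= x -> x <= y -> y <= h ->
  \int[mu]_(s in `[0, y]) k s - \int[mu]_(s in `[0, x]) k s =
  \int[mu]_(s in `[x, y]) k s.
Proof.
move=> ik x0 xy yh.
have iW (a b : R) : 0 <= a -> b <= h -> mu.-integrable `[a, b] (EFin \o k).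
  move=> a0 bh; apply: integrableS ik => //; apply: subset_itv; by rewrite bnd_simp.
rewrite -(Rintegral_itv_obnd_cbnd (r := x)); last first.
  apply: integrableS (iW x y x0 yh) => //.
  by apply: subset_itvr; rewrite bnd_simp.
by apply: Rintegral_itvB; rewrite ?bnd_simp//; exact: iW.
Qed.

Let U_cont : {within `[0, h], continuous U}.
Proof.
have := @parameterized_integral_continuous R 0 h g h0 ig.
rewrite /parameterized_integral => H x.
by apply: cvgD; [exact: cvg_cst|exact: H].
Qed.

Lemma measurable_chain_prim : measurable_fun `[0, h] U.
Proof. by apply: subspace_continuous_measurable_fun. Qed.

Lemma integrable_chain (f : R -> R) (M : R) : measurable_fun setT f -> (forall t, `|f t| <= M) ->
  mu.-integrable `[0, h] (EFin \o (fun t => f (U t) * g t)).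
Proof.
move=> mf fM.
have := @integrableMr _ _ _ mu `[0, h] (measurable_itvR _) (f \o U) (EFin \o g).
apply => //.
- exact: (measurableT_comp mf measurable_chain_prim).
- by exists M; split; [exact: num_real|move=> z Mz t _; exact: le_trans (fM _) (ltW Mz)].
Qed.

(* The defect of the identity is additive in the interval and quadratic in the
   length of the interval, so it vanishes by bisection. *)
Lemma chain_lipschitz (f : R -> R) (K M : R) : measurable_fun setT f ->
  (forall t, `|f t| <= M) -> (forall s t, `|f s - f t| <= K * `|s - t|) ->
  oint f (U 0) (U h) = \int[mu]_(t in `[0, h]) (f (U t) * g t).
Proof.
move=> mf fM fK.
have K0 : 0 <= K by have := fK 1 0; rewrite subr0 normr1 mulr1; exact: le_trans.
pose D x y := oint f (U x) (U y) - \int[mu]_(t in `[x, y]) (f (U t) * g t).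
have ic := integrable_chain mf fM.
suff : D 0 h = 0 by move/eqP; rewrite subr_eq0 => /eqP.
have ingn : mu.-integrable `[0, h] (EFin \o (fun t => `|g t|)) by exact: ign.
have Gxy (x y : R) : 0 <= x -> x <= y -> y <= h -> G y - G x = \int[mu]_(t in `[x, y]) `|g t|.
  by move=> x0 xy yh; rewrite /G itvB.
have Uxy (x y : R) : 0 <= x -> x <= y -> y <= h -> U y - U x = \int[mu]_(t in `[x, y]) g t.
  by move=> x0 xy yh; rewrite /U -itvB//; ring.
have Gge0 (x y : R) : 0 <= x -> x <= y -> y <= h -> 0 <= G y - G x.
  by move=> x0 xy yh; rewrite Gxy//; apply: Rintegral_ge0 => t _; exact: normr_ge0.
have UG (x y : R) : 0 <= x -> x <= y -> y <= h -> `|U y - U x| <= G y - G x.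
  move=> x0 xy yh; rewrite Uxy// Gxy//; apply: le_normr_Rintegral => //.
  exact: igW.
(* Both integrals are compared with [f (U x) * (U y - U x)], each at the cost of
   [K * (G y - G x) ^+ 2]; hence the constant [2 * K]. *)
apply: (@additive_quadratic_eq0 D G (2 * K) 0 h) => //.
- move=> x y z x0 xy yz zh; rewrite /D (ointD (U x) (U y) (U z) mf fM).
  have alg (p q A B C I J L : R) : B - A = I -> C - B = J -> C - A = L ->
      p + q - L = p - I + (q - J) by move=> <- <- <-; ring.
  exact: (alg _ _ _ _ _ _ _ _ (itvB ic x0 xy (le_trans yz zh))
    (itvB ic (le_trans x0 xy) yz zh) (itvB ic x0 (le_trans xy yz) zh)).
- move=> x y x0 xy yh; rewrite /D.
  have H1 := oint_approx (U x) (U y) mf fM fK.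
  have H2 : `|f (U x) * (U y - U x) - \int[mu]_(t in `[x, y]) (f (U t) * g t)| <=
      K * (G y - G x) ^+ 2.
    rewrite Uxy// -RintegralZl//; last exact: igW.
    have i1 : mu.-integrable `[x, y] (EFin \o (fun t => f (U x) * g t)).
      by have := integrableZl (measurable_itvR _) (f (U x)) (igW x0 yh).
    have i2 : mu.-integrable `[x, y] (EFin \o (fun t => f (U t) * g t)).
      by apply: integrableS ic => //; apply: subset_itv; rewrite bnd_simp.
    rewrite -RintegralB//; apply: (le_trans (le_normr_Rintegral _ _)) => //.
      by have := integrableB (measurable_itvR _) i1 i2.
    rewrite expr2 mulrA {2}Gxy// -RintegralZl//; last exact: ign.
    apply: le_Rintegral => //.
    + by apply: integrable_norm; have := integrableB (measurable_itvR _) i1 i2.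
    + by have := integrableZl (measurable_itvR _) (K * (G y - G x)) (ign x0 yh).
    move=> t /=; rewrite in_itv/= => /andP[xt ty].
    rewrite -mulrBl normrM ler_wpM2r//; apply: (le_trans (fK _ _)).
    rewrite ler_wpM2l// distrC; apply: (le_trans (UG _ _ x0 xt (le_trans ty yh))).
    by rewrite lerB//; have := Gge0 _ _ (le_trans x0 xt) ty yh; lra.
  have H3 : K * (U y - U x) ^+ 2 <= K * (G y - G x) ^+ 2.
    rewrite ler_wpM2l// -(real_normK (num_real (U y - U x))).
    rewrite ler_pXn2r ?nnegrE ?normr_ge0//.
      exact: UG.
    exact: Gge0.
  have alg (p q r : R) : p - r = (p - q) + (q - r) by ring.
  have -> : oint f (U x) (U y) - \int[mu]_(t in `[x, y]) (f (U t) * g t) = _ :=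
    alg _ (f (U x) * (U y - U x)) _.
  apply: (le_trans (ler_normD _ _)); rewrite -mulrA mulr2n mulrDl !mul1r.
  exact: lerD (le_trans H1 H3) H2.
- exact: (@parameterized_integral_continuous R 0 h (fun t => `|g t|) h0).
- move=> x y; rewrite !in_itv/= => /andP[x0 _] /andP[_ yh] xy.
  by rewrite -subr_ge0; exact: Gge0.
Qed.

(* The identity passes to the monotone class generated by Lipschitz functions. *)
Lemma chain_bounded : forall (f : R -> R) (M : R), measurable_fun setT f ->
  (forall t, `|f t| <= M) ->
  oint f (U 0) (U h) = \int[mu]_(t in `[0, h]) (f (U t) * g t).
Proof.
have int1 x y : forall (f0 : R -> R) (M0 : R), measurable_fun setT f0 -> (forall t, `|f0 t| <= M0) ->
    mu.-integrable `[x, y] (EFin \o f0) by move=> *; exact: bounded_integrable_itv.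
have Plim (f_ : nat -> R -> R) (f : R -> R) (M : R) :
    (forall k, measurable_fun setT (f_ k)) -> measurable_fun setT f ->
    (forall k x, `|f_ k x| <= M) ->
    (forall k, oint (f_ k) (U 0) (U h) = \int[mu]_(t in `[0, h]) (f_ k (U t) * g t)) ->
    (forall x, f_ k x @[k --> \oo] --> f x) ->
    oint f (U 0) (U h) = \int[mu]_(t in `[0, h]) (f (U t) * g t).
  move=> mf_ mf f_M Ef ff.
  have c1 : oint (f_ k) (U 0) (U h) @[k --> \oo] --> oint f (U 0) (U h).
    apply: cvgB.
      apply: (@Rintegral_dominated_cvg _ _ _ _ _ _ _ (cst M)) => //.
      - by move=> k; apply: measurable_funR; exact: mf_.
      - by apply: measurable_funR; exact: mf.
      - exact: (int1 _ _ (cst M) `|M|).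
    apply: (@Rintegral_dominated_cvg _ _ _ _ _ _ _ (cst M)) => //.
    - by move=> k; apply: measurable_funR; exact: mf_.
    - by apply: measurable_funR; exact: mf.
    - exact: (int1 _ _ (cst M) `|M|).
  have c2 : \int[mu]_(t in `[0, h]) (f_ k (U t) * g t) @[k --> \oo] -->
      \int[mu]_(t in `[0, h]) (f (U t) * g t).
    have mg : measurable_fun `[0, h] g by move/integrableP : ig => [/measurable_EFinP].
    apply: (@Rintegral_dominated_cvg _ _ R mu `[0, h]%classic (fun k t => f_ k (U t) * g t)
      (fun t => f (U t) * g t) (fun t => M * `|g t|)) => //.
    - move=> k; apply: measurable_funM => //.
      exact: (measurableT_comp (mf_ k) measurable_chain_prim).
    - apply: measurable_funM => //.
      exact: (measurableT_comp mf measurable_chain_prim).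
    - by move=> t _; apply: cvgMl; exact: ff.
    - by have := integrableZl (measurable_itvR _) M (ign (lexx 0) (lexx h)).
    - by move=> k t _; rewrite normrM ler_wpM2r.
  rewrite -(cvg_lim _ c1)// -(cvg_lim _ c2)//.
  by under eq_fun do rewrite Ef.
move=> f M mf fM.
refine (@bounded_measurable_ind _ (measurableTypeR R) R (@RGenOInfty.G R)
  (fun f : R -> R => oint f (U 0) (U h) = \int[mu]_(t in `[0, h]) (f (U t) * g t))
  _ _ _ _ _ _ f M mf fM).
- move=> _ _ [a ->] [b ->]; exists (Num.max a b).
  by apply/seteqP; split => x /=; rewrite !in_itv/= !andbT gt_max => /andP.
- exact: RGenOInfty.measurableE.
- move=> _ [c ->].
  (* Ramps of slope [k] converging pointwise to the indicator of a half-line; half-lines generate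
     the Borel sets and are stable under intersection. *)
  pose f_ (k : nat) t : R := Num.max 0 (Num.min 1 (k%:R * (t - c))).
  have f01 k t : 0 <= f_ k t <= 1.
    by rewrite /f_ le_max lexx/= ge_max ler01/= ge_min lexx.
  apply: (Plim f_ _ 1).
  + move=> k; apply: measurable_maxr => //; apply: measurable_minr => //.
    by apply: measurable_funM => //; exact: measurable_funB.
  + by apply: measurable_indic; exact: measurable_itv.
  + by move=> k t; rewrite ger0_norm; have /andP[] := f01 k t.
  + move=> k; apply: (@chain_lipschitz _ k%:R 1).
    * apply: measurable_maxr => //; apply: measurable_minr => //.
      by apply: measurable_funM => //; exact: measurable_funB.
    * by move=> t; rewrite ger0_norm; have /andP[] := f01 k t.
    * move=> s t; have k0 : (0 : R) <= k%:R by [].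
      have -> : k%:R * `|s - t| = `|k%:R * (s - c) - k%:R * (t - c)|.
        by rewrite -mulrBr normrM (ger0_norm k0); congr (_ * `|_|); ring.
      exact: clip01_lipschitz.
  + move=> x.
    have [xc|xc] := leP x c.
      apply: cvg_near_cst; apply: nearW => k; rewrite /f_.
      have kx : k%:R * (x - c) <= 0 by rewrite mulr_ge0_le0// subr_le0.
      rewrite indicE memNset; last by rewrite /= in_itv/= andbT => /(le_lt_trans xc); rewrite ltxx.
      by rewrite min_r ?max_l// (le_trans kx).
    apply: cvg_near_cst; near=> k; rewrite /f_ indicE mem_set; last by rewrite /= in_itv/= andbT.
    rewrite min_l ?max_r ?ler01// -ler_pdivrMr ?subr_gt0//.
    by near: k; exact: nbhs_infty_ger.
- apply: (@chain_lipschitz _ 0 1); first exact: measurable_cst.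
    by move=> t; rewrite normr1.
  by move=> s t; rewrite subrr normr0 mul0r.
- move=> a {mf fM} {}f k mf mk [Mf fM] [Mk kM] Pf Pk.
  have olin x y : \int[mu]_(t in `[x, y]) (a * f t + k t) =
      a * \int[mu]_(t in `[x, y]) f t + \int[mu]_(t in `[x, y]) k t.
    have if_ := int1 x y f Mf mf fM; have ik := int1 x y k Mk mk kM.
    rewrite (RintegralD (f1 := fun t => a * f t)) ?RintegralZl//.
    by have := integrableZl (measurable_itvR _) a if_.
  have -> : oint (fun x => a * f x + k x) (U 0) (U h) =
      a * oint f (U 0) (U h) + oint k (U 0) (U h).
    by rewrite /oint !olin mulrBr opprD addrACA.
  rewrite Pf Pk -RintegralZl//; last exact: integrable_chain mf fM.
  rewrite -RintegralD//; last 2 first.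
  - by have := integrableZl (measurable_itvR _) a (integrable_chain mf fM).
  - exact: integrable_chain mk kM.
  by apply: eq_Rintegral => t _; rewrite mulrDl mulrA.
- by move=> f_ {mf fM} {}f {}M *; apply: (Plim f_ f M).
Unshelve. all: by end_near. Qed.

End chain.
End chain_1d.

(** * Test functions and weak derivatives *)

Section bump.
Context {R : realType}.

(** The polynomial in [1 / x] makes the family stable under differentiation; [P = 1] is the
    classical flat function. *)
Definition bump_exp (P : {poly R}) (x : R) : R :=
  if 0 < x then P.[x^-1] * expR (- x^-1) else 0.

Lemma exprn_le_expR k (z : R) : 0 <= z -> z ^+ k.+1 <= k.+1%:R ^+ k.+1 * expR z.
Proof.
move=> z0; have k0 : (0 : R) < k.+1%:R by [].
have -> : expR z = expR (z / k.+1%:R) ^+ k.+1.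
  by rewrite -expRM_natl mulrC divfK// gt_eqF.
rewrite -exprMn; apply: lerXn2r; rewrite ?nnegrE// ?mulr_ge0 ?expR_ge0//.
rewrite -ler_pdivrMl// mulrC; apply: le_trans (expR_ge1Dx _).
by rewrite lerDr.
Qed.

(** With [z = 1 / x], the exponential beats two more powers of [z] than the polynomial has. The
    quadratic rate makes the difference quotient at 0 vanish in the limit. *)
Lemma bump_exp_small (P : {poly R}) : exists2 C : R, 0 <= C &
  forall x, 0 < x -> x <= 1 -> `|bump_exp P x| <= C * x ^+ 2.
Proof.
pose A : R := \sum_(i < size P) `|P`_i|.
pose k := (size P).+1.
exists (A * k.+1%:R ^+ k.+1).
  by rewrite mulr_ge0 ?exprn_ge0// sumr_ge0.
move=> x x0 x1; rewrite /bump_exp x0.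
set z := x^-1; have z0 : 0 < z by rewrite invr_gt0.
have z1 : 1 <= z by rewrite -invr1 lef_pV2// posrE.
have PA : `|P.[z]| <= A * z ^+ (size P).
  rewrite horner_coef (le_trans (ler_norm_sum _ _ _))// /A mulr_suml ler_sum// => i _.
  rewrite normrM ler_wpM2l// ger0_norm ?exprn_ge0 ?(ltW z0)//.
  by rewrite ler_weXn2l// ltnW.
rewrite normrM (gtr0_norm (expR_gt0 _)).
apply: (@le_trans _ _ (A * z ^+ size P * expR (- z))).
  by rewrite ler_wpM2r// expR_ge0.
rewrite expRN -mulrA -mulrA ler_wpM2l ?sumr_ge0//.
rewrite ler_pdivrMr ?expR_gt0//.
have -> : x = z^-1 by rewrite invrK.
rewrite (_ : _ * _ * _ = k.+1%:R ^+ k.+1 * expR z / z ^+ 2); last by rewrite exprVn mulrAC.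
rewrite ler_pdivlMr ?exprn_gt0// -exprD addn2.
exact/exprn_le_expR/ltW.
Qed.

Lemma is_derive_bump_exp (P : {poly R}) (x : R) :
  is_derive x 1 (bump_exp P) (bump_exp ('X ^+ 2 * (P - P^`())) x).
Proof.
have [x0|x0|x0] := ltgtP 0 x.
- have H : is_derive x 1 (fun y => P.[y^-1] * expR (- y^-1))
      (bump_exp ('X ^+ 2 * (P - P^`())) x).
    have dinv : is_derive x 1 (@GRing.inv R) (- x ^- 2 *: 1).
      by apply: is_deriveV => //; rewrite gt_eqF.
    have dexp : is_derive (x^-1) 1 (fun z : R => expR (- z)) (expR (- x^-1) * - 1).
      exact: (@is_derive1_comp _ expR (fun z => - z)).
    have dP : is_derive (x^-1) 1 (horner P) (P^`()).[x^-1] by exact: is_derive_poly.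
    have := is_derive1_comp (is_deriveM dP dexp) dinv.
    move=> H; apply: is_derive_eq.
    rewrite /bump_exp x0 /= !hornerE -exprVn /GRing.scale/=; ring.
  apply: near_eq_is_derive H.
  near=> y; rewrite /bump_exp ifT//.
  by near: y; exact: lt_nbhsr.
- have H : is_derive x 1 (cst 0 : R -> R) (bump_exp ('X ^+ 2 * (P - P^`())) x).
    by rewrite /bump_exp ltNge (ltW x0)/=; exact: is_derive_cst.
  apply: near_eq_is_derive H.
  near=> y; rewrite /bump_exp ifF//.
  by apply/negbTE; rewrite -leNgt ltW//; near: y; exact: lt_nbhsl.
rewrite -x0 {x0 x}.
have [C C0 hC] := bump_exp_small P.
have b0 Q : bump_exp Q 0 = 0 by rewrite /bump_exp ltxx.
have cv : (fun h : R => h^-1 *: ((bump_exp P \o shift 0) (h *: 1) - bump_exp P 0)) @ 0^'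
    --> (0 : R).
  apply/cvgrPdist_le => e e0; near=> h.
  rewrite sub0r normrN b0 subr0 /= addr0 /GRing.scale/= mulr1.
  have [h0|h0] := leP h 0.
    by rewrite /bump_exp ltNge h0/= mulr0 normr0 ltW.
  have h1 : h <= 1.
    apply: (le_trans (ler_norm _)); near: h; apply: dnbhs0_le.
    exact: ltr01.
  rewrite normrM normfV (gtr0_norm h0) ler_pdivrMl//.
  apply: (le_trans (hC _ h0 h1)); rewrite expr2 mulrA mulrC ler_wpM2l ?(ltW h0)//.
  have Ch : `|h| <= e / (C + 1).
    by near: h; apply: dnbhs0_le; rewrite divr_gt0// ltr_wpDl.
  rewrite gtr0_norm// in Ch; apply: (@le_trans _ _ ((C + 1) * h)).
    by rewrite ler_wpM2r ?(ltW h0)// lerDl.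
  by rewrite mulrC -ler_pdivlMr// ltr_wpDl.
rewrite b0; apply: DeriveDef; first by apply/cvg_ex; exists 0.
exact: cvg_lim cv.
Unshelve. all: by end_near. Qed.

Lemma bump1_ge0 x : 0 <= bump_exp 1 x.
Proof. by rewrite /bump_exp; case: ifP => // _; rewrite hornerE mul1r expR_ge0. Qed.

Lemma bump1_le1 x : bump_exp 1 x <= 1.
Proof.
rewrite /bump_exp; case: ifP => // x0; rewrite hornerE mul1r -expR0 ler_expR.
by rewrite oppr_le0 invr_ge0 ltW.
Qed.

Lemma bump1_cvg x : bump_exp 1 (k%:R * x) @[k --> \oo] --> (\1_[set y : R | 0 < y] x : R).
Proof.
rewrite indicE; have [x0|x0] := ltP 0 x; last first.
  rewrite memNset; last by rewrite /= ltNge x0.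
  apply: cvg_near_cst; apply: nearW => k.
  by rewrite /bump_exp ltNge mulr_ge0_le0.
rewrite mem_set//.
have E : \forall k \near \oo, expR (- (x^-1 * (k%:R)^-1)) = bump_exp 1 (k%:R * x).
  near=> k; have k0 : (0 : R) < k%:R.
    by rewrite ltr0n; near: k; exact: nbhs_infty_gt.
  by rewrite /bump_exp mulr_gt0// hornerE mul1r invfM mulrC.
apply: cvg_trans (near_eq_cvg E) _.
have -> : nbhs (true%:R : R) = nbhs (expR (- (x^-1 * 0))) by rewrite mulr0 oppr0 expR0.
apply: continuous_cvg; first exact: continuous_expR.
apply: cvgN; apply: cvgMr; apply/cvgrPdist_lt => e e0.
have [N _ hN] := near_infty_natSinv_lt (PosNum e0).
exists N.+1 => // k /= Nk; rewrite sub0r normrN ger0_norm ?invr_ge0//.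
case: k Nk => // k Nk; exact: hN.
Unshelve. all: by end_near. Qed.

End bump.

Section smooth.
Context {R : realType} {n : nat}.
Local Notation V := 'rV[R]_n.
Local Notation E i := (delta_mx ord0 i : V).

(** A test function must have differentiable partial derivatives of every order. An explicit class
    stable under partial derivatives reduces this to one induction. *)
Inductive smooth_bump : (V -> R) -> Prop :=
| smooth_comp (P : {poly R}) i (a c : R) :
    smooth_bump (fun x => bump_exp P (a * x ord0 i + c))
| smooth_cst (c : R) : smooth_bump (cst c)
| smooth_scale (k : R) f : smooth_bump f -> smooth_bump (k *: f)
| smooth_add f g : smooth_bump f -> smooth_bump g -> smooth_bump (f + g)
| smooth_mul f g : smooth_bump f -> smooth_bump g -> smooth_bump (f * g).

Lemma smooth_bump_diff f : smooth_bump f ->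
  (forall x, differentiable f x) /\ forall i, smooth_bump ('D_(E i) f).
Proof.
elim=> {f} [P i a c|c|k f _ [df Sf]|f g Sf [df Sdf] Sg [dg Sdg]|f g Sf [df Sdf] Sg [dg Sdg]].
- split=> [x|j].
    apply: (@differentiable_comp _ _ _ _ (fun x : V => a * x ord0 i + c) (bump_exp P)).
      apply: differentiableD; last exact: differentiable_cst.
      by apply: (@differentiableZ _ _ _ (fun x : V => x ord0 i) a); exact: differentiable_coord.
    by apply/derivable1_diffP; have [] := is_derive_bump_exp P (a * x ord0 i + c).
  pose Q := 'X ^+ 2 * (P - P^`()).
  have -> : 'D_(E j) (fun x : V => bump_exp P (a * x ord0 i + c)) =
      (a * (i == j)%:R) *: (fun x : V => bump_exp Q (a * x ord0 i + c)).
    apply/funext => x.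
    transitivity ('D_(a * (i == j)%:R) (bump_exp P) (a * x ord0 i + c)).
      rewrite /derive.
      have -> : (fun h : R => h^-1 *: (((fun x0 : V => bump_exp P (a * x0 ord0 i + c)) \o shift x) (h *: E j) - bump_exp P (a * x ord0 i + c))) =
         (fun h : R => h^-1 *: ((bump_exp P \o shift (a * x ord0 i + c)) (h *: (a * (i == j)%:R)) - bump_exp P (a * x ord0 i + c))) => //.
      apply/funext => h /=.
      by rewrite !mxE eqxx/=; congr (_ *: (bump_exp P _ - _)); rewrite /GRing.scale/=; ring.
    have [dP eP] := is_derive_bump_exp P (a * x ord0 i + c).
    have db : differentiable (bump_exp P) (a * x ord0 i + c) by exact/derivable1_diffP.
    transitivity ((a * (i == j)%:R) *: 'D_1 (bump_exp P) (a * x ord0 i + c)).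
      rewrite !deriveE// -linearZ; congr ('d _ _ _).
      by rewrite [RHS]mulr1.
    by rewrite eP.
  exact/smooth_scale/smooth_comp.
- split=> [x|j]; first exact: differentiable_cst.
  rewrite (_ : 'D_(E j) (cst c) = cst 0); first exact: smooth_cst.
  by apply/funext => x; rewrite derive_cst.
- split=> [x|j]; first exact: differentiableZ.
  rewrite (_ : 'D_(E j) (k *: f) = k *: 'D_(E j) f); first exact: smooth_scale.
  by apply/funext => x; rewrite deriveZ//; exact: diff_derivable.
- split=> [x|j]; first exact: differentiableD.
  rewrite (_ : 'D_(E j) (f + g) = 'D_(E j) f + 'D_(E j) g); first exact: smooth_add.
  by apply/funext => x; rewrite deriveD//; exact: diff_derivable.
- split=> [x|j]; first exact: differentiableM.
  rewrite (_ : 'D_(E j) (f * g) = f * 'D_(E j) g + g * 'D_(E j) f).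
    by apply: smooth_add; exact: smooth_mul.
  by apply/funext => x; rewrite deriveM//; exact: diff_derivable.
Qed.

Lemma smooth_bump_test f K : smooth_bump f -> compact K ->
  (forall x, ~ K x -> f x = 0) -> test_function f.
Proof.
move=> Sf cK fK; split; last by exists K.
suff Sp s : smooth_bump (partials s f) by move=> s x; exact: (smooth_bump_diff (Sp s)).1.
by elim: s => //= i s IH; exact: (smooth_bump_diff IH).2.
Qed.

Definition rV_box (a b : V) : set V := [set x | forall i, a ord0 i < x ord0 i < b ord0 i].

(** Smooth functions between 0 and 1 that vanish off the open box and converge to its indicator as
    [k] grows; the only test functions that are ever built. *)
Definition box_bump (a b : V) (k : nat) : V -> R := fun x =>
  \prod_(i < n) (bump_exp 1 (k%:R * (x ord0 i - a ord0 i)) *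
                 bump_exp 1 (k%:R * (b ord0 i - x ord0 i))).

Lemma box_bump_smooth a b k : smooth_bump (box_bump a b k).
Proof.
rewrite /box_bump; elim: (index_enum _) => [|i s IH].
  rewrite (_ : (fun x => _) = cst 1); first exact: smooth_cst.
  by apply/funext => x; rewrite big_nil.
rewrite (_ : (fun x => _) = ((fun x : V => bump_exp 1 (k%:R * x ord0 i + - (k%:R * a ord0 i))) *
    (fun x : V => bump_exp 1 ((- k%:R) * x ord0 i + k%:R * b ord0 i))) *
    (fun x => \prod_(j <- s) (bump_exp 1 (k%:R * (x ord0 j - a ord0 j)) *
                 bump_exp 1 (k%:R * (b ord0 j - x ord0 j))))).
  apply: smooth_mul => //; apply: smooth_mul; exact: smooth_comp.
apply/funext => x; rewrite big_cons; congr (bump_exp _ _ * bump_exp _ _ * _); ring.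
Qed.

Lemma box_bump_ge0 a b k x : 0 <= box_bump a b k x.
Proof. by apply: prodr_ge0 => i _; rewrite mulr_ge0// bump1_ge0. Qed.

Lemma box_bump_le1 a b k x : box_bump a b k x <= 1.
Proof.
suff : 0 <= box_bump a b k x <= 1 by case/andP.
apply: (big_ind (fun y : R => 0 <= y <= 1)); first by rewrite ler01 lexx.
  by move=> y z /andP[y0 y1] /andP[z0 z1]; rewrite mulr_ge0//= mulr_ile1.
by move=> i _; rewrite mulr_ge0 ?bump1_ge0//= mulr_ile1 ?bump1_ge0 ?bump1_le1.
Qed.

Lemma box_bump_supp a b k x : ~ rV_box a b x -> box_bump a b k x = 0.
Proof.
move=> nx; have [i /negP ni] : exists i, ~ (a ord0 i < x ord0 i < b ord0 i).
  by apply/existsNP.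
rewrite /box_bump (bigD1 i)//= {1}/bump_exp.
case: ifP => [k1|_]; last by rewrite !mul0r.
rewrite [X in _ * X * _](_ : _ = 0) ?mulr0 ?mul0r//.
rewrite /bump_exp ifF//; apply/negP => k2; move/negP : ni; apply.
have [k0|k0] := eqVneq (k%:R : R) 0; first by move: k1; rewrite k0 mul0r ltxx.
have kp : (0 : R) < k%:R by rewrite lt_def k0 ler0n.
by move: k1 k2; rewrite !pmulr_rgt0// !subr_gt0 => -> ->.
Qed.

Lemma box_bump_cvg a b x : box_bump a b k x @[k --> \oo] --> (\1_(rV_box a b) x : R).
Proof.
have -> : \1_(rV_box a b) x = \prod_(i < n) (\1_[set y : R | 0 < y] (x ord0 i - a ord0 i) *
    \1_[set y : R | 0 < y] (b ord0 i - x ord0 i)) :> R.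
  rewrite indicE; have [/set_mem xab|/negP xab] := boolP (x \in _).
    by rewrite big1// => i _; rewrite !indicE !mem_set/= ?subr_gt0 ?mulr1//; have /andP[] := xab i.
  have [i /negP ni] : exists i, ~ (a ord0 i < x ord0 i < b ord0 i).
    by apply/existsNP => H; apply: xab; rewrite inE.
  rewrite (bigD1 i)//= !indicE.
  have [ai|ai] := ltP (a ord0 i) (x ord0 i); last first.
    by rewrite memNset ?mul0r//= subr_gt0 ltNge ai.
  rewrite [X in _ * X * _](_ : _ = 0) ?mulr0 ?mul0r//.
  by rewrite memNset//= subr_gt0 => xb; rewrite ai xb in ni.
rewrite /box_bump; elim: (index_enum _) => [|i s IH].
  by under eq_fun do rewrite big_nil; rewrite big_nil; exact: cvg_cst.
under eq_fun do rewrite big_cons; rewrite big_cons.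
by apply: cvgM IH; apply: cvgM; exact: bump1_cvg.
Qed.

Definition rV_cube (r : R) : set V := [set x | forall i, - r <= x ord0 i <= r].

Lemma compact_rV_cube r : compact (rV_cube r).
Proof.
have := @rV_compact R n (fun=> `[- r, r]%classic) (fun=> @segment_compact _ _ _).
rewrite (_ : [set v : V | _] = rV_cube r)//.
Qed.

Lemma measurable_rV_cube r : measurable (rV_cube r).
Proof.
by apply: closed_measurable_rV; apply: compact_closed; [exact: norm_hausdorff|exact: compact_rV_cube].
Qed.

Lemma rV_cubeS r s : r <= s -> rV_cube r `<=` rV_cube s.
Proof. by move=> rs x H i; have := H i; lra. Qed.

Lemma compact_sub_cube (K : set V) : compact K -> exists r : R, 0 < r /\ K `<=` rV_cube r.
Proof.
move=> /compact_bounded[M [_ MK]]; exists (`|M| + 1); split; first by rewrite ltr_wpDl.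
move=> x /(MK (`|M| + 1)) H i.
have xM : `|x| <= `|M| + 1.
  by apply: H; rewrite (le_lt_trans (ler_norm _))// ltrDl.
rewrite -ler_norml; apply: le_trans xM.
have -> : `|x| = mx_norm x by [].
rewrite mx_normrE.
by apply/bigmax_geP; right => /=; exists (ord0, i).
Qed.

Lemma box_bump_test a b k : test_function (box_bump a b k).
Proof.
pose r : R := \sum_(i < n) (`|a ord0 i| + `|b ord0 i|).
apply: (@smooth_bump_test _ (rV_cube r)).
- exact: box_bump_smooth.
- exact: compact_rV_cube.
move=> x nx; apply: box_bump_supp => xab; apply: nx => i.
have : `|a ord0 i| + `|b ord0 i| <= r.
  rewrite /r (bigD1 i)//= lerDl sumr_ge0// => j _; exact: addr_ge0.
have /andP[] := xab i; have := ler_norm (b ord0 i); have := ler_norm (- a ord0 i).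
have := normr_ge0 (a ord0 i); have := normr_ge0 (b ord0 i).
rewrite normrN; lra.
Qed.

Lemma measurable_rV_box a b : measurable (rV_box a b).
Proof.
rewrite (_ : rV_box a b =
    \bigcap_(i in [set: 'I_n]) (rV_coord i @^-1` `]a ord0 i, b ord0 i[)).
  apply: fin_bigcap_measurable => // i _.
  by rewrite -[X in measurable X]setTI; apply: measurable_rV_coord => //; exact: measurable_itv.
by apply/seteqP; split => [y H i _|y H i]; have := H i; rewrite /= in_itv/=; exact.
Qed.

Definition rV_boxes : set (set V) := [set A | exists a b, A = rV_box a b].

Lemma setI_closed_rV_boxes : setI_closed rV_boxes.
Proof.
move=> _ _ [a [b ->]] [c [d ->]].
exists (\row_i Num.max (a ord0 i) (c ord0 i)), (\row_i Num.min (b ord0 i) (d ord0 i)).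
apply/seteqP; split => x.
  move=> [H1 H2] i; rewrite !mxE gt_max lt_min.
  by have /andP[-> ->] := H1 i; have /andP[-> ->] := H2 i.
by move=> H; split => i; have := H i; rewrite !mxE gt_max lt_min => /andP[/andP[h1 h2] /andP[h3 h4]];
  rewrite ?h1 ?h2 ?h3 ?h4.
Qed.

Lemma measurable_rV_boxes : (measurable : set (set V)) = <<s rV_boxes >>.
Proof.
apply/seteqP; split; last first.
  apply: smallest_sub; first exact: sigma_algebra_measurable.
  by move=> _ [a [b ->]]; exact: measurable_rV_box.
apply: smallest_sub; first exact: smallest_sigma_algebra.
move=> A; rewrite -bigcup_seq => -[i _ [B mB <-]]; rewrite setTI.
have SA : sigma_algebra setT <<s rV_boxes >> by exact: smallest_sigma_algebra.
suff : (measurable : set (set (measurableTypeR R))) `<=`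
    [set B | <<s rV_boxes >> (rV_coord i @^-1` B)] by apply.
move=> {}B {}mB.
have : (@RGenOInfty.G R).-sigma.-measurable B by rewrite -RGenOInfty.measurableE.
apply: (smallest_sub (C := sigma_algebra setT)).
  split=> /=.
  - by rewrite preimage_set0; case: SA.
  - by move=> C HC; rewrite setTD preimage_setC -setTD; case: SA => _ + _; apply.
  - by move=> F HF; rewrite preimage_bigcup; case: SA => _ _; apply.
move=> _ [c ->] /=.
(* An open half-space is exhausted by boxes cut at [- m] and [m] in the remaining directions. *)
rewrite (_ : _ @^-1` _ = \bigcup_(m : nat)
    rV_box (\row_j (if j == i then c else - m%:R)) (\row_j m%:R)).
  by case: SA => _ _; apply => m; apply: sub_sigma_algebra; do 2 eexists.
apply/seteqP; split => [x /=|x [m _ H]] /=; rewrite in_itv/= andbT /rV_coord.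
  move=> cx; pose s : R := \sum_(j < n) `|x ord0 j|.
  have [m ms] : exists m : nat, s < m%:R.
    by have [m _ hm] := nbhs_infty_gtr s; exists m; exact: (hm m (leqnn _)).
  exists m => // j; rewrite !mxE.
  have xs : `|x ord0 j| < m%:R.
    by apply: le_lt_trans ms; rewrite /s (bigD1 j)//= lerDl sumr_ge0.
  move: xs; rewrite ltr_norml => /andP[h1 h2]; rewrite h2 andbT.
  by case: eqP => [->|].
by have := H i; rewrite !mxE eqxx => /andP[].
Qed.

End smooth.

(** * Fubini's theorem for real-valued integrals *)

Section real_fubini.
Context {R : realType}.

Lemma Rintegral_indic d (T : measurableType d) (m : {measure set T -> \bar R})
    (D : set T) (f : T -> R) : \int[m]_(x in D) f x = \int[m]_x (f x * \1_D x).
Proof.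
rewrite Rintegral_mkcond; apply: eq_Rintegral => x _.
by rewrite patchE indicE; case: ifPn => _; rewrite ?mulr1 ?mulr0.
Qed.

Lemma integrable_mul_indic d (T : measurableType d) (m : {measure set T -> \bar R})
    (D : set T) (f : T -> R) : measurable D ->
  m.-integrable D (EFin \o f) <-> m.-integrable setT (EFin \o (fun x => f x * \1_D x)).
Proof.
move=> mD; rewrite [in X in X <-> _](integrable_mkcond _ mD).
rewrite (_ : (EFin \o f) \_ D = EFin \o (fun x => f x * \1_D x))//.
by apply/funext => x; rewrite patchE /= indicE; case: ifPn => _; rewrite ?mulr1 ?mulr0.
Qed.

Lemma ae_Rintegral d (T : measurableType d) (m : {measure set T -> \bar R})
    (D : set T) (f g : T -> R) : measurable D ->
  measurable_fun D f -> measurable_fun D g ->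
  {ae m, forall x, D x -> f x = g x} ->
  \int[m]_(x in D) f x = \int[m]_(x in D) g x.
Proof.
move=> mD mf mg fg; congr fine; apply: ae_eq_integral => //.
- exact/measurable_EFinP.
- exact/measurable_EFinP.
- by apply: filterS fg => x H /H /= ->.
Qed.

Context d1 d2 (T1 : measurableType d1) (T2 : measurableType d2).
Variables (m1 : {sigma_finite_measure set T1 -> \bar R}).
Variables (m2 : {sigma_finite_measure set T2 -> \bar R}).

Lemma integrable_Rintegral1 (f : T1 * T2 -> R) : (m1 \x m2)%E.-integrable setT (EFin \o f) ->
  m1.-integrable setT (EFin \o (fun x => \int[m2]_y f (x, y))).
Proof.
move=> If; have IF := integrable_fubini_F If.
apply: (eq_integrable measurableT (fun x => (fine (fubini_F m2 (EFin \o f) x))%:E)) => //.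
rewrite (_ : (fun x => _) = EFin \o (fine \o fubini_F m2 (EFin \o f)))//.
apply/integrableP; have /integrableP[mF iF] := IF; split.
  by apply/measurable_EFinP; apply: measurableT_comp.
apply: le_lt_trans iF; apply: ge0_le_integral => //.
- apply: measurableT_comp => //; apply/measurable_EFinP; exact: measurableT_comp.
- exact: measurableT_comp.
- by move=> x _ /=; case: fubini_F => [r||]//=; rewrite ?normr0 ?leey.
Qed.

Lemma Rfubini (f : T1 * T2 -> R) : (m1 \x m2)%E.-integrable setT (EFin \o f) ->
  \int[m1]_x \int[m2]_y f (x, y) = \int[m2]_y \int[m1]_x f (x, y).
Proof.
move=> If; have IF := integrable_fubini_F If; have mG := measurable_fubini_G If.
have := Fubini If => /(congr1 fine).
(* [fine] alters the inner integral only where it is infinite, which is a null set. *)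
have -> : fine (\int[m1]_x \int[m2]_y (EFin \o f) (x, y))%E = \int[m1]_x \int[m2]_y f (x, y).
  congr fine; apply: ae_eq_integral => //.
  - by have /integrableP[] := IF.
  - apply/measurable_EFinP; apply: (measurableT_comp (f := fine)) => //; by have /integrableP[] := IF.
  - by have := integrable_ae measurableT IF; apply: filterS => x /(_ I) h _; rewrite /= fineK.
move=> ->; congr fine; apply: ae_eq_integral => //.
- by apply/measurable_EFinP; exact: (measurableT_comp (f := fine)).
- have := ae_integrable2 If; apply: filterS => x Ix _; rewrite /= fineK//.
  exact: integrable_fin_num.
Qed.

End real_fubini.

Lemma measurable_sg (R : realType) : measurable_fun setT (Num.sg : R -> R).
Proof.
apply: nondecreasing_measurable => // x y xy.
case: (sgrP y) => y0; case: (sgrP x) => x0; rewrite ?lexx ?ler01 ?lerN10//; lra.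
Qed.

(** * Locally integrable functions and the fundamental lemma *)

Section locint.
Context {R : realType} {n : nat}.
Local Notation V := 'rV[R]_n.
Local Notation mu := (@borel_lebesgue R n).
Local Notation mu1 := (@lebesgue_measure R).
Implicit Types (u : V -> R) (phi : V -> R).

(** The Borel counterpart of [L1loc]; cubes exhaust the compact sets. *)
Definition locint u := measurable_fun setT u /\
  forall r : R, mu.-integrable (rV_cube r) (EFin \o u).

Lemma borel_lebesgue_cube_lty (r : R) : (mu (rV_cube r) < +oo)%E.
Proof.
have [r0|r0] := ltP 0 r; first by rewrite borel_lebesgue_cube// ltry.
apply: (@le_lt_trans _ _ (mu (rV_cube 1))); last by rewrite borel_lebesgue_cube// ltry.
apply: le_measure; rewrite ?inE; try exact: measurable_rV_cube.
by apply: rV_cubeS; apply: le_trans r0 _.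
Qed.

Lemma bounded_integrable_cube u (M r : R) : measurable_fun setT u ->
  (forall x, rV_cube r x -> `|u x| <= M) -> mu.-integrable (rV_cube r) (EFin \o u).
Proof.
move=> mf fM; apply: measurable_bounded_integrable.
- exact: measurable_rV_cube.
- exact: borel_lebesgue_cube_lty.
- exact: measurable_funTS.
- exists M; split; first by rewrite num_real.
  by move=> y My x /fM /le_trans; apply; exact: ltW.
Qed.

Lemma rV_cube_exhaust (x : V) : exists k : nat, rV_cube k%:R x.
Proof.
have [k _ hk] := nbhs_infty_gtr (\sum_(j < n) `|x ord0 j|).
exists k => i; rewrite -ler_norml; apply: le_trans (ltW (hk k (leqnn _))).
by rewrite (bigD1 i)//= lerDl sumr_ge0.
Qed.

Lemma integrable_mul_bounded d (T : measurableType d) (m : {measure set T -> \bar R})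
    (D : set T) (f g : T -> R) (M : R) : measurable D -> m.-integrable D (EFin \o f) ->
  measurable_fun D g -> (forall x, D x -> `|g x| <= M) ->
  m.-integrable D (EFin \o (fun x => f x * g x)).
Proof.
move=> mD If mg gM; have /integrableP[/measurable_EFinP mf _] := If.
apply: (@le_integrable _ _ _ _ _ _ _ (EFin \o (fun x => f x * M))) => //.
- exact/measurable_EFinP/measurable_funM.
- move=> x Dx /=; rewrite lee_fin !normrM ler_wpM2l//.
  by rewrite (le_trans (gM _ Dx))// ler_norm.
- rewrite (_ : EFin \o _ = (fun x => ((EFin \o f) x * M%:E)%E))//.
  exact: integrableZr.
Qed.

Lemma locint_mul_bounded u (g : V -> R) (M : R) : locint u -> measurable_fun setT g ->
  (forall x, `|g x| <= M) -> locint (fun x => u x * g x).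
Proof.
move=> [mu_ iu] mg gM; split; first exact: measurable_funM.
move=> r; apply: (integrable_mul_bounded (M := M)) => //.
- exact: measurable_rV_cube.
- exact: measurable_funTS.
Qed.

Lemma locint_test u (g : V -> R) (M r : R) : locint u -> measurable_fun setT g ->
  (forall x, `|g x| <= M) -> (forall x, ~ rV_cube r x -> g x = 0) ->
  mu.-integrable setT (EFin \o (fun x => u x * g x)).
Proof.
move=> lu mg gM g0; have [_ /(_ r)] := locint_mul_bounded lu mg gM.
rewrite (integrable_mul_indic _ _ (measurable_rV_cube _)).
rewrite (_ : (fun x => u x * g x * _) = (fun x => u x * g x))//.
apply/funext => x; rewrite indicE; have [xr|/negP xr] := boolP (x \in _); first by rewrite mulr1.
by rewrite g0 ?mulr0 ?mul0r// => rx; apply: xr; rewrite inE.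
Qed.

Lemma locintD u v : locint u -> locint v -> locint (fun x => u x + v x).
Proof.
move=> [mu_ iu] [mv iv]; split; first exact: measurable_funD.
move=> r; rewrite (_ : EFin \o _ = (EFin \o u) \+ (EFin \o v))//.
by apply: integrableD => //; exact: measurable_rV_cube.
Qed.

Lemma locintZ u (c : R) : locint u -> locint (fun x => c * u x).
Proof.
move=> [mu_ iu]; split; first exact: measurable_funM.
move=> r; rewrite (_ : EFin \o _ = (fun x => c%:E * (EFin \o u) x)%E)//.
by apply: integrableZl => //; exact: measurable_rV_cube.
Qed.

Lemma locint_cst (c : R) : locint (cst c).
Proof.
split=> // r; apply: (@bounded_integrable_cube _ `|c|) => //.
Qed.

Lemma locint_sum I (s : seq I) (F : I -> V -> R) : (forall i, locint (F i)) ->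
  locint (fun x => \sum_(i <- s) F i x).
Proof.
move=> lF; elim: s => [|i s IH].
  by under eq_fun do rewrite big_nil; exact: (locint_cst 0).
by under eq_fun do rewrite big_cons; exact: locintD.
Qed.

Lemma rV_cube_norm (x : V) : rV_cube `|x| x.
Proof.
move=> i; rewrite -ler_norml; have -> : `|x| = mx_norm x by [].
by rewrite mx_normrE; apply/bigmax_geP; right => /=; exists (ord0, i).
Qed.

Lemma rV_cubeD (r s : R) (x y : V) : rV_cube r x -> rV_cube s y -> rV_cube (r + s) (x + y).
Proof. by move=> hx hy i; have := hx i; have := hy i; rewrite !mxE; lra. Qed.

Lemma rV_cubeZ (r c : R) (x : V) : 0 <= c -> rV_cube r x -> rV_cube (c * r) (c *: x).
Proof. move=> c0 hx i; have /andP[h1 h2] := hx i; rewrite mxE; nra. Qed.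

Lemma locint_shift u (a : V) : locint u -> locint (fun x => u (x + a)).
Proof.
move=> [mu_ iu]; split; first exact: (measurableT_comp mu_ (measurable_addrV a)).
move=> r; have := iu (r + `|a|).
move=> /(integrable_mul_indic _ _ (measurable_rV_cube _))/(integrable_shift_rV a).
move=> /(integrableS measurableT (measurable_rV_cube r) (@subsetT _ _)).
apply: eq_integrable; first exact: measurable_rV_cube.
move=> x; rewrite inE => rx /=; rewrite indicE mem_set ?mulr1//.
by apply: rV_cubeD => //; exact: rV_cube_norm.
Qed.

(* Every box inside the open cube is a limit of bumps, and boxes generate the
   Borel sets; hence [u] is orthogonal to all bounded functions on the cube. *)
Lemma fundamental_lemma u : locint u ->
  (forall phi, test_function phi -> \int[mu]_x (u x * phi x) = 0) ->
  {ae mu, forall x, u x = 0}.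
Proof.
move=> lu H; have [mu_ iu] := lu.
pose D (k : nat) : set V := rV_box (const_mx (- k%:R)) (const_mx k%:R).
have mD k : measurable (D k) by exact: measurable_rV_box.
have DS k : D k `<=` rV_cube k%:R.
  by move=> x Dx i; have := Dx i; rewrite !mxE => /andP[/ltW -> /ltW ->].
have iD k : mu.-integrable (D k) (EFin \o u).
  exact: (integrableS (measurable_rV_cube _) (mD k) (DS k) (iu _)).
have box0 k a b : rV_box a b `<=` D k -> \int[mu]_(x in D k) (u x * \1_(rV_box a b) x) = 0.
  move=> abk.
  have c1 : \int[mu]_(x in D k) (u x * box_bump a b m x) @[m --> \oo] -->
      \int[mu]_(x in D k) (u x * \1_(rV_box a b) x).
    apply: (@Rintegral_dominated_cvg _ _ _ _ _ _ _ (fun x => `|u x|)) => //.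
    - move=> m; apply: measurable_funTS; apply: measurable_funM => //.
      apply: continuous_measurable_rV => x; apply: differentiable_continuous.
      by have [/(_ [::]) + _] := box_bump_test a b m; apply.
    - apply: measurable_funTS; apply: measurable_funM => //.
      by apply: measurable_indic; exact: measurable_rV_box.
    - by move=> x _; apply: cvgMr; exact: box_bump_cvg.
    - exact: (integrable_abse (iD k)).
    - move=> m x _; rewrite normrM ler_piMr// ger0_norm ?box_bump_ge0//.
      exact: box_bump_le1.
  rewrite -(cvg_lim _ c1)//; apply/cvg_lim => //.
  rewrite (_ : (fun m => _) = cst 0); first exact: cvg_cst.
  apply/funext => m /=; rewrite -(H (box_bump a b m)); last exact: box_bump_test.
  rewrite [LHS]Rintegral_indic; apply: eq_Rintegral => x _; rewrite indicE.
  have [xr|/negP xr] := boolP (x \in _); first by rewrite mulr1.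
  rewrite mulr0 box_bump_supp ?mulr0// => /abk Dx; apply: xr; exact/mem_set.
have all0 k (f : V -> R) (M : R) : measurable_fun setT f -> (forall x, `|f x| <= M) ->
    \int[mu]_(x in D k) (u x * f x) = 0.
  apply: (bounded_measurable_ind (P := fun f => \int[mu]_(x in D k) (u x * f x) = 0)
    setI_closed_rV_boxes measurable_rV_boxes).
  - move=> A GA; have [c [d AE]] : rV_boxes (A `&` D k).
      by apply: setI_closed_rV_boxes => //; do 2 eexists.
    rewrite -(box0 k c d) -AE; last exact: subIsetr.
    apply: eq_Rintegral => x /set_mem Dx.
    by rewrite !indicE in_setI (mem_set Dx) andbT.
  - rewrite -(box0 k (const_mx (- k%:R)) (const_mx k%:R))//.
    by apply: eq_Rintegral => x xD; rewrite indicE xD.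
  - move=> a f0 g0 mf mg [Mf fM] [Mg gM] Pf Pg.
    under eq_Rintegral => x _ do rewrite mulrDr mulrCA.
    have If : mu.-integrable (D k) (EFin \o (fun x => u x * f0 x)).
      by apply: (integrable_mul_bounded (M := Mf)) => //; exact: measurable_funTS.
    have Ig : mu.-integrable (D k) (EFin \o (fun x => u x * g0 x)).
      by apply: (integrable_mul_bounded (M := Mg)) => //; exact: measurable_funTS.
    rewrite RintegralD//; first by rewrite RintegralZl// Pf Pg mulr0 addr0.
    exact: (integrableZl (mD k) a If).
  - move=> f_ f0 M' mf_ mf fM Pf_ ff.
    have c1 : \int[mu]_(x in D k) (u x * f_ m x) @[m --> \oo] -->
        \int[mu]_(x in D k) (u x * f0 x).
      apply: (@Rintegral_dominated_cvg _ _ _ _ _ _ _ (fun x => `|u x| * M')) => //.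
      - by move=> m; apply: measurable_funTS; exact: measurable_funM.
      - by apply: measurable_funTS; exact: measurable_funM.
      - by move=> x _; apply: cvgMr; exact: ff.
      - exact: (integrableZr (mD k) M' (integrable_abse (iD k))).
      - by move=> m x _; rewrite normrM ler_wpM2l.
    rewrite -(cvg_lim _ c1)//; apply/cvg_lim => //.
    by rewrite (_ : (fun m => _) = cst 0); [exact: cvg_cst|apply/funext => m /=].
have aeD k : {ae mu, forall x, D k x -> u x = 0}.
  have : (\int[mu]_(x in D k) `|(EFin \o u) x| = 0)%E.
    rewrite -[LHS]fineK; last first.
      rewrite ge0_fin_numE; last exact: integral_ge0.
      by have /integrableP[] := iD k.
    (* Testing against the sign of [u] gives the integral of its absolute value. *)
    congr EFin; rewrite -(all0 k (Num.sg \o u) 1).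
    - by apply: eq_Rintegral => x _; rewrite /= mulrC -normrEsg.
    - by apply: measurableT_comp => //; exact: measurable_sg.
    - by move=> x /=; rewrite normr_sg; case: eqP; rewrite ?lexx ?ler01.
  move=> H0; have mf : measurable_fun (D k) (EFin \o u).
    by apply/measurable_EFinP; exact: measurable_funTS.
  have [/(_ H0) + _] := ae_eq_integral_abs mu (mD k) mf.
  by apply: filterS => x Hx /Hx [].
move: aeD => /ae_foralln; apply: filterS => x Hx.
have [k kx] := rV_cube_exhaust x; apply: (Hx k.+1) => i.
rewrite !mxE; have := kx i; rewrite -[k.+1]addn1 natrD; lra.
Qed.

End locint.

(** * Calculus of test functions *)

Section test_functions.
Context {R : realType} {n : nat}.
Local Notation V := 'rV[R]_n.
Local Notation E i := (delta_mx ord0 i : V).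
Local Notation mu1 := (@lebesgue_measure R).
Implicit Types (phi : V -> R).

Lemma test_diff phi x : test_function phi -> differentiable phi x.
Proof. by move=> [/(_ [::])]. Qed.

Lemma test_continuous phi : test_function phi -> continuous phi.
Proof. by move=> tphi x; apply: differentiable_continuous; exact: test_diff. Qed.

Lemma test_measurable phi : test_function phi -> measurable_fun setT phi.
Proof. by move=> tphi; apply: continuous_measurable_rV; exact: test_continuous. Qed.

Lemma test_supp phi : test_function phi ->
  exists2 r : R, 0 < r & forall x, ~ rV_cube r x -> phi x = 0.
Proof.
move=> [_ [K cK K0]]; have [r [r0 Kr]] := compact_sub_cube cK.
by exists r => // x nx; apply: K0 => /Kr.
Qed.

Lemma test_bounded phi : test_function phi -> exists2 M : R, 0 <= M &
  forall x, `|phi x| <= M.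
Proof.
move=> tphi; have [_ [K cK K0]] := tphi.
have : compact (phi @` K).
  by apply: continuous_compact => //; apply: continuous_subspaceT; exact: test_continuous.
move=> /compact_bounded[M [_ HM]]; exists (`|M| + 1); first exact: addr_ge0.
move=> x; have [Kx|nKx] := pselect (K x); last by rewrite K0// normr0 addr_ge0.
by apply: HM; [rewrite (le_lt_trans (ler_norm _))// ltrDl|exists x].
Qed.

Lemma derive_supp phi (K : set V) (x y : V) : closed K ->
  (forall x, ~ K x -> phi x = 0) -> ~ K x -> 'D_y phi x = 0.
Proof.
move=> cK K0 nKx; rewrite -(derive_cst (0 : R) x y).
apply: near_eq_derive.
have : nbhs x (~` K) by apply: open_nbhs_nbhs; split => //; rewrite openC.
by apply: filterS => z /K0.
Qed.

Lemma test_partial phi i : test_function phi -> test_function ('D_(E i) phi).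
Proof.
move=> [dphi [K cK K0]]; split.
  by move=> s x; have := dphi (rcons s i) x; rewrite /partials foldr_rcons.
exists K => // x nKx; apply: derive_supp nKx => //.
by apply: compact_closed => //; exact: norm_hausdorff.
Qed.

Lemma derive_comp_shift phi (a v x : V) : 'D_v (fun x => phi (x - a)) x = 'D_v phi (x - a).
Proof.
rewrite /derive.
have -> // : (fun h : R => h^-1 *: (((fun x => phi (x - a)) \o shift x) (h *: v) - phi (x - a)))
  = (fun h : R => h^-1 *: ((phi \o shift (x - a)) (h *: v) - phi (x - a))).
by apply/funext => h /=; rewrite addrA.
Qed.

Lemma test_shift phi (a : V) : test_function phi -> test_function (fun x => phi (x - a)).
Proof.
move=> tphi; have [r _ hr] := test_supp tphi; have [dphi _] := tphi; split.
  have Ep s : partials s (fun x => phi (x - a)) = (fun x => partials s phi (x - a)).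
    elim: s => //= i s ->; apply/funext => x; exact: derive_comp_shift.
  move=> s x; rewrite Ep.
  apply: (@differentiable_comp _ _ _ _ (fun x => x - a) (partials s phi)) => //.

exists (rV_cube (r + `|a|)); first exact: compact_rV_cube.
move=> x nx; apply: hr => xr; apply: nx; rewrite -[x](subrK a).
by apply: rV_cubeD => //; exact: rV_cube_norm.
Qed.

Lemma test_deriveE phi (x y : V) : test_function phi ->
  'D_y phi x = \sum_i y ord0 i * 'D_(E i) phi x.
Proof.
move=> tphi; have dp := test_diff x tphi.
rewrite deriveE// {1}(matrix_sum_delta y) big_ord1 linear_sum; apply: eq_bigr => i _.
by rewrite linearZ deriveE.
Qed.

Lemma test_derive_continuous phi (y : V) : test_function phi -> continuous ('D_y phi).
Proof.
move=> tphi; have -> : 'D_y phi = (fun x => \sum_i y ord0 i * 'D_(E i) phi x).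
  by apply/funext => x; exact: test_deriveE.
elim: (index_enum _) => [|i s IH].
  by under eq_fun do rewrite big_nil; exact: cst_continuous.
under eq_fun do rewrite big_cons.
move=> x; apply: (@continuousD _ _ _ (fun x => y ord0 i * 'D_(E i) phi x)); last exact: IH.
apply: (@continuousM _ _ (cst (y ord0 i)) ('D_(E i) phi)); first exact: cst_continuous.
exact/test_continuous/test_partial.
Qed.

Lemma test_derive_bounded phi (y : V) : test_function phi -> exists2 M : R, 0 <= M &
  forall x, `|'D_y phi x| <= M.
Proof.
move=> tphi.
have /choice[M hM] : forall i, exists M : R, 0 <= M /\ forall x, `|'D_(E i) phi x| <= M.
  by move=> i; have [M M0 hM] := test_bounded (test_partial i tphi); exists M.
exists (\sum_i `|y ord0 i| * M i).
  by apply: sumr_ge0 => i _; rewrite mulr_ge0//; have [] := hM i.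
move=> x; rewrite test_deriveE//; apply: le_trans (ler_norm_sum _ _ _) _.
by apply: ler_sum => i _; rewrite normrM ler_wpM2l//; have [_] := hM i.
Qed.

Lemma test_derive_supp phi (r : R) (x y : V) : test_function phi ->
  (forall x, ~ rV_cube r x -> phi x = 0) -> ~ rV_cube r x -> 'D_y phi x = 0.
Proof.
move=> tphi hr nx; apply: derive_supp nx => //.
by apply: compact_closed; [exact: norm_hausdorff|exact: compact_rV_cube].
Qed.

Lemma is_derive_line phi (x y : V) (t : R) : test_function phi ->
  is_derive t 1 (fun t : R => phi (x - t *: y)) (- 'D_y phi (x - t *: y)).
Proof.
move=> tphi; pose z := x - t *: y.
have E1 : (fun h : R => h^-1 *: (((fun t : R => phi (x - t *: y)) \o shift t) (h *: 1) -
     phi (x - t *: y))) = (fun h : R => h^-1 *: ((phi \o shift z) (h *: (- y)) - phi z)).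
  apply/funext => h /=; congr (_ *: (phi _ - _)).
  by apply/rowP => i; rewrite !mxE /GRing.scale/=; ring.
have dz := test_diff z tphi.
apply: DeriveDef.
  rewrite /derivable E1; exact: diff_derivable.
transitivity ('D_(- y) phi z); last by rewrite !deriveE// linearN.
by rewrite /derive E1.
Qed.

Lemma test_line_continuous (x y : V) (g : V -> R) : continuous g ->
  continuous (fun t : R => g (x - t *: y)).
Proof.
move=> cg t; apply: (@continuous_comp _ _ _ (fun t : R => x - t *: y) g); last exact: cg.
apply: cvgB; first exact: cvg_cst.
by apply: cvgZr_tmp; exact: cvg_id.
Qed.

Lemma test_FTC phi (x y : V) (h : R) : test_function phi -> 0 <= h ->
  \int[mu1]_(t in `[0, h]) 'D_y phi (x - t *: y) = phi x - phi (x - h *: y).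
Proof.
move=> tphi; rewrite le_eqVlt => /predU1P[<-|h0].
  by rewrite set_itv1 Rintegral_set1 scale0r subr0 subrr.
have H := @continuous_FTC2 _ (fun t => 'D_y phi (x - t *: y)) (fun t : R => - phi (x - t *: y)) 0 h h0.
rewrite /Rintegral H/=.
- by rewrite scale0r subr0 opprK addrC.
- apply: continuous_subspaceT.
  exact: (test_line_continuous (test_derive_continuous tphi)).
- have cp : continuous (fun t : R => - phi (x - t *: y)).
    by move=> t; apply: cvgN; exact: (test_line_continuous (test_continuous tphi)).
  split.
  + move=> t _; apply: derivableN; by have [] := is_derive_line x y t tphi.
  + by apply: cvg_at_right_filter; exact: cp.
  + by apply: cvg_at_left_filter; exact: cp.
- move=> t _; rewrite derive1E.
  have [dt Et] := is_derive_line x y t tphi.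
  by rewrite deriveN// Et opprK.
Qed.

End test_functions.

(** * Integration of the weak identity along segments *)

Section weak.
Context {R : realType} {n : nat}.
Local Notation V := 'rV[R]_n.
Local Notation E i := (delta_mx ord0 i : V).
Local Notation mu := (@borel_lebesgue R n).
Local Notation mu1 := (@lebesgue_measure R).
Local Notation R1 := (measurableTypeR R).
Implicit Types (phi u : V -> R) (G : V -> V).

Lemma measurable_line (y : V) : measurable_fun setT (fun p : V * R1 => p.1 + p.2 *: y).
Proof.
apply: measurable_funD_rV; first exact: measurable_fst.
apply: measurable_funZ_rV => //; exact: measurable_snd.
Qed.

(** By Tonelli and translation invariance, the inner integral over [x] of the dominating function
    [k] does not depend on [t] in [[0, h]]. *)
Lemma integrable_line u (psi : V * R1 -> R) (M r h : R) (y : V) :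
  locint u -> measurable_fun setT psi -> (forall p, `|psi p| <= M) ->
  (forall p, ~ rV_cube r p.1 -> psi p = 0) -> 0 <= h ->
  (mu \x mu1)%E.-integrable setT
    (EFin \o (fun p => u (p.1 + p.2 *: y) * psi p * \1_`[0, h] p.2)).
Proof.
move=> [mu_ iu] mpsi psiM psi0 h0.
have m1 : measurable_fun setT (fun p : V * R1 => \1_`[0, h] p.2 : R).
  apply: (measurableT_comp (f := \1_(`[0, h] : set R1) : R1 -> R)).
    exact: measurable_indic.
  exact: measurable_snd.
have ml := measurable_line y.
(* A cube large enough to contain [x + t *: y] for [x] in the cube of size [r] and [0 <= t <= h]. *)
pose r' := r + h * `|y|.
have mc : measurable_fun setT (fun p : V * R1 => \1_(rV_cube r' : set V) (p.1 + p.2 *: y) : R).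
  apply: (measurableT_comp (f := \1_(rV_cube r' : set V) : V -> R)) ml.
  apply: measurable_indic; exact: measurable_rV_cube.
have mul : measurable_fun setT (fun p : V * R1 => u (p.1 + p.2 *: y)).
  exact: (measurableT_comp mu_).
pose k (p : V * R1) : R := M * (`|u (p.1 + p.2 *: y)| * \1_(rV_cube r' : set V) (p.1 + p.2 *: y)) * \1_`[0, h] p.2.
have mk : measurable_fun setT k.
  apply: measurable_funM => //; apply: measurable_funM => //; apply: measurable_funM => //.
  exact: measurableT_comp.
have M0 : 0 <= M by apply: le_trans (psiM (0, 0 : R1)).
have k0 p : 0 <= k p by rewrite /k !mulr_ge0.
have ik : (\int[mu \x mu1]_p (k p)%:E < +oo)%E.
  pose C := (\int[mu]_(x in rV_cube r') `|(EFin \o u) x|)%E.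
  have C0 : (0 <= C)%E by exact: integral_ge0.
  have Coo : (C < +oo)%E by have /integrableP[] := iu r'.
  rewrite fubini_tonelli2//; last by apply/measurable_EFinP.
  have mw : measurable_fun setT (fun x : V => (`|u x| * \1_(rV_cube r' : set V) x)%:E).
    apply/measurable_EFinP; apply: measurable_funM; first exact: measurableT_comp.
    by apply: measurable_indic; exact: measurable_rV_cube.
  have Eg (t : R1) : fubini_G mu (fun p => (k p)%:E) t = (M%:E * C * (\1_`[0, h] t)%:E)%E.
    rewrite /fubini_G /k.
    under eq_integral do rewrite /= mulrAC EFinM.
    rewrite (@ge0_integralZl _ _ _ _ _ measurableT
      (fun x : V => (`|u (x + t *: y)| * \1_(rV_cube r') (x + t *: y))%:E))//; last 2 first.
    - exact: (measurableT_comp mw (measurable_addrV _)).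
    - by rewrite lee_fin mulr_ge0.
    rewrite (ge0_integral_shift_rV (t *: y) mw)//.
    rewrite EFinM muleAC; congr (_ * _ * _)%E.
    rewrite /C [RHS]integral_mkcond; apply: eq_integral => x _.
    by rewrite patchE indicE; case: ifPn => _; rewrite ?mulr1 ?mulr0.
  under eq_integral => t _ do rewrite Eg.
  rewrite ge0_integralZl//; last 2 first.
  - by apply/measurable_EFinP; exact: measurable_indic.
  - by rewrite mule_ge0.
  rewrite integral_indic// setIT; apply: lte_mul_pinfty.
  - by rewrite mule_ge0.
  - by rewrite ge0_fin_numE ?mule_ge0// lte_mul_pinfty.
  - exact: lebesgue_itvcc_lty.
apply: (@le_integrable _ _ _ _ _ _ _ (EFin \o k)) => //.
- apply/measurable_EFinP; apply: measurable_funM => //; exact: measurable_funM.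
- move=> p _; rewrite /= lee_fin (ger0_norm (k0 p)) /k !normrM.
  rewrite (ger0_norm (_ : 0 <= \1_`[0, h] p.2))// indicE.
  have [/set_mem/=|] := boolP (p.2 \in _); last by rewrite !mulr0.
  rewrite in_itv/= => /andP[t0 th]; rewrite !mulr1.
  have [rp|rp] := pselect (rV_cube r p.1); last first.
    by rewrite psi0// normr0 mulr0 !mulr_ge0.
  rewrite indicE mem_set ?mulr1 1?mulrC ?ler_wpM2r//.
  apply: rV_cubeD => //; apply: (@rV_cubeS _ _ (p.2 * `|y|)).
    by rewrite ler_wpM2r.
  by apply: rV_cubeZ => //; exact: rV_cube_norm.
- apply/integrableP; split; first exact/measurable_EFinP.
  by under eq_integral do rewrite /= ger0_norm//.
Qed.

Lemma Rfubini_line u (psi : V * R1 -> R) (M r h : R) (y : V) :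
  locint u -> measurable_fun setT psi -> (forall p, `|psi p| <= M) ->
  (forall p, ~ rV_cube r p.1 -> psi p = 0) -> 0 <= h ->
  \int[mu]_x \int[mu1]_(t in `[0, h]) (u (x + t *: y) * psi (x, t)) =
  \int[mu1]_(t in `[0, h]) \int[mu]_x (u (x + t *: y) * psi (x, t)).
Proof.
move=> lu mpsi psiM psi0 h0.
have H := @integrable_line u psi M r h y lu mpsi psiM psi0 h0.
under eq_Rintegral do rewrite Rintegral_indic.
rewrite (Rfubini H) [RHS]Rintegral_indic; apply: eq_Rintegral => t _ /=.
rewrite indicE; case: (t \in _); last first.
  by rewrite mulr0; under eq_Rintegral do rewrite mulr0; rewrite Rintegral_cst// mul0r.
by rewrite mulr1; under eq_Rintegral do rewrite mulr1.
Qed.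

Lemma ae_integrable_line u (y : V) (h : R) : locint u -> 0 <= h ->
  {ae mu, forall x, mu1.-integrable `[0, h] (EFin \o (fun t : R => u (x + t *: y)))}.
Proof.
move=> lu h0.
have mc (k : nat) : measurable_fun setT (fun p : V * R1 => \1_(rV_cube k%:R : set V) p.1 : R).
  apply: (measurableT_comp (f := \1_(rV_cube k%:R : set V) : V -> R)).
    by apply: measurable_indic; exact: measurable_rV_cube.
  exact: measurable_fst.
have H k := ae_integrable1 (@integrable_line u _ 1 k%:R h y lu (mc k) _ _ h0).
have {}H : forall k : nat, {ae mu, forall x, mu1.-integrable setT
    (fun t : R1 => (u (x + t *: y) * \1_(rV_cube k%:R : set V) x * \1_`[0, h] t)%:E)}.
  move=> k; apply: H => k' p; first by rewrite indicE; case: (_ \in _); rewrite ?normr0 ?normr1.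
  by move=> np; rewrite indicE memNset.
move: H => /ae_foralln; apply: filterS => x Hx.
have [k kx] := rV_cube_exhaust x.
apply: (proj2 (integrable_mul_indic mu1 (fun t : R1 => u (x + t *: y)) (measurable_itvR _))).
have E1 : \1_(rV_cube k%:R) x = 1 :> R by rewrite indicE mem_set.
by apply: eq_integrable (Hx k) => // t _; rewrite /= E1 mulr1.
Qed.

Lemma locint_prim u (y : V) (h : R) : locint u -> 0 <= h ->
  locint (fun x => \int[mu1]_(t in `[0, h]) u (x + t *: y)).
Proof.
move=> lu h0; pose I x := \int[mu1]_(t in `[0, h]) u (x + t *: y).
have mc (r : R) : measurable_fun setT (fun p : V * R1 => \1_(rV_cube r : set V) p.1 : R).
  apply: (measurableT_comp (f := \1_(rV_cube r : set V) : V -> R)).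
    by apply: measurable_indic; exact: measurable_rV_cube.
  exact: measurable_fst.
have H (r : R) : mu.-integrable setT (EFin \o (fun x => I x * \1_(rV_cube r) x)).
  have := integrable_Rintegral1 (@integrable_line u _ 1 r h y lu (mc r) _ _ h0).
  rewrite (_ : EFin \o (fun x => \int[_]_y0 _) = EFin \o (fun x => I x * \1_(rV_cube r) x)).
    apply=> p; first by rewrite indicE; case: (_ \in _); rewrite ?normr0 ?normr1.
    by move=> np; rewrite indicE memNset.
  apply/funext => x /=; congr EFin; rewrite /I Rintegral_indic indicE.
  case: (x \in _) => /=; rewrite ?mulr1n ?mulr0n.
    by rewrite mulr1; under eq_Rintegral do rewrite mulr1.
  by rewrite mulr0; under eq_Rintegral do rewrite mulr0 mul0r; rewrite Rintegral_cst// mul0r.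
split; last first.
  by move=> r; exact: (proj2 (integrable_mul_indic mu _ (measurable_rV_cube r)) (H r)).
apply: (@measurable_fun_cvg _ _ R setT (fun (k : nat) (x : V) => I x * \1_(rV_cube k%:R) x)).
  by move=> k; have /integrableP[/measurable_EFinP] := H k%:R.
move=> x _; have [k kx] := rV_cube_exhaust x.
apply: cvg_near_cst; exists k => // m /= km.
by rewrite indicE mem_set ?mulr1//; apply: rV_cubeS kx; rewrite ler_nat.
Qed.

Lemma Rintegral_shift (f : V -> R) (a : V) : measurable_fun setT f ->
  \int[mu]_x f (x + a) = \int[mu]_x f x.
Proof.
by move=> mf; congr fine; apply: (integral_shift_rV a (f := EFin \o f)); exact/measurable_EFinP.
Qed.

(** Translation invariance moves the increment from [u] to [phi]; there it is the integral of a
    directional derivative along the segment, and Fubini exchanges the two integrals. *)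
Lemma weak_line u phi (y : V) (h : R) : locint u -> test_function phi -> 0 <= h ->
  \int[mu]_x ((u (x + h *: y) - u x) * phi x) =
  - \int[mu1]_(t in `[0, h]) \int[mu]_x (u x * 'D_y phi (x - t *: y)).
Proof.
move=> lu tphi h0; have [mu_ iu] := lu.
have [r r0 hr] := test_supp tphi; have [M M0 hM] := test_bounded tphi.
have [M' M'0 hM'] := test_derive_bounded y tphi.
have mphi := test_measurable tphi.
have mDphi : measurable_fun setT ('D_y phi).
  by apply: continuous_measurable_rV; exact: test_derive_continuous.
pose r' := r + h * `|y|.
have supp' (t : R) (f : V -> R) x : 0 <= t <= h -> (forall x, ~ rV_cube r x -> f x = 0) ->
    ~ rV_cube r' x -> f (x - t *: y) = 0.
  move=> /andP[t0 th] hf nx; apply: hf => xr; apply: nx; rewrite -[x](subrK (t *: y)).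
  apply: rV_cubeD => //; apply: (@rV_cubeS _ _ (t * `|y|)); first by rewrite ler_wpM2r.
  by apply: rV_cubeZ => //; exact: rV_cube_norm.
have h1 : \int[mu]_x (u (x + h *: y) * phi x) = \int[mu]_x (u x * phi (x - h *: y)).
  rewrite -(@Rintegral_shift (fun x => u x * phi (x - h *: y)) (h *: y)); last first.
    by apply: measurable_funM => //; exact: (measurableT_comp mphi (measurable_addrV _)).
  by apply: eq_Rintegral => x _; rewrite addrK.
have i1 : mu.-integrable setT (EFin \o (fun x => u (x + h *: y) * phi x)).
  by apply: (locint_test (locint_shift (h *: y) lu) mphi hM hr).
have i2 : mu.-integrable setT (EFin \o (fun x => u x * phi x)) by exact: (locint_test lu mphi hM hr).
have i3 : mu.-integrable setT (EFin \o (fun x => u x * phi (x - h *: y))).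
  apply: (@locint_test _ _ _ _ M r') => //.
    exact: (measurableT_comp mphi (measurable_addrV _)).
  by move=> x nx; apply: supp' => //; rewrite h0 lexx.
under eq_Rintegral do rewrite mulrBl.
rewrite RintegralB// h1 -RintegralB//.
(* Clamping [t] to [[0, h]] makes the integrand vanish off one cube for all real [t], as
   [Rfubini_line] demands. That lemma is then applied with the direction 0, since the translation
   already sits on [phi]. *)
pose c (t : R) := Num.max 0 (Num.min t h).
have cE t : 0 <= t <= h -> c t = t.
  by move=> /andP[t0 th]; rewrite /c min_l// max_r.
have c0h t : 0 <= c t <= h by rewrite /c le_max lexx/= ge_max h0 ge_min lexx orbT.
have mc : measurable_fun setT (fun p : V * R1 => c p.2).
  have mc1 : measurable_fun setT (c : R1 -> R).
    by apply: measurable_funR; apply: measurable_maxr => //; exact: measurable_minr.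
  exact: (measurableT_comp mc1 measurable_snd).
have := @Rfubini_line u (fun p => 'D_y phi (p.1 - c p.2 *: y)) M' r' h 0 lu _ _ _ h0.
have Eint x : \int[mu1]_(t in `[0, h]) (u (x + t *: 0) * 'D_y phi (x - c t *: y)) =
     u x * (phi x - phi (x - h *: y)).
  have mt : measurable_fun setT (fun t : R1 => 'D_y phi (x - t *: y)).
    apply: (measurableT_comp mDphi).
    apply: measurable_funD_rV => //.
    rewrite (_ : (fun t : R1 => - (t *: y)) = (fun t : R1 => t *: (- y))).
      exact: measurable_funZ_rV.
    by apply/funext => t; rewrite scalerN.
  transitivity (\int[mu1]_(t in `[0, h]) (u x * 'D_y phi (x - t *: y))).
    apply: eq_Rintegral => t; rewrite inE/= in_itv/= => th.
    by rewrite scaler0 addr0 cE.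
  have Ib := bounded_integrable_itv 0 h mt (fun t => hM' (x - t *: y)).
  by rewrite (RintegralZl (u x) (measurable_itvR _) Ib) test_FTC.
under eq_Rintegral do rewrite Eint.
have Eint2 : \int[mu1]_(t in `[0, h]) \int[mu]_x (u (x + t *: 0) * 'D_y phi (x - c t *: y)) =
   \int[mu1]_(t in `[0, h]) \int[mu]_x (u x * 'D_y phi (x - t *: y)).
  apply: eq_Rintegral => t; rewrite inE/= in_itv/= => th.
  by apply: eq_Rintegral => x _; rewrite scaler0 addr0 cE.
move=> H; transitivity (- \int[mu]_x (u x * (phi x - phi (x - h *: y)))); last first.
  rewrite -Eint2; congr (- _); apply: H.
  - apply: (measurableT_comp mDphi); apply: measurable_funD_rV; first exact: measurable_fst.
    rewrite (_ : (fun p : V * R1 => - (c p.2 *: y)) = (fun p : V * R1 => c p.2 *: (- y))).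
      exact: measurable_funZ_rV.
    by apply/funext => t; rewrite scalerN.
  - by move=> p; exact: hM'.
  - move=> p np; apply: (supp' (c p.2) ('D_y phi) p.1 (c0h _) _ np) => x.
    exact: (@test_derive_supp _ _ phi r x y tphi hr).
have i4 : mu.-integrable setT (EFin \o (fun x => u x * (phi x - phi (x - h *: y)))).
  rewrite (_ : EFin \o _ = ((EFin \o (fun x => u x * phi x)%R) \- (EFin \o (fun x => u x * phi (x - h *: y))%R))%E).
    exact: integrableB.
  by apply/funext => x /=; rewrite mulrBr.
rewrite -[RHS]mulN1r -(RintegralZl (-1) measurableT i4); apply: eq_Rintegral => x _.
by rewrite mulN1r mulrBr opprB.
Qed.

Lemma prim_line u phi (y : V) (M r h : R) : locint u -> measurable_fun setT phi ->
  (forall x, `|phi x| <= M) -> (forall x, ~ rV_cube r x -> phi x = 0) -> 0 <= h ->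
  \int[mu]_x ((\int[mu1]_(t in `[0, h]) u (x + t *: y)) * phi x) =
  \int[mu1]_(t in `[0, h]) \int[mu]_x (u x * phi (x - t *: y)).
Proof.
move=> lu mphi hM hr h0; have [mu_ iu] := lu.
transitivity (\int[mu]_x \int[mu1]_(t in `[0, h]) (u (x + t *: y) * phi x)).
  have I1 := locint_prim y lu h0.
  have E1 : {ae mu, forall x, setT x -> (\int[mu1]_(t in `[0, h]) u (x + t *: y)) * phi x =
      \int[mu1]_(t in `[0, h]) (u (x + t *: y) * phi x)}.
    by apply: filterS (ae_integrable_line y lu h0) => x ix _; rewrite RintegralZr.
  apply: ae_Rintegral => //.
    by apply: measurable_funM => //; have [] := I1.
  have m1 : measurable_fun setT (fun p : V * R1 => phi p.1).
    exact: (measurableT_comp mphi measurable_fst).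
  have := integrable_Rintegral1 (@integrable_line u _ M r h y lu m1 _ _ h0).
  have -> : (fun x => \int[mu1]_t (u ((x, t).1 + (x, t).2 *: y) * phi (x, t).1 * \1_`[0, h] (x, t).2)) =
     (fun x => \int[mu1]_(t in `[0, h]) (u (x + t *: y) * phi x)).
    by apply/funext => x; rewrite [RHS]Rintegral_indic.
  by move=> /(_ (fun p => hM p.1) (fun p => hr p.1))/integrableP[/measurable_EFinP].
have m1 : measurable_fun setT (fun p : V * R1 => phi p.1).
  exact: (measurableT_comp mphi measurable_fst).
have H := @Rfubini_line u (fun p => phi p.1) M r h y lu m1 (fun p => hM p.1) (fun p => hr p.1) h0.
apply: (etrans H).
apply: eq_Rintegral => t _.
rewrite -(@Rintegral_shift (fun x => u x * phi (x - t *: y)) (t *: y)); last first.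
  by apply: measurable_funM => //; exact: (measurableT_comp mphi (measurable_addrV _)).
by apply: eq_Rintegral => x _; rewrite addrK.
Qed.

End weak.

(** * Weak gradients and absolute continuity on lines *)

Section weak_derivative.
Context {R : realType} {n : nat}.
Local Notation V := 'rV[R]_n.
Local Notation E i := (delta_mx ord0 i : V).
Local Notation mu := (@borel_lebesgue R n).
Local Notation mu1 := (@lebesgue_measure R).
Local Notation R1 := (measurableTypeR R).
Implicit Types (phi u : V -> R) (G : V -> V).

Lemma integrableD_fun d (T : measurableType d) (m : {measure set T -> \bar R}) (D : set T)
    (f g : T -> R) : measurable D -> m.-integrable D (EFin \o f) ->
  m.-integrable D (EFin \o g) -> m.-integrable D (EFin \o (fun x => f x + g x)).
Proof. by move=> mD If Ig; exact: (integrableD mD If Ig). Qed.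

Lemma integrableZ_fun d (T : measurableType d) (m : {measure set T -> \bar R}) (D : set T)
    (c : R) (f : T -> R) : measurable D -> m.-integrable D (EFin \o f) ->
  m.-integrable D (EFin \o (fun x => c * f x)).
Proof. by move=> mD If; exact: (integrableZl mD c If). Qed.

Lemma RintegralN_any d (T : measurableType d) (m : {measure set T -> \bar R}) (D : set T)
    (f : T -> R) : \int[m]_(x in D) (- f x) = - \int[m]_(x in D) f x.
Proof.
rewrite /Rintegral (integralE _ _ (fun x => (- f x)%:E)) (integralE _ _ (fun x => (f x)%:E)).
rewrite (_ : (fun x => (- f x)%:E) = (\- (EFin \o f))%E)// funeposN funenegN.
have : (0 <= \int[m]_(x in D) (EFin \o f)^\+%E x)%E by exact: integral_ge0.
have : (0 <= \int[m]_(x in D) (EFin \o f)^\-%E x)%E by exact: integral_ge0.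
move: (integral _ _ _) => a; move: (integral _ _ _) => b.
by case: a => [a||]; case: b => [b||]//= _ _; rewrite ?oppr0// opprB.
Qed.

Lemma Rintegral_sum d (T : measurableType d) (m : {measure set T -> \bar R}) (D : set T)
    I (s : seq I) (F : I -> T -> R) : measurable D ->
  (forall i, m.-integrable D (EFin \o F i)) ->
  m.-integrable D (EFin \o (fun x => \sum_(i <- s) F i x)) /\
  \int[m]_(x in D) (\sum_(i <- s) F i x) = \sum_(i <- s) \int[m]_(x in D) F i x.
Proof.
move=> mD IF; elim: s => [|i s [IH1 IH2]].
  under [in X in X /\ _]eq_fun do rewrite big_nil; under eq_Rintegral do rewrite big_nil.
  by rewrite big_nil Rintegral_cst// mul0r; split => //; exact: integrable0.
under [in X in X /\ _]eq_fun do rewrite big_cons; under eq_Rintegral do rewrite big_cons.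
rewrite big_cons RintegralD// IH2; split => //.
exact: (integrableD_fun mD (IF i) IH1).
Qed.

(** [weak_gradient] for Borel functions and the Borel measure, with real-valued integrals. All of
    the analysis is done for it; Lebesgue measurable functions are replaced by Borel versions at the
    end. *)
Definition bweak u G := [/\ locint u, forall i, locint (fun x => G x ord0 i) &
  forall phi i, test_function phi ->
    \int[mu]_x (u x * 'D_(E i) phi x) = - \int[mu]_x (G x ord0 i * phi x)].

(* Absolute continuity on almost every line, phrased for one direction [y]. *)
Definition line_primitive u (g : V -> R) (y : V) := forall h : R, 0 <= h ->
  {ae mu, forall x, u (x + h *: y) - u x = \int[mu1]_(t in `[0, h]) g (x + t *: y)}.

Lemma locint_dotrV G y : (forall i, locint (fun x => G x ord0 i)) ->
  locint (fun x => dotrV (G x) y).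
Proof.
move=> lG; apply: (@locint_sum _ _ _ _ (fun i x => G x ord0 i * y ord0 i)) => i.
rewrite (_ : (fun x => _) = (fun x => y ord0 i * G x ord0 i)); first exact: locintZ.
by apply/funext => x; rewrite mulrC.
Qed.

Lemma integrable_test u phi : locint u -> test_function phi ->
  mu.-integrable setT (EFin \o (fun x => u x * phi x)).
Proof.
move=> lu tphi; have [r _ hr] := test_supp tphi; have [M _ hM] := test_bounded tphi.
exact: (locint_test lu (test_measurable tphi) hM hr).
Qed.

Lemma bweak_dir u G y phi : bweak u G -> test_function phi ->
  \int[mu]_x (u x * 'D_y phi x) = - \int[mu]_x (dotrV (G x) y * phi x).
Proof.
move=> [lu lG w] tphi.
have i1 i : mu.-integrable setT (EFin \o (fun x => y ord0 i * (u x * 'D_(E i) phi x))).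
  by apply: integrableZ_fun => //; apply: integrable_test => //; exact: test_partial.
have i2 i : mu.-integrable setT (EFin \o (fun x => y ord0 i * (G x ord0 i * phi x))).
  by apply: integrableZ_fun => //; exact: (integrable_test (lG i)).
transitivity (\int[mu]_x (\sum_(i < n) y ord0 i * (u x * 'D_(E i) phi x))).
  apply: eq_Rintegral => x _; rewrite test_deriveE// mulr_sumr.
  by apply: eq_bigr => i _; rewrite mulrCA.
transitivity (- \int[mu]_x (\sum_(i < n) y ord0 i * (G x ord0 i * phi x))); last first.
  congr (- _); apply: eq_Rintegral => x _; rewrite /dotrV mulr_suml.
  by apply: eq_bigr => i _; rewrite mulrA (mulrC (y ord0 i)).
rewrite (Rintegral_sum _ measurableT i1).2 (Rintegral_sum _ measurableT i2).2 -sumrN.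
apply: eq_bigr => i _; rewrite RintegralZl//; last first.
  by apply: integrable_test => //; exact: test_partial.
rewrite w// RintegralZl ?mulrN//.
exact: (integrable_test (lG i)).
Qed.

(** Test the weak identity with the translates of [phi] by [t *: y] and integrate over [t] in
    [[0, h]]: both sides of the claim have the same integral against every [phi], so the fundamental
    lemma applies. *)
Lemma bweak_line u G y : bweak u G -> line_primitive u (fun x => dotrV (G x) y) y.
Proof.
move=> wu h h0; have [lu lG _] := wu.
set g := fun x => dotrV (G x) y; have lg : locint g by exact: locint_dotrV.
pose I x := \int[mu1]_(t in `[0, h]) g (x + t *: y).
have lI : locint I by exact: locint_prim.
have l1 : locint (fun x => u (x + h *: y) + -1 * u x).
  by apply: locintD; [exact: locint_shift|exact: locintZ].
have l2 : locint (fun x => u (x + h *: y) + -1 * u x + -1 * I x).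
  by apply: locintD => //; exact: locintZ.
suff : {ae mu, forall x, u (x + h *: y) + -1 * u x + -1 * I x = 0}.
  by apply: filterS => x; rewrite !mulN1r => /eqP; rewrite subr_eq0 => /eqP.
apply: fundamental_lemma => // phi tphi.
have [r _ hr] := test_supp tphi; have [M _ hM] := test_bounded tphi.
transitivity (\int[mu]_x ((u (x + h *: y) - u x) * phi x + -1 * (I x * phi x))).
  by apply: eq_Rintegral => x _; rewrite mulrDl mulN1r mulN1r !mulNr mul1r.
have iI : mu.-integrable setT (EFin \o (fun x => I x * phi x)) by exact: integrable_test.
rewrite RintegralD//; last 2 first.
- have := integrable_test l1 tphi; apply: eq_integrable => // x _.
  by rewrite /= mulN1r.
- exact: integrableZ_fun.
rewrite RintegralZl// weak_line// (prim_line y lg (test_measurable tphi) hM hr h0).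
rewrite -RintegralN_any mulN1r; apply/eqP; rewrite subr_eq0; apply/eqP.
apply: eq_Rintegral => t _; have := bweak_dir y wu (test_shift (t *: y) tphi).
under eq_Rintegral => x _ do rewrite (derive_comp_shift phi (t *: y) y x).
by move=> ->; rewrite opprK.
Qed.

Lemma Rintegral_cst_itv (c h : R) : 0 < h -> \int[mu1]_(t in `[0, h]) c = c * h.
Proof.
move=> h0; rewrite Rintegral_cst//; congr (_ * _).
by have := congr1 fine (lebesgue_itvcc (ltW h0)); rewrite /= subr0; apply.
Qed.

(** For [t] within 1 of [t0] the translates of [psi] are all supported in one cube, on which [M]
    times the absolute value of [v] dominates. *)
Lemma conv_continuous (v psi : V -> R) (M r : R) (y : V) : locint v -> continuous psi ->
  (forall x, `|psi x| <= M) -> (forall x, ~ rV_cube r x -> psi x = 0) ->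
  continuous (fun t : R => \int[mu]_x (v x * psi (x - t *: y))).
Proof.
move=> lv cpsi hM hr t0; pose r' := r + (`|t0| + 1) * `|y|.
have mpsi : measurable_fun setT psi by exact: continuous_measurable_rV.
have M0 : 0 <= M by apply: le_trans (hM 0).
have tb (t : R) : `]t0 - 1, t0 + 1[%classic t -> `|t| <= `|t0| + 1.
  rewrite /= in_itv/= => /andP[h1 h2].
  have := ler_norm t0; have := ler_norm (- t0); rewrite normrN ler_norml; lra.
have supp (t : R) x : `]t0 - 1, t0 + 1[%classic t -> ~ rV_cube r' x -> psi (x - t *: y) = 0.
  move=> /tb tt nx; apply: hr => xr; apply: nx; rewrite -[x](subrK (t *: y)).
  apply: rV_cubeD => //; apply: (@rV_cubeS _ _ `|t *: y|); last exact: rV_cube_norm.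
  by rewrite normrZ ler_wpM2r.
have mshift (t : R) : measurable_fun setT (fun x : V => psi (x - t *: y)).
  exact: (measurableT_comp mpsi (measurable_addrV _)).
have Ig : mu.-integrable setT (EFin \o (fun x => `|v x| * (M * \1_(rV_cube r' : set V) x))).
  apply: (@locint_test _ _ _ _ M r').
  - split; first by apply: measurableT_comp => //; case: lv.
    by move=> s; have [_ /(_ s) iv] := lv; exact: (integrable_abse iv).
  - by apply: measurable_funM => //; apply: measurable_indic; exact: measurable_rV_cube.
  - move=> x; rewrite ger0_norm ?mulr_ge0// ler_piMr//.
  - by move=> x nx; rewrite indicE memNset// mulr0.
have It (t : R) : `]t0 - 1, t0 + 1[%classic t ->
    mu.-integrable setT (EFin \o (fun x => v x * psi (x - t *: y))).
  move=> tt; apply: (@locint_test _ _ _ _ M r') => // x nx; exact: supp.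
have H := @continuity_under_integral R _ _ mu (fun t x => v x * psi (x - t *: y)) setT measurableT
  (t0 - 1) (t0 + 1) It _ _ Ig.
apply: H; last first.
- by rewrite inE/= in_itv/= ltrBlDr ltrDl ltr01.
- move=> t tt; apply: aeW => x _; rewrite normrM ler_wpM2l// indicE.
  have [xr|xr] := pselect (rV_cube r' x); first by rewrite mem_set// mulr1.
  by rewrite supp// normr0 mulr_ge0.
- apply: aeW => x _ t _; apply: cvgMr; exact: (test_line_continuous cpsi).
Qed.

(* The two sides of the weak identity, translated by [t *: y], have the same
   integral over every [0, h], and their difference [K] is continuous at 0. *)
Lemma line_bweak u G : locint u -> (forall i, locint (fun x => G x ord0 i)) ->
  (forall i, line_primitive u (fun x => G x ord0 i) (E i)) -> bweak u G.
Proof.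
move=> lu lG H; split => // phi i tphi.
set g := fun x => G x ord0 i; have lg : locint g by exact: lG.
have [mu_ _] := lu; have [mg _] := lg.
have [r _ hr] := test_supp tphi; have [M M0 hM] := test_bounded tphi.
have [M' M'0 hM'] := test_derive_bounded (E i) tphi.
have mphi := test_measurable tphi.
have mD : measurable_fun setT ('D_(E i) phi).
  by apply: continuous_measurable_rV; exact: test_derive_continuous.
pose A (t : R) := \int[mu]_x (u x * 'D_(E i) phi (x - t *: E i)).
pose B (t : R) := \int[mu]_x (g x * phi (x - t *: E i)).
have hD x : ~ rV_cube r x -> 'D_(E i) phi x = 0 by exact: test_derive_supp.
have cA : continuous A.
  exact: (conv_continuous lu (test_derive_continuous tphi) hM' hD).
have cB : continuous B.
  exact: (conv_continuous lg (test_continuous tphi) hM hr).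
pose K t := A t + B t.
have cK : continuous K by move=> t; apply: cvgD; [exact: cA|exact: cB].
have int (f : R -> R) h : continuous f -> mu1.-integrable `[0, h] (EFin \o f).
  move=> cf; apply: continuous_compact_integrable; first exact: segment_compact.
  exact: continuous_subspaceT.
suff : K 0 = 0.
  rewrite /K => /eqP; rewrite addr_eq0 => /eqP; rewrite /A /B.
  by under eq_Rintegral do rewrite scale0r subr0; under [in RHS]eq_Rintegral do rewrite scale0r subr0.
have K0h h : 0 <= h -> \int[mu1]_(t in `[0, h]) K t = 0.
  move=> h0; rewrite RintegralD//; [|exact: int|exact: int].
  rewrite -(prim_line _ lg mphi hM hr h0).
  apply/eqP; rewrite addrC -[X in _ + X]opprK -(weak_line _ lu tphi h0) subr_eq0; apply/eqP.
  apply: ae_Rintegral => //.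
  - by apply: measurable_funM => //; have [] := locint_prim (E i) lg h0.
  - apply: measurable_funM => //; apply: measurable_funB => //.
    exact: (measurableT_comp mu_ (measurable_addrV _)).
  - by apply: filterS (H i h h0) => x -> _.
apply/eqP/negPn/negP => K0.
have e0 : 0 < `|K 0| / 2 by rewrite divr_gt0// normr_gt0.
move/cvgrPdist_le : (cK 0) => /(_ _ e0) /nbhs_ballP[d /= d0 Hd].
pose h := d / 2.
have h0 : 0 < h by rewrite divr_gt0.
have hd t : 0 <= t <= h -> `|K 0 - K t| <= `|K 0| / 2.
  move=> /andP[t0 th]; apply: Hd; rewrite /ball/= sub0r normrN ger0_norm//.
  apply: le_lt_trans th _; rewrite /h; lra.
have iKh := int K h cK.
have ic : mu1.-integrable `[0, h] (EFin \o cst (K 0)) by apply: int; exact: cst_continuous.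
have : \int[mu1]_(t in `[0, h]) (K 0 - K t) = K 0 * h.
  rewrite (RintegralB (measurable_itvR _) ic iKh) K0h ?(ltW h0)// subr0.
  exact: Rintegral_cst_itv.
have id : mu1.-integrable `[0, h] (EFin \o (fun t => K 0 - K t)).
  exact: (integrableB (measurable_itvR _) ic iKh).
have := le_normr_Rintegral (measurable_itvR _) id.
move=> + E1; rewrite E1 => /le_trans H1.
have : `|K 0 * h| <= `|K 0| / 2 * h.
  apply: H1.
  have -> : `|K 0| / 2 * h = \int[mu1]_(t in `[0, h]) (`|K 0| / 2).
    by rewrite Rintegral_cst_itv.
  apply: le_Rintegral => //.
  - exact: (integrable_abse id).
  - by apply: int; exact: cst_continuous.
rewrite normrM (gtr0_norm h0) ler_pM2r// leNgt => /negP; apply.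
rewrite -normr_gt0 in K0; lra.
Qed.

End weak_derivative.

Section ae_fubini.
Context d1 d2 (T1 : measurableType d1) (T2 : measurableType d2) (R : realType).
Variables (m1 : {sigma_finite_measure set T1 -> \bar R}).
Variables (m2 : {sigma_finite_measure set T2 -> \bar R}).

Lemma measurable_fun_Rintegral (f : T1 * T2 -> R) : measurable_fun setT f ->
  measurable_fun setT (fun x => \int[m2]_y f (x, y)).
Proof.
move=> mf; apply: (measurableT_comp (f := fine)) => //.
rewrite (_ : (fun x => _) = (fun x => \int[m2]_y ((EFin \o f)^\+%E (x, y)) -
   \int[m2]_y ((EFin \o f)^\-%E (x, y)))%E); last first.
  apply/funext => x; rewrite integralE; congr (_ - _)%E.
    by apply: eq_integral => y _; rewrite !funeposE.
  by apply: eq_integral => y _; rewrite !funenegE.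
have mEf : measurable_fun setT (EFin \o f) by exact/measurable_EFinP.
apply: emeasurable_funB.
  apply: (measurable_fun_fubini_tonelli_F (m2 := m2)) => //; exact: measurable_funepos.
apply: (measurable_fun_fubini_tonelli_F (m2 := m2)) => //; exact: measurable_funeneg.
Qed.

(** A measurable exceptional set whose sections are null in one direction is null for the product
    measure, so almost all of its sections in the other direction are null. *)
Lemma ae_swap (P : set (T1 * T2)) : measurable P ->
  (forall y, {ae m1, forall x, P (x, y)}) ->
  {ae m1, forall x, {ae m2, forall y, P (x, y)}}.
Proof.
move=> mP H; have mA := measurableC mP; set A := ~` P in mA.
have := indic_fubini_tonelli m1 m2 mA.
rewrite indic_fubini_tonelli_FE// indic_fubini_tonelli_GE//.
rewrite [RHS]integral0_eq; last first.
  move=> y _ /=; have [N [mN N0 PN]] := H y.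
  apply/eqP; rewrite eq_le measure_ge0 andbT -N0; apply: le_measure; rewrite ?inE//.
    exact: measurable_ysection.
  by move=> x; rewrite /ysection/= inE => Ax; apply: PN.
move=> H0; have mf : measurable_fun setT (m2 \o xsection A) by exact: measurable_fun_xsection.
have [+ _] := ae_eq_integral_abs m1 measurableT mf.
have -> : (\int[m1]_x `|(m2 \o xsection A) x| = 0)%E.
  by rewrite -H0; apply: eq_integral => x _; rewrite gee0_abs.
move=> /(_ erefl); apply: filterS => x /(_ I) /= Ax.
exists (xsection A x); split => //; first exact: measurable_xsection.
by move=> y; rewrite /xsection/= inE.
Qed.

End ae_fubini.

(** * The chain rule and uniqueness of weak gradients *)

Section chain_rule.
Context {R : realType} {n : nat}.
Local Notation V := 'rV[R]_n.
Local Notation E i := (delta_mx ord0 i : V).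
Local Notation mu := (@borel_lebesgue R n).
Local Notation mu1 := (@lebesgue_measure R).
Local Notation R1 := (measurableTypeR R).
Implicit Types (u g : V -> R) (G : V -> V).

Lemma measurable_ray (x y : V) : measurable_fun setT (fun t : R => x + t *: y).
Proof. by apply: measurable_funD_rV => //; exact: measurable_funZ_rV. Qed.

(** The null set in [line_primitive] depends on the length of the segment. [ae_swap] reverses the
    quantifiers, which requires the primitive [J] to be jointly measurable in the base point and the
    length. *)
Lemma ae_line_primitive u g y (h : R) : locint u -> locint g -> line_primitive u g y ->
  {ae mu, forall x, {ae mu1, forall t : R, 0 <= t <= h ->
    u (x + t *: y) = u x + \int[mu1]_(s in `[0, t]) g (x + s *: y)}}.
Proof.
move=> [mu_ _] [mg _] H.
pose J (p : V * R1) := \int[mu1]_s (g (p.1 + s *: y) * \1_`[0, p.2] s).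
have mJ : measurable_fun setT J.
  apply: (@measurable_fun_Rintegral _ _ _ R1 _ mu1
    (fun q : (V * R1) * R1 => g (q.1.1 + q.2 *: y) * \1_`[0, q.1.2] q.2)).
  apply: measurable_funM.
    apply: (measurableT_comp mg); apply: measurable_funD_rV.
      exact: (measurableT_comp measurable_fst).
    by apply: measurable_funZ_rV => //; exact: measurable_snd.
  rewrite (_ : (fun q => _) = \1_[set q : (V * R1) * R1 | 0 <= q.2 <= q.1.2]).
    apply: measurable_indic.
    rewrite (_ : [set q | _] = [set q : (V * R1) * R1 | 0 <= q.2] `&` [set q | q.2 <= q.1.2]).
      apply: measurableI.
        rewrite (_ : [set q | _] = snd @^-1` `[0, +oo[%classic).
          by rewrite -[X in measurable X]setTI; apply: measurable_snd.
        by apply/seteqP; split => q /=; rewrite in_itv/= andbT.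
      have m1 : measurable_fun setT (fun q : (V * R1) * R1 => q.2 : R) by exact: measurable_snd.
      have m2 : measurable_fun setT (fun q : (V * R1) * R1 => q.1.2 : R).
        exact: (measurableT_comp measurable_snd measurable_fst).
      rewrite -[X in measurable X]setTI; exact: measurable_fun_le.
    by apply/seteqP; split => q /= => [/andP[]//|[-> ->]].
  apply/funext => q; rewrite !indicE; have [h1|h1] := boolP (0 <= q.2 <= q.1.2).
    by rewrite !mem_set//= in_itv.
  by rewrite !memNset//=; [exact/negP|rewrite in_itv/=; exact/negP].
pose P := [set p : V * R1 | 0 <= p.2 <= h -> u (p.1 + p.2 *: y) - u p.1 = J p].
have mP : measurable P.
  pose D p := u (p.1 + p.2 *: y) - u p.1 - J p.
  have mD : measurable_fun setT D.
    apply: measurable_funB => //; apply: measurable_funB; apply: (measurableT_comp mu_).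
      exact: measurable_line.
    exact: measurable_fst.
  rewrite (_ : P = ~` (snd @^-1` `[0, h]%classic) `|` D @^-1` [set 0]).
    apply: measurableU; last by rewrite -[X in measurable X]setTI; exact: mD.
    apply: measurableC; rewrite -[X in measurable X]setTI; exact: measurable_snd.
  apply/seteqP; split => p; rewrite /P/= in_itv/=.
    move=> Hp; have [th|th] := boolP (0 <= p.2 <= h); last by left; apply/negP.
    by right; rewrite /D Hp// subrr.
  move=> [//|D0 _]; move/eqP : D0; rewrite /D subr_eq0 => /eqP//.
have := @ae_swap _ _ _ _ _ mu mu1 P mP.
have HP (t : R1) : {ae mu, forall x, P (x, t)}.
  have [t0|t0] := leP 0 (t : R); last by apply: aeW => x /andP[]; rewrite leNgt t0.
  by apply: filterS (H t t0) => x Hx _; rewrite /= Hx /J -Rintegral_indic.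
move=> /(_ HP); apply: filterS => x; apply: filterS => t Ht th.
have := Ht th; rewrite /J /= => Ht'.
by rewrite Rintegral_indic -Ht' [RHS]addrC subrK.
Qed.

Lemma line_chain u g y (phi F : R -> R) : locint u -> locint g -> line_primitive u g y ->
  measurable_fun setT phi -> (forall M : R, exists B : R, forall t, `|t| <= M -> `|phi t| <= B) ->
  (forall a b, F b - F a = oint phi a b) ->
  line_primitive (F \o u) (fun x => phi (u x) * g x) y.
Proof.
move=> lu lg H mphi bphi FE h h0; have [mu_ _] := lu; have [mg _] := lg.
have H1 := ae_integrable_line y lg h0.
have H2 := @ae_line_primitive u g y h lu lg H.
move: (H h h0) H1 H2; apply: filterS3 => x; rewrite /mkset => Hx ix aex.
set gx := fun t : R => g (x + t *: y) in ix aex Hx *.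
pose U (t : R) := u x + \int[mu1]_(s in `[0, t]) gx s.
have U0 : U 0 = u x by rewrite /U set_itv1 Rintegral_set1 addr0.
have Uh : U h = u (x + h *: y) by rewrite /U -Hx addrC subrK.
pose M := `|u x| + \int[mu1]_(s in `[0, h]) `|gx s|.
have UM t : 0 <= t <= h -> `|U t| <= M.
  move=> /andP[t0 th]; rewrite /U (le_trans (ler_normD _ _))// lerD2l.
  have sub : `[0, t]%classic `<=` (`[0, h]%classic : set R1).
    by move=> s; rewrite /= !in_itv/= => /andP[-> /le_trans ->].
  have it : mu1.-integrable `[0, t] (EFin \o gx).
    exact: (integrableS (measurable_itvR _) (measurable_itvR _) sub ix).
  apply: le_trans (le_normr_Rintegral _ it) _ => //.
  have E1 : \int[mu1]_(t0 in `[0, t]) `|gx t0| = \int[mu1]_(s in `[0, h]) (`|gx s| * \1_`[0, t] s).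
    rewrite [LHS]Rintegral_indic [RHS]Rintegral_indic; apply: eq_Rintegral => s _.
    rewrite -mulrA; congr (_ * _); rewrite !indicE -natrM; congr (_%:R).
    by rewrite mulnb -in_setI (proj2 (setIidPl _ _) sub).
  rewrite E1; apply: le_Rintegral => //.
  - apply: (integrable_mul_bounded (M := 1)) => //; first exact: (integrable_abse ix).

    by move=> s _; rewrite indicE; case: (s \in _); rewrite ?normr0 ?normr1.
  - exact: (integrable_abse ix).
  - by move=> s _; rewrite indicE; case: (s \in _); rewrite ?mulr1 ?mulr0.
have [B hB] := bphi M.
(* [phi] is only locally bounded. [U] takes its values in [[- M, M]] on the segment, so truncating
   [phi] there changes neither side. *)
pose f (t : R) := phi t * \1_[set t : R | `|t| <= M] t.
have mf : measurable_fun setT f.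
  apply: measurable_funM => //; apply: measurable_indic.
  rewrite (_ : [set t : R | _] = `[- M, M]%classic); first exact: measurable_itv.
  by apply/seteqP; split => t; rewrite /= in_itv/= ler_norml.
have fE t : `|t| <= M -> f t = phi t by move=> tM; rewrite /f indicE mem_set// mulr1.
have fB t : `|f t| <= `|B|.
  rewrite /f indicE; have [tM|tM] := pselect (`|t| <= M).
    by rewrite mem_set// mulr1 (le_trans (hB _ tM))// ler_norm.
  by rewrite memNset// mulr0 normr0.
rewrite /= FE -U0 -Uh.
have -> : oint phi (U 0) (U h) = oint f (U 0) (U h).
  have U0M := UM 0; have UhM := UM h; rewrite !lexx h0/= in U0M UhM.
  have {}U0M := U0M isT; have {}UhM := UhM isT.
  rewrite /oint; congr (_ - _); apply: eq_Rintegral => t; rewrite inE/= in_itv/= => th;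
    rewrite fE//; move: U0M UhM; rewrite !ler_norml; lra.
rewrite (chain_bounded (u x) h0 ix mf fB).
have mU : measurable_fun `[0, h] U by exact: measurable_chain_prim.
apply: ae_Rintegral.
- exact: measurable_itvR.
- apply: measurable_funM; first exact: (measurableT_comp mf mU).
  by have /integrableP[/measurable_EFinP] := ix.
- apply: measurable_funR; apply: measurable_funM.
    exact: (measurableT_comp mphi (measurableT_comp mu_ (measurable_ray x y))).
  exact: (measurableT_comp mg (measurable_ray x y)).
- have [N [mN N0 PN]] := aex; exists N; split => // t Ht; apply: PN => Ht'; apply: Ht.
  rewrite /= in_itv/= => th.
  by rewrite Ht'// -/(U t) fE//; apply: UM.
Qed.

Lemma bweak_chain u G (phi F : R -> R) : bweak u G -> measurable_fun setT phi ->
  (forall M : R, exists B : R, forall t, `|t| <= M -> `|phi t| <= B) ->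
  (forall a b, F b - F a = oint phi a b) ->
  locint (F \o u) -> (forall i, locint (fun x => phi (u x) * G x ord0 i)) ->
  bweak (F \o u) (fun x => phi (u x) *: G x).
Proof.
move=> wu mphi bphi FE lF lG; have [lu lGu _] := wu.
have GE i : (fun x => (phi (u x) *: G x) ord0 i) = (fun x => phi (u x) * G x ord0 i).
  by apply/funext => x; rewrite mxE.
apply: line_bweak => // i; rewrite GE//.
apply: (line_chain lu (lGu i) _ mphi bphi FE).
have := @bweak_line _ _ u G (E i) wu; rewrite (_ : (fun x => dotrV _ _) = (fun x => G x ord0 i))//.
apply/funext => x; rewrite /dotrV (bigD1 i)//= mxE !eqxx mulr1 big1 ?addr0// => j ji.
by rewrite mxE (negbTE ji) andbF mulr0.
Qed.

Lemma bweakZD u v G H (a : R) : bweak u G -> bweak v H ->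
  bweak (fun x => a * u x + v x) (fun x => a *: G x + H x).
Proof.
move=> [lu lG wG] [lv lH wH].
have GE i : (fun x => (a *: G x + H x) ord0 i) = (fun x => a * G x ord0 i + H x ord0 i).
  by apply/funext => x; rewrite !mxE.
split.
- by apply: locintD => //; exact: locintZ.
- by move=> i; rewrite GE; apply: locintD => //; exact: locintZ.
move=> phi i tphi; have tD := test_partial i tphi.
have lin (f g : V -> R) psi : locint f -> locint g -> test_function psi ->
    \int[mu]_x ((a * f x + g x) * psi x) =
    a * \int[mu]_x (f x * psi x) + \int[mu]_x (g x * psi x).
  move=> lf lg tpsi; have If := integrable_test lf tpsi; have Ig := integrable_test lg tpsi.
  rewrite -RintegralZl// -RintegralD//; last exact: integrableZ_fun.
  by apply: eq_Rintegral => x _; rewrite mulrDl mulrA.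
rewrite lin// wG// wH//; under [in RHS]eq_Rintegral do rewrite !mxE.
by rewrite lin// opprD mulrN.
Qed.

Lemma bweak_unique u G H : bweak u G -> bweak u H -> {ae mu, forall x, G x = H x}.
Proof.
move=> wG wH.
have w0 : bweak (fun x => -1 * u x + u x) (fun x => -1 *: G x + H x) by exact: bweakZD.
have u0 : (fun x => -1 * u x + u x) = cst 0.
  by apply/funext => x; rewrite mulN1r addNr.
rewrite u0 in w0; have [_ l w] := w0.
have H0 i : {ae mu, forall x, (-1 *: G x + H x) ord0 i = 0}.
  apply: fundamental_lemma => // phi tphi.
  have := w phi i tphi => /eqP; rewrite eq_sym eqr_oppLR => /eqP ->.
  under eq_Rintegral do rewrite mul0r.
  by rewrite Rintegral_cst// mul0r oppr0.
have : {ae mu, forall x, forall k : nat, forall i : 'I_n, k = i -> (-1 *: G x + H x) ord0 i = 0}.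
  apply: ae_foralln => k; have [kn|kn] := ltnP k n.
    by apply: filterS (H0 (Ordinal kn)) => x + i ki; rewrite (_ : Ordinal kn = i)//; exact: val_inj.
  by apply: aeW => x i ki; have := ltn_ord i; rewrite -ki ltnNge kn.
apply: filterS => x Hx; apply/rowP => i; have := Hx i i erefl.
by rewrite !mxE mulN1r => /eqP; rewrite addrC subr_eq0 => /eqP.
Qed.

(** The chain rule with the derivative [\1_N] and the primitive 0 shows that [\1_N (u x) *: G x] is
    a weak gradient of the zero function, so it vanishes almost everywhere by uniqueness. *)
Lemma bweak_null u G (N : set R) : bweak u G -> measurable N -> mu1 N = 0%E ->
  {ae mu, forall x, N (u x) -> G x = 0}.
Proof.
move=> wu mN N0; have [lu lG _] := wu; have [mu_ _] := lu.
have m1 : measurable_fun setT (\1_N : R -> R) by exact: measurable_indic.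
have mNu : measurable_fun setT (fun x => \1_N (u x) : R) by exact: (measurableT_comp m1).
have w1 : bweak (cst 0 \o u) (fun x => \1_N (u x) *: G x).
  apply: (@bweak_chain u G \1_N (cst 0)) => //.
  - move=> M; exists 1 => t _; rewrite indicE; by case: (t \in _); rewrite ?normr0 ?normr1.
  - move=> a b; rewrite subrr /oint.
    have I0 (x y : R) : \int[@lebesgue_measure R]_(t in `[x, y]) \1_N t = 0.
      rewrite /Rintegral integral_indic; [|exact: measurable_itvR|exact: mN].
      suff H : (@lebesgue_measure R (N `&` `[x, y]%classic) = 0)%E by exact: (congr1 fine H).
      apply/eqP; rewrite eq_le measure_ge0 andbT -N0; apply: le_measure; rewrite ?inE//.
      by apply: measurableI => //; exact: measurable_itvR.
    by rewrite !I0 subrr.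
  - exact: locint_cst.
  - move=> i; rewrite (_ : (fun x => _) = (fun x => G x ord0 i * \1_N (u x))).
      apply: (@locint_mul_bounded _ _ _ _ 1) => // x; rewrite indicE.
      by case: (_ \in _); rewrite ?normr0 ?normr1.
    by apply/funext => x; rewrite mulrC.
have w2 : bweak (cst 0 \o u) (fun x => -1 *: G x + G x).
  have <- : (fun x => -1 * u x + u x) = cst 0 \o u by apply/funext => x; rewrite mulN1r addNr.
  exact: bweakZD.
apply: filterS (bweak_unique w1 w2) => x Hx Nx.
by move: Hx; rewrite indicE mem_set// scale1r => ->; rewrite scaleN1r addNr.
Qed.

End chain_rule.

(** * Decay of the distribution function *)

Section young.
Context {R : realType}.
Local Notation mu n := (@borel_lebesgue R n).

Lemma mule_le1 (c : R) (x : \bar R) : 0 <= c <= 1 -> (0 <= x)%E -> (c%:E * x <= x)%E.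
Proof.
by move=> /andP[_ c1] x0; rewrite -[leRHS]mul1e; apply: lee_wpmul2r; rewrite ?lee_fin.
Qed.

Lemma young_rV_scale n (Phi : 'rV[R]_n -> \bar R) (t : R) x : young_rV Phi ->
  0 <= t <= 1 -> (Phi (t *: x) <= t%:E * Phi x)%E.
Proof.
move=> yP t01; have := young_rV_convex yP x 0 t01.
by rewrite scaler0 addr0 (young_rV_0 yP) mule0 adde0.
Qed.

Lemma young_scale (A : R -> \bar R) (t x : R) : young A -> 0 <= t <= 1 -> 0 <= x ->
  (A (t * x)%R <= t%:E * A x)%E.
Proof.
move=> yA t01 x0; have := young_convex yA t01 x0 (lexx 0).
by rewrite mulr0 addr0 (young_0 yA) mule0 adde0.
Qed.

Lemma young_homo (A : R -> \bar R) (s t : R) : young A -> 0 <= s -> s <= t -> (A s <= A t)%E.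
Proof.
move=> yA s0 st; have [t0|t0] := leP t 0.
  by have -> : s = t by apply/eqP; rewrite eq_le st (le_trans t0 s0).
have -> : s = s / t * t by rewrite divfK// gt_eqF.
have st01 : 0 <= s / t <= 1 by rewrite divr_ge0 ?(ltW t0)//= ler_pdivrMr// mul1r.
apply: le_trans (young_scale yA st01 (ltW t0)) _.
have /andP[h0 h1] := st01.
exact: (mule_le1 st01 (young_ge0 yA (ltW t0))).
Qed.

Lemma measurable_young_rV n (Phi : 'rV[R]_n -> \bar R) : young_rV Phi ->
  measurable_fun setT Phi.
Proof. by move=> yP; apply: lower_semicontinuous_measurable_rV; exact: young_rV_lsc. Qed.

Lemma coord_le_enorm n (x : 'rV[R]_n) i : `|x ord0 i| <= enorm x.
Proof.
rewrite /enorm -sqrtr_sqr ler_sqrt; last by apply: sumr_ge0 => j _; exact: sqr_ge0.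
by rewrite (bigD1 i)//= lerDl; apply: sumr_ge0 => j _; exact: sqr_ge0.
Qed.

Lemma enorm_ge0 n (x : 'rV[R]_n) : 0 <= enorm x.
Proof. exact: sqrtr_ge0. Qed.

(** Repeated midpoints: at each step one coordinate vector takes half of the weight and the
    remaining sum the other half. The price is the factor [2^-1 ^+ size l] on the coordinates. *)
Lemma convex_comb_coords n (C : set 'rV[R]_n) (s : R) :
  (forall t x y, 0 <= t <= 1 -> C x -> C y -> C (t *: x + (1 - t) *: y)) -> C 0 ->
  (forall i (c : R), `|c| <= s -> C (c *: delta_mx ord0 i)) ->
  forall (l : seq 'I_n) (c : 'I_n -> R), (forall i, `|c i| <= s * (2^-1) ^+ size l) ->
    C (\sum_(i <- l) c i *: delta_mx ord0 i).
Proof.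
move=> Cc C0 Cs; elim=> [|i l IH] c hc; first by rewrite big_nil.
rewrite big_cons.
have -> : c i *: delta_mx ord0 i + \sum_(j <- l) c j *: delta_mx ord0 j =
  2^-1 *: ((2 * c i) *: delta_mx ord0 i) + (1 - 2^-1) *: \sum_(j <- l) (2 * c j) *: delta_mx ord0 j
  :> 'rV[R]_n.
  have -> : (1 - 2^-1 : R) = 2^-1 by field.
  rewrite scaler_sumr scalerA mulKf//; congr (_ + _); apply: eq_bigr => j _.
  by rewrite scalerA mulKf.
have h2 j : `|2 * c j| <= s * (2^-1) ^+ size l.
  have := hc j; rewrite /= exprS normrM ger0_norm//; lra.
apply: Cc; [by apply/andP; split; lra| |exact: IH].
apply: Cs; apply: le_trans (h2 i) _.
have s0 : 0 <= s.
  have := le_trans (normr_ge0 _) (hc i); rewrite pmulr_lge0//; exact: exprn_gt0.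
by rewrite ler_piMr// exprn_ile1//; lra.
Qed.

(** Finiteness near 0 is used only at the points [s e_i]; evenness and convexity spread these
    finitely many values over a cube. *)
Lemma young_rV_bounded_near0 n (Phi : 'rV[R]_n -> \bar R) : young_rV Phi ->
  exists r M : R, [/\ 0 < r, 0 < M & forall x : 'rV[R]_n, (forall i, `|x ord0 i| <= r) -> (Phi x <= M%:E)%E].
Proof.
move=> yP; have /nbhs_ballP[e /= e0 He] := young_rV_fin yP.
pose s := e / 2; have s0 : 0 < s by rewrite divr_gt0.
have fin i : (Phi (s *: delta_mx ord0 i) < +oo)%E.
  apply: He; split => // k j; rewrite /ball/= !mxE sub0r normrN.
  rewrite (ord1 k) eqxx/=; case: (j == i); rewrite ?mulr1 ?mulr0 ?normr0//.
  by rewrite ger0_norm ?(ltW s0)// /s; lra.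
pose M : R := 1 + \sum_(i < n) fine (Phi (s *: delta_mx ord0 i)).
have f0 i : 0 <= fine (Phi (s *: delta_mx ord0 i)) by apply: fine_ge0; exact: (young_rV_ge0 yP).
have M0 : 0 < M by rewrite ltr_pwDl// sumr_ge0.
have PM i : (Phi (s *: delta_mx ord0 i) <= M%:E)%E.
  rewrite -[leLHS]fineK; last by rewrite ge0_fin_numE// (young_rV_ge0 yP).
  by rewrite lee_fin /M (bigD1 i)//= addrCA lerDl addr_ge0// sumr_ge0.
exists (s * (2^-1) ^+ n), M; split => //; first by rewrite mulr_gt0// exprn_gt0.
move=> x hx; rewrite (matrix_sum_delta x) big_ord1 -big_enum/=.
apply: (@convex_comb_coords n [set x | (Phi x <= M%:E)%E] s).
- move=> t y z t01 /= Py Pz; apply: le_trans (young_rV_convex yP _ _ t01) _.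
  have /andP[t0 t1] := t01.
  have -> : M%:E = (t%:E * M%:E + (1 - t)%:E * M%:E)%E by rewrite -!EFinM -EFinD; congr EFin; ring.
  by apply: leeD; apply: lee_wpmul2l => //; rewrite lee_fin// subr_ge0.
- by rewrite /= (young_rV_0 yP) lee_fin ltW.
- move=> i c cs /=.
  have cs1 : `|c / s| <= 1 by rewrite normrM normfV (gtr0_norm s0) ler_pdivrMr// mul1r.
  have -> : c *: delta_mx ord0 i = (c / s) *: (s *: delta_mx ord0 i) :> 'rV[R]_n.
    by rewrite scalerA divfK// gt_eqF.
  have E1 : Phi ((c / s) *: (s *: delta_mx ord0 i)) = Phi (`|c / s| *: (s *: delta_mx ord0 i)).
    by case: (ger0P (c / s)) => // _; rewrite scaleNr (young_rV_even yP).
  rewrite E1; apply: le_trans (young_rV_scale _ yP _) _; first by rewrite normr_ge0.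
  apply: le_trans (PM i); apply: mule_le1; first by rewrite normr_ge0.
  exact: (young_rV_ge0 yP).
- move=> i; apply: le_trans (hx i) _; rewrite ler_pM2l//.
  by rewrite size_enum_ord.
Qed.

Lemma sym_body_sublevel n (Phi : 'rV[R]_n -> \bar R) (tau : R) : young_rV Phi -> 0 < tau ->
  sym_body [set x | (Phi x <= tau%:E)%E].
Proof.
move=> yP tau0; split.
- move=> t y z t01 /= Py Pz; apply: le_trans (young_rV_convex yP _ _ t01) _.
  have /andP[t0 t1] := t01.
  have -> : tau%:E = (t%:E * tau%:E + (1 - t)%:E * tau%:E)%E.
    by rewrite -!EFinM -EFinD; congr EFin; ring.
  by apply: leeD; apply: lee_wpmul2l => //; rewrite lee_fin// subr_ge0.
- by move=> x /=; rewrite (young_rV_even yP).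
- rewrite (_ : [set x | _] = Phi @^-1` `]-oo, tau%:E]%classic).
    rewrite -[X in measurable X]setTI; apply: (measurable_young_rV yP) => //.
    exact: emeasurable_itv.
  by apply/seteqP; split => x; rewrite /= in_itv.
- have [r hr] := young_rV_cvgy yP tau; exists r => x /= Px i.
  apply: le_trans (coord_le_enorm _ _) _; rewrite leNgt; apply/negP => /hr.
  by rewrite ltNge Px.
have [r [M [r0 M0 hM]]] := young_rV_bounded_near0 yP.
pose m := Num.max M tau; have m0 : 0 < m by rewrite lt_max M0.
exists (r * (tau / m)); first by rewrite mulr_gt0// divr_gt0.
move=> x hx /=.
have tm : 0 <= tau / m <= 1.
  by rewrite divr_ge0 ?(ltW tau0) ?(ltW m0)//= ler_pdivrMr// mul1r le_max lexx orbT.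
have -> : x = (tau / m) *: ((m / tau) *: x).
  by rewrite scalerA -[m / tau]invf_div mulfV ?scale1r// gt_eqF// divr_gt0.
apply: le_trans (young_rV_scale _ yP tm) _.
have Pm : (Phi ((m / tau) *: x) <= m%:E)%E.
  apply: le_trans (hM _ _) _; last by rewrite lee_fin le_max lexx.
  move=> i; rewrite mxE normrM ger0_norm ?divr_ge0 ?(ltW tau0) ?(ltW m0)//.
  by rewrite -ler_pdivlMl ?divr_gt0// invf_div mulrC.
apply: (@le_trans _ _ ((tau / m)%:E * m%:E)%E).
  by apply: lee_wpmul2l => //; rewrite lee_fin; case/andP: tm.
by rewrite -EFinM divfK// gt_eqF.
Qed.

(** As [A] is non-decreasing and exceeds [tau] at [x], its sublevel set lies in the ball of radius
    [x], hence in the cube of half-side [x]. *)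
Lemma sublevel_volume n (Phi : 'rV[R]_n -> \bar R) A (tau x : R) : young_rV Phi ->
  young_symmetral Phi A -> 0 < tau -> 0 < x -> (tau%:E < A x)%E ->
  (mu n [set y | (Phi y <= tau%:E)%E] <= ((2 * x) ^+ n)%:E)%E.
Proof.
move=> yP [yA AP] tau0 x0 Ax.
rewrite -(lebesgue_rVE (sym_body_meas (sym_body_sublevel yP tau0))) -AP ?(ltW tau0)//.
rewrite -(borel_lebesgue_cube n x0).
have mC : measurable [set y : 'rV[R]_n | forall i, - x <= y ord0 i <= x] by exact: measurable_rV_cube.
rewrite -(lebesgue_rVE mC); apply: le_outer_measure => y /= Ay i.
rewrite -ler_norml; apply: le_trans (coord_le_enorm _ _) _; rewrite leNgt; apply/negP => xy.
have := lt_le_trans Ax (young_homo yA (ltW x0) (ltW xy)).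
by rewrite ltNge Ay.
Qed.

(** A Young inequality for the polar of a sublevel set: if [Phi xi] exceeds [tau], convexity puts
    [(tau / Phi xi) xi] into the sublevel set, where the bound [h] is available. *)
Lemma polar_young n (Phi : 'rV[R]_n -> \bar R) (tau h : R) (xi y : 'rV[R]_n) : young_rV Phi ->
  0 < tau -> 0 < h -> (forall x, (Phi x <= tau%:E)%E -> `|dotrV y x| <= h) ->
  (`|dotrV xi y|%:E <= h%:E + (h / tau)%:E * Phi xi)%E.
Proof.
move=> yP tau0 h0 H; rewrite dotrVC.
have P0 := young_rV_ge0 yP xi.
have [Pt|Pt] := leP (Phi xi) tau%:E.
  apply: (@le_trans _ _ h%:E); first by rewrite lee_fin; exact: H.
  by rewrite leeDl// mule_ge0// lee_fin divr_ge0// ltW.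
apply: (@le_trans _ _ ((h / tau)%:E * Phi xi)%E); last by rewrite leeDr// lee_fin ltW.
case Pr : (Phi xi) Pt P0 => [r| |]//= Pt _; last first.
  by rewrite gt0_muley ?leey// lte_fin divr_gt0.
rewrite -EFinM lee_fin; rewrite lte_fin in Pt; have r0 : 0 < r by exact: lt_trans Pt.
have tr : 0 <= tau / r <= 1 by rewrite divr_ge0 ?(ltW tau0) ?(ltW r0)//= ler_pdivrMr// mul1r ltW.
have : `|dotrV y ((tau / r) *: xi)| <= h.
  apply: H; apply: le_trans (young_rV_scale _ yP tr) _.
  by rewrite Pr -EFinM divfK// gt_eqF.
rewrite dotrVZr normrM ger0_norm ?divr_ge0 ?(ltW tau0) ?(ltW r0)//.
rewrite -ler_pdivlMl ?divr_gt0// invf_div => /le_trans; apply.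
by rewrite mulrC mulrA mulrAC.
Qed.

End young.

(** * Energy of a band from translated superlevel sets *)

Section one_step.
Context {R : realType} {n : nat}.
Local Notation V := 'rV[R]_n.
Local Notation mu := (@borel_lebesgue R n).
Local Notation mu1 := (@lebesgue_measure R).
Local Notation R1 := (measurableTypeR R).
Implicit Types (u : V -> R) (G : V -> V) (Phi : V -> \bar R).

Lemma line_chain_bounded u g y (phi : R -> R) (M : R) : locint u -> locint g ->
  line_primitive u g y -> measurable_fun setT phi -> (forall t, `|phi t| <= M) ->
  line_primitive (oint phi 0 \o u) (fun x => phi (u x) * g x) y.
Proof.
move=> lu lg H mphi phiM; apply: line_chain => // [K|a b]; first by exists M => t _.
by rewrite (@ointD _ _ M 0 a b mphi phiM) addrC addKr.
Qed.

Lemma oint_indic (t t' a b : R) : t < t' -> a <= t -> t' <= b ->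
  oint \1_[set s : R | t < s < t'] a b = t' - t.
Proof.
move=> tt' at_ t'b; rewrite oint_le; last by lra.
have mI : measurable ([set s : R | t < s < t'] : set R1).
  rewrite (_ : [set s | _] = `]t, t'[%classic); first exact: measurable_itvR.
  by apply/seteqP; split => s; rewrite /= in_itv.
rewrite /Rintegral integral_indic; [|exact: measurable_itvR|exact: mI].
have -> : [set s : R | t < s < t'] `&` `[a, b]%classic = `]t, t'[%classic.
  apply/seteqP; split => s; rewrite /= !in_itv/=; first by case.
  by move=> /andP[h1 h2]; split; [rewrite h1 h2|lra].
have := @lebesgue_measure_itv R `]t, t'[; rewrite /= lte_fin tt' => H.
exact: (congr1 fine H).
Qed.

Definition band_energy (Phi : V -> \bar R) u G (s t : R) : \bar R :=
  (\int[mu]_(x in [set x | (s < u x < t)%R]) Phi (G x))%E.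

Lemma measurable_band u (s t : R) : measurable_fun setT u -> measurable [set x : V | s < u x < t].
Proof.
move=> mu_; rewrite (_ : [set x | _] = u @^-1` `]s, t[%classic).
  by rewrite -[X in measurable X]setTI; apply: mu_ => //; exact: measurable_itv.
by apply/seteqP; split => x; rewrite /= in_itv.
Qed.

Lemma measurable_gt u (t : R) : measurable_fun setT u -> measurable [set x : V | t < u x].
Proof.
move=> mu_; rewrite (_ : [set x | _] = u @^-1` `]t, +oo[%classic).
  by rewrite -[X in measurable X]setTI; apply: mu_ => //; exact: measurable_itv.
by apply/seteqP; split => x; rewrite /= in_itv/= andbT.
Qed.

Lemma measurable_ge u (t : R) : measurable_fun setT u -> measurable [set x : V | t <= u x].
Proof.
move=> mu_; rewrite (_ : [set x | _] = u @^-1` `[t, +oo[%classic).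
  by rewrite -[X in measurable X]setTI; apply: mu_ => //; exact: measurable_itv.
by apply/seteqP; split => x; rewrite /= in_itv/= andbT.
Qed.

Lemma measurable_gradient G : (forall i, locint (fun x => G x ord0 i)) -> measurable_fun setT G.
Proof. by move=> lG; apply: measurable_fun_rVP => i; have [] := lG i. Qed.

(* A good translation exists because [|{u >= t'} `&` ({u > t} - y)|], averaged
   over [y \in D], is at most [|{u >= t'}| |{u > t}| / |D|]. *)
Lemma exists_translation (A B D : set V) (a b : R) : measurable A -> measurable B ->
  measurable D -> mu A = a%:E -> mu B = b%:E -> 0 < a -> 0 < b ->
  ((4 * b)%:E <= mu D)%E ->
  exists2 y, D y & (mu (A `&` [set x | B (x + y)%R]) <= (a / 2)%:E)%E.
Proof.
move=> mA mB mD Aa Bb a0 b0 Db; apply: contrapT => H.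
have {}H y : D y -> ((a / 2)%:E <= mu (A `&` [set x | B (x + y)%R]))%E.
  move=> Dy; apply: ltW; rewrite ltNge; apply/negP => h; apply: H; exists y => //.
have mBxy : measurable [set p : V * V | B (p.1 + p.2)].
  rewrite -[X in measurable X]setTI; apply: (_ : measurable_fun setT (fun p : V * V => p.1 + p.2)) => //.
  by apply: measurable_funD_rV; [exact: measurable_fst|exact: measurable_snd].
pose S := [set p : V * V | A p.1] `&` [set p | D p.2] `&` [set p | B (p.1 + p.2)].
have mS : measurable S.
  apply: measurableI => //; apply: measurableI.
    by rewrite -[X in measurable X]setTI; exact: measurable_fst.
  by rewrite -[X in measurable X]setTI; exact: measurable_snd.
have := indic_fubini_tonelli mu mu mS.
rewrite indic_fubini_tonelli_FE// indic_fubini_tonelli_GE// => E1.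
(* If all translates were bad, Tonelli would give [4 b (a / 2) <= a b]. *)
have l1 : ((4 * b)%:E * (a / 2)%:E <= \int[mu]_y (mu \o ysection S) y)%E.
  apply: (@le_trans _ _ (\int[mu]_(y in D) (a / 2)%:E)%E).
    rewrite integral_cst// muleC; apply: lee_wpmul2l => //.
    by rewrite lee_fin divr_ge0// ltW.
  apply: (@le_trans _ _ (\int[mu]_(y in D) (mu \o ysection S) y)%E).
    apply: ge0_le_integral => //.
    - by move=> y _; rewrite lee_fin divr_ge0// ltW.
    - by apply: measurable_funTS; exact: measurable_fun_ysection.
    - move=> y Dy /=; apply: le_trans (H y Dy) _.
      apply: le_measure; rewrite ?inE.
      + apply: measurableI => //; rewrite -[X in measurable X]setTI; exact: measurable_addrV.
      + exact: measurable_ysection.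
      + by move=> x [Ax Bx]; rewrite /ysection/= inE.
  by apply: ge0_subset_integral => //; exact: measurable_fun_ysection.
have l2 : (\int[mu]_x (mu \o xsection S) x <= a%:E * b%:E)%E.
  rewrite -Aa -Bb muleC -integral_cst// integral_mkcond.
  apply: ge0_le_integral => //.
  - exact: measurable_fun_xsection.
  - exact: (proj1 (measurable_restrictT _ mA)).
  move=> x _ /=; rewrite patchE; have [/set_mem Ax|xA] := boolP (x \in A).
    rewrite -(borel_lebesgue_shift x mB); apply: le_measure; rewrite ?inE.
    + exact: measurable_xsection.
    + by rewrite -[X in measurable X]setTI; exact: measurable_addrV.
    + by move=> y; rewrite /xsection/= inE => -[_ /=]; rewrite addrC.
  rewrite (_ : xsection S x = set0) ?measure0//.
  apply/seteqP; split => // y; rewrite /xsection/= inE => -[[Ax _] _].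
  by move: xA; rewrite mem_set.
rewrite E1 in l2; have := le_trans l1 l2; rewrite -!EFinM lee_fin leNgt => /negP; apply.
nra.
Qed.

Lemma indic_band_neq0 u (t t' : R) x :
  \1_[set s : R | t < s < t'] (u x) = \1_[set z : V | t < u z < t'] x :> R.
Proof.
rewrite !indicE; have [h|h] := boolP (t < u x < t'); first by rewrite !mem_set.
by rewrite !memNset//=; exact/negP.
Qed.

Section line_average.
Variables (w : V -> \bar R) (y : V).
Hypothesis mw : measurable_fun setT w.
Hypothesis w0 : forall z, (0 <= w z)%E.

Let k (p : V * R1) : \bar R := (w (p.1 + p.2 *: y)%R * (\1_(`[0, 1]%classic : set R1) p.2)%:E)%E.

Let mk : measurable_fun setT k.
Proof.
apply: emeasurable_funM; first exact: (measurableT_comp mw (measurable_line y)).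
apply/measurable_EFinP.
apply: (measurableT_comp (f := \1_`[0, 1]%classic : R1 -> R)) measurable_snd.
by apply: measurable_indic; exact: measurable_itvR.
Qed.

Let k0 p : (0 <= k p)%E. Proof. by rewrite mule_ge0. Qed.

Let kE z : (\int[mu1]_(s in `[0%R, 1%R]) w (z + s *: y)%R = \int[mu1]_s k (z, s))%E.
Proof.
rewrite integral_mkcond; apply: eq_integral => s _ /=.
by rewrite patchE /k indicE/=; case: ifP => _; rewrite ?mule1 ?mule0.
Qed.

Lemma measurable_line_average :
  measurable_fun setT (fun z : V => \int[mu1]_(s in `[0%R, 1%R]) w (z + s *: y)%R)%E.
Proof.
rewrite (_ : (fun z => _) = fubini_F mu1 k); first exact: measurable_fun_fubini_tonelli_F.
by apply/funext => z; exact: kE.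
Qed.

Lemma integral_line_average :
  (\int[mu]_z \int[mu1]_(s in `[0%R, 1%R]) w (z + s *: y)%R = \int[mu]_z w z)%E.
Proof.
under eq_integral do rewrite kE.
rewrite (fubini_tonelli (m1 := mu) (m2 := mu1) k mk k0).
transitivity (\int[mu1]_(s in (`[0%R, 1%R]%classic : set R1)) (\int[mu]_z w z))%E.
  rewrite [RHS]integral_mkcond; apply: eq_integral => s _.
  rewrite patchE /k /=; case: ifP => sI; rewrite indicE sI/=.
    by under eq_integral do rewrite mule1; exact: ge0_integral_shift_rV.
  by under eq_integral do rewrite mule0; rewrite integral0.
rewrite integral_cst; last exact: measurable_itvR.
by have := @lebesgue_itvcc R 0 1 ler01; rewrite subr0 => H; rewrite [X in (_ * X)%E]H mule1.
Qed.

End line_average.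

(** Between [z] and [z + y] the function crosses the whole band, so [<G, y>] restricted to the band
    has integral [t' - t] in absolute value. [polar_young] with [h = (t' - t) / 2] absorbs half of
    this and leaves the other half to [Phi]. *)
Lemma line_growth Phi u G (t t' tau : R) (y : V) : young_rV Phi -> bweak u G ->
  t < t' -> 0 < tau -> (forall x, (Phi x <= tau%:E)%E -> `|dotrV y x| <= (t' - t) / 2) ->
  {ae mu, forall z, t' <= u z -> u (z + y) <= t ->
    (tau%:E <= \int[mu1]_(s in `[0%R, 1%R])
      (Phi (G (z + s *: y)%R) * (\1_[set z | (t < u z < t')%R] (z + s *: y)%R)%:E))%E}.
Proof.
move=> yP wu tt' tau0 yL; have [lu lG _] := wu; have [mu_ _] := lu.
have mG := measurable_gradient lG.
pose phi : R -> R := \1_[set s : R | t < s < t'].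
have mphi : measurable_fun setT phi.
  apply: measurable_indic; rewrite (_ : [set s | _] = `]t, t'[%classic); first exact: measurable_itv.
  by apply/seteqP; split => s; rewrite /= in_itv.
have phi1 s : `|phi s| <= 1 by rewrite /phi indicE; case: (s \in _); rewrite ?normr0 ?normr1.
pose g x := dotrV (G x) y; have lg : locint g by exact: locint_dotrV.
pose k x := phi (u x) * g x.
have lk : locint k.
  rewrite (_ : k = (fun x => g x * phi (u x))); last by apply/funext => x; rewrite /k mulrC.
  by apply: (@locint_mul_bounded _ _ _ _ 1) => //; exact: (measurableT_comp mphi).
have H1 := line_chain_bounded lu lg (@bweak_line _ _ u G y wu) mphi phi1 ler01.
have H2 := ae_integrable_line y lk ler01.
move: H1 H2; apply: filterS2 => z; rewrite /= scale1r => Hz iz uz uzy.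
set d := t' - t; have d0 : 0 < d by rewrite subr_gt0.
set w := fun z => (Phi (G z) * (\1_[set z | (t < u z < t')%R] z)%:E)%E.
have mw : measurable_fun setT w.
  apply: emeasurable_funM; first exact: (measurableT_comp (measurable_young_rV yP)).
  by apply/measurable_EFinP; apply: measurable_indic; exact: measurable_band.
have w0 x : (0 <= w x)%E by rewrite mule_ge0// young_rV_ge0.
rewrite -[leRHS]/(\int[mu1]_(s in `[0%R, 1%R]) w (z + s *: y)%R)%E.
have {}Hz : `|\int[mu1]_(s in `[0, 1]) k (z + s *: y)| = d.
  rewrite -Hz distrC -(ger0_norm (ltW d0)); congr (`|_|).
  rewrite /d -(oint_indic tt' uzy uz) -/phi.
  by rewrite (@ointD _ phi 1 (u (z + y)) 0 (u z) mphi phi1) (ointC _ 0) addrC.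
have dI : (d%:E <= \int[mu1]_(s in `[0%R, 1%R]) `|(k (z + s *: y))%:E|)%E.
  rewrite -Hz EFin_normr_Rintegral//; apply: le_abse_integral => //.
  by have /integrableP[] := iz.
have kw x : (`|(k x)%:E| <= (d / 2)%:E + (d / 2 / tau)%:E * w x)%E.
  rewrite /k /w /phi indic_band_neq0 indicE abse_EFin; case: (x \in _).
    by rewrite mul1r mule1; apply: polar_young => //; rewrite divr_gt0.
  by rewrite mul0r normr0 mule0 mule0 adde0 lee_fin divr_ge0// ltW.
have mwz : measurable_fun setT (fun s : R1 => w (z + s *: y)).
  by apply: (measurableT_comp mw); exact: (measurable_ray z y).
have : (d%:E <= (d / 2)%:E + (d / 2 / tau)%:E * \int[mu1]_(s in `[0%R, 1%R]) w (z + s *: y)%R)%E.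
  apply: le_trans dI _.
  apply: (@le_trans _ _ (\int[mu1]_(s in `[0%R, 1%R]) ((d / 2)%:E + (d / 2 / tau)%:E * w (z + s *: y)%R))%E).
    apply: ge0_le_integral => //.
    - by apply: measurableT_comp => //; have /integrableP[] := iz.
    - apply: emeasurable_funD => //; apply: measurable_funeM; exact: measurable_funTS.
  rewrite ge0_integralD//; last 3 first.
  - by move=> s _; rewrite lee_fin divr_ge0// ltW.
  - by move=> s _; rewrite mule_ge0// lee_fin divr_ge0 ?divr_ge0// ltW.
  - by apply: measurable_funeM; exact: measurable_funTS.
  rewrite ge0_integralZl//; last 2 first.
  - exact: measurable_funTS.
  - by rewrite lee_fin divr_ge0 ?divr_ge0// ltW.
  rewrite integral_cst; last exact: measurable_itvR.
  have := @lebesgue_itvcc R 0 1 ler01; rewrite subr0 => H.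
  by rewrite [X in (_ * X)%E]H mule1.
have : (0 <= \int[mu1]_(s in `[0%R, 1%R]) w (z + s *: y)%R)%E by exact: integral_ge0.
case: (integral _ _ _) => [r| |]// r0; last by rewrite leey.
rewrite -EFinM -EFinD !lee_fin => h.
have : d / 2 <= d / 2 / tau * r by lra.
by rewrite mulrAC ler_pdivlMr// ler_pM2l// divr_gt0.
Qed.

(* Translate [{u > t}] by a vector [y] of the polar of the sublevel set
   [{Phi <= tau}]: half of [{u >= t'}] leaves [{u > t}], and along each such segment
   [u] loses [t' - t] at the expense of the energy in the band. *)
Lemma one_step : exists2 c : R, 0 < c & forall (Phi : V -> \bar R) (A : R -> \bar R) u G,
  young_rV Phi -> young_symmetral Phi A -> bweak u G ->
  forall t t' x tau : R, t < t' -> 0 < x -> 0 < tau -> (tau%:E < A x)%E ->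
  ((x ^+ n)%:E * mu [set z | (t < u z)%R] <= (c * (t' - t) ^+ n)%:E)%E ->
  (mu [set z | (t' <= u z)%R] * tau%:E <= 2%:E * band_energy Phi u G t t')%E.
Proof.
have [c c0 H] := @polar_volume R n.
(* Tuned to make the volume of [D] at least 4 times that of [{u > t}]: one [2 ^+ n] comes from the
   level [(t' - t) / 2] of the polar, the other from the cube of side [2 x] that contains the
   sublevel set. *)
exists (c / (4 * 4 ^+ n)); first by rewrite divr_gt0// mulr_gt0// exprn_gt0.
move=> Phi A u G yP AP wu t t' x tau tt' x0 tau0 Ax xa.
have [lu lG _] := wu; have [mu_ _] := lu.
have mG := measurable_gradient lG.
have E0 : (0 <= band_energy Phi u G t t')%E.
  by apply: integral_ge0 => z _; exact: young_rV_ge0.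
set A' := [set z | t' <= u z]; set B := [set z | t < u z] in xa *.
have mA' : measurable A' by exact: measurable_ge.
have mB : measurable B by exact: measurable_gt.
have AB : A' `<=` B by move=> z /=; exact: lt_le_trans.
have xn0 : 0 < x ^+ n by exact: exprn_gt0.
have Boo : (mu B < +oo)%E.
  by rewrite ltey; apply/eqP => Boo; move: xa; rewrite Boo gt0_muley ?lte_fin.
have Aoo : (mu A' < +oo)%E by apply: le_lt_trans Boo; apply: le_measure; rewrite ?inE.
have [A0|A0] := eqVneq (mu A') 0%E; first by rewrite A0 mul0e mule_ge0.
pose a := fine (mu A'); pose b := fine (mu B).
have Aa : mu A' = a%:E by rewrite fineK// ge0_fin_numE.
have Bb : mu B = b%:E by rewrite fineK// ge0_fin_numE.
have a0 : 0 < a by rewrite lt_def -eqe -Aa A0/= -lee_fin -Aa measure_ge0.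
have ab : a <= b by rewrite -lee_fin -Aa -Bb; apply: le_measure; rewrite ?inE.
have b0 : 0 < b by exact: lt_le_trans ab.
pose delta := t' - t; have d0 : 0 < delta by rewrite subr_gt0.
pose L := [set z : V | (Phi z <= tau%:E)%E].
have d20 : 0 < delta / 2 by rewrite divr_gt0.
have [D [mD DL vD]] := H L (delta / 2) (sym_body_sublevel yP tau0) d20.
have vL := sublevel_volume yP AP tau0 x0 Ax.
have D4 : ((4 * b)%:E <= mu D)%E.
  have : ((c * (delta / 2) ^+ n)%:E <= ((2 * x) ^+ n)%:E * mu D)%E.
    by apply: le_trans vD _; apply: lee_wpmul2r.
  rewrite Bb -EFinM lee_fin in xa.
  have [->|Dfin] := eqVneq (mu D) +oo%E; first by move=> _; exact: leey.
  rewrite -(@fineK _ (mu D)); last by rewrite ge0_fin_numE ?ltey.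
  move: (fine (mu D)) => d; rewrite -EFinM !lee_fin => vd.
  have p2 : (0 : R) < 2 ^+ n by exact: exprn_gt0.
  have E4 : (4 : R) ^+ n = 2 ^+ n * 2 ^+ n by rewrite -exprMn; congr (_ ^+ _); ring.
  move: vd xa; rewrite E4 !exprMn exprVn -/delta.
  set P := x ^+ n in xn0 *; set Q := delta ^+ n; set T := 2 ^+ n in p2 *.
  rewrite mulrA ler_pdivrMr// => h1.
  rewrite mulrAC ler_pdivlMr ?mulr_gt0// => h2.
  have TP : 0 < P * (T * T) by rewrite !mulr_gt0.
  rewrite -(ler_pM2l TP); have := le_trans h2 h1; lra.
have [y Dy Ay] := exists_translation mA' mB mD Aa Bb a0 b0 D4.
pose B' := A' `\` [set z | B (z + y)].
have mBy : measurable [set z | B (z + y)].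
  rewrite -[X in measurable X]setTI; exact: measurable_addrV.
have mB' : measurable B' by exact: measurableD.
have B'a : ((a / 2)%:E <= mu B')%E.
  have := measureDI mu mA' mBy; rewrite -/B' => EA.
  have : (a%:E <= mu B' + (a / 2)%:E)%E by rewrite -Aa EA; apply: leeD2l.
  by rewrite -leeBlDr// -EFinB; have -> : a - a / 2 = a / 2 by field.
pose w z := (Phi (G z) * (\1_[set z | (t < u z < t')%R] z)%:E)%E.
have mw : measurable_fun setT w.
  apply: emeasurable_funM; first exact: (measurableT_comp (measurable_young_rV yP)).
  by apply/measurable_EFinP; apply: measurable_indic; exact: measurable_band.
have w0 z : (0 <= w z)%E by rewrite mule_ge0// young_rV_ge0.
have wE : (\int[mu]_z w z = band_energy Phi u G t t')%E.
  rewrite /band_energy [RHS]integral_mkcond; apply: eq_integral => z _.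
  by rewrite /w patchE indicE; case: ifP => _; rewrite ?mule1 ?mule0.
pose Iw z := (\int[mu1]_(s in `[0%R, 1%R]) w (z + s *: y)%R)%E.
have mI : measurable_fun setT Iw by exact: measurable_line_average.
have I0 z : (0 <= Iw z)%E by exact: integral_ge0.
have intI : (\int[mu]_z Iw z = band_energy Phi u G t t')%E by rewrite integral_line_average.
have key := line_growth yP wu tt' tau0 (DL y Dy).
have : (tau%:E * mu B' <= \int[mu]_(z in B') Iw z)%E.
  rewrite -integral_cst//.
  have [N [mN N0 PN]] := key.
  apply: (@le_trans _ _ (\int[mu]_(z in B' `\` N) tau%:E)%E).
    rewrite !integral_cst//; last exact: measurableD.
    apply: lee_wpmul2l; first by rewrite lee_fin ltW.
    have BN0 : mu (B' `&` N) = 0%E.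
      apply/eqP; rewrite eq_le measure_ge0 andbT -N0; apply: le_measure; rewrite ?inE//.
      exact: measurableI.
    by rewrite [leLHS](measureDI mu mB' mN) [X in (_ + X)%E]BN0 adde0.
  apply: (@le_trans _ _ (\int[mu]_(z in B' `\` N) Iw z)%E).
    apply: ge0_le_integral => //; first exact: measurableD.
    - by move=> z _; rewrite lee_fin ltW.
    - exact: measurable_funTS.
    - move=> z [[Az Bz] Nz]; apply: contrapT => Hn; apply: Nz; apply: PN => /(_ Az).
      by move=> /(_ _)/Hn; apply; rewrite leNgt; exact/negP.
  apply: ge0_subset_integral => //; first exact: measurableD.
  exact: measurable_funTS.
move=> H1.
have H2 : (\int[mu]_(z in B') Iw z <= band_energy Phi u G t t')%E.
  by rewrite -intI; apply: ge0_subset_integral.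
have H3 := le_trans H1 H2.
have H4 : ((a / 2)%:E * tau%:E <= band_energy Phi u G t t')%E.
  by apply: le_trans H3; rewrite muleC; apply: lee_wpmul2l => //; rewrite lee_fin ltW.
rewrite Aa; have -> : (a%:E * tau%:E = 2%:E * ((a / 2)%:E * tau%:E))%E.
  by rewrite -!EFinM; congr EFin; field.
by apply: lee_wpmul2l.
Qed.

End one_step.

(** * Summation of the one-step bound over dyadic volumes *)

Section decay.
Context {R : realType}.
Local Notation mu1 := (@lebesgue_measure R).
Local Notation R1 := (measurableTypeR R).

Lemma expR_powR (x r : R) : expR x `^ r = expR (r * x).
Proof. by rewrite /powR gt_eqF ?expR_gt0// expRK. Qed.

Lemma le_add3 (x1 x2 y1 y2 z w s : R) :
  x1 <= y1 + z -> x2 <= y2 + w -> y2 + y1 <= s -> x1 + x2 <= s + (z + w).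
Proof. by lra. Qed.

Lemma powR_exprn (x r : R) i : 0 <= x -> (x ^+ i) `^ r = (x `^ r) ^+ i.
Proof. by move=> x0; rewrite -[x ^+ i]powR_mulrn// powRAC powR_mulrn// powR_ge0. Qed.

(** The active terms are bounded by a geometric sum that ends at the last active index, whose term
    is at most [W]; the bound is therefore independent of [k]. *)
Lemma geometric_sum_le (rho r W : R) (P : nat -> bool) k : 1 < rho -> 0 <= r -> 0 <= W ->
  (forall i, P i -> rho ^+ i * r <= W) ->
  \sum_(i < k) (P i)%:R * (rho ^+ i * r) <= W * (rho / (rho - 1)).
Proof.
move=> rho1 r0 W0 H; have d0 : 0 < rho - 1 by rewrite subr_gt0.
have rho0 : 0 < rho by exact: lt_trans rho1.
elim: k => [|k IH]; first by rewrite big_ord0 mulr_ge0// divr_ge0// ltW.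
have [Pk|Pk] := boolP (P k); last by rewrite big_ord_recr/= (negbTE Pk) mul0r addr0.
apply: (@le_trans _ _ (\sum_(i < k.+1) rho ^+ i * r)).
  by apply: ler_sum => i _; rewrite ler_piMl ?lern1 ?leq_b1// mulr_ge0// exprn_ge0// ltW.
rewrite -mulr_suml.
have E : \sum_(i < k.+1) rho ^+ i = (rho ^+ k.+1 - 1) / (rho - 1).
  by rewrite subrX1 mulrC mulKf// gt_eqF.
rewrite E; apply: (@le_trans _ _ (rho ^+ k * r * (rho / (rho - 1)))); last first.
  by rewrite ler_wpM2r ?H// divr_ge0// ltW.
rewrite [leRHS]mulrA [leLHS]mulrAC ler_wpM2r ?invr_ge0 ?(ltW d0)//.
rewrite [leRHS]mulrAC -exprSr ler_wpM2r//; lra.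
Qed.

Variables (n : nat) (a : R -> R).
Hypothesis n2 : (2 <= n)%N.
Hypothesis a_gt0 : forall x, 0 < x -> 0 < a x.
Hypothesis a_homo : forall x y, 0 < x -> x <= y -> a x <= a y.
Hypothesis a_quot : forall x y, 0 < x -> x <= y -> y / a y <= x / a x.

Let p : R := (n%:R - 1)^-1.
Let q : R := n%:R^-1.

Let n1 : (0 : R) < n%:R - 1.
Proof. by rewrite subr_gt0 ltr1n. Qed.
Let n0 : (0 : R) < n%:R. Proof. by rewrite ltr0n ltnW. Qed.
Let p0 : 0 < p. Proof. by rewrite invr_gt0. Qed.
Let q0 : 0 < q. Proof. by rewrite invr_gt0. Qed.
Let pq : p * (1 - q) = q.
Proof. by rewrite /p /q; field; rewrite !gt_eqF. Qed.
Let q1 : 0 < 1 - q.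
Proof. by rewrite subr_gt0 invf_lt1// ltr1n. Qed.

Definition young_kernel (s : R) : R := (s / a s) `^ p.

(** [m t] and [M t] model the volumes of [{u > t}] and [{u >= t}], and [e s t] the energy between
    the two levels. Having both volumes lets [quantile] reach every intermediate volume, even one
    skipped by a jump. *)
Variables (m M : R -> R) (e : R -> R -> R) (c : R).
Hypothesis c0 : 0 < c.
Hypothesis mM : forall t, 0 < t -> 0 <= m t <= M t.
Hypothesis e_ge0 : forall s t, 0 <= e s t.
Hypothesis step : forall t t' x, 0 < t -> t < t' -> 0 < x ->
  x ^+ n * m t <= c * (t' - t) ^+ n -> M t' * a x <= 2 * e t t'.
Hypothesis quantile : forall al be b, 0 < al -> al <= be -> m be <= b -> b <= m al ->
  exists t, [/\ al <= t, t <= be, m t <= b & b <= M t].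
Hypothesis e_add : forall s t r, s <= t -> t <= r -> e s t + e t r <= e s r.

Variables (S lam : R).
Hypothesis S0 : 0 < S.
Hypothesis lam0 : 0 < lam.
Hypothesis ik : mu1.-integrable `]0, S[ (EFin \o young_kernel).

(* The [s] at which the integrand of [young_kernel_int] is large at volume [b]. *)
Let F (b : R) : set R := [set s | 0 < s /\ lam * b `^ (1 - q) < s / a s].

Let mF b : measurable (F b : set R1).
Proof.
apply: is_interval_measurable => x y [x0 Fx] [y0 Fy] z /andP[xz zy]; split.
  exact: lt_le_trans xz.
by apply: lt_le_trans Fy _; apply: a_quot => //; exact: lt_le_trans xz.
Qed.

Let iF b : mu1.-integrable `]0, S[ (EFin \o (fun s => b `^ q * \1_(F b) s)).
Proof.
apply: (@integrableS _ _ _ mu1 `[0, S]%classic); try exact: measurable_itvR.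
  by move=> s; rewrite /= !in_itv/= => /andP[/ltW -> /ltW ->].
apply: (bounded_integrable_itv (M := `|b `^ q|)).
  by apply: measurable_funM => //; apply: measurable_indic; exact: mF.
by move=> t; rewrite normrM indicE; case: (t \in _); rewrite ?normr0 ?normr1 ?mulr1 ?mulr0.
Qed.

Let J (b : R) : R := \int[mu1]_(s in `]0, S[) (b `^ q * \1_(F b) s).

Let J0 b : 0 <= J b.
Proof. by apply: Rintegral_ge0 => s _; rewrite mulr_ge0// powR_ge0. Qed.

Let cc : R := Num.min 1 (c / 2).

Let cc0 : 0 < cc. Proof. by rewrite lt_min ltr01 divr_gt0. Qed.

Let ccn : 2 * cc ^+ n <= c.
Proof.
have h1 : cc <= 1 by rewrite ge_min lexx.
have h2 : cc <= c / 2 by rewrite ge_min lexx orbT.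
have : cc ^+ n <= cc.
  by case: n n2 => [//|k _]; rewrite exprS ler_piMr ?(ltW cc0)// exprn_ile1// ltW.
lra.
Qed.

Lemma decay_step (al be b : R) : 0 < al -> al <= be -> 0 < b -> m al <= 2 * b -> b <= M be ->
  S / a S <= lam * b `^ (1 - q) ->
  cc * (be - al) <= 2 * lam * e al be + J b.
Proof.
move=> al0; rewrite le_eqVlt => /predU1P[<- b0 _ _ _|alb b0 mb bM Sb].
  by rewrite subrr mulr0 addr_ge0 ?mulr_ge0 ?(ltW lam0).
rewrite /J; set r := b `^ q; have r0 : 0 < r by exact: powR_gt0.
have rn : r ^+ n = b by rewrite -powR_mulrn ?(ltW r0)// -powRrM mulVf ?gt_eqF// powRr1// ltW.
have bqE : b `^ (1 - q) * r = b.
  by rewrite /r -powRD ?subrK ?powRr1 ?(ltW b0)// oner_eq0.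
pose x := cc * (be - al) / r.
have d0 : 0 < be - al by rewrite subr_gt0.
have x0 : 0 < x by rewrite divr_gt0// mulr_gt0.
have xr : x * r = cc * (be - al) by rewrite divfK// gt_eqF.
rewrite -xr.
have I0 : 0 <= \int[mu1]_(s in `]0, S[) (r * \1_(F b) s).
  by apply: Rintegral_ge0 => s _; rewrite mulr_ge0// ltW.
have := step al0 alb x0.
have -> : x ^+ n * m al <= c * (be - al) ^+ n.
  rewrite /x expr_div_n rn mulrAC ler_pdivrMr// exprMn.
  apply: (@le_trans _ _ (cc ^+ n * (be - al) ^+ n * (2 * b))).
    by rewrite ler_wpM2l// mulr_ge0// exprn_ge0// ltW.
  rewrite (_ : cc ^+ n * (be - al) ^+ n * (2 * b) = 2 * cc ^+ n * ((be - al) ^+ n * b)); last by ring.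
  by rewrite -[leRHS]mulrA ler_wpM2r// mulr_ge0 ?exprn_ge0 ?ltW.
move=> /(_ isT) Max.
have bax : b * a x <= 2 * e al be.
  by apply: le_trans Max; rewrite ler_wpM2r// ltW// a_gt0.
have [Fx|nFx] := pselect (forall s, 0 < s < x -> F b s); last first.
  have /existsNP[s /not_implyP[/andP[s0 sx] Fs]] := nFx.
  have sF : s / a s <= lam * b `^ (1 - q) by rewrite leNgt; apply/negP => h; apply: Fs.
  have := le_trans (a_quot s0 (ltW sx)) sF; rewrite ler_pdivrMr ?a_gt0// => h.
  apply: (@le_trans _ _ (lam * (b * a x))).
    apply: le_trans (ler_wpM2r (ltW r0) h) _.
    by rewrite -{2}bqE le_eqVlt; apply/orP; left; apply/eqP; ring.
  rewrite -[leLHS]addr0; apply: lerD => //.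
  by rewrite [2 * lam]mulrC -mulrA ler_pM2l.
have xS : x <= S.
  rewrite leNgt; apply/negP => Sx; have /Fx[_] : 0 < S < x by rewrite S0.
  by rewrite ltNge Sb.
rewrite -[leLHS]add0r; apply: lerD; first by rewrite !mulr_ge0// ltW.
have mx : measurable (`]0, x[%classic : set R1) by exact: measurable_itvR.
have vx : mu1 `]0, x[%classic = x%:E.
  have := @lebesgue_measure_itv R `]0, x[; rewrite /= lte_fin x0 => H.
  by rewrite -[x in RHS]subr0; exact: H.
have -> : x * r = \int[mu1]_(s in `]0, x[) r.
  by rewrite Rintegral_cst// mulrC; congr (_ * _); exact: (esym (congr1 fine vx)).
have icx : mu1.-integrable `]0, x[ (EFin \o cst r).
  apply: (@integrableS _ _ _ mu1 `[0, x]%classic) => //; try exact: measurable_itvR.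
    by move=> s; rewrite /= !in_itv/= => /andP[/ltW -> /ltW ->].
  exact: (bounded_integrable_itv (M := `|r|)).
rewrite [leLHS]Rintegral_indic [leRHS]Rintegral_indic; apply: le_Rintegral => //.
- exact: (proj1 (integrable_mul_indic mu1 (cst r) mx) icx).
- exact: (proj1 (integrable_mul_indic mu1 _ (measurable_itvR _)) (iF b)).
move=> s _; have [sx|sx] := boolP (s \in `]0, x[).
  have Fs : F b s by apply: Fx; rewrite in_itv in sx.
  have sS : s \in `]0, S[.
    by move: sx; rewrite !in_itv/= => /andP[-> /lt_le_trans ->].
  by rewrite !indicE !mem_set// !mulr1.
rewrite [X in _ * X](_ : _ = 0) ?mulr0 ?mulr_ge0 ?(ltW r0)//.
by rewrite indicE memNset//=; exact/negP.
Qed.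

(** Induction on the number of doublings of the volume from [be] down to [al]: split at a level [t]
    of volume [2 * b]. The energies of the two parts add up, and the doubled volume shifts the sum
    of the [J] by one index. *)
Lemma decay_iter k (al be b : R) : 0 < al -> al <= be -> 0 < b -> m be <= b -> b <= M be ->
  m al <= 2 ^+ k * (2 * b) -> S / a S <= lam * b `^ (1 - q) ->
  cc * (be - al) <= 2 * lam * e al be +
    \sum_(i < k.+1) J (2 ^+ i * b).
Proof.
elim: k be b => [|k IH] be b al0 albe b0 mb bM mal Sb.
  rewrite big_ord_recl big_ord0 addr0 expr0 mul1r; apply: decay_step => //.
  by rewrite expr0 mul1r in mal.
rewrite big_ord_recl expr0 mul1r.
have [mal2|mal2] := leP (m al) (2 * b).
  apply: le_trans (decay_step al0 albe b0 mal2 bM Sb) _.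
  by rewrite lerD2l lerDl sumr_ge0.
have mb2 : m be <= 2 * b by apply: le_trans mb _; lra.
have [t [alt tb mt tM]] := quantile al0 albe mb2 (ltW mal2).
have t0 : 0 < t by exact: lt_le_trans alt.
have b20 : 0 < 2 * b by rewrite mulr_gt0.
have h1 := decay_step t0 tb b0 mt bM Sb.
have Sb2 : S / a S <= lam * (2 * b) `^ (1 - q).
  apply: le_trans Sb _; rewrite ler_pM2l//; apply: ge0_ler_powR; rewrite ?nnegrE ?(ltW q1)//; lra.
have mal' : m al <= 2 ^+ k * (2 * (2 * b)) by move: mal; rewrite exprSr -mulrA.
have h2 := IH t (2 * b) al0 alt b20 mt tM mal' Sb2.
have h3 : 2 * lam * (e al t + e t be) <= 2 * lam * e al be.
  by rewrite ler_wpM2l ?mulr_ge0 ?(ltW lam0)// e_add.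
have ES : \sum_(i < k.+1) J (2 ^+ i * (2 * b)) = \sum_(i < k.+1) J (2 ^+ lift ord0 i * b).
  by apply: eq_bigr => i _; rewrite mulrA -exprSr.
rewrite ES in h2.
have -> : cc * (be - al) = cc * (be - t) + cc * (t - al) by ring.
rewrite mulrDr in h3; exact: (le_add3 h1 h2 h3).
Qed.

(** At a fixed [s] the volumes [2 ^+ i * b] with [s] in [F] form an initial stretch, and their
    powers sum like a geometric series of ratio [2]^ q[. Since]p * (1 - q) =
    q[, the last one is at most]lam [^ (- p)] times the kernel at [s]. The number [k] of doublings
    disappears. *)
Lemma decay_bound (al be b E : R) : 0 < al -> al <= be -> 0 < b -> m be <= b -> b <= M be ->
  e al be <= E -> S / a S <= lam * b `^ (1 - q) ->
  cc * (be - al) <= 2 * lam * E +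
    (2 `^ q / (2 `^ q - 1)) * (lam `^ (- p) * \int[mu1]_(s in `]0, S[) young_kernel s).
Proof.
move=> al0 albe b0 mb bM eE Sb.
have [k hk] : exists k : nat, m al <= 2 ^+ k * (2 * b).
  have [k _ hk] := nbhs_infty_gtr (m al / (2 * b)).
  exists k; rewrite -ler_pdivrMr ?mulr_gt0//; apply: le_trans (ltW (hk k (leqnn _))) _.
  by rewrite -natrX ler_nat ltnW// ltn_expl.
apply: le_trans (decay_iter al0 albe b0 mb bM hk Sb) _.
apply: lerD; first by rewrite ler_wpM2l// mulr_ge0// ltW.
have [Is <-] := @Rintegral_sum R _ _ mu1 `]0, S[%classic _ (index_enum 'I_k.+1)
  (fun i : 'I_k.+1 => fun s => (2 ^+ i * b) `^ q * \1_(F (2 ^+ i * b)) s) (measurable_itvR _)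
  (fun i => iF (2 ^+ i * b)).
have iK : mu1.-integrable `]0, S[ (EFin \o (fun s => lam `^ (- p) * young_kernel s)).
  by apply: integrableZ_fun => //; exact: measurable_itvR.
rewrite -(RintegralZl _ (measurable_itvR _) ik) -(RintegralZl _ (measurable_itvR _) iK).
apply: le_Rintegral => //.
  by apply: integrableZ_fun => //; exact: measurable_itvR.
move=> s; rewrite /= in_itv/= => /andP[s0 _].
have rho1 : 1 < 2 `^ q :> R.
  have := @gt0_ltr_powR R q q0 1 2; rewrite !nnegrE powR1; apply => //.
  by rewrite ltr1n.
have := @geometric_sum_le (2 `^ q) (b `^ q) (lam `^ (- p) * young_kernel s) (fun i => s \in F (2 ^+ i * b)) k.+1
  rho1 (powR_ge0 _ _) _ _.
move=> H; rewrite mulrC; apply: le_trans (H _ _).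
- apply: ler_sum => i _; rewrite indicE mulrC powRM ?exprn_ge0 ?(ltW b0)//.
  by rewrite powR_exprn.
- by rewrite mulr_ge0 ?powR_ge0.
move=> i /set_mem[_ Fs].
have B0 : 0 < 2 ^+ i * b by rewrite mulr_gt0// exprn_gt0.
have -> : 2 `^ q ^+ i * b `^ q = (2 ^+ i * b) `^ q :> R.
  by rewrite powRM ?exprn_ge0 ?(ltW b0)// powR_exprn.
rewrite powRN [leRHS]mulrC ler_pdivlMr ?powR_gt0//.
rewrite -[in leLHS]pq mulrC [p * _]mulrC powRrM -powRM ?powR_ge0 ?(ltW lam0)//.
apply: ge0_ler_powR; rewrite ?nnegrE ?(ltW p0) ?mulr_ge0 ?powR_ge0 ?(ltW lam0)//.
- exact: ltW.
- by rewrite invr_ge0 ltW// a_gt0.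
- exact: ltW.
Qed.

End decay.

Section decay_rate.
Context {R : realType}.
Local Notation mu1 := (@lebesgue_measure R).
Variables (n : nat) (a : R -> R).
Hypothesis n2 : (2 <= n)%N.
Hypothesis a_gt0 : forall x, 0 < x -> 0 < a x.
Hypothesis a_homo : forall x y, 0 < x -> x <= y -> a x <= a y.
Hypothesis a_quot : forall x y, 0 < x -> x <= y -> y / a y <= x / a x.
Hypothesis ik : forall S, 0 < S -> mu1.-integrable `]0, S[ (EFin \o young_kernel n a).

Let p : R := (n%:R - 1)^-1.
Let q : R := n%:R^-1.
Let n1 : (0 : R) < n%:R - 1. Proof. by rewrite subr_gt0 ltr1n. Qed.
Let n0 : (0 : R) < n%:R. Proof. by rewrite ltr0n ltnW. Qed.
Let pq : p * (1 - q) = q.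
Proof. by rewrite /p /q; field; rewrite !gt_eqF. Qed.
Let q1 : 0 < 1 - q.
Proof. by rewrite subr_gt0 invf_lt1// ltr1n. Qed.

Definition young_kernel_int (S : R) : R := \int[mu1]_(s in `]0, S[) young_kernel n a s.

Lemma young_kernel_int_ge (S : R) : 0 < S -> S * young_kernel n a S <= young_kernel_int S.
Proof.
move=> S0; have vS : mu1 `]0, S[%classic = S%:E.
  have := @lebesgue_measure_itv R `]0, S[; rewrite /= lte_fin S0 => H.
  by rewrite -[S in RHS]subr0; exact: H.
have -> : S * young_kernel n a S = \int[mu1]_(s in `]0, S[) young_kernel n a S.
  rewrite Rintegral_cst; last exact: measurable_itvR.
  by rewrite mulrC; congr (_ * _); exact: (esym (congr1 fine vS)).
apply: le_Rintegral.
- exact: measurable_itvR.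
- apply: (@integrableS _ _ _ mu1 `[0, S]%classic); try exact: measurable_itvR.
    by move=> s; rewrite /= !in_itv/= => /andP[/ltW -> /ltW ->].
  exact: (bounded_integrable_itv (f := cst (young_kernel n a S)) (M := `|young_kernel n a S|)).
- exact: ik.
move=> s; rewrite /= in_itv/= => /andP[s0 sS].
apply: ge0_ler_powR.
- by rewrite invr_ge0 ltW.
- by rewrite nnegrE ltW// divr_gt0// a_gt0.
- by rewrite nnegrE ltW// divr_gt0// a_gt0.
- exact: a_quot (ltW sS).
Qed.

Lemma young_kernel_int_gt0 (S : R) : 0 < S -> 0 < young_kernel_int S.
Proof.
move=> S0; apply: lt_le_trans (young_kernel_int_ge S0).
by rewrite mulr_gt0// powR_gt0// divr_gt0// a_gt0.
Qed.

Variables (m M : R -> R) (e : R -> R -> R) (c : R).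
Hypothesis c0 : 0 < c.
Hypothesis mM : forall t, 0 < t -> 0 <= m t <= M t.
Hypothesis e_ge0 : forall s t, 0 <= e s t.
Hypothesis step : forall t t' x, 0 < t -> t < t' -> 0 < x ->
  x ^+ n * m t <= c * (t' - t) ^+ n -> M t' * a x <= 2 * e t t'.
Hypothesis quantile : forall al be b, 0 < al -> al <= be -> m be <= b -> b <= m al ->
  exists t, [/\ al <= t, t <= be, m t <= b & b <= M t].
Hypothesis e_add : forall s t r, s <= t -> t <= r -> e s t + e t r <= e s r.

(* Apply the one-step bound between the levels at which the volume is [2 ^ k * M be];
   the resulting bounds add up like a geometric series. *)
Lemma decay_rate (al be S E : R) : 0 < al -> al <= be -> 0 < M be -> 0 < S -> 0 < E ->
  e al be <= E -> E <= M be * a S ->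
  Num.min 1 (c / 2) * (be - al) <=
  (2 + 2 `^ q / (2 `^ q - 1)) * (E `^ q * young_kernel_int S `^ (1 - q)).
Proof.
move=> al0 albe Mb S0 E0 eE ES; set I := young_kernel_int S.
have I0 : 0 < I by exact: young_kernel_int_gt0.
have aS0 : 0 < a S by exact: a_gt0.
pose lam := (I / E) `^ (1 - q); have lam0 : 0 < lam by rewrite powR_gt0// divr_gt0.
have be0 : 0 < be by exact: lt_le_trans albe.
have Slam : S / a S <= lam * M be `^ (1 - q).
  have IS := young_kernel_int_ge S0.
  apply: (@le_trans _ _ ((I / a S) `^ (1 - q))); last first.
    rewrite /lam -powRM ?divr_ge0 ?(ltW I0) ?(ltW E0) ?(ltW Mb)//.
    apply: ge0_ler_powR; rewrite ?nnegrE ?(ltW q1) ?mulr_ge0 ?invr_ge0 ?(ltW I0) ?(ltW aS0) ?(ltW E0) ?(ltW Mb)//.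
    by rewrite -mulrA ler_pM2l// [leRHS]mulrC ler_pdivlMr// [leLHS]mulrC ler_pdivrMr.
  apply: (@le_trans _ _ ((S * young_kernel n a S / a S) `^ (1 - q))); last first.
    apply: ge0_ler_powR; rewrite ?nnegrE ?(ltW q1) ?divr_ge0 ?mulr_ge0 ?powR_ge0 ?(ltW I0) ?(ltW aS0) ?(ltW S0)//.
    by rewrite ler_pM2r// invr_gt0.
  rewrite /young_kernel -/p; move: (a S) aS0 => Q Q0.
  rewrite -(lnK (_ : S \is Num.pos))// -(lnK (_ : Q \is Num.pos))//.
  move: (ln S) (ln Q) => X Y; rewrite -!expRN -!expRD !expR_powR -!expRD !expR_powR ler_expR.
  have -> : (1 - q) * (X + p * (X - Y) - Y) = (1 - q) * (X - Y) + (p * (1 - q)) * (X - Y) by ring.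
  by rewrite pq le_eqVlt; apply/orP; left; apply/eqP; ring.
have mbe : m be <= M be by have /andP[] := mM be0.
have := @decay_bound R n a n2 a_gt0 a_quot m M e c c0 e_ge0 step quantile e_add S lam S0 lam0 (ik S0)
  al be (M be) E al0 albe Mb mbe (lexx _) eE Slam.
move=> /le_trans; apply; rewrite -/I -/q -/p.
have E1 : lam * E = E `^ q * I `^ (1 - q).
  rewrite /lam -(lnK (_ : I \is Num.pos))// -(lnK (_ : E \is Num.pos))//.
  move: (ln I) (ln E) => X Y; rewrite -!expRN -!expRD !expR_powR -!expRD; congr expR; ring.
have E2 : lam `^ (- p) * I = E `^ q * I `^ (1 - q).
  rewrite /lam -(lnK (_ : I \is Num.pos))// -(lnK (_ : E \is Num.pos))//.
  move: (ln I) (ln E) => X Y; rewrite -!expRN -!expRD !expR_powR -!expRD; congr expR.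
  have -> : - p * ((1 - q) * (X - Y)) = - (p * (1 - q)) * (X - Y) by ring.
  by rewrite pq; ring.
by rewrite -/(young_kernel_int S) -/I -(mulrA 2) E1 E2 -mulrDl.
Qed.

End decay_rate.

(** * Sobolev conjugates *)

(** If [A] were infinite at some point, the integrand would vanish beyond it, against divergence at
    infinity. *)
Lemma young_fin {R : realType} (n : nat) (A : R -> \bar R) (t : R) : (2 <= n)%N -> young A ->
  diverges_at_infty n A -> 0 <= t -> (A t < +oo)%E.
Proof.
move=> n2 yA divA t0; rewrite ltey; apply/eqP => At.
pose s := Num.max t 1; have s0 : 0 < s by rewrite lt_max ltr01 orbT.
have := divA s s0; rewrite integral0_eq// => x; rewrite /= in_itv/= andbT => sx.
rewrite /sobolev_integrand (_ : A x = +oo%E).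
  by rewrite invey mule0 poweR0r// gt_eqF// invr_gt0 subr_gt0 ltr1n.
apply/eqP; rewrite -leye_eq -At; apply: young_homo => //.
by apply: le_trans (ltW sx); rewrite le_max lexx.
Qed.

Section sobolev_conjugate.
Context {R : realType}.
Local Notation mu1 := (@lebesgue_measure R).
Local Notation R1 := (measurableTypeR R).
Variables (n : nat) (A : R -> \bar R).
Hypothesis n2 : (2 <= n)%N.
Hypothesis yA : young A.
Hypothesis convA : converges_at_0 n A.
Hypothesis finA : forall t : R, 0 <= t -> (A t < +oo)%E.
Hypothesis divA : diverges_at_infty n A.

Let p : R := (n%:R - 1)^-1.
Let n1 : (0 : R) < n%:R - 1. Proof. by rewrite subr_gt0 ltr1n. Qed.
Let p0 : 0 < p. Proof. by rewrite invr_gt0. Qed.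
Let n0 : (0 : R) < n%:R. Proof. by rewrite ltr0n ltnW. Qed.

Lemma lebesgue_itvoo (x : R) : 0 < x -> mu1 `]0, x[%classic = x%:E.
Proof.
move=> x0; have := @lebesgue_measure_itv R `]0, x[; rewrite /= lte_fin x0 => H.
by rewrite -[x in RHS]subr0; exact: H.
Qed.

Lemma sobolev_integrand_noninc (s t : R) : 0 < s -> s <= t ->
  (sobolev_integrand n A t <= sobolev_integrand n A s)%E.
Proof.
move=> s0 st; have t0 : 0 < t by exact: lt_le_trans st.
have As := young_ge0 yA (ltW s0); have At := young_ge0 yA (ltW t0).
have q0 (r : R) : 0 < r -> (0 <= A r -> 0 <= r%:E / A r)%E.
  by move=> r0 Ar; rewrite mule_ge0 ?lee_fin ?(ltW r0)// inve_ge0.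
rewrite /sobolev_integrand; apply: gt0_ler_poweR; rewrite ?in_itv/= ?leey ?andbT ?q0 ?(ltW p0)//.
have sn : A s \is a fin_num by rewrite ge0_fin_numE// finA// ltW.
have tn : A t \is a fin_num by rewrite ge0_fin_numE// finA// ltW.
have st01 : 0 <= s / t <= 1 by rewrite divr_ge0 ?(ltW s0) ?(ltW t0)//= ler_pdivrMr// mul1r.
have := young_scale yA st01 (ltW t0); rewrite divfK ?gt_eqF//.
have hA := young_homo yA (ltW s0) st.
have [x Ex] : exists x, A s = x%:E by exists (fine (A s)); rewrite fineK.
have [y Ey] : exists y, A t = y%:E by exists (fine (A t)); rewrite fineK.
rewrite {}Ex {}Ey !lee_fin in As At hA *.
move: As At hA => x0 y0 xy h.
have [->|xn] := eqVneq x 0; first by rewrite inve0 gt0_muley ?lte_fin// leey.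
have xp : 0 < x by rewrite lt_neqAle eq_sym xn.
have yp : 0 < y by exact: lt_le_trans xy.
rewrite !inver !gt_eqF// -!EFinM lee_fin ler_pdivrMr// mulrAC ler_pdivlMr//.
by move: h; rewrite mulrAC ler_pdivlMr// mulrC.
Qed.

Lemma measurable_sobolev_integrand (i : interval R) : (forall x, x \in i -> 0 < x) ->
  measurable_fun ([set` i] : set R1) (sobolev_integrand n A).
Proof.
move=> i0; apply: (measurability _ (ErealGenOInfty.measurableE R)).
move=> _ [_ [c ->] <-]; apply: is_interval_measurable => x y.
move=> [xi /=]; rewrite in_itv/= andbT => kx [yi /=]; rewrite in_itv/= andbT => ky z /andP[xz zy].
have zi : z \in i by have := @interval_is_interval R i x y xi yi z; rewrite xz zy; apply.
split => //=; rewrite in_itv/= andbT; apply: lt_le_trans ky _.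
by apply: sobolev_integrand_noninc => //; exact: i0.
Qed.

(** If [A] vanished at some [t > 0], it would vanish on [[0, t]], where the integrand would be
    infinite, against convergence at zero. *)
Lemma young_pos (t : R) : 0 < t -> (0 < A t)%E.
Proof.
move=> t0; rewrite lt_neqAle young_ge0 ?(ltW t0)// andbT; apply/eqP => At.
have [a a0 Ia] := convA; pose s := Num.min t a; have s0 : 0 < s by rewrite lt_min t0.
have : (\int[mu1]_(x in `]0%R, s[) sobolev_integrand n A x < +oo)%E.
  apply: le_lt_trans Ia; apply: ge0_subset_integral; try exact: measurable_itvR.
  - by apply: measurable_sobolev_integrand => x; rewrite in_itv/= => /andP[].
  - by move=> x _; exact: poweR_ge0.
  - by move=> x; rewrite /= !in_itv/= => /andP[-> /lt_le_trans ->//]; rewrite ge_min lexx orbT.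
rewrite (eq_integral (fun=> +oo%E)); last first.
  move=> x; rewrite inE/= in_itv/= => /andP[x0 xs].
  rewrite /sobolev_integrand (_ : A x = 0%E) ?inve0 ?gt0_muley ?lte_fin// ?poweRyr ?gt_eqF//.
  apply/eqP; rewrite eq_le young_ge0 ?(ltW x0)// andbT [X in (_ <= X)%E]At.
  by apply: young_homo => //; [exact: ltW|rewrite (le_trans (ltW xs))// ge_min lexx].
rewrite integral_cst; last exact: measurable_itvR.
by rewrite [X in (_ * X)%E]lebesgue_itvoo// gt0_mulye// lte_fin.
Qed.

Definition young_fine (t : R) : R := fine (A t).
Local Notation a := young_fine.

Lemma young_fineE (t : R) : 0 <= t -> A t = (a t)%:E.
Proof.
by move=> t0; rewrite fineK// ge0_fin_numE ?finA//; exact: young_ge0.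
Qed.

Lemma young_fine_gt0 (t : R) : 0 < t -> 0 < a t.
Proof. by move=> t0; rewrite -lte_fin -young_fineE ?young_pos// ltW. Qed.

Lemma young_fine_quot (s t : R) : 0 < s -> s <= t -> t / a t <= s / a s.
Proof.
move=> s0 st; have t0 : 0 < t by exact: lt_le_trans st.
have st01 : 0 <= s / t <= 1 by rewrite divr_ge0 ?(ltW s0) ?(ltW t0)//= ler_pdivrMr// mul1r.
have := young_scale yA st01 (ltW t0).
rewrite divfK ?gt_eqF// young_fineE ?(ltW s0)// young_fineE ?(ltW t0)// -EFinM lee_fin.
move=> h; rewrite ler_pdivrMr ?young_fine_gt0// mulrAC ler_pdivlMr ?young_fine_gt0//.
by move: h; rewrite mulrAC ler_pdivlMr// mulrC.
Qed.

Lemma sobolev_integrandE (t : R) : 0 < t -> sobolev_integrand n A t = (young_kernel n a t)%:E.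
Proof.
move=> t0; rewrite /sobolev_integrand young_fineE ?(ltW t0)// inver gt_eqF ?young_fine_gt0//.
Qed.

Lemma young_kernel_noninc (s t : R) : 0 < s -> s <= t -> young_kernel n a t <= young_kernel n a s.
Proof.
move=> s0 st; have t0 : 0 < t by exact: lt_le_trans st.
apply: ge0_ler_powR.
- exact: ltW.
- by rewrite nnegrE ltW// divr_gt0// young_fine_gt0.
- by rewrite nnegrE ltW// divr_gt0// young_fine_gt0.
- exact: young_fine_quot.
Qed.

Lemma measurable_young_kernel (i : interval R) : (forall x, x \in i -> 0 < x) ->
  measurable_fun ([set` i] : set R1) (young_kernel n a).
Proof.
move=> i0; apply: (measurability _ (RGenOInfty.measurableE R)).
move=> _ [_ [c ->] <-]; apply: is_interval_measurable => x y.
move=> [xi /=]; rewrite in_itv/= andbT => kx [yi /=]; rewrite in_itv/= andbT => ky z /andP[xz zy].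
have zi : z \in i by have := @interval_is_interval R i x y xi yi z; rewrite xz zy; apply.
split => //=; rewrite in_itv/= andbT; apply: lt_le_trans ky _.
by apply: young_kernel_noninc => //; exact: i0.
Qed.

Lemma integrable_young_kernel (S : R) : 0 < S -> mu1.-integrable `]0, S[ (EFin \o young_kernel n a).
Proof.
move=> S0; have mk : measurable_fun (`]0, S[%classic : set R1) (young_kernel n a).
  by apply: measurable_young_kernel => x; rewrite in_itv/= => /andP[].
have k0 x : 0 <= young_kernel n a x by exact: powR_ge0.
have [b b0 Ib] := convA.
have ib : mu1.-integrable `]0, b[ (EFin \o young_kernel n a).
  apply/integrableP; split.
    by apply/measurable_EFinP; apply: measurable_young_kernel => x; rewrite in_itv/= => /andP[].
  apply: le_lt_trans Ib; rewrite le_eqVlt; apply/orP; left; apply/eqP.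
  apply: eq_integral => x; rewrite inE/= in_itv/= => /andP[x0 _].
  by rewrite sobolev_integrandE// ger0_norm.
have ib' := proj1 (integrable_mul_indic mu1 _ (measurable_itvR _)) ib.
apply: (@le_integrable _ _ _ mu1 `]0, S[%classic (measurable_itvR _) _
  (EFin \o (fun x => young_kernel n a x * \1_`]0, b[ x + young_kernel n a b))).
- exact/measurable_EFinP.
- move=> x; rewrite /= in_itv/= lee_fin => /andP[x0 xS].
  rewrite ger0_norm// ger0_norm; last by rewrite addr_ge0// mulr_ge0.
  have [xb|bx] := ltP x b.
    by rewrite indicE mem_set ?mulr1 ?lerDl//= in_itv/= x0.
  by rewrite ler_wpDl ?mulr_ge0//; exact: young_kernel_noninc.
apply: integrableD_fun; first exact: measurable_itvR.
  exact: (integrableS measurableT (measurable_itvR _) (@subsetT _ _) ib').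
apply: (@integrableS _ _ _ mu1 `[0, S]%classic); try exact: measurable_itvR.
  by move=> s; rewrite /= !in_itv/= => /andP[/ltW -> /ltW ->].
exact: (bounded_integrable_itv (f := cst (young_kernel n a b)) (M := `|young_kernel n a b|)).
Qed.

Lemma sobolev_HE (s : R) : 0 < s ->
  sobolev_H n A s = ((young_kernel_int n a s) `^ ((n%:R - 1) / n%:R))%:E.
Proof.
move=> s0; rewrite /sobolev_H -poweR_EFin; congr (_ `^ _)%E.
rewrite /young_kernel_int /Rintegral fineK; last first.
  exact: (integrable_fin_num (measurable_itvR _) (integrable_young_kernel s0)).
by apply: eq_integral => x; rewrite inE/= in_itv/= => /andP[x0 _]; exact: sobolev_integrandE.
Qed.

Lemma young_kernel_int_homo (s t : R) : 0 < s -> s <= t -> young_kernel_int n a s <= young_kernel_int n a t.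
Proof.
move=> s0 st; rewrite -lee_fin /young_kernel_int /Rintegral !fineK; last 2 first.
- apply: (integrable_fin_num (measurable_itvR _) (integrable_young_kernel _)).
  exact: lt_le_trans st.
- exact: (integrable_fin_num (measurable_itvR _) (integrable_young_kernel s0)).
apply: ge0_subset_integral; try exact: measurable_itvR.
- apply/measurable_EFinP; apply: measurable_young_kernel => x; by rewrite in_itv/= => /andP[].
- by move=> x _; rewrite lee_fin powR_ge0.
- by move=> x; rewrite /= !in_itv/= => /andP[-> /lt_le_trans ->].
Qed.

Lemma young_kernel_int_unbounded (T : R) : exists2 S : R, 0 < S & T <= young_kernel_int n a S.
Proof.
apply: contrapT => H.
have {}H (S : R) : 0 < S -> young_kernel_int n a S <= T.
  by move=> S0; rewrite leNgt; apply/negP => /ltW h; apply: H; exists S.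
pose F (i : nat) : set R1 := `]1, i%:R[%classic.
have F0 i x : F i x -> 0 < x by rewrite /F/= in_itv/= => /andP[/(lt_trans ltr01)].
have FU : \bigcup_i F i = `]1, +oo[%classic.
  apply/seteqP; split => x; rewrite /F/=.
    by move=> [i _]; rewrite /= !in_itv/= andbT => /andP[].
  rewrite in_itv/= andbT => x1; have [k _ hk] := nbhs_infty_gtr x.
  by exists k => //=; rewrite in_itv/= x1 hk/=.
have := @ge0_nondecreasing_set_cvg_integral _ _ R F (sobolev_integrand n A) mu1.
rewrite FU (divA ltr01) => /(_ _ _ _ _)/cvgeyPge H1.
have : \forall k \near \oo, ((T + 1)%:E <= \int[mu1]_(x in F k) sobolev_integrand n A x)%E.
  apply: H1.
  - move=> i j ij; apply/subsetPset => x; rewrite /F/= !in_itv/= => /andP[-> /lt_le_trans]; apply.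
    by rewrite ler_nat.
  - by move=> i; exact: measurable_itvR.
  - by move=> i; apply: measurable_sobolev_integrand => x; exact: F0.
  - by move=> i x _; exact: poweR_ge0.
move=> [N _ /(_ N.+1)/=]; rewrite leqnSn => /(_ isT).
have N0 : (0 : R) < N.+1%:R by [].
apply/negP; rewrite -ltNge; apply: (@le_lt_trans _ _ T%:E); last by rewrite lte_fin ltrDl.
apply: (@le_trans _ _ (young_kernel_int n a N.+1%:R)%:E); last by rewrite lee_fin H.
rewrite /young_kernel_int /Rintegral fineK; last first.
  exact: (integrable_fin_num (measurable_itvR _) (integrable_young_kernel N0)).
have -> : (\int[mu1]_(x in F N.+1) sobolev_integrand n A x =
    \int[mu1]_(x in F N.+1) (young_kernel n a x)%:E)%E.
  by apply: eq_integral => x; rewrite inE => /F0 x0; exact: sobolev_integrandE.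
apply: ge0_subset_integral; try exact: measurable_itvR.
- apply/measurable_EFinP; apply: measurable_young_kernel => x; by rewrite in_itv/= => /andP[].
- by move=> x _; rewrite lee_fin powR_ge0.
- by move=> x; rewrite /F/= !in_itv/= => /andP[/(lt_trans ltr01) -> ->].
Qed.

Lemma young_kernel_int_small (eps : R) : 0 < eps -> exists2 S : R, 0 < S & young_kernel_int n a S <= eps.
Proof.
move=> eps0.
have i1 := proj1 (integrable_mul_indic mu1 _ (measurable_itvR _)) (integrable_young_kernel ltr01).
have [d [d0 Hd]] := integral_normr_continuous i1 eps0.
pose S := Num.min 1 (d / 2); have S0 : 0 < S by rewrite lt_min ltr01 divr_gt0.
exists S => //; have := Hd `]0, S[%classic (measurable_itvR _).
rewrite [X in (X < _)%E]lebesgue_itvoo// lte_fin => /(_ _)/ltW H.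
apply: le_trans (H _); last by rewrite gt_min; apply/orP; right; lra.
rewrite le_eqVlt; apply/orP; left; apply/eqP; apply: eq_Rintegral => x.
rewrite inE/= in_itv/= => /andP[x0 xS].
rewrite indicE mem_set ?mulr1 ?ger0_norm ?powR_ge0//= in_itv/= x0/=.
by apply: lt_le_trans xS _; rewrite ge_min lexx.
Qed.

Local Notation N := (sobolev_conjugate n A).
Local Notation r := ((n%:R - 1) / n%:R : R).

Let r0 : 0 < r. Proof. by rewrite divr_gt0. Qed.

Let powRVK (x : R) : 0 <= x -> (x `^ r^-1) `^ r = x.
Proof. by move=> x0; rewrite -powRrM mulVf ?gt_eqF// powRr1. Qed.

Definition sobolev_h (s : R) : R := young_kernel_int n a s `^ r.

Lemma sobolev_H_le0 (s : R) : s <= 0 -> sobolev_H n A s = 0%E.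
Proof.
move=> s0; rewrite /sobolev_H set_itv_ge; last by rewrite bnd_simp -leNgt.
by rewrite integral_set0 poweR0r// gt_eqF.
Qed.

Lemma sobolev_Hinv_fin (t : R) : exists2 s : R, 0 <= s & sobolev_Hinv n A t = s%:E.
Proof.
have [S S0 IS] := young_kernel_int_unbounded (Num.max 0 t `^ r^-1).
have tS : t <= sobolev_h S.
  apply: (@le_trans _ _ (Num.max 0 t)); first by rewrite le_max lexx orbT.
  rewrite -[leLHS]powRVK ?le_max ?lexx//.
  by apply: ge0_ler_powR; rewrite ?nnegrE ?powR_ge0 ?(ltW r0)// Rintegral_ge0// => x _; exact: powR_ge0.
have h1 : (sobolev_Hinv n A t <= S%:E)%E.
  apply: ge_ereal_inf; exists S%:E => //; exists S => //; split; first exact: ltW.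
  by rewrite sobolev_HE// lee_fin.
have h0 : (0 <= sobolev_Hinv n A t)%E by apply/ereal_infP => _ [s [s0 _] <-]; rewrite lee_fin.
case: (sobolev_Hinv n A t) h1 h0 => [s| |]//; rewrite ?leye_eq//.
by move=> _; rewrite lee_fin => s0; exists s.
Qed.

Lemma sobolev_conjugateE (t : R) : exists s : R,
  [/\ 0 <= s, sobolev_Hinv n A t = s%:E & N t = A s].
Proof.
by have [s s0 Es] := sobolev_Hinv_fin t; exists s; split=> //; rewrite /sobolev_conjugate Es.
Qed.

Lemma sobolev_conjugate_fin (t : R) : (N t < +oo)%E.
Proof. by have [s [s0 _ ->]] := sobolev_conjugateE t; exact: finA. Qed.

Lemma sobolev_conjugate_ge0 (t : R) : (0 <= N t)%E.
Proof. by have [s [s0 _ ->]] := sobolev_conjugateE t; exact: young_ge0. Qed.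

Lemma sobolev_conjugate_homo (s t : R) : s <= t -> (N s <= N t)%E.
Proof.
move=> st; have [x [x0 Ex ->]] := sobolev_conjugateE s.
have [y [y0 Ey ->]] := sobolev_conjugateE t.
apply: young_homo => //; rewrite -lee_fin -Ex -Ey; apply: ereal_inf_le_tmp.
move=> _ [z [z0 zt] <-]; exists z => //; split => //.
by apply: le_trans zt; rewrite lee_fin.
Qed.

(** The reason why convergence of [N |w_k|] to 0 forces convergence of [w_k] to 0. It rests on the
    smallness of the kernel integral near zero. *)
Lemma sobolev_conjugate_gt0 (t : R) : 0 < t -> (0 < N t)%E.
Proof.
move=> t0; have [x [x0 Ex ->]] := sobolev_conjugateE t.
apply: young_pos; rewrite -lte_fin -Ex.
have t20 : 0 < t / 2 by rewrite divr_gt0.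
have [S S0 IS] := young_kernel_int_small (powR_gt0 r^-1 t20).
have hS : sobolev_h S < t.
  apply: (@le_lt_trans _ _ (t / 2)); last by rewrite ltr_pdivrMr// ltr_pMr// ltr1n.
  rewrite -[leRHS]powRVK ?(ltW t20)//.
  apply: ge0_ler_powR; rewrite ?nnegrE ?powR_ge0 ?(ltW r0)//.
  by apply: Rintegral_ge0 => z _; exact: powR_ge0.
apply: (@lt_le_trans _ _ S%:E); first by rewrite lte_fin.
apply/ereal_infP => _ [s [s0 ts] <-]; rewrite lee_fin leNgt; apply/negP => sS.
move: ts; apply/negP; rewrite -ltNge.
have [s0'|s0'] := leP s 0; first by rewrite sobolev_H_le0// lte_fin.
rewrite (sobolev_HE s0') lte_fin; refine (le_lt_trans _ hS); rewrite /sobolev_h.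
apply: ge0_ler_powR; rewrite ?nnegrE ?(ltW r0)//.
- by apply: Rintegral_ge0 => z _; exact: powR_ge0.
- by apply: Rintegral_ge0 => z _; exact: powR_ge0.
- exact: young_kernel_int_homo (ltW sS).
Qed.

(** The form in which a decay estimate is converted into a bound on [N]. If [E < m * N t], left
    continuity of [A] gives [S] below [s = Hinv t] with [E <= m * a S]; the hypothesis then puts
    [Hinv t] at most at [S], a contradiction. *)
Lemma sobolev_conjugate_le (t m E : R) : 0 <= m -> 0 < E ->
  (forall S : R, 0 < S -> E <= m * a S -> t <= sobolev_h S) -> (m%:E * N t <= E%:E)%E.
Proof.
move=> m0 E0 H; have [s [s0 Es Ns]] := sobolev_conjugateE t.
rewrite Ns young_fineE// -EFinM lee_fin leNgt; apply/negP => Em.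
have [s00|s00] := eqVneq s 0.
  move: Em; rewrite s00 /young_fine (young_0 yA)/= mulr0; by rewrite ltNge (ltW E0).
have sp : 0 < s by rewrite lt_neqAle eq_sym s00.
have mp : 0 < m.
  rewrite lt_neqAle m0 andbT; apply/eqP => m00; move: Em; rewrite -m00 mul0r.
  by rewrite ltNge (ltW E0).
have Ea : E / m < a s by rewrite ltr_pdivrMr// mulrC.
have := young_left_continuous yA sp; rewrite (young_fineE s0) => /fine_cvg ca.
have nS : \forall S \near s^'-, E / m < a S by exact: (cvgr_gt _ ca).
near s^'- => S.
have S0 : 0 < S by near: S; exact: nbhs_left_gt.
have Ss : S < s by near: S; exact: nbhs_left_lt.
have ES : E <= m * a S.
  by rewrite mulrC -ler_pdivrMr// ltW//; near: S.
have := H S S0 ES => tS.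
have : (sobolev_Hinv n A t <= S%:E)%E.
  apply: ge_ereal_inf; exists S%:E => //; exists S => //; split; first exact: ltW.
  by rewrite sobolev_HE// lee_fin.
by rewrite Es lee_fin leNgt Ss.
Unshelve. all: by end_near. Qed.

Lemma measurable_sobolev_conjugate : measurable_fun setT (fine \o N).
Proof.
apply: nondecreasing_measurable => // s t st.
apply: fine_le; rewrite ?ge0_fin_numE ?sobolev_conjugate_ge0 ?sobolev_conjugate_fin//.
exact: sobolev_conjugate_homo.
Qed.

End sobolev_conjugate.

(** * Modification of the Young function near the origin *)

Section regularization.
Context {R : realType} {n : nat}.
Local Notation V := 'rV[R]_n.
Local Notation mu := (@borel_lebesgue R n).
Local Notation mu1 := (@lebesgue_measure R).
Local Notation R1 := (measurableTypeR R).
Hypothesis n2 : (2 <= n)%N.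

Let n0 : (0 : R) < n%:R. Proof. by rewrite ltr0n ltnW. Qed.

Lemma half01 : 0 <= (2^-1 : R) <= 1.
Proof. lra. Qed.

Lemma measurable_sublevel (Phi : V -> \bar R) (tau : \bar R) : young_rV Phi ->
  measurable [set x | (Phi x <= tau)%E].
Proof.
move=> yP; rewrite (_ : [set x | _] = Phi @^-1` `]-oo, tau]%classic); last first.
  by apply/seteqP; split => x; rewrite /= in_itv.
rewrite -[X in measurable X]setTI; apply: (measurable_young_rV yP) => //.
exact: emeasurable_itv.
Qed.

(** The cube of half-side [s / n] lies in the ball of radius [s], since the square root of [n] is at
    most [n]; the ball lies in the sublevel set of [A]. *)
Lemma cube_volume_le_sublevel (Phi : V -> \bar R) (A : R -> \bar R) (tau s : R) : young_rV Phi ->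
  young_symmetral Phi A -> 0 <= tau -> 0 < s -> (A s <= tau%:E)%E ->
  (((2 * (s / n%:R)) ^+ n)%:E <= mu [set y | (Phi y <= tau%:E)%E])%E.
Proof.
move=> yP [yA AP] tau0 s0 As; have sn0 : 0 < s / n%:R by rewrite divr_gt0.
rewrite -(lebesgue_rVE (measurable_sublevel _ yP)) -AP// -(borel_lebesgue_cube n sn0).
have mC : measurable [set y : V | forall i, - (s / n%:R) <= y ord0 i <= s / n%:R].
  exact: measurable_rV_cube.
rewrite -(lebesgue_rVE mC); apply: le_outer_measure => y /= yi.
apply: le_trans As; apply: (young_homo yA (enorm_ge0 y)).
rewrite /enorm -[leRHS]gtr0_norm// -sqrtr_sqr ler_sqrt; last exact: sqr_ge0.
apply: (@le_trans _ _ (\sum_(i < n) (s / n%:R) ^+ 2)).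
  apply: ler_sum => i _; rewrite -(real_normK (num_real (y ord0 i))).
  apply: lerXn2r; rewrite ?nnegrE ?(ltW sn0)//; by rewrite ler_norml.
rewrite sumr_const card_ord -[leLHS]mulr_natl.
have -> : n%:R * (s / n%:R) ^+ 2 = s ^+ 2 / n%:R by field; rewrite gt_eqF.
by rewrite ler_pdivrMr// ler_peMr ?sqr_ge0// ler1n ltnW.
Qed.

(** For [s = 2 n rho] the sublevel set at height [A s] has at least the volume of a cube of
    half-side [2 rho], so it does not fit into the cube of half-side [rho]. *)
Lemma sublevel_unbounded (Phi : V -> \bar R) (A : R -> \bar R) (rho : R) : young_rV Phi ->
  young_symmetral Phi A -> (forall t, 0 <= t -> (A t < +oo)%E) -> 0 < rho ->
  exists z : V, (Phi z < +oo)%E /\ exists i, rho < `|z ord0 i|.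
Proof.
move=> yP AP Afin rho0; have [yA _] := AP.
pose s := n%:R * (2 * rho); have s0 : 0 < s by rewrite !mulr_gt0.
have As0 := young_ge0 yA (ltW s0).
pose tau := fine (A s); have As : A s = tau%:E.
  by rewrite fineK// ge0_fin_numE// Afin// ltW.
have tau0 : 0 <= tau by rewrite fine_ge0.
have H := @cube_volume_le_sublevel Phi A tau s yP AP tau0 s0.
rewrite As in H; have {}H := H (lexx _).
apply: contrapT => /forallNP Hz.
suff : (mu [set y | (Phi y <= tau%:E)%E] <= ((2 * rho) ^+ n)%:E)%E.
  move=> /(le_trans H); rewrite lee_fin leNgt => /negP; apply.
  have -> : 2 * (s / n%:R) = 2 * (2 * rho) by rewrite /s [_ * (2 * rho)]mulrC mulfK ?gt_eqF.
  have nn : (0 < n)%N by exact: ltnW.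
  rewrite ltrXn2r -?lt0n ?nn//=; lra.
rewrite -(borel_lebesgue_cube n rho0); apply: le_measure; rewrite ?inE.
- exact: measurable_sublevel.
- exact: measurable_rV_cube.
move=> y /= Py i; rewrite -ler_norml leNgt; apply/negP => yi.
by apply: (Hz y); split; [exact: le_lt_trans Py (ltry _)|exists i].
Qed.

(* Pick [z] far from 0 with [Phi z] finite: [x / 2] is a mean of [(x + z) / 2] and
   [(x - z) / 2], and [Phi1 = Phi] far from 0. *)
Lemma modification_le (Phi Phi1 : V -> \bar R) (A : R -> \bar R) (r : R) : young_rV Phi -> young_rV Phi1 ->
  young_symmetral Phi A -> (forall t, 0 <= t -> (A t < +oo)%E) ->
  (forall x, r < enorm x -> Phi1 x = Phi x) ->
  exists2 c : R, 0 <= c & forall x, (Phi1 (2^-1 *: x) <= c%:E + Phi x)%E.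
Proof.
move=> yP yP1 AP Afin Pr.
(* With [|z_i| > 3 |r|] and [|x_i| <= r], both points [(x + z) / 2] and [(x - z) / 2] have norm
   greater than [r], where [Phi1 = Phi]. *)
have [z [Pz [i zi]]] := sublevel_unbounded yP AP Afin (ltac:(rewrite ltr_pwDr// normr_ge0) : 0 < 3 * `|r| + 1).
have h01 : 0 <= (2^-1 : R) <= 1 by exact: half01.
have Pz0 := young_rV_ge0 yP z.
have Pzf : Phi z = (fine (Phi z))%:E by rewrite fineK// ge0_fin_numE.
exists (fine (Phi z)); first exact: fine_ge0.
move=> x; rewrite -Pzf.
have Px0 := young_rV_ge0 yP x.
have [rx|xr] := ltP r (enorm x).
  apply: le_trans (young_rV_scale _ yP1 h01) _; rewrite Pr//.
  by apply: le_trans (mule_le1 h01 Px0) _; rewrite leeDr.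
have r0 : 0 <= r by exact: le_trans (enorm_ge0 x) xr.
have xi : `|x ord0 i| <= r by exact: le_trans (coord_le_enorm _ _) xr.
have mid (s : bool) : (Phi1 (2^-1 *: (x + (-1) ^+ s *: z)) <= Phi z + Phi x)%E.
  have rs : r < enorm (2^-1 *: (x + (-1) ^+ s *: z)).
    apply: lt_le_trans (coord_le_enorm _ i); rewrite !mxE normrM gtr0_norm ?invr_gt0//.
    rewrite mulrC ltr_pdivlMr//.
    rewrite (ger0_norm r0) in zi.
    have : `|z ord0 i| <= `|x ord0 i + (-1) ^+ s * z ord0 i| + `|x ord0 i|.
      have -> : `|z ord0 i| = `|(-1) ^+ s * z ord0 i| by rewrite normrMsign.
      rewrite -{1}(addKr (x ord0 i) ((-1) ^+ s * z ord0 i)) addrC.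
      apply: le_trans (ler_normD _ _) _.
      by rewrite normrN.
    lra.
  rewrite Pr// scalerDr.
  have -> : 2^-1 *: ((-1) ^+ s *: z) = (1 - 2^-1) *: ((-1) ^+ s *: z).
    by congr (_ *: _); field.
  apply: le_trans (young_rV_convex yP _ _ h01) _.
  have -> : Phi ((-1) ^+ s *: z) = Phi z.
    by case: (s); rewrite ?expr0 ?expr1 ?scale1r// scaleN1r (young_rV_even yP).
  rewrite addeC; apply: leeD; apply: mule_le1 => //; lra.
have -> : 2^-1 *: x = 2^-1 *: (2^-1 *: (x + (-1) ^+ true *: z)) +
    (1 - 2^-1) *: (2^-1 *: (x + (-1) ^+ false *: z)).
  by apply/rowP => j; rewrite !mxE /= expr1 expr0; field.
apply: le_trans (young_rV_convex yP1 _ _ h01) _.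
have -> : (Phi z + Phi x = (2^-1 : R)%:E * (Phi z + Phi x) + (1 - 2^-1 : R)%:E * (Phi z + Phi x))%E.
  rewrite -ge0_muleDl ?lee_fin//; [|lra..].
  by rewrite -EFinD addrCA subrr addr0 mul1e.
by apply: leeD; apply: lee_wpmul2l; rewrite ?lee_fin//; lra.
Qed.

(** Compare volumes. Half of the sublevel set of [Phi] at height [A s] lies in the sublevel set of
    [Phi1], so the latter has at least the volume of a cube of half-side [s / (2 n)]. Were the claim
    false, it would have at most that of a cube of half-side [s / (4 n)]. *)
Lemma modification_symmetral_le (Phi Phi1 : V -> \bar R) (A A1 : R -> \bar R) (c : R) :
  young_rV Phi -> young_rV Phi1 -> young_symmetral Phi A -> young_symmetral Phi1 A1 ->
  (forall t, 0 <= t -> (A t < +oo)%E) -> 0 <= c ->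
  (forall x, (Phi1 (2^-1 *: x) <= c%:E + Phi x)%E) ->
  forall s : R, 0 < s -> (A1 (s / (4 * n%:R))%R <= c%:E + A s)%E.
Proof.
move=> yP yP1 AP AP1 Afin c0 cP s s0; have [yA _] := AP.
have As0 := young_ge0 yA (ltW s0).
pose sg := fine (A s); have As : A s = sg%:E by rewrite fineK// ge0_fin_numE// Afin// ltW.
have sg0 : 0 <= sg by rewrite fine_ge0.
rewrite As -EFinD leNgt; apply/negP => H1.
have s40 : 0 < s / (4 * n%:R) by rewrite divr_gt0// mulr_gt0.
have [tau [tau0 ctau tauA]] : exists tau : R, [/\ 0 < tau, c + sg <= tau & (tau%:E < A1 (s / (4 * n%:R))%R)%E].
  move: H1; case: (A1 _) => [y||]//; last by exists (c + sg + 1); split; rewrite ?ltry// ?lerDl// ltr_pwDr// addr_ge0.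
  rewrite lte_fin => H1; exists ((c + sg + y) / 2); rewrite lte_fin; split; [|lra..].
  have : 0 <= c + sg by rewrite addr_ge0.
  lra.
have U := sublevel_volume yP1 AP1 tau0 s40 tauA.
have Lw := @cube_volume_le_sublevel Phi A sg s yP AP sg0 s0; rewrite As in Lw; have {Lw} Lw := Lw (lexx _).
have S := borel_lebesgue_scale (ltac:(by rewrite invr_gt0) : (0 : R) < 2^-1) (@measurable_sublevel Phi sg%:E yP).
have := @le_measure _ _ _ mu [set x | (Phi ((2^-1)^-1 *: x) <= sg%:E)%E] [set y | (Phi1 y <= tau%:E)%E].
rewrite !inE => -/(_ _ (measurable_sublevel _ yP1)) H.
have {H} : (mu [set x | (Phi ((2^-1)^-1 *: x) <= sg%:E)%E] <= mu [set y | (Phi1 y <= tau%:E)%E])%E.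
  apply: H.
    have := measurable_scalerV ((2^-1)^-1) measurableT (measurable_sublevel sg%:E yP).
    by rewrite setTI.
  move=> x /= Px; have := cP (2 *: x); rewrite scalerA mulVf// scale1r => /le_trans; apply.
  rewrite invrK in Px; apply: (@le_trans _ _ (c + sg)%:E); last by rewrite lee_fin.
  by rewrite EFinD leeD2l.
have -> : mu [set x | (Phi ((2^-1)^-1 *: x) <= sg%:E)%E] = (((2^-1 : R) ^+ n)%:E * mu [set x | (Phi x <= sg%:E)%E])%E by [].
move=> /le_trans/(_ U) {S}.
have : (((2^-1 : R) ^+ n)%:E * ((2 * (s / n%:R)) ^+ n)%:E <= ((2^-1 : R) ^+ n)%:E * mu [set x | (Phi x <= sg%:E)%E])%E.
  by apply: lee_wpmul2l => //; rewrite lee_fin exprn_ge0// invr_ge0.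
move=> /le_trans H /H; rewrite -EFinM lee_fin -exprMn leNgt => /negP; apply.
have sn0 : 0 < s / n%:R by rewrite divr_gt0.
have -> : 2 * (s / (4 * n%:R)) = 2^-1 * (s / n%:R) by field; rewrite gt_eqF.
have nn : (0 < n)%N by exact: ltnW.
rewrite ltrXn2r -?lt0n ?nn//=; lra.
Qed.

Lemma integral_itvy_scale (k a : R) (h : R -> \bar R) : 0 < k -> 0 <= a ->
  measurable_fun (`]a, +oo[%classic : set R1) h -> (forall t, a < t -> (0 <= h t)%E) ->
  (\int[mu1]_(t in `]a, +oo[%classic) h t =
   k%:E * \int[mu1]_(t in `](a / k)%R, +oo[%classic) h (k * t)%R)%E.
Proof.
move=> k0 a0 mh h0.
have mf : measurable_fun setT (fun x : R1 => k * x : R1) by exact: measurable_funM.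
pose g := h \_ `]a, +oo[%classic.
have mg : measurable_fun setT g.
  by apply/(measurable_restrictT _ (measurable_itvR _)).
have g0 x : (0 <= g x)%E.
  rewrite /g patchE; case: ifPn => // /set_mem; rewrite /= in_itv/= andbT; exact: h0.
rewrite integral_mkcond -/g.
have -> : (\int[mu1]_(t in `](a / k)%R, +oo[%classic) h (k * t)%R = \int[mu1]_t g (k * t)%R)%E.
  rewrite integral_mkcond; apply: eq_integral => x _.
  rewrite /g !patchE; congr (if _ then _ else _).
  apply/idP/idP => /set_mem; rewrite /= in_itv/= andbT => H; apply/mem_set; rewrite /= in_itv/= andbT.
    by rewrite mulrC -ltr_pdivrMr.
  by rewrite ltr_pdivrMr// mulrC.
rewrite -[X in (_ * X)%E](ge0_integral_pushforward mf mu1 measurableT mg)//.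
rewrite -(ge0_integral_mscale _ _ (NngNum (ltW k0)))//.
apply: eq_measure_integral => B mB _; rewrite /pushforward /mscale/=.
have ki : 0 < k^-1 by rewrite invr_gt0.
have := lebesgue_measure_scale ki mB; rewrite invrK => H.
transitivity (k%:E * (k^-1%:E * mu1 B))%E; last by congr (_ * _)%E; exact: esym H.
by rewrite muleA -EFinM mulfV ?gt_eqF// mul1e.
Qed.

(** Beyond a point [b] where [A] is positive, the constant [c] is absorbed in a multiple of [A]. The
    integrand of [A1] then dominates a multiple of that of [A] at [k * t], and a dilation preserves
    divergence. *)
Lemma modification_diverges (A A1 : R -> \bar R) (c k : R) : young A -> young A1 ->
  diverges_at_infty n A -> 0 <= c -> 1 <= k ->
  (forall s : R, 0 < s -> (A1 (s / k)%R <= c%:E + A s)%E) -> diverges_at_infty n A1.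
Proof.
move=> yA yA1 divA c0 k1 cA a a0; have k0 : 0 < k by exact: lt_le_trans k1.
have [b [ab b0 Ab]] : exists b : R, [/\ a <= b, 0 < b & (0 < A b)%E].
  have [t t0 At] := young_nonconstant yA.
  exists (Num.max a t); split; rewrite ?lt_max ?le_max ?a0 ?lexx//.
  apply: (@lt_le_trans _ _ (A t)).
    by rewrite lt_neqAle eq_sym -{1}(young_0 yA) At (young_ge0 yA t0).
  by apply: young_homo => //; rewrite le_max lexx orbT.
have Afin (t : R) : 0 <= t -> (A t < +oo)%E by exact: (@young_fin R n A t n2 yA divA).
pose d := fine (A b); have d0 : 0 < d by rewrite fine_gt0// Ab Afin// ltW.
have Abd : A b = d%:E by rewrite fineK// ge0_fin_numE ?Afin ?(young_ge0 yA)// ltW.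
pose K := c / d + 1; have K0 : 0 < K by rewrite ltr_wpDl// divr_ge0// ltW.
have le1 t : b < t -> (A1 t <= K%:E * A (k * t)%R)%E.
  move=> bt; have t0 : 0 < t by exact: lt_trans bt.
  have := cA (k * t) (mulr_gt0 k0 t0); rewrite [(k * t) / k]mulrC mulKf ?gt_eqF// => /le_trans; apply.
  have Akt := young_ge0 yA (ltW (mulr_gt0 k0 t0)).
  rewrite /K EFinD ge0_muleDl ?lee_fin ?divr_ge0 ?(ltW d0)// mul1e leeD2r//.
  apply: (@le_trans _ _ ((c / d)%:E * A b)%E).
    by rewrite Abd -EFinM divfK// gt_eqF.
  apply: lee_wpmul2l; first by rewrite lee_fin divr_ge0// ltW.
  apply: young_homo => //; first exact: ltW.
  by apply: le_trans (ltW bt) _; rewrite ler_peMl// ltW.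
pose p := (n%:R - 1 : R)^-1.
have n1 : (0 : R) < n%:R - 1 by rewrite subr_gt0 ltr1n.
have p0 : 0 < p by rewrite invr_gt0.
have si0 B (t : R) : (0 <= sobolev_integrand n B t)%E by exact: poweR_ge0.
pose C := ((k * K)^-1) `^ p.
have C0 : 0 < C by rewrite powR_gt0// invr_gt0 mulr_gt0.
have le2 t : b < t -> (C%:E * sobolev_integrand n A (k * t)%R <= sobolev_integrand n A1 t)%E.
  move=> bt; have t0 : 0 < t by exact: lt_trans bt.
  have kt0 := mulr_gt0 k0 t0.
  have Af := Afin _ (ltW kt0).
  have Ag0 : (0 < A (k * t)%R)%E.
    apply: lt_le_trans Ab _; apply: young_homo => //; first exact: ltW.
    by apply: le_trans (ltW bt) _; rewrite ler_peMl// ltW.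
  pose y := fine (A (k * t)); have y0 : 0 < y by rewrite fine_gt0// Ag0.
  have Ay : A (k * t) = y%:E by rewrite fineK// ge0_fin_numE// ltW.
  have H1 := le1 t bt; rewrite Ay -EFinM in H1.
  have H0 := young_ge0 yA1 (ltW t0).
  pose z := fine (A1 t).
  have Az : A1 t = z%:E by rewrite fineK// ge0_fin_numE// (le_lt_trans H1 (ltry _)).
  have z0 : 0 <= z by rewrite fine_ge0.
  rewrite /sobolev_integrand Ay Az; rewrite Az lee_fin in H1.
  have [z00|z00] := eqVneq z 0.
    by rewrite z00 (inver 0) eqxx gt0_muley ?lte_fin// poweRyr ?leey// gt_eqF.
  have zp : 0 < z by rewrite lt_neqAle eq_sym z00.
  have qE (v w : R) : 0 < w -> (v%:E / w%:E = (v / w)%:E)%E by move=> w0; rewrite inver gt_eqF.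
  rewrite !qE// !poweR_EFin -/p /C -EFinM lee_fin -powRM; last 2 first.
    by rewrite invr_ge0 mulr_ge0// ltW.
    by rewrite divr_ge0// ltW.
  apply: ge0_ler_powR; rewrite ?nnegrE ?(ltW p0)//.
  - by rewrite ltW// mulr_gt0 ?invr_gt0 ?mulr_gt0 ?invr_gt0.
  - by rewrite divr_ge0// ltW.
  have -> : (k * K)^-1 * (k * t / y) = t / (K * y) by field; rewrite !gt_eqF.
  by rewrite ler_pM2l// lef_pV2 ?posrE// mulr_gt0.
have ba (t : R) : b / k < t -> 0 < t by apply: le_lt_trans; rewrite divr_ge0// ltW.
have fin1 (t : R) : 0 <= t -> (A1 t < +oo)%E.
  move=> t0; have bt : b < Num.max t b + 1 by rewrite (@le_lt_trans _ _ (Num.max t b))// ?le_max ?lexx ?orbT// ltrDl.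
  have u0 : 0 < Num.max t b + 1 by exact: lt_trans bt.
  apply: (@le_lt_trans _ _ (A1 (Num.max t b + 1)%R)).
    by apply: young_homo => //; rewrite ler_wpDr// le_max lexx.
  apply: le_lt_trans (le1 _ bt) _; rewrite lte_mul_pinfty//.
  - by rewrite lee_fin ltW.
  - by apply: Afin; rewrite ltW// mulr_gt0.
have mI B (fB : forall t : R, 0 <= t -> (B t < +oo)%E) (yB : young B) (x : R) : 0 < x ->
    measurable_fun (`]x, +oo[%classic : set R1) (sobolev_integrand n B).
  move=> x0; apply: (measurable_sobolev_integrand n2 yB fB) => y; rewrite in_itv/= andbT.
  exact: lt_trans.
apply/eqP; rewrite -leye_eq.
apply: (@le_trans _ _ (\int[mu1]_(t in `]b, +oo[%classic) sobolev_integrand n A1 t)%E); last first.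
  apply: ge0_subset_integral => //.
  - exact: mI.
  - by move=> t; rewrite /= !in_itv/= !andbT; exact: le_lt_trans.
have mk : measurable_fun (`]b, +oo[%classic : set R1) (fun t : R => sobolev_integrand n A (k * t)).
  apply: (@measurable_comp _ _ _ R1 R1 _ (`](k * b)%R, +oo[%classic) (sobolev_integrand n A) _ ( *%R k)).
  - exact: measurable_itvR.
  - by move=> _ [t + <-]; rewrite /= !in_itv/= !andbT ltr_pM2l.
  - by apply: mI => //; rewrite mulr_gt0.
  - exact: measurable_funM.
apply: (@le_trans _ _ (\int[mu1]_(t in `]b, +oo[%classic) (C%:E * sobolev_integrand n A (k * t)%R))%E); last first.
  apply: ge0_le_integral => //.
  - by move=> t _; rewrite mule_ge0// lee_fin ltW.
  - exact: measurable_funeM.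
  - exact: mI.
  - by move=> t; rewrite /= in_itv/= andbT; exact: le2.
rewrite ge0_integralZl ?lee_fin ?(ltW C0)//.
have := @integral_itvy_scale k (k * b) (sobolev_integrand n A) k0 (mulr_ge0 (ltW k0) (ltW b0)).
rewrite [(k * b) / k]mulrC mulKf ?gt_eqF// divA ?mulr_gt0// => H.
have {}H := H (mI _ Afin yA _ (mulr_gt0 k0 b0)) (fun t _ => si0 A t).
have : (\int[mu1]_(t in `]b, +oo[%classic) sobolev_integrand n A (k * t)%R = +oo)%E.
  apply/eqP; apply: contrapT => /negP I.
  have If : (\int[mu1]_(t in `]b, +oo[%classic) sobolev_integrand n A (k * t)%R)%E \is a fin_num.
    by rewrite ge0_fin_numE ?integral_ge0// ltey.
  by move: H; rewrite -(fineK If) -EFinM.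
by move=> ->; rewrite gt0_muley ?leey// lte_fin.
Qed.

(** The constant vanishes when the integral converges at zero, since then [Phi1 = Phi]. This is what
    allows [Omega] of infinite measure in that case. *)
Lemma regular_at_0_modification (Phi Phi1 : V -> \bar R) (A A1 : R -> \bar R) : young_rV Phi ->
  young_symmetral Phi A -> diverges_at_infty n A -> regular_at_0 Phi A Phi1 A1 ->
  diverges_at_infty n A1 /\
  exists2 c : R, 0 <= c & (forall x, (Phi1 (2^-1 *: x) <= c%:E + Phi x)%E) /\ (converges_at_0 n A -> c = 0).
Proof.
move=> yP AP divA [yP1 AP1 conv1 [r Pr] P1P]; have [yA _] := AP; have [yA1 _] := AP1.
have finA (t : R) : 0 <= t -> (A t < +oo)%E by exact: (@young_fin R n A t n2 yA divA).
have [c c0 cP] := modification_le yP yP1 AP finA Pr.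
split.
  apply: (modification_diverges yA yA1 divA c0 _ (modification_symmetral_le yP yP1 AP AP1 finA c0 cP)).
  have : 1 <= n%:R :> R by rewrite ler1n ltnW.
  lra.
have [cv|ncv] := pselect (converges_at_0 n A).
  exists 0 => //; split => // x; rewrite add0e P1P//.
  have h01 : 0 <= (2^-1 : R) <= 1 by exact: half01.
  by apply: le_trans (young_rV_scale _ yP h01) (mule_le1 h01 (young_rV_ge0 yP x)).
by exists c.
Qed.

End regularization.

(** * The Orlicz-Sobolev inequality in modular form *)

Section quantile.
Context {R : realType} {n : nat}.
Local Notation V := 'rV[R]_n.
Local Notation mu := (@borel_lebesgue R n).
Variable u : V -> R.
Hypothesis mu_ : measurable_fun setT u.
Hypothesis ufin : forall t : R, 0 < t -> (mu [set x | (t < u x)%R] < +oo)%E.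

Definition gt_volume (t : R) : R := fine (mu [set x | (t < u x)%R]).
Definition ge_volume (t : R) : R := fine (mu [set x | (t <= u x)%R]).

Lemma ge_volume_lty (t : R) : 0 < t -> (mu [set x | (t <= u x)%R] < +oo)%E.
Proof.
move=> t0; apply: (@le_lt_trans _ _ (mu [set x | (t / 2 < u x)%R])); last by apply: ufin; rewrite divr_gt0.
apply: le_measure; rewrite ?inE; [exact: measurable_ge|exact: measurable_gt|].
by move=> x /=; apply: lt_le_trans; lra.
Qed.

Lemma gt_volumeE (t : R) : 0 < t -> mu [set x | (t < u x)%R] = (gt_volume t)%:E.
Proof. by move=> t0; rewrite fineK// ge0_fin_numE ?measure_ge0// ufin. Qed.

Lemma ge_volumeE (t : R) : 0 < t -> mu [set x | (t <= u x)%R] = (ge_volume t)%:E.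
Proof. by move=> t0; rewrite fineK// ge0_fin_numE ?measure_ge0// ge_volume_lty. Qed.

Lemma gt_volume_le_ge (t : R) : 0 < t -> 0 <= gt_volume t <= ge_volume t.
Proof.
move=> t0; rewrite fine_ge0 ?measure_ge0//= -lee_fin -gt_volumeE// -ge_volumeE//.
apply: le_measure; rewrite ?inE; [exact: measurable_gt|exact: measurable_ge|].
by move=> x /=; exact: ltW.
Qed.

Lemma gt_volume_noninc (s t : R) : 0 < s -> s <= t -> gt_volume t <= gt_volume s.
Proof.
move=> s0 st; rewrite -lee_fin -!gt_volumeE//; last exact: lt_le_trans st.
apply: le_measure; rewrite ?inE; [exact: measurable_gt|exact: measurable_gt|].
by move=> x /=; exact: le_lt_trans.
Qed.

Lemma gt_volume_right (t b : R) : 0 < t -> (forall s, t < s -> gt_volume s <= b) -> gt_volume t <= b.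
Proof.
move=> t0 H; rewrite -lee_fin -gt_volumeE//.
pose F k := [set x | (t + k.+1%:R^-1 < u x)%R].
have -> : [set x | (t < u x)%R] = \bigcup_k F k.
  apply/seteqP; split => x /=; last by move=> [k _]; rewrite /F/=; apply: lt_trans; rewrite ltrDl.
  move=> tu; exists (Num.truncn (u x - t)^-1) => //; rewrite /F/= -ltrBrDl.
  have ut : 0 < u x - t by rewrite subr_gt0.
  by rewrite invf_plt ?posrE//; exact: truncnS_gt.
have mF k : measurable (F k) by exact: measurable_gt.
have c : mu (F k) @[k --> \oo] --> mu (\bigcup_k F k).
  apply: nondecreasing_cvg_mu => //; first exact: bigcupT_measurable.
  move=> i j ij; apply/subsetPset => x; rewrite /F/=; apply: le_lt_trans.
  by rewrite lerD2l lef_pV2 ?posrE// ler_nat.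
rewrite -(cvg_lim _ c)//; apply: lime_le; first by apply/cvg_ex; exists (mu (\bigcup_k F k)).
apply: nearW => k; rewrite /F gt_volumeE ?lee_fin; last by rewrite addr_gt0.
by apply: H; rewrite ltrDl.
Qed.

Lemma ge_volume_left (s0 t b : R) : 0 < s0 -> s0 < t -> (forall s, s0 <= s -> s < t -> b <= gt_volume s) -> b <= ge_volume t.
Proof.
move=> s00 st H; have t0 : 0 < t by exact: lt_trans st.
rewrite -lee_fin -ge_volumeE//.
pose e (k : nat) : R := t - (t - s0) / k.+1%:R.
have ts0 : 0 < t - s0 by rewrite subr_gt0.
have es k : s0 <= e k by rewrite /e lerBrDr addrC -lerBrDr ler_pdivrMr// ler_peMr ?(ltW ts0)// ler1n.
have et k : e k < t by rewrite /e ltrBlDr ltrDl divr_gt0.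
pose F k := [set x | (e k < u x)%R].
have -> : [set x | (t <= u x)%R] = \bigcap_k F k.
  apply/seteqP; split => x /=; first by move=> tu k _; rewrite /F/=; exact: lt_le_trans tu.
  move=> Fx; rewrite leNgt; apply/negP => ut.
  have := Fx (Num.truncn ((t - s0) / (t - u x))) I; rewrite /F/= /e; apply/negP; rewrite -leNgt.
  have tu0 : 0 < t - u x by rewrite subr_gt0.
  rewrite lerBrDr addrC -lerBrDr ler_pdivrMr// mulrC -ler_pdivrMr//; exact/ltW/truncnS_gt.
have mF k : measurable (F k) by exact: measurable_gt.
have c : mu (F k) @[k --> \oo] --> mu (\bigcap_k F k).
  apply: nonincreasing_cvg_mu => //; first by apply: ufin; exact: lt_le_trans (es 0%N).
    exact: bigcapT_measurable.
  move=> i j ij; apply/subsetPset => x; rewrite /F/=; apply: le_lt_trans.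
  by rewrite lerD2l lerN2 ler_pM2l// lef_pV2 ?posrE// ler_nat.
rewrite -(cvg_lim _ c)//; apply: lime_ge; first by apply/cvg_ex; exists (mu (\bigcap_k F k)).
apply: nearW => k; rewrite /F gt_volumeE ?lee_fin; last exact: lt_le_trans (es k).
exact: H.
Qed.

(** Take the infimum of the levels where the volume has dropped to [b]. The strict volume is right
    continuous, and the volume of [{u >= t}] is the limit of the strict ones from the left; a
    plateau of [u] is thus caught between the two. *)
Lemma volume_quantile (al be b : R) : 0 < al -> al <= be -> gt_volume be <= b -> b <= gt_volume al ->
  exists t, [/\ al <= t, t <= be, gt_volume t <= b & b <= ge_volume t].
Proof.
move=> al0 albe mb ma; pose S := [set s : R | al <= s /\ gt_volume s <= b].
have S0 : S !=set0 by exists be.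
have lS : lbound S al by move=> s [].
have hS : has_inf S by split=> //; exists al.
pose t := inf S.
have at_ : al <= t by exact: lb_le_inf.
have tb : t <= be by apply: ge_inf; [exists al|].
have t0 : 0 < t by exact: lt_le_trans at_.
exists t; split => //.
  apply: gt_volume_right => // s ts.
  have [z [az zb] zs] := inf_lt S0 ts.
  by apply: le_trans zb; apply: gt_volume_noninc; rewrite ?(ltW zs)//; exact: lt_le_trans az.
have [->|neq] := eqVneq t al.
  by apply: le_trans ma _; have /andP[] := gt_volume_le_ge al0.
apply: (@ge_volume_left al) => //; first by rewrite lt_neqAle eq_sym neq.
move=> s as_ st; rewrite leNgt; apply/negP => /ltW H.
by move: st; rewrite ltNge => /negP; apply; apply: ge_inf; [exists al|].
Qed.

End quantile.

(** * From single bands of levels to the whole space *)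

Section embedding.
Context {R : realType} {n : nat}.
Local Notation V := 'rV[R]_n.
Local Notation mu := (@borel_lebesgue R n).
Local Notation mu1 := (@lebesgue_measure R).
Local Notation R1 := (measurableTypeR R).
Variables (Phi : V -> \bar R) (A : R -> \bar R).
Hypothesis n2 : (2 <= n)%N.
Hypothesis yP : young_rV Phi.
Hypothesis AP : young_symmetral Phi A.
Hypothesis convA : converges_at_0 n A.
Hypothesis divA : diverges_at_infty n A.

Let yA : young A. Proof. by case: AP. Qed.
Let finA (t : R) : 0 <= t -> (A t < +oo)%E.
Proof. by exact: (@young_fin R n A t n2 yA divA). Qed.
Let a := young_fine A.
Local Notation N := (sobolev_conjugate n A).
Let N_ge0 (t : R) : (0 <= N t)%E.
Proof. exact: (sobolev_conjugate_ge0 n2 yA convA finA divA). Qed.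
Let N_homo (s t : R) : s <= t -> (N s <= N t)%E.
Proof. exact: (sobolev_conjugate_homo n2 yA convA finA divA). Qed.
Let N_fin (t : R) : (N t < +oo)%E.
Proof. exact: (sobolev_conjugate_fin n2 yA convA finA divA). Qed.

Lemma band_energy_le (u : V -> R) G (s t : R) : bweak u G ->
  (band_energy Phi u G s t <= \int[mu]_x Phi (G x))%E.
Proof.
move=> [[mu_ _] lG _]; apply: ge0_subset_integral => //.
- exact: measurable_band.
- exact: measurableT_comp (measurable_young_rV yP) (measurable_gradient lG).
- by move=> x _; exact: young_rV_ge0.
Qed.

(* The decay rate between [be / 2] and [be] bounds [kappa * be] by [sobolev_H] of the
   quotient energy over volume, once the energy of the band is small. *)
Lemma level_energy (kappa : R) : 0 < kappa -> exists2 eta : R, 0 < eta & forall (u : V -> R) G, bweak u G ->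
  (forall t : R, 0 < t -> (mu [set x | (t < u x)%R] < +oo)%E) ->
  (\int[mu]_x Phi (G x) < +oo)%E -> forall be : R, 0 < be ->
  (band_energy Phi u G (be / 2)%R be <= eta%:E)%E ->
  (mu [set x | (be <= u x)%R] * N (kappa * be)%R <= band_energy Phi u G (be / 2)%R be)%E.
Proof.
move=> k0; have [c c0 Hc] := @one_step R n.
pose q : R := n%:R^-1; have q0 : 0 < q by rewrite invr_gt0 ltr0n ltnW.
have r_q : (n%:R - 1) / n%:R = 1 - q :> R by rewrite mulrBl mulfV ?mul1r// gt_eqF// ltr0n ltnW.
pose c2 := Num.min 1 (c / 2); have c20 : 0 < c2 by rewrite lt_min ltr01 divr_gt0.
pose K : R := 2 + 2 `^ q / (2 `^ q - 1).
have K0 : 0 < K.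
  rewrite ltr_pwDl// divr_ge0 ?powR_ge0// subr_ge0.
  have := @ge0_ler_powR R q (ltW q0) 1 2; rewrite !nnegrE powR1; apply; lra.
pose eta := (c2 / (2 * K * kappa)) `^ q^-1.
have z0 : 0 < c2 / (2 * K * kappa) by rewrite divr_gt0// !mulr_gt0.
have eta0 : 0 < eta by rewrite powR_gt0.
have etaq : eta `^ q = c2 / (2 * K * kappa).
  by rewrite /eta -powRrM mulVf ?gt_eqF// powRr1// ltW.
exists eta => // u G wu ufin Ifin be be0 ele.
have [lu lG _] := wu; have [mu_ _] := lu.
have mG : measurable_fun setT (fun x => Phi (G x)).
  exact: measurableT_comp (measurable_young_rV yP) (measurable_gradient lG).
pose e (s t : R) : R := fine (band_energy Phi u G s t).
have be_ge0 s t : (0 <= band_energy Phi u G s t)%E by apply: integral_ge0 => x _; exact: young_rV_ge0.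
have eE s t : band_energy Phi u G s t = (e s t)%:E.
  rewrite fineK// ge0_fin_numE//; apply: le_lt_trans Ifin; exact: band_energy_le.
have e_ge0 s t : 0 <= e s t by exact: fine_ge0.
have e_add s t r : s <= t -> t <= r -> e s t + e t r <= e s r.
  move=> st tr; rewrite -lee_fin EFinD -!eE /band_energy -ge0_integral_setU//.
  - apply: ge0_subset_integral => //.
    + by apply: measurableU; exact: measurable_band.
    + exact: measurable_band.
    + exact: measurable_funTS.
    + by move=> x _; exact: young_rV_ge0.
    + by move=> x /= [] /andP[h1 h2]; apply/andP; split; lra.
  - exact: measurable_band.
  - exact: measurable_band.
  - exact: measurable_funTS.
  - by move=> x _; exact: young_rV_ge0.
  - by apply/disj_setPLR => x /= /andP[h1 h2] /andP[h3 h4]; lra.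
pose m := gt_volume u; pose M := ge_volume u.
have step t t' x : 0 < t -> t < t' -> 0 < x -> x ^+ n * m t <= c * (t' - t) ^+ n -> M t' * a x <= 2 * e t t'.
  move=> t0 tt' x0 H; have t'0 : 0 < t' by exact: lt_trans tt'.
  have H' : ((x ^+ n)%:E * mu [set z | (t < u z)%R] <= (c * (t' - t) ^+ n)%:E)%E.
    by rewrite gt_volumeE// -EFinM lee_fin.
  have M0 : 0 <= M t' by exact: fine_ge0.
  have ax : 0 < a x by exact: (young_fine_gt0 n2 yA convA finA).
  (* [one_step] is stated for [tau] strictly below [A x]. The value [a x] is reached by
     approximating it from below. *)
  have tauP tau : 0 < tau -> tau < a x -> M t' * tau <= 2 * e t t'.
    move=> tau0 tx; have Ax : (tau%:E < A x)%E by rewrite (young_fineE yA finA (ltW x0)) lte_fin.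
    have := Hc Phi A u G yP AP wu t t' x tau tt' x0 tau0 Ax H'.
    by rewrite (ge_volumeE mu_ ufin t'0) eE -!EFinM lee_fin.
  have [->|Mn] := eqVneq (M t') 0; first by rewrite mul0r mulr_ge0.
  have Mp : 0 < M t' by rewrite lt_neqAle eq_sym Mn.
  rewrite leNgt; apply/negP => L.
  pose tau := Num.max (a x / 2) (2 * e t t' / M t' / 2 + a x / 2).
  have L' : 2 * e t t' / M t' < a x by rewrite ltr_pdivrMr// [a x * _]mulrC.
  have := tauP tau; rewrite /tau lt_max divr_gt0//= gt_max.
  have -> : a x / 2 < a x by lra.
  have -> : 2 * e t t' / M t' / 2 + a x / 2 < a x by lra.
  move=> /(_ isT isT); apply/negP.
  rewrite -ltNge [M t' * _]mulrC -ltr_pdivrMr// lt_max; apply/orP; right; lra.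
pose eb := e (be / 2) be.
rewrite eE in ele *; rewrite lee_fin -/eb in ele.
rewrite (ge_volumeE mu_ ufin be0) -/eb.
apply/lee_addgt0Pr => eps eps0.
(* The band energy may be zero, while [decay_rate] and [sobolev_conjugate_le] need a positive bound;
   [eps] is removed at the end. *)
pose E := Num.min (eb + eps) eta.
have E0 : 0 < E by rewrite lt_min eta0 andbT ltr_wpDl// e_ge0.
have EE : E <= eb + eps by rewrite ge_min lexx.
have Eeta : E <= eta by rewrite ge_min lexx orbT.
have ebE : eb <= E by rewrite le_min ele andbT lerDl ltW.
apply: (@le_trans _ _ E%:E); last by rewrite -EFinD lee_fin.
have M0 : 0 <= M be by exact: fine_ge0.
apply: (sobolev_conjugate_le n2 yA convA finA divA M0 E0) => S S0 ES.
have Mb : 0 < M be.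
  rewrite lt_neqAle M0 andbT; apply/eqP => Mb; move: ES; rewrite -Mb mul0r.
  by rewrite leNgt E0.
have b20 : 0 < be / 2 by rewrite divr_gt0.
have D := decay_rate n2 (fun x => @young_fine_gt0 _ _ _ n2 yA convA finA x)
  (fun x y => @young_fine_quot _ _ _ n2 yA convA finA x y)
  (fun S => @integrable_young_kernel _ _ _ n2 yA convA finA S) c0
  (gt_volume_le_ge mu_ ufin) e_ge0 step (volume_quantile mu_ ufin) e_add b20
  (ltac:(lra) : be / 2 <= be) Mb S0 E0 ebE ES.
move: D; rewrite -/q -/K -/c2 /sobolev_h r_q; set J := _ `^ (1 - q) => D.
have J0 : 0 <= J by exact: powR_ge0.
have D2 : K * (E `^ q * J) <= K * (c2 / (2 * K * kappa) * J).
  rewrite ler_pM2l// ler_wpM2r// -etaq; apply: ge0_ler_powR; rewrite ?nnegrE ?(ltW E0) ?(ltW eta0) ?(ltW q0)//.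
have := le_trans D D2.
have -> : K * (c2 / (2 * K * kappa) * J) = c2 * (J / kappa / 2) by field; rewrite !gt_eqF.
rewrite ler_pM2l// => L.
by rewrite mulrC -ler_pdivlMr//; lra.
Qed.

Lemma sobolev_conjugate0 : N 0 = 0%E.
Proof.
apply/eqP; rewrite eq_le N_ge0 andbT; apply/lee_addgt0Pr => eps eps0; rewrite add0e.
have := @sobolev_conjugate_le R n A n2 yA convA finA divA 0 1 eps ler01 eps0.
by rewrite mul1e; apply=> S _ _; exact: powR_ge0.
Qed.

Lemma sobolev_conjugate_fineE (t : R) : N t = (fine (N t))%:E.
Proof. by rewrite fineK// ge0_fin_numE. Qed.

Lemma measurable_sobolev_conjugate_comp (u : V -> R) : measurable_fun setT u ->
  measurable_fun setT (fun x => N (u x)).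
Proof.
move=> mu_; rewrite (_ : (fun x => N (u x)) = EFin \o ((fine \o N) \o u)).
  apply/measurable_EFinP; apply: measurableT_comp mu_.
  exact: (measurable_sobolev_conjugate n2 yA convA finA divA).
by apply/funext => x /=; exact: sobolev_conjugate_fineE.
Qed.

Lemma ge0_integral_setU_le (f : V -> \bar R) (C D : set V) : measurable C -> measurable D ->
  measurable_fun setT f -> (forall x, 0 <= f x)%E ->
  (\int[mu]_(x in C `|` D) f x <= \int[mu]_(x in C) f x + \int[mu]_(x in D) f x)%E.
Proof.
move=> mC mD mf f0; have -> : C `|` D = C `|` (D `\` C).
  apply/seteqP; split => x; last by case=> [|[]]; [left|right].
  by case=> [|Dx]; [left|have [|] := pselect (C x); [left|right]].
rewrite ge0_integral_setU//; last 3 first.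
- exact: measurableD.
- exact: measurable_funTS.
- by apply/disj_setPS => x [Cx []].
by apply: leeD2l; apply: ge0_subset_integral => //; [exact: measurableD|exact: measurable_funTS].
Qed.

Section bands.
Variables (kappa eta : R).
Hypothesis k0 : 0 < kappa.
Hypothesis level : forall (u : V -> R) G, bweak u G ->
  (forall t : R, 0 < t -> (mu [set x | (t < u x)%R] < +oo)%E) ->
  (\int[mu]_x Phi (G x) < +oo)%E -> forall be : R, 0 < be ->
  (band_energy Phi u G (be / 2)%R be <= eta%:E)%E ->
  (mu [set x | (be <= u x)%R] * N (2 * kappa * be)%R <= band_energy Phi u G (be / 2)%R be)%E.
Variables (u : V -> R) (G : V -> V).
Hypothesis wu : bweak u G.
Hypothesis ufin : forall t : R, 0 < t -> (mu [set x | (t < u x)%R] < +oo)%E.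
Hypothesis Gfin : (\int[mu]_x Phi (G x) < +oo)%E.

Let mu_ : measurable_fun setT u. Proof. by case: wu => [[]]. Qed.
Let mG : measurable_fun setT (fun x => Phi (G x)).
Proof.
have [_ lG _] := wu.
exact: measurableT_comp (measurable_young_rV yP) (measurable_gradient lG).
Qed.
Let mN : measurable_fun setT (fun x => N (kappa * u x)%R).
Proof. by apply: measurable_sobolev_conjugate_comp; exact: measurable_funM. Qed.

Let B (s : R) := [set x | s <= u x < 2 * s].

Lemma measurable_dyadic_band (s : R) : measurable (B s).
Proof.
rewrite (_ : B s = u @^-1` `[s, 2 * s[%classic).
  by rewrite -[X in measurable X]setTI; apply: mu_ => //; exact: measurable_itv.
by apply/seteqP; split => x; rewrite /= in_itv.
Qed.

Lemma dyadic_band_volume (s : R) : 0 < s ->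
  (\int[mu]_(x in B s) N (kappa * u x)%R <= mu [set x | (s <= u x)%R] * N (2 * kappa * s)%R)%E.
Proof.
move=> s0; apply: (@le_trans _ _ (\int[mu]_(x in B s) cst (N (2 * kappa * s)%R) x)%E).
  apply: ge0_le_integral => //.
  - exact: measurable_dyadic_band.
  - exact: measurable_funTS.
  - move=> x /= /andP[_ us]; apply: N_homo.
    by rewrite [2 * kappa]mulrC -mulrA ler_pM2l// ltW.
rewrite integral_cst; last exact: measurable_dyadic_band.
rewrite muleC; apply: lee_wpmul2r => //; apply: le_measure; rewrite ?inE.
- exact: measurable_dyadic_band.
- exact: measurable_ge.
- by move=> x /= /andP[].
Qed.

(** On [[s, 2 s[] the function [N (kappa * u)] is at most [N (2 kappa s)], which the level estimate
    bounds by the energy of []s / 2, s[]. Doubling sends these energy bands into the intervals [[s,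
    2 s[], so they are disjoint and their energies add up to at most the total. *)
Lemma dyadic_bands_le (s : nat -> R) : (forall k, 0 < s k) -> trivIset setT (fun k => `[s k, 2 * s k[%classic) ->
  (forall k, (band_energy Phi u G (s k / 2)%R (s k) <= eta%:E)%E) ->
  (\int[mu]_(x in \bigcup_k B (s k)) N (kappa * u x)%R <= \int[mu]_x Phi (G x))%E.
Proof.
move=> s0 tB es.
rewrite ge0_integral_bigcup//; last 3 first.
- by move=> k; exact: measurable_dyadic_band.
- exact: measurable_funTS.
- apply/trivIsetP => i j _ _ ij; move/trivIsetP : tB => /(_ i j I I ij) tij.
  rewrite -subset0 => x /= [bi bj]; have : (`[s i, 2 * s i[%classic `&` `[s j, 2 * s j[%classic) (u x).
    by split; rewrite /= in_itv.
  by rewrite tij.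
pose D k := [set x | s k / 2 < u x < s k].
apply: (@le_trans _ _ (\sum_(0 <= k <oo) \int[mu]_(x in D k) Phi (G x))%E).
  apply: lee_nneseries => [k _ _|k _]; first by apply: integral_ge0 => x _; exact: N_ge0.
  by apply: le_trans (dyadic_band_volume (s0 k)) _; exact: level.
have yP0 x : (0 <= Phi (G x))%E by exact: young_rV_ge0.
rewrite -ge0_integral_bigcup//; last 3 first.
- by move=> k; exact: measurable_band.
- exact: measurable_funTS.
- apply/trivIsetP => i j _ _ ij; move/trivIsetP : tB => /(_ i j I I ij) tij.
  rewrite -subset0 => x /= [/andP[b1 b2] /andP[b3 b4]].
  have : (`[s i, 2 * s i[%classic `&` `[s j, 2 * s j[%classic) (2 * u x).
    by split; rewrite /= in_itv/=; apply/andP; split; lra.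
  by rewrite tij.
apply: ge0_subset_integral => //.
- by apply: bigcupT_measurable => k; exact: measurable_band.
Qed.

(** The band energies form a convergent series, so all but finitely many are below [eta] and the
    level estimate applies to those, however large [kappa] is. *)
Lemma dyadic_bands_fin (s : nat -> R) : 0 < eta -> (forall k, 0 < s k) ->
  trivIset setT (fun k => `[s k, 2 * s k[%classic) ->
  (\int[mu]_(x in \bigcup_k B (s k)) N (kappa * u x)%R < +oo)%E.
Proof.
move=> eta0 s0 tB.
pose D k := [set x | s k / 2 < u x < s k].
have De k : band_energy Phi u G (s k / 2)%R (s k) = (\int[mu]_(x in D k) Phi (G x))%E by [].
have S : (\sum_(0 <= k <oo) \int[mu]_(x in D k) Phi (G x) < +oo)%E.
  rewrite -ge0_integral_bigcup//; last 4 first.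
  - by move=> k; exact: measurable_band.
  - exact: measurable_funTS.
  - by move=> x _; exact: young_rV_ge0.
  - apply/trivIsetP => i j _ _ ij; move/trivIsetP : tB => /(_ i j I I ij) tij.
    rewrite -subset0 => x /= [/andP[b1 b2] /andP[b3 b4]].
    have : (`[s i, 2 * s i[%classic `&` `[s j, 2 * s j[%classic) (2 * u x).
      by split; rewrite /= in_itv/=; apply/andP; split; lra.
    by rewrite tij.
  apply: le_lt_trans Gfin; apply: ge0_subset_integral => //.
  - by apply: bigcupT_measurable => k; exact: measurable_band.
  - by move=> x _; exact: young_rV_ge0.
have e0 k : (0 <= \int[mu]_(x in D k) Phi (G x))%E by apply: integral_ge0 => x _; exact: young_rV_ge0.
have [K HK] : exists K : nat, forall k, (K <= k)%N -> (band_energy Phi u G (s k / 2)%R (s k) <= eta%:E)%E.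
  have := nneseries_tail_cvg S (fun k _ => e0 k).
  move=> /fine_cvgP[F C].
  have [K _ HK] : \forall k \near \oo, (\sum_(k <= j <oo) \int[mu]_(x in D j) Phi (G x) < eta%:E)%E.
    near=> k.
    have Ff : (\sum_(k <= j <oo) \int[mu]_(x in D j) Phi (G x))%E \is a fin_num by near: k.
    rewrite -(fineK Ff) lte_fin; near: k; exact: (cvgr_lt _ C).
  exists K => k Kk; rewrite De; apply: le_trans (ltW (HK k Kk)).
  have := @nneseries_lim_ge R (fun j => \int[mu]_(x in D j) Phi (G x))%E xpredT k k.+1.
  by rewrite big_nat1; apply.
have -> : \bigcup_i B (s i) = \big[setU/set0]_(k < K) B (s k) `|` \bigcup_k B (s (k + K)%N).
  apply/seteqP; split => x.
    move=> [k _ Bk]; have [kK|Kk] := ltnP k K.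
      by left; rewrite -(bigcup_mkord K (fun k => B (s k))); exists k.
    by right; exists (k - K)%N => //; rewrite subnK.
  by rewrite -(bigcup_mkord K (fun k => B (s k))) => -[[k kK Bk]|[k _ Bk]]; [exists k|exists (k + K)%N].
have mU : measurable (\bigcup_k B (s (k + K)%N)) by apply: bigcupT_measurable => k; exact: measurable_dyadic_band.
have IU : (\int[mu]_(x in \bigcup_k B (s (k + K)%N)) N (kappa * u x)%R < +oo)%E.
  apply: le_lt_trans Gfin; apply: dyadic_bands_le => //.
    apply/trivIsetP => i j _ _ ij; move/trivIsetP : tB; apply => //.
    by rewrite eqn_add2r.
  by move=> k; apply: HK; rewrite leq_addl.
(* The first [K] bands are restored one at a time; each has finite volume, and [N] is bounded on it
   by a finite value. *)
elim: K {HK} (\bigcup_k _) mU IU => [|K IH] U mU IU; first by rewrite big_ord0 set0U.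
rewrite big_ord_recr/= -setUA; apply: IH.
  by apply: measurableU => //; exact: measurable_dyadic_band.
apply: (@le_lt_trans _ _ (\int[mu]_(x in B (s K)) N (kappa * u x)%R + \int[mu]_(x in U) N (kappa * u x)%R)%E).
  by apply: ge0_integral_setU_le => //; exact: measurable_dyadic_band.
rewrite lte_add_pinfty//; apply: le_lt_trans (dyadic_band_volume (s0 K)) _.
by rewrite lte_mul_pinfty// ?N_fin// ?measure_ge0// ge0_fin_numE ?measure_ge0// ge_volume_lty.
Unshelve. all: by end_near. Qed.

(** Nonnegative and negative powers of 2 are kept as two families indexed by [nat]; each family is
    charged the whole energy once, which produces a factor 2. *)
Lemma dyadic_cover (x : R) : 0 < x ->
  (exists k : nat, 2 ^+ k <= x < 2 * 2 ^+ k) \/ (exists k : nat, 2 ^- k.+1 <= x < 2 * 2 ^- k.+1).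
Proof.
have ex2 (y : R) : exists k : nat, y < 2 ^+ k.+1.
  exists (Num.truncn `|y|); apply: le_lt_trans (ler_norm y) _; apply: lt_trans (truncnS_gt _) _.
  by rewrite -natrX ltr_nat ltn_expl.
move=> x0; have [x1|x1] := leP 1 x.
  left; case: (ex_minnP (ex2 x)) => k xk kmin; exists k; rewrite -exprS xk andbT.
  case: k xk kmin => [|k] xk kmin; first by rewrite expr0.
  by rewrite leNgt; apply/negP => /kmin; rewrite ltnn.
right; have ex : exists k : nat, 2 ^- k.+1 <= x.
  have [k xk] := ex2 x^-1; exists k.
  by rewrite -[leRHS]invrK lef_pV2 ?posrE ?invr_gt0 ?exprn_gt0// ltW.
case: (ex_minnP ex) => k xk kmin; exists k; rewrite xk/=.
have -> : 2 * 2 ^- k.+1 = 2 ^- k :> R by rewrite exprS invfM mulrA mulfV// mul1r.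
case: k xk kmin => [|k] xk kmin; first by rewrite expr0 invr1.
by rewrite ltNge; apply/negP => /kmin; rewrite ltnn.
Qed.

Lemma trivIset_dyadic : trivIset setT (fun k : nat => `[2 ^+ k : R, 2 * 2 ^+ k[%classic).
Proof.
apply/trivIsetP => i j _ _; wlog ij : i j / (i < j)%N => [H|_].
  by rewrite neq_ltn => /orP[] h; [|rewrite setIC]; apply: H => //; rewrite neq_ltn h.
rewrite -subset0 => x /= []; rewrite !in_itv/= => /andP[_ h1] /andP[h2 _].
have := le_lt_trans h2 h1; rewrite -exprS ltNge => /negP; apply.
by rewrite ler_weXn2l// ler1n.
Qed.

Lemma trivIset_dyadicV : trivIset setT (fun k : nat => `[2 ^- k.+1 : R, 2 * 2 ^- k.+1[%classic).
Proof.
apply/trivIsetP => i j _ _; wlog ij : i j / (i < j)%N => [H|_].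
  by rewrite neq_ltn => /orP[] h; [|rewrite setIC]; apply: H => //; rewrite neq_ltn h.
rewrite -subset0 => x /= []; rewrite !in_itv/= => /andP[h2 _] /andP[_ h1].
have := le_lt_trans h2 h1.
have -> : 2 * 2 ^- j.+1 = 2 ^- j :> R by rewrite exprS invfM mulrA mulfV// mul1r.
rewrite ltNge => /negP; apply; rewrite lef_pV2 ?posrE ?exprn_gt0//.
by rewrite ler_weXn2l// ler1n.
Qed.

Lemma gt0_dyadic : [set x | 0 < u x] =
  (\bigcup_k B (2 ^+ k)) `|` (\bigcup_k B (2 ^- k.+1)).
Proof.
apply/seteqP; split => x /=.
  by move=> /dyadic_cover[[k hk]|[k hk]]; [left|right]; exists k.
by case=> -[k _ /andP[h _]]; apply: lt_le_trans h; rewrite ?invr_gt0 exprn_gt0.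
Qed.

Let mbig (s : nat -> R) : measurable (\bigcup_k B (s k)).
Proof. by apply: bigcupT_measurable => k; exact: measurable_dyadic_band. Qed.

Lemma gt0_integral_fin : 0 < eta -> (\int[mu]_(x in [set x | (0 < u x)%R]) N (kappa * u x)%R < +oo)%E.
Proof.
move=> eta0; rewrite gt0_dyadic; apply: le_lt_trans (ge0_integral_setU_le _ _ mN _) _ => //.
rewrite lte_add_pinfty//; apply: dyadic_bands_fin => //.
- exact: trivIset_dyadic.
- exact: trivIset_dyadicV.
Qed.

Lemma gt0_integral_le : (\int[mu]_x Phi (G x) <= eta%:E)%E ->
  (\int[mu]_(x in [set x | (0 < u x)%R]) N (kappa * u x)%R <= 2%:E * \int[mu]_x Phi (G x))%E.
Proof.
move=> Ge; have e s t : (band_energy Phi u G s t <= eta%:E)%E by exact: le_trans (band_energy_le _ _ wu) Ge.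
rewrite gt0_dyadic; apply: le_trans (ge0_integral_setU_le _ _ mN _) _ => //.
have -> : (2%:E * \int[mu]_x Phi (G x) = \int[mu]_x Phi (G x) + \int[mu]_x Phi (G x))%E.
  by rewrite mule_natl mule2n.
apply: leeD; apply: dyadic_bands_le => //.
- exact: trivIset_dyadic.
- exact: trivIset_dyadicV.
Qed.

End bands.

Let abs_split (u : V -> R) (kappa : R) : measurable_fun setT u ->
  (\int[mu]_x N (kappa * `|u x|)%R <= \int[mu]_(x in [set x | (0 < u x)%R]) N (kappa * u x)%R +
    \int[mu]_(x in [set x | (0 < - u x)%R]) N (kappa * - u x)%R)%E.
Proof.
move=> mu_; have m0 : measurable [set x | 0 < u x] by exact: measurable_gt.
have m1 : measurable [set x | 0 < - u x].
  by apply: (@measurable_gt _ _ (fun x => - u x)); exact: measurable_funN.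
have mN : measurable_fun setT (fun x => N (kappa * `|u x|)%R).
  by apply: measurable_sobolev_conjugate_comp; apply: measurable_funM => //; exact: measurableT_comp.
have mU : measurable ([set x | 0 < u x] `|` [set x | 0 < - u x]) by exact: measurableU.
rewrite -(setvU ([set x | 0 < u x] `|` [set x | 0 < - u x])).
apply: le_trans (ge0_integral_setU_le _ _ mN _) _ => //; first exact: measurableC.
rewrite [X in (X + _)%E]integral0_eq ?add0e; last first.
  move=> x /= /not_orP[/negP + /negP]; rewrite -!leNgt => h1 h2.
  have -> : u x = 0 by apply/eqP; rewrite eq_le h1 -oppr_le0.
  by rewrite normr0 mulr0 sobolev_conjugate0.
apply: le_trans (ge0_integral_setU_le _ _ mN _) _ => //.
rewrite le_eqVlt; apply/orP; left; apply/eqP; congr (_ + _)%E; apply: eq_integral => x; rewrite inE/= => h.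
  by rewrite gtr0_norm.
by rewrite -normrN gtr0_norm.
Qed.

Let opp_bweak (u : V -> R) G : bweak u G -> bweak (fun x => - u x) (fun x => - G x).
Proof.
move=> wu; have w0 : bweak (fun _ : V => 0) (fun _ => 0).
  have := bweakZD (-1) wu wu.
  rewrite (_ : (fun x => -1 * u x + u x) = (fun _ => 0)); last by apply/funext => x; rewrite mulN1r addNr.
  by rewrite (_ : (fun x => -1 *: G x + G x) = (fun _ => 0))//; apply/funext => x; rewrite scaleN1r addNr.
have := bweakZD (-1) wu w0.
rewrite (_ : (fun x => -1 * u x + 0) = (fun x => - u x)); last by apply/funext => x; rewrite mulN1r addr0.
by rewrite (_ : (fun x => -1 *: G x + 0) = (fun x => - G x))//; apply/funext => x; rewrite scaleN1r addr0.
Qed.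

Let level_half (w : V -> R) (u : V -> R) : measurable_fun setT u -> measurable_fun setT w -> (forall x, w x <= `|u x|) ->
  (forall t : R, 0 < t -> (mu [set x | (t < `|u x|)%R] < +oo)%E) ->
  forall t : R, 0 < t -> (mu [set x | (t < w x)%R] < +oo)%E.
Proof.
move=> mu_ mw wu H t t0; apply: le_lt_trans (H t t0); apply: le_measure; rewrite ?inE.
- exact: measurable_gt.
- by apply: (@measurable_gt _ _ (fun x => `|u x|)); exact: measurableT_comp.
- by move=> x /= /lt_le_trans; apply.
Qed.

Let PhiN (G : V -> V) : (\int[mu]_x Phi (- G x)%R = \int[mu]_x Phi (G x))%E.
Proof. by apply: eq_integral => x _; rewrite (young_rV_even yP). Qed.

Lemma sobolev_modular_fin (kappa : R) (u : V -> R) G : 0 < kappa -> bweak u G ->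
  (forall t : R, 0 < t -> (mu [set x | (t < `|u x|)%R] < +oo)%E) ->
  (\int[mu]_x Phi (G x) < +oo)%E -> (\int[mu]_x N (kappa * `|u x|)%R < +oo)%E.
Proof.
move=> k0 wu uf Gf; have [[mu_ _] _ _] := wu; have mNu := measurable_funN mu_.
have [eta eta0 lev] := level_energy (mulr_gt0 (ltr0n _ 2) k0 : 0 < 2 * kappa).
apply: le_lt_trans (abs_split kappa mu_) _; rewrite lte_add_pinfty//.
  apply: (gt0_integral_fin k0 lev wu) => //.
  by apply: (level_half mu_ mu_) uf => x; exact: ler_norm.
apply: (gt0_integral_fin k0 lev (opp_bweak wu)) => //; last by rewrite PhiN.
by apply: (level_half mu_ mNu) uf => x; rewrite -normrN; exact: ler_norm.
Qed.

(** The factor 4 counts the two dyadic families for each of the positive and negative parts of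
    [u]. *)
Lemma sobolev_modular_le (kappa : R) : 0 < kappa -> exists2 eta : R, 0 < eta & forall (u : V -> R) G, bweak u G ->
  (forall t : R, 0 < t -> (mu [set x | (t < `|u x|)%R] < +oo)%E) ->
  (\int[mu]_x Phi (G x) <= eta%:E)%E ->
  (\int[mu]_x N (kappa * `|u x|)%R <= 4%:E * \int[mu]_x Phi (G x))%E.
Proof.
move=> k0; have [eta eta0 lev] := level_energy (mulr_gt0 (ltr0n _ 2) k0 : 0 < 2 * kappa).
exists eta => // u G wu uf Ge; have [[mu_ _] _ _] := wu; have mNu := measurable_funN mu_.
have Gf : (\int[mu]_x Phi (G x) < +oo)%E by exact: le_lt_trans Ge (ltry _).
apply: le_trans (abs_split kappa mu_) _.
have -> : (4%:E * \int[mu]_x Phi (G x) = 2%:E * \int[mu]_x Phi (G x) + 2%:E * \int[mu]_x Phi (G x))%E.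
  rewrite -ge0_muleDl// -EFinD; congr (_%:E * _)%E; lra.
apply: leeD.
  apply: (gt0_integral_le k0 lev wu) => //.
  by apply: (level_half mu_ mu_) uf => x; exact: ler_norm.
rewrite -PhiN; apply: (gt0_integral_le k0 lev (opp_bweak wu)); rewrite ?PhiN//.
by apply: (level_half mu_ mNu) uf => x; rewrite -normrN; exact: ler_norm.
Qed.

End embedding.

(** * Growth of the composed function *)

Section locally_lipschitz.
Context {R : realType}.
Local Notation mu1 := (@lebesgue_measure R).
Local Notation R1 := (measurableTypeR R).
Implicit Types f : R -> R.

Lemma Rintegral_shift_R (f : R -> R) (h : R) : measurable_fun setT f ->
  \int[mu1]_x f (x + h) = \int[mu1]_x f x.
Proof.
move=> mf; have mE : measurable_fun setT (EFin \o f) by exact/measurable_EFinP.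
congr fine; rewrite integralE [RHS]integralE; congr (_ - _)%E.
  rewrite -[RHS](ge0_integral_shift_R h (measurable_funepos mE))//.
  by apply: eq_integral => x _; rewrite (funepos_comp (EFin \o f) (fun x => x + h)).
rewrite -[RHS](ge0_integral_shift_R h (measurable_funeneg mE))//.
by apply: eq_integral => x _; rewrite (funeneg_comp (EFin \o f) (fun x => x + h)).
Qed.

Lemma oint_shift (f : R -> R) (a b h : R) : measurable_fun setT f ->
  oint (fun t => f (t + h)) a b = oint f (a + h) (b + h).
Proof.
move=> mf; have key x y : \int[mu1]_(t in `[x, y]) f (t + h) = \int[mu1]_(t in `[x + h, y + h]) f t.
  have mr : measurable_fun setT (f \_ `[x + h, y + h]%classic).
    by apply/(measurable_restrictT _ (measurable_itvR _)); exact: measurable_funR.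
  rewrite [LHS]Rintegral_mkcond [RHS]Rintegral_mkcond -[RHS](Rintegral_shift_R h mr).
  apply: eq_Rintegral => t _; rewrite !patchE; congr (if _ then _ else _).
  by apply/idP/idP => /set_mem; rewrite /= in_itv/= => H; apply/mem_set; rewrite /= in_itv/=; lra.
by rewrite /oint !key.
Qed.

(** Near each pair of points the Lipschitz bound holds for all large constants; compactness of the
    square makes the constant uniform. *)
Lemma locally_lipschitz_itv f (M : R) : [locally [lipschitz f x | x in setT]] ->
  exists2 L : R, 0 < L & forall a b : R, `|a| <= M -> `|b| <= M -> `|f a - f b| <= L * `|a - b|.
Proof.
move=> lf; pose K := `[- M, M]%classic `*` `[- M, M]%classic : set (R * R).
have cK : compact K by apply: compact_setX; exact: segment_compact.
move/compact_near_coveringP : cK => /(_ R +oo (fun L p => `|f p.1 - f p.2| <= L * `|p.1 - p.2|) _).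
have H : forall x, K x -> \forall x' \near x & L \near +oo, `|f x'.1 - f x'.2| <= L * `|x'.1 - x'.2|.
  move=> x _; have [L [Lr HL]] := lf x (conj I I).
  have L1 : L < L + 1 by rewrite ltrDl.
  exists ([set p : R * R | `|f p.1 - f p.2| <= (L + 1) * `|p.1 - p.2|], [set L' : R | L + 1 < L']).
    split => /=; last by exists (L + 1); split => //; rewrite num_real.
    have H : nbhs x [set p : R * R | ([set: R] `*` [set: R]) p -> `|f p.1 - f p.2| <= (L + 1) * `|p.1 - p.2|].
      exact: HL _ L1.
    by apply: (@filterS _ (nbhs x) _ _ _ _ H) => p; apply.
  move=> [p L'] /= [h1 h2]; apply: le_trans h1 _.
  by rewrite ler_wpM2r// ltW.
move=> /(_ H)[L [Lr HL]]; exists (Num.max 1 (L + 1)); first by rewrite lt_max ltr01.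
move=> a b aM bM; have LL : L < Num.max 1 (L + 1) by rewrite lt_max ltrDl ltr01 orbT.
by apply: (HL _ LL (a, b)); split; rewrite /= in_itv/= -ler_norml.
Qed.

Lemma derivable_difference_quotient f (t : R) : derivable f t 1 ->
  k.+1%:R * (f (t + k.+1%:R^-1) - f t) @[k --> \oo] --> derive1 f t.
Proof.
move=> df; rewrite derive1E.
have hs : (fun k : nat => k.+1%:R^-1 : R) k @[k --> \oo] --> (0 : R)^'.
  move=> S HS.
  have H : \forall k \near \oo, [set y | y != 0 -> S y] (@harmonic R k) := @cvg_harmonic R _ HS.
  rewrite nbhs_filterE/=; apply: filterS H => k /=; apply.
  by rewrite gt_eqF// invr_gt0.
have -> : (fun k : nat => k.+1%:R * (f (t + k.+1%:R^-1) - f t)) =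
    (fun h => h^-1 *: ((f \o shift t) (h *: 1) - f t)) \o (fun k : nat => k.+1%:R^-1 : R).
  by apply/funext => k /=; rewrite /GRing.scale/= mulr1 invrK (addrC t).
exact: (cvg_comp _ _ hs df).
Qed.

Lemma clip_lipschitz (M s t : R) : 0 <= M ->
  `|Num.max (- M) (Num.min M s) - Num.max (- M) (Num.min M t)| <= `|s - t|.
Proof.
move=> M0; have MM : - M <= M by lra.
wlog st : s t / s <= t.
  by move=> H; have [/H//|/ltW/H] := leP s t; rewrite distrC (distrC t).
rewrite distrC (distrC s) [leRHS]ger0_norm ?subr_ge0// ler_norml.
have [x1|x1] := leP M s; have [y1|y1] := leP M t; rewrite ?(max_r MM).
- by apply/andP; split; lra.
- by exfalso; lra.
- by have [x2|x2] := leP (- M) s; apply/andP; split; lra.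
- by have [x2|x2] := leP (- M) s; have [y2|y2] := leP (- M) t; apply/andP; split; lra.
Qed.

Lemma lipschitz_derivative f (B : R -> R) : [locally [lipschitz f x | x in setT]] ->
  (forall t : R, 0 <= B t) ->
  {ae mu1, forall t : R, derivable f t 1 /\ `|derive1 f t| <= B t} ->
  exists phi : R -> R, [/\ measurable_fun setT phi, forall t, `|phi t| <= B t &
    forall a b, f b - f a = oint phi a b].
Proof.
move=> lf B0 [N [mN N0 PN]].
pose phi t := derive1 f t * \1_(~` N) t.
have dN (t : R) : ~ N t -> derivable f t 1 /\ `|derive1 f t| <= B t.
  by move=> Nt; apply: contrapT => H; apply: Nt; exact: PN.
have cf : continuous f.
  move=> x; have [L L0 HL] := locally_lipschitz_itv (`|x| + 1) lf.
  apply/cvgrPdist_le => eps eps0.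
  near=> y; have xy : `|x - y| <= Num.min 1 (eps / L).
    near: y; apply: cvgr_dist_le; last by rewrite lt_min ltr01 divr_gt0.
    exact: cvg_id.
  move: xy; rewrite le_min => /andP[xy1 xy2].
  have yM : `|y| <= `|x| + 1.
    by rewrite -[y](subrK x) addrC; apply: le_trans (ler_normD _ _) _; rewrite lerD2l distrC.
  apply: le_trans (HL x y _ yM) _; first by rewrite lerDl.
  by rewrite mulrC -ler_pdivlMr.
have mf : measurable_fun setT f by exact: continuous_measurable_fun.
have mNc : measurable (~` N) by exact: measurableC.
have m1 : measurable_fun setT (\1_(~` N) : R -> R) by exact: measurable_indic.
have mq (F : R -> R) (k : nat) : measurable_fun setT F -> measurable_fun setT (fun t : R => k.+1%:R * (F (t + k.+1%:R^-1) - F t) * \1_(~` N) t).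
  move=> mF; apply: measurable_funM => //; apply: measurable_funM => //; apply: measurable_funB => //.
  by apply: measurableT_comp => //; exact: measurable_funD.
have qphi (t : R) : k.+1%:R * (f (t + k.+1%:R^-1) - f t) * \1_(~` N) t @[k --> \oo] --> phi t.
  rewrite /phi indicE; have [/set_mem Nt|_] := boolP (t \in ~` N).
    by apply: cvgMl; apply: derivable_difference_quotient; have [] := dN t Nt.
  by rewrite mulr0; under eq_fun do rewrite mulr0; exact: cvg_cst.
have mphi : measurable_fun setT phi.
  by apply: (measurable_fun_cvg (fun k => mq f k mf)) => t _; exact: qphi.
exists phi; split => // [t|a b].
  rewrite /phi indicE; have [/set_mem Nt|_] := boolP (t \in ~` N).
    by rewrite mulr1; have [] := dN t Nt.
  by rewrite mulr0 normr0.
wlog ab : a b / a <= b.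
  move=> H; have [/H//|/ltW/H H'] := leP a b.
  by rewrite ointC -H' opprB.
pose M : R := `|a| + `|b| + 1.
have [L L0 HL] := locally_lipschitz_itv M lf.
have M0 : 0 < M by rewrite ltr_wpDl// addr_ge0.
(* Composing [f] with this projection makes it bounded and globally Lipschitz without altering it on
   [[a, b + 1]], which contains all the points used. *)
pose clip (t : R) : R := Num.max (- M) (Num.min M t).
have clipM (t : R) : `|clip t| <= M.
  by rewrite ler_norml /clip le_max lexx/= ge_max ge_min lexx/= andbT; lra.
have clipE (t : R) : `|t| <= M -> clip t = t.
  by rewrite ler_norml => /andP[h1 h2]; rewrite /clip (min_idPr h2) (max_idPr h1).
have clip_lip (s t : R) : `|clip s - clip t| <= `|s - t| := clip_lipschitz s t (ltW M0).
pose F := f \o clip.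
have FL (s t : R) : `|F s - F t| <= L * `|s - t|.
  by apply: le_trans (HL _ _ (clipM s) (clipM t)) _; rewrite ler_pM2l.
pose MF : R := `|f 0| + L * M.
have FM (t : R) : `|F t| <= MF.
  rewrite -(subrK (f 0) (F t)) addrC; apply: le_trans (ler_normD _ _) _; rewrite lerD2l.
  apply: le_trans (HL _ _ (clipM t) _) _; first by rewrite normr0 ltW.
  by rewrite subr0 ler_pM2l.
have mF : measurable_fun setT F.
  apply: measurableT_comp => //; rewrite /clip.
  by apply: measurable_maxr => //; exact: measurable_minr.
have Fab (t : R) : a <= t -> t <= b + 1 -> F t = f t.
  move=> h1 h2; rewrite /F/= clipE// ler_norml /M.
  have := ler_norm a; have := ler_norm b; have := lerNnormlW (lexx `|a|); have := lerNnormlW (lexx `|b|).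
  have := normr_ge0 a; have := normr_ge0 b; lra.
pose h (k : nat) : R := k.+1%:R^-1.
have h0 k : 0 < h k by rewrite invr_gt0.
have h1 k : h k <= 1 by rewrite invf_le1// ler1n.
have I0 (t : R) : a <= t <= b -> k.+1%:R * (F (t + h k) - F t) * \1_(~` N) t @[k --> \oo] --> phi t.
  move=> /andP[at_ tb].
  have -> : (fun k : nat => k.+1%:R * (F (t + h k) - F t) * \1_(~` N) t) =
      (fun k : nat => k.+1%:R * (f (t + k.+1%:R^-1) - f t) * \1_(~` N) t).
    apply/funext => k; have := h0 k; have := h1 k => k1 k2.
    by rewrite (Fab (t + h k)) ?(Fab t)//; lra.
  exact: qphi.
have I1 : \int[mu1]_(t in `[a, b]) (k.+1%:R * (F (t + h k) - F t) * \1_(~` N) t) @[k --> \oo] --> \int[mu1]_(t in `[a, b]) phi t.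
  apply: (@Rintegral_dominated_cvg _ _ _ mu1 _ _ _ (cst L)).
  - exact: measurable_itvR.
  - by move=> k; apply: measurable_funR; exact: mq.
  - exact: measurable_funR.
  - by move=> t; rewrite /= in_itv/=; exact: I0.
  - exact: (bounded_integrable_itv (f := cst L) (M := `|L|)).
  - move=> k t _; rewrite indicE normrM; apply: (@le_trans _ _ (L * 1)); last by rewrite mulr1.
    apply: ler_pM => //; last by rewrite normr_nat lern1 leq_b1.
    rewrite normrM gtr0_norm// -ler_pdivlMl//; apply: le_trans (FL _ _) _.
    by rewrite addrAC subrr add0r mulrC gtr0_norm// invr_gt0.
(* The integral of [F (t + h k) - F t] over [[a, b]] telescopes into two integrals over intervals of
   length [h k]. *)
have I2 k : \int[mu1]_(t in `[a, b]) (k.+1%:R * (F (t + h k) - F t) * \1_(~` N) t) =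
    k.+1%:R * (oint F b (b + h k) - oint F a (a + h k)).
  have mS : measurable_fun setT (fun t : R => F (t + h k)).
    by apply: measurableT_comp => //; exact: measurable_funD.
  transitivity (\int[mu1]_(t in `[a, b]) (k.+1%:R * (F (t + h k) - F t))).
    apply: ae_Rintegral.
    - exact: measurable_itvR.
    - by apply: measurable_funR; exact: mq.
    - by apply: measurable_funR; apply: measurable_funM => //; exact: measurable_funB.
    - exists N; split => // t /= H; apply: contrapT => Nt; apply: H => _.
      by rewrite indicE mem_set ?mulr1.
  rewrite RintegralZl; last 2 first.
  - exact: measurable_itvR.
  - apply: (@bounded_integrable_itv _ (fun t => F (t + h k) - F t) (MF + MF)); first exact: measurable_funB.
    by move=> t; apply: le_trans (ler_normB _ _) _; rewrite lerD.
  congr (_ * _); rewrite RintegralB; last 3 first.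
  - exact: measurable_itvR.
  - exact: (@bounded_integrable_itv _ (fun t => F (t + h k)) MF).
  - exact: (@bounded_integrable_itv _ F MF).
  rewrite -!oint_le// oint_shift//.
  rewrite (@ointD _ F MF (a + h k) a (b + h k))// (@ointD _ F MF a b (b + h k))//.
  by rewrite (ointC F a (a + h k)); lra.
have I3 (x : R) : k.+1%:R * oint F x (x + h k) @[k --> \oo] --> F x.
  apply/cvgrPdist_le => eps eps0.
  have hc : h k @[k --> \oo] --> (0 : R) by exact: cvg_harmonic.
  near=> k.
  have := @oint_approx _ F L MF x (x + h k) mF FM FL; rewrite [x + h k - x]addrAC subrr add0r => H.
  have -> : F x - k.+1%:R * oint F x (x + h k) = - ((h k)^-1 * (oint F x (x + h k) - F x * h k)).
    by rewrite /h; field; rewrite addrC natr1 pnatr_eq0.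
  rewrite normrN normrM gtr0_norm ?invr_gt0// -ler_pdivlMl ?invr_gt0// invrK.
  apply: le_trans H _; rewrite expr2 mulrCA ler_pM2l//.
  rewrite mulrC -ler_pdivlMr//; near: k.
  by apply: (cvgr_le _ hc); exact: divr_gt0.
rewrite oint_le// -(Fab a)//; last by lra.
rewrite -(Fab b)//; last by lra.
have c1 : k.+1%:R * (oint F b (b + h k) - oint F a (a + h k)) @[k --> \oo] --> F b - F a.
  by under eq_fun do rewrite mulrBr; apply: cvgB; exact: I3.
have -> : F b - F a = lim (k.+1%:R * (oint F b (b + h k) - oint F a (a + h k)) @[k --> \oo]).
  by apply/esym/cvg_lim.
apply/cvg_lim => //; by under eq_fun do rewrite -I2.
Unshelve. all: by end_near. Qed.

End locally_lipschitz.

(** * Growth bounds drawn from the implicit function *)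

Section growth.
Context {R : realType} {n : nat}.
Local Notation V := 'rV[R]_n.
Local Notation mu := (@borel_lebesgue R n).
Local Notation mu1 := (@lebesgue_measure R).
Local Notation R1 := (measurableTypeR R).

(** [Psi] exceeds 1 on a sphere, and convexity with [Psi 0 = 0] propagates this linearly outwards.
    It turns modular bounds into local integrability. *)
Lemma young_rV_coercive (Psi : V -> \bar R) : young_rV Psi ->
  exists2 C : R, 0 < C & forall x, ((enorm x)%:E <= C%:E * (1 + Psi x))%E.
Proof.
move=> yP; have [r Hr] := young_rV_cvgy yP 1.
pose C : R := 2 * (`|r| + 1); have C0 : 0 < C by rewrite mulr_gt0// ltr_pwDr.
have rC : r < C / 2.
  by rewrite /C [2 * _]mulrC mulfK//; apply: le_lt_trans (ler_norm r) _; rewrite ltrDl.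
exists C => // x; have P0 := young_rV_ge0 yP x.
rewrite ge0_muleDr// mule1.
have [xC|Cx] := leP (enorm x) C.
  apply: (@le_trans _ _ C%:E); first by rewrite lee_fin.
  by rewrite leeDl// mule_ge0// lee_fin ltW.
have x0 : 0 < enorm x by exact: lt_trans Cx.
apply: (@le_trans _ _ (C%:E * Psi x)%E); last by rewrite leeDr// lee_fin ltW.
pose t := C / enorm x.
have t01 : 0 <= t <= 1 by rewrite divr_ge0 ?(ltW C0) ?(ltW x0)//= ler_pdivrMr// mul1r ltW.
have et : enorm (t *: x) = C.
  rewrite /enorm; under eq_bigr do rewrite mxE exprMn.
  rewrite -mulr_sumr sqrtrM ?sqr_ge0// sqrtr_sqr ger0_norm; last by case/andP: t01.
  by rewrite -/(enorm x) /t divfK// gt_eqF.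
have := Hr (t *: x); rewrite et => /(_ _) H.
have {}H : (1%:E < Psi (t *: x))%E by apply: H; apply: lt_trans rC _; rewrite ltr_pdivrMr// ltr_pMr// ltr1n.
have := lt_le_trans H (young_rV_scale _ yP t01).
have tp : 0 < t by rewrite divr_gt0.
move=> /ltW H2.
have -> : (C%:E * Psi x = (enorm x)%:E * (t%:E * Psi x))%E.
  by rewrite muleA -EFinM /t mulrCA mulfV ?mulr1// gt_eqF.
by rewrite -[leLHS]mule1; apply: lee_wpmul2l => //; rewrite lee_fin ltW.
Qed.

(** The sublevel set has at least the volume of a cube of half-side [s / n], so it cannot lie in the
    cube of half-side [s / (2 n)]. *)
Lemma sublevel_direction (Phi : V -> \bar R) (A : R -> \bar R) (s : R) : (2 <= n)%N -> young_rV Phi ->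
  young_symmetral Phi A -> (forall t : R, 0 <= t -> (A t < +oo)%E) -> 0 < s ->
  exists xi : V, (Phi xi <= A s)%E /\ exists i, s / (2 * n%:R) < `|xi ord0 i|.
Proof.
move=> n2 yP AP Afin s0; have [yA _] := AP; have n0 : (0 : R) < n%:R by rewrite ltr0n ltnW.
have As0 := young_ge0 yA (ltW s0).
pose tau := fine (A s); have As : A s = tau%:E by rewrite fineK// ge0_fin_numE// Afin// ltW.
have tau0 : 0 <= tau by rewrite fine_ge0.
have H := @cube_volume_le_sublevel R n n2 Phi A tau s yP AP tau0 s0.
rewrite As in H *; have {}H := H (lexx _).
pose rho := s / (2 * n%:R); have rho0 : 0 < rho by rewrite divr_gt0// mulr_gt0.
apply: contrapT => /forallNP Hz.
suff : (mu [set y | (Phi y <= tau%:E)%E] <= ((2 * rho) ^+ n)%:E)%E.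
  move=> /(le_trans H); rewrite lee_fin leNgt => /negP; apply.
  have -> : 2 * (s / n%:R) = 2 * (2 * rho) by rewrite /rho; field; rewrite gt_eqF.
  have nn : (0 < n)%N by exact: ltnW.
  rewrite ltrXn2r -?lt0n ?nn//=; lra.
rewrite -(borel_lebesgue_cube n rho0); apply: le_measure; rewrite ?inE.
- exact: measurable_sublevel.
- exact: measurable_rV_cube.
move=> y /= Py i; rewrite -ler_norml leNgt; apply/negP => yi.
by apply: (Hz y); split => //; exists i.
Qed.

Section linear_bound.
Variable (A : R -> \bar R).
Hypothesis n2 : (2 <= n)%N.
Hypothesis yA : young A.
Hypothesis convA : converges_at_0 n A.
Hypothesis finA : forall t : R, 0 <= t -> (A t < +oo)%E.
Hypothesis divA : diverges_at_infty n A.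
Let a := young_fine A.
Local Notation N := (sobolev_conjugate n A).

Lemma young_kernel_int_linear (S : R) : 1 <= S ->
  young_kernel_int n a S <= young_kernel_int n a 1 + young_kernel n a 1 * S.
Proof.
move=> S1; have S0 : 0 < S by exact: lt_le_trans S1.
have ik s (s0 : 0 < s) := integrable_young_kernel n2 yA convA finA s0.
have kE s : 0 < s -> (young_kernel_int n a s)%:E = (\int[mu1]_(x in `]0%R, s[) (young_kernel n a x)%:E)%E.
  move=> s0; rewrite /young_kernel_int /Rintegral fineK//.
  exact: (integrable_fin_num (measurable_itvR _) (ik _ s0)).
rewrite -lee_fin EFinD !kE//.
have k1 : 0 <= young_kernel n a 1 by exact: powR_ge0.
have U : `]0, S[%classic = `]0, 1[%classic `|` `[1, S[%classic :> set R1.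
  apply/seteqP; split => x; rewrite /= !in_itv/=; last by case=> /andP[]; lra.
  by move=> /andP[x0 xS]; have [x1|x1] := ltP x 1; [left; rewrite x0|right].
have mk (i : interval R) : (forall x, x \in i -> 0 < x) -> measurable_fun ([set` i] : set R1) (EFin \o young_kernel n a).
  by move=> i0; apply/measurable_EFinP; exact: (measurable_young_kernel n2 yA convA finA).
have k0 x : (0 <= (young_kernel n a x)%:E)%E by rewrite lee_fin powR_ge0.
rewrite [X in (\int[_]_(x in X) _)%E]U ge0_integral_setU//; last 2 first.
- by rewrite -U; apply: mk => x; rewrite in_itv/= => /andP[].
- by apply/disj_setPS => x []; rewrite /= !in_itv/= => /andP[_ +] /andP[+ _]; lra.
apply: leeD2l.
apply: (@le_trans _ _ (\int[mu1]_(x in `[1%R, S[) cst (young_kernel n a 1)%:E x)%E).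
  apply: ge0_le_integral => //.
  - by apply: mk => x; rewrite in_itv/= => /andP[/(lt_le_trans ltr01)].
  - move=> x; rewrite /= in_itv/= => /andP[x1 _]; rewrite lee_fin.
    exact: (young_kernel_noninc n2 yA convA finA).
rewrite integral_cst//.
have := @lebesgue_measure_itv R `[1, S[; rewrite /= lte_fin => H.
rewrite [X in (_ * X)%E]H; case: ifP => _; last by rewrite mule0 lee_fin mulr_ge0// ltW.
by rewrite -EFinB -EFinM lee_fin ler_wpM2l//; lra.
Qed.

(** The kernel is non-increasing, so its integral grows at most linearly beyond 1, and a power with
    exponent in [[0, 1]] keeps [sobolev_H] below a linear function. Here [s] is the generalized
    inverse of [t]. *)
Lemma sobolev_conjugate_linear : exists2 C : R, 0 < C & forall t : R, 0 <= t ->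
  exists s : R, [/\ 0 <= s, N t = A s & t <= C * (1 + s)].
Proof.
pose C0 := 1 + young_kernel_int n a 1 + young_kernel n a 1.
have k1 : 0 <= young_kernel n a 1 by exact: powR_ge0.
have I1 : 0 <= young_kernel_int n a 1 by apply: Rintegral_ge0 => x _; exact: powR_ge0.
exists (3 * C0) => [|t t0]; first by rewrite mulr_gt0// /C0; lra.
have [s [s0 Es Ns]] := sobolev_conjugateE n2 yA convA finA divA t.
exists s; split=> //.
(* Work with a point less than 1 above the infimum that defines the inverse; the slack is absorbed
   by [1 + s]. *)
have [s' [s'0 ts'] s's] : exists2 s' : R, 0 <= s' /\ (t%:E <= sobolev_H n A s')%E & s' < s + 1.
  apply: contrapT => H; have : (s + 1)%:E \in [set` `]-oo, sobolev_Hinv n A t]].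
    rewrite inE/= in_itv/=; apply/ereal_infP => _ [x hx <-]; rewrite lee_fin leNgt; apply/negP => xs.
    by apply: H; exists x.
  by rewrite inE/= in_itv/= Es lee_fin leNgt ltrDl ltr01.
pose S := s' + 1; have S1 : 1 <= S by rewrite lerDr.
have S0 : 0 < S by exact: lt_le_trans S1.
have [s'00|s'00] := leP s' 0.
  move: ts'; rewrite (sobolev_H_le0 A n2 s'00) lee_fin => h; apply: (le_trans h).
  by rewrite !mulr_ge0// /C0; lra.
move: ts'; rewrite (sobolev_HE n2 yA convA finA s'00) lee_fin -/a => ts'.
have IS : young_kernel_int n a s' <= young_kernel_int n a S.
  by apply: (young_kernel_int_homo n2 yA convA finA) => //; rewrite lerDl.
have I0 : 0 <= young_kernel_int n a s' by apply: Rintegral_ge0 => x _; exact: powR_ge0.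
have n1 : (0 : R) < n%:R - 1 by rewrite subr_gt0 ltr1n.
have n0 : (0 : R) < n%:R by rewrite ltr0n ltnW.
have r01 : 0 <= ((n%:R - 1) / n%:R : R) <= 1.
  by rewrite divr_ge0 ?(ltW n1) ?(ltW n0)//= ler_pdivrMr//; lra.
have pr x : 0 <= x -> x `^ ((n%:R - 1) / n%:R) <= 1 + x :> R.
  move=> x0; have /andP[r0 r1] := r01; apply: (@le_trans _ _ ((1 + x) `^ ((n%:R - 1) / n%:R))).
    by apply: ge0_ler_powR; rewrite ?nnegrE//; lra.
  rewrite -[leRHS]powRr1; last by lra.
  by apply: ler_powR => //; lra.
apply: le_trans ts' _; apply: le_trans (pr _ I0) _.
have := young_kernel_int_linear S1.
rewrite /C0 /S in IS *; nra.
Qed.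

End linear_bound.

Section domination.
Variables (Phi Psi Phi1 : V -> \bar R) (A1 : R -> \bar R) (E : R -> R) (theta : V -> R) (c : R).
Hypothesis n2 : (2 <= n)%N.
Hypothesis yPhi : young_rV Phi.
Hypothesis yPsi : young_rV Psi.
Hypothesis yPhi1 : young_rV Phi1.
Hypothesis AP1 : young_symmetral Phi1 A1.
Hypothesis conv1 : converges_at_0 n A1.
Hypothesis div1 : diverges_at_infty n A1.
Hypothesis E_ge0 : forall t : R, 0 <= t -> 0 <= E t.
Hypothesis E_homo : forall s t : R, 0 <= s -> s <= t -> E s <= E t.
Hypothesis c0 : 0 <= c.
Local Notation N := (sobolev_conjugate n A1).
Hypothesis thetaP : implicit_theta Phi N E theta.
Hypothesis Psi_le : forall x, (Psi x <= c%:E + young_quotient Phi x (E (theta x)))%E.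

Let yA1 : young A1. Proof. by case: AP1. Qed.
Let fin1 (t : R) : 0 <= t -> (A1 t < +oo)%E.
Proof. by exact: (@young_fin R n A1 t n2 yA1 div1). Qed.

(* Compare [t] with [s := theta (E t *: xi)]: if [t <= s] use [E t <= E s], otherwise
   the value [N s] of the right-hand side is at most [N t]. *)
Lemma young_domination (t : R) xi : 0 <= t -> (Psi (E t *: xi) <= c%:E + Phi xi + N t)%E.
Proof.
move=> t0; have N0 := sobolev_conjugate_ge0 n2 yA1 conv1 fin1 div1.
have P0 := young_rV_ge0 yPhi xi.
have [Et0|Et0] := eqVneq (E t *: xi) 0.
  by rewrite Et0 (young_rV_0 yPsi) !adde_ge0// lee_fin.
have Etp : 0 < E t.
  rewrite lt_neqAle E_ge0// andbT; apply/eqP => H; by move: Et0; rewrite -H scale0r eqxx.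
set z := E t *: xi; have [th0 thE] := thetaP z.
apply: le_trans (Psi_le z) _; rewrite -addeA; apply: leeD2l.
have [tht|tth] := leP (theta z) t.
  rewrite -thE; apply: (@le_trans _ _ (N t)); last by rewrite leeDr.
  exact: (sobolev_conjugate_homo n2 yA1 conv1 fin1 div1).
apply: (@le_trans _ _ (Phi xi)); last by rewrite leeDl.
have Eth : E t <= E (theta z) by apply: E_homo => //; exact: ltW.
have Ethp : 0 < E (theta z) by exact: lt_le_trans Eth.
rewrite /young_quotient (negbTE Et0) (gt_eqF Ethp) /z scalerA.
have q01 : 0 <= (E (theta z))^-1 * E t <= 1.
  by rewrite mulr_ge0 ?invr_ge0 ?(ltW Ethp) ?(ltW Etp)//= mulrC ler_pdivrMr// mul1r.
exact: le_trans (young_rV_scale _ yPhi q01) (mule_le1 q01 P0).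
Qed.

(** Needed for the local integrability of [f \o u]. Write [N t = A1 s] and take [xi] of length at
    least [s / (2 n)] with [Phi xi <= N t]. Then [Psi (E t *: xi) <= c + 2 N t], and coercivity
    bounds [s * E t] by a multiple of [1 + N t]; finally [t] is at most a multiple of [1 + s]. *)
Lemma growth_bound (r : R) : (forall x, r < enorm x -> Phi1 x = Phi x) ->
  exists2 C : R, 0 < C & forall t : R, 0 <= t -> ((t * E t)%:E <= C%:E * (1 + N t))%E.
Proof.
move=> Pr; have N0 := sobolev_conjugate_ge0 n2 yA1 conv1 fin1 div1.
have Nfin := sobolev_conjugate_fin n2 yA1 conv1 fin1 div1.
have n0 : (0 : R) < n%:R by rewrite ltr0n ltnW.
have [C1 C10 H1] := sobolev_conjugate_linear n2 yA1 conv1 fin1 div1.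
have [C2 C20 H2] := young_rV_coercive yPsi.
(* Above this threshold the vector [xi] has norm greater than [r], so [Phi1 xi = Phi xi]. For
   smaller [s], [t] is at most [T] and the constant [K1] suffices. *)
pose s0 : R := 1 + 2 * n%:R * `|r|.
have s01 : 1 <= s0 by rewrite lerDl !mulr_ge0.
pose T := C1 * (1 + s0); have T0 : 0 <= T by rewrite mulr_ge0; lra.
pose K1 := T * E T; have K10 : 0 <= K1 by rewrite mulr_ge0// E_ge0.
pose K2 := 2 * C1 * (2 * n%:R * (C2 * (2 + c))).
have c2 : 0 < 2 + c by rewrite ltr_pwDl.
have K20 : 0 < K2 by rewrite !mulr_gt0.
exists (K1 + K2) => [|t t0]; first by lra.
have [s [s_ge0 Ns ts]] := H1 t t0.
pose y := fine (N t); have Ny : N t = y%:E by rewrite fineK// ge0_fin_numE.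
have y0 : 0 <= y by exact: fine_ge0.
have [ss0|s0s] := leP s s0.
  have tT : t <= T by apply: le_trans ts _; rewrite ler_pM2l//; lra.
  apply: (@le_trans _ _ K1%:E).
    by rewrite lee_fin /K1 ler_pM// ?E_ge0// E_homo.
  rewrite Ny -EFinD -EFinM lee_fin; nra.
have sp : 0 < s by lra.
have [xi [Pxi [i xii]]] := sublevel_direction n2 yPhi1 AP1 fin1 sp.
have rxi : r < enorm xi.
  apply: lt_le_trans (coord_le_enorm xi i); apply: le_lt_trans xii.
  rewrite ler_pdivlMr ?mulr_gt0// [r * _]mulrC; apply: (@le_trans _ _ (2 * n%:R * `|r|)).
    by rewrite ler_pM2l ?mulr_gt0// ler_norm.
  by rewrite /s0 in s0s; lra.
rewrite (Pr _ rxi) -Ns Ny in Pxi.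
have D := young_domination xi t0.
have D2 : (Psi (E t *: xi) <= (c + y + y)%:E)%E.
  apply: le_trans D _; rewrite Ny !EFinD; apply: leeD => //; exact: leeD2l.
have D3 : enorm (E t *: xi) <= C2 * (1 + (c + y + y)).
  rewrite -lee_fin; apply: le_trans (H2 _) _; rewrite EFinM EFinD; apply: lee_wpmul2l.
    by rewrite lee_fin ltW.
  exact: leeD2l.
have Et := E_ge0 t0.
have D4 : E t * (s / (2 * n%:R)) <= C2 * (1 + (c + y + y)).
  apply: le_trans D3; apply: le_trans (coord_le_enorm _ i); rewrite mxE normrM ger0_norm//.
  by rewrite ler_wpM2l// ltW.
have D5 : E t * s <= 2 * n%:R * (C2 * (1 + (c + y + y))).
  have -> : E t * s = 2 * n%:R * (E t * (s / (2 * n%:R))) by field; rewrite gt_eqF.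
  by rewrite ler_pM2l// mulr_gt0.
have tE : t * E t <= 2 * C1 * (E t * s).
  rewrite [E t * s]mulrC mulrA; apply: ler_wpM2r => //; apply: le_trans ts _; nra.
rewrite Ny -EFinD -EFinM lee_fin; apply: le_trans tE _.
apply: (@le_trans _ _ (K2 * (1 + y))); last by rewrite ler_wpM2r//; lra.
have -> : K2 * (1 + y) = 2 * C1 * (2 * n%:R * (C2 * ((2 + c) * (1 + y)))) by rewrite /K2; ring.
rewrite ler_pM2l; last by rewrite mulr_gt0.
apply: le_trans D5 _; rewrite ler_pM2l ?mulr_gt0// ler_pM2l//.
have := mulr_ge0 c0 y0; lra.
Qed.

End domination.
End growth.

(** * Convergence *)

Section transfer.
Context {R : realType} {n : nat}.
Local Notation V := 'rV[R]_n.
Local Notation mu := (@borel_lebesgue R n).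
Local Notation lam := (lebesgue_rV R n).
Local Notation LV := (caratheodory_type (@borel_lebesgue R n)^*%mu).
Local Notation E i := (delta_mx ord0 i : V).

Lemma L1loc_locint (v : V -> R) : L1loc v ->
  exists v' : V -> R, locint v' /\ {ae mu, forall x, v x = v' x}.
Proof.
move=> [mv iv]; have [g [mg vg]] := lebesgue_borel_fun mv.
exists g; split => //; split => // r; apply/integrableP; split.
  by apply: measurable_funTS; exact/measurable_EFinP.
have /integrableP[_] := iv _ (@compact_rV_cube R n r).
rewrite (@ge0_integral_lebesgue_ae _ _ _ (fun x => `|(EFin \o v) x|%E) (fun x => `|(EFin \o g) x|%E))//.
- exact: measurable_rV_cube.
- by apply: measurableT_comp => //; exact/measurable_EFinP.
- by apply: filterS vg => x /= ->.
Qed.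

Lemma locint_L1loc (v v' : V -> R) : locint v' -> {ae mu, forall x, v x = v' x} -> L1loc v.
Proof.
move=> [mv iv] vv; split; first exact: lebesgue_measurable_ae mv vv.
move=> K cK; have [r [r0 Kr]] := compact_sub_cube cK.
have mK : measurable K by apply: closed_measurable_rV; apply: compact_closed => //; exact: norm_hausdorff.
apply/integrableP; split.
  apply: measurable_funTS; apply/measurable_EFinP; exact: lebesgue_measurable_ae mv vv.
rewrite (@ge0_integral_lebesgue_ae _ _ K (fun x => `|(EFin \o v) x|%E) (fun x => `|(EFin \o v') x|%E))//; last 2 first.
- by apply: measurableT_comp => //; exact/measurable_EFinP.
- by apply: filterS vv => x /= ->.
have /integrableP[_ H] := iv r; apply: le_lt_trans H.
apply: ge0_subset_integral => //; first exact: measurable_rV_cube.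
by apply: measurable_funTS; apply: measurableT_comp => //; exact/measurable_EFinP.
Qed.

Lemma ae_forall_ord m (P : 'I_m -> V -> Prop) : (forall i, {ae mu, forall x, P i x}) ->
  {ae mu, forall x, forall i, P i x}.
Proof.
move=> aeP; have : {ae mu, forall x, forall k : nat, forall i : 'I_m, k = i -> P i x}.
  apply: ae_foralln => k; have [km|km] := ltnP k m.
    by apply: filterS (aeP (Ordinal km)) => x + i ki; rewrite (_ : Ordinal km = i)//; exact: val_inj.
  by apply: aeW => x i ki; have := ltn_ord i; rewrite -ki ltnNge km.
by apply: filterS => x Hx i; exact: Hx.
Qed.

Lemma ae_eq_coords (G H : V -> V) : (forall i, {ae mu, forall x, G x ord0 i = H x ord0 i}) ->
  {ae mu, forall x, G x = H x}.
Proof. by move=> /ae_forall_ord; apply: filterS => x Hx; exact/rowP. Qed.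

Lemma integral_lebesgue_mul_ae (v v' phi : V -> R) : measurable_fun setT v' -> measurable_fun setT phi ->
  {ae mu, forall x, v x = v' x} ->
  (\int[lam]_x (v x * phi x)%:E = \int[mu]_x (v' x * phi x)%:E)%E.
Proof.
move=> mv mp vv; apply: integral_lebesgue_ae => //.
  by apply/measurable_EFinP; exact: measurable_funM.
by apply: filterS vv => x ->.
Qed.

Lemma weak_gradient_bweak (v : V -> R) G : weak_gradient v G -> exists v' G',
  [/\ bweak v' G', {ae mu, forall x, v x = v' x} & {ae mu, forall x, G x = G' x}].
Proof.
move=> [lv lG w]; have [v' [lv' vv]] := L1loc_locint lv.
have /choice[g gP] i := L1loc_locint (lG i).
pose G' x : V := \row_i g i x.
have G'E i : (fun x => G' x ord0 i) = g i by apply/funext => x; rewrite mxE.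
have GG i : {ae mu, forall x, G x ord0 i = G' x ord0 i}.
  by have [_] := gP i; apply: filterS => x ->; rewrite mxE.
have lG' i : locint (fun x => G' x ord0 i) by rewrite G'E; have [] := gP i.
exists v', G'; split => //; last exact: ae_eq_coords.
split => // phi i tphi; have := w phi i tphi.
have mphi := test_measurable tphi.
rewrite (integral_lebesgue_mul_ae (proj1 lv') _ vv); last exact: test_measurable (test_partial _ tphi).
rewrite (integral_lebesgue_mul_ae (proj1 (lG' i)) mphi (GG i)).
by move=> /(congr1 fine); rewrite fineN.
Qed.

Lemma bweak_weak_gradient (v v' : V -> R) G : bweak v' G -> {ae mu, forall x, v x = v' x} -> weak_gradient v G.
Proof.
move=> [lv lG w] vv; split.
- exact: locint_L1loc vv.
- by move=> i; apply: locint_L1loc (lG i) _; exact: aeW.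
move=> phi i tphi; have mphi := test_measurable tphi.
have tD := test_partial i tphi.
rewrite (integral_lebesgue_mul_ae (proj1 lv) _ vv); last exact: test_measurable tD.
rewrite (integral_lebesgue_mul_ae (proj1 (lG i)) mphi); last exact: aeW.
have i1 := integrable_test lv tD; have i2 := integrable_test (lG i) tphi.
have := w phi i tphi; rewrite /Rintegral.
rewrite -[in X in _ -> X](fineK (integrable_fin_num measurableT i1)).
rewrite -[in X in _ -> X](fineK (integrable_fin_num measurableT i2)).
by move=> H; rewrite -EFinN -H.
Qed.

Lemma ae_volume_le (v v' : V -> R) (t : R) : measurable_fun setT v' -> {ae mu, forall x, v x = v' x} ->
  (mu [set x | (t < `|v' x|)%R] <= lam [set x | (t < `|v x|)%R])%E.
Proof.
move=> mv' [N [mN N0 PN]].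
have mB : measurable [set x | t < `|v' x|].
  by apply: (@measurable_gt _ _ (fun x => `|v' x|)); exact: measurableT_comp.
rewrite -(lebesgue_rVE mB).
apply: (@le_trans _ _ (lam ([set x | (t < `|v x|)%R] `|` N))).
  apply: le_outer_measure => x /= tx; have [Nx|Nx] := pselect (N x); [by right|left].
  have -> : v x = v' x by apply: contrapT => H; apply: Nx; exact: PN.
  by [].
apply: le_trans (outer_measureU2 _ _ _) _.
have lN : lam N = 0%E by rewrite lebesgue_rVE.
by rewrite [X in (_ + X)%E]lN adde0.
Qed.

Lemma modular_integral_ae (Phi : V -> \bar R) (D : set V) (G G' : V -> V) : young_rV Phi ->
  measurable D -> measurable_fun setT G' -> {ae mu, forall x, G x = G' x} ->
  (\int[lam]_(x in D) Phi (G x) = \int[mu]_(x in D) Phi (G' x))%E.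
Proof.
move=> yP mD mG GG; apply: ge0_integral_lebesgue_ae => //.
- exact: measurableT_comp (measurable_young_rV yP) mG.
- by move=> x; exact: young_rV_ge0.
- by move=> x; exact: young_rV_ge0.
- by apply: filterS GG => x ->.
Qed.

End transfer.

(** * Convergence of integrals and subsequences *)

Section convergence.
Context d (T : measurableType d) {R : realType} (mu : {measure set T -> \bar R}).

(* [min (f_ k) g] is handled by dominated convergence; the excess is at most [h_ k]. *)
Lemma dominated_cvg0 (D : set T) (f_ h_ : nat -> T -> \bar R) (g : T -> \bar R) : measurable D ->
  (forall k, measurable_fun D (f_ k)) -> (forall k, measurable_fun D (h_ k)) -> measurable_fun D g ->
  (forall k x, (0 <= f_ k x)%E) -> (forall k x, (0 <= h_ k x)%E) -> (forall x, (0 <= g x)%E) ->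
  (forall k x, D x -> (f_ k x <= g x + h_ k x)%E) ->
  (\int[mu]_(x in D) g x < +oo)%E ->
  (\int[mu]_(x in D) h_ k x)%E @[k --> \oo] --> 0%E ->
  {ae mu, forall x, D x -> f_ k x @[k --> \oo] --> 0%E} ->
  (\int[mu]_(x in D) f_ k x)%E @[k --> \oo] --> 0%E.
Proof.
move=> mD mf mh mg f0 h0 g0 fgh ig ih ff.
have mm k : measurable_fun D (fun x => mine (f_ k x) (g x)) by exact: measurable_mine.
have ae0 : {ae mu, forall x, D x -> mine (f_ k x) (g x) @[k --> \oo] --> cst 0%E x}.
  apply: filterS ff => x /= Hx Dx.
  apply: (squeeze_cvge _ (cvg_cst _) (Hx Dx)).
  by apply: nearW => k /=; rewrite le_min f0 g0 ge_min lexx.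
have ig' : mu.-integrable D g.
  by apply/integrableP; split => //; rewrite (eq_integral g)// => x _; rewrite gee0_abs.
have dom : {ae mu, forall x k, D x -> (`|mine (f_ k x) (g x)| <= g x)%E}.
  apply: aeW => x k _; rewrite gee0_abs ?ge_min ?lexx ?orbT//.
  by rewrite le_min f0 g0.
have c1 : (\int[mu]_(x in D) mine (f_ k x) (g x))%E @[k --> \oo] --> 0%E.
  have [_ _] := @dominated_convergence _ _ _ mu D mD (fun k x => mine (f_ k x) (g x)) (cst 0%E) g mm
    (measurable_cst _) ae0 ig' dom.
  by rewrite integral0.
have c2 : (\int[mu]_(x in D) mine (f_ k x) (g x) + \int[mu]_(x in D) h_ k x)%E @[k --> \oo] --> 0%E.
  by rewrite -[0%E in X in _ --> X]add0e; apply: cvgeD.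
apply: (squeeze_cvge _ (cvg_cst _) c2).
- apply: nearW => k; rewrite integral_ge0//=.
  rewrite -ge0_integralD//; last by move=> x _; rewrite le_min f0 g0.
  apply: ge0_le_integral => //.
  + exact: emeasurable_funD.
  + move=> x Dx; rewrite /mine; case: ifPn => _; first by rewrite leeDl.
    exact: fgh.
Qed.

Lemma subseq_eventually (P : nat -> nat -> Prop) : (forall k, exists m, forall j, (m <= j)%N -> P k j) ->
  exists s : nat -> nat, (forall i j, (i < j)%N -> (s i < s j)%N) /\ forall k, P k (s k).
Proof.
move=> /choice[m mP].
pose s := fix s k := if k is k'.+1 then maxn (m k) (s k').+1 else m 0%N.
have sS k : (s k < s k.+1)%N by rewrite /= leq_max leqnn orbT.
exists s; split.
  move=> i j; elim: j => // j IH; rewrite ltnS leq_eqVlt => /predU1P[->//|/IH/ltn_trans]; exact.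
by case=> [|k]; apply: mP => //=; rewrite leq_maxl.
Qed.

(** Diagonal choice: the integral over [C k] of the [k]-th selected term is at most [2 ^ - (k + 1)],
    so the series of these truncated terms is integrable and its terms tend to 0 almost everywhere.
    Every point is eventually in [C k]. The finite index [J] allows one subsequence for all
    coordinates. *)
Lemma integral_cvg0_subseq (J : finType) (C : nat -> set T) (f_ : J -> nat -> T -> \bar R) :
  (forall m, measurable (C m)) ->
  (forall i j, (i <= j)%N -> C i `<=` C j) -> \bigcup_m C m = setT ->
  (forall a k, measurable_fun setT (f_ a k)) -> (forall a k x, (0 <= f_ a k x)%E) ->
  (forall a m, (\int[mu]_(x in C m) f_ a k x)%E @[k --> \oo] --> 0%E) ->
  exists s : nat -> nat, (forall i j, (i < j)%N -> (s i < s j)%N) /\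
    forall a, {ae mu, forall x, f_ a (s k) x @[k --> \oo] --> 0%E}.
Proof.
move=> mC ndC CT mf f0 c.
have [s [sinc sP]] : exists s : nat -> nat, (forall i j, (i < j)%N -> (s i < s j)%N) /\
    forall k a, (\int[mu]_(x in C k) f_ a (s k) x <= (1 / (2 ^ (k + 1))%:R)%:E)%E.
  apply: (@subseq_eventually (fun k j => forall a, (\int[mu]_(x in C k) f_ a j x <= (1 / (2 ^ (k + 1))%:R)%:E)%E)) => k.
  have p0 : (0 : R) < 1 / (2 ^ (k + 1))%:R by rewrite divr_gt0// ltr0n expn_gt0.
  have /choice[m Hm] a : exists m, forall j, (m <= j)%N -> (\int[mu]_(x in C k) f_ a j x <= (1 / (2 ^ (k + 1))%:R)%:E)%E.
    have /fine_cvgP[F H] := c a k.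
    have [m _ Hm] : \forall j \near \oo, (\int[mu]_(x in C k) f_ a j x <= (1 / (2 ^ (k + 1))%:R)%:E)%E.
      near=> j; have Fj : (\int[mu]_(x in C k) f_ a j x)%E \is a fin_num by near: j.
      rewrite -(fineK Fj) lee_fin; near: j; exact: (cvgr_le _ H).
    by exists m => j mj; exact: Hm.
  exists (\max_a m a)%N => j mj a; apply: Hm; apply: leq_trans mj; exact: leq_bigmax.
exists s; split => // a.
pose F k x := (f_ a (s k) \_ (C k)) x.
have F0 k x : (0 <= F k x)%E by rewrite /F patchE; case: ifP.
have mF k : measurable_fun setT (F k).
  by apply/(measurable_restrictT _ (mC k)); exact: measurable_funTS.
have IF : (\int[mu]_x (\sum_(0 <= k <oo) F k x) < +oo)%E.
  rewrite integral_nneseries//.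
  apply: (@le_lt_trans _ _ (\sum_(0 <= k <oo) (1 / (2 ^ (k + 1))%:R)%:E)%E).
    apply: lee_nneseries => [k _ _|k _]; first exact: integral_ge0.
    by apply: le_trans (sP k a); rewrite [leRHS]integral_mkcond.
  by rewrite (cvg_lim _ (@cvg_geometric_eseries_half R 1 0))// ltry.
have iS : mu.-integrable setT (fun x => \sum_(0 <= k <oo) F k x)%E.
  apply/integrableP; split; first exact: ge0_emeasurable_sum.
  by rewrite (eq_integral (fun x => \sum_(0 <= k <oo) F k x)%E)// => x _; rewrite gee0_abs// nneseries_ge0.
have := integrable_ae measurableT iS; apply: filterS => x /(_ I) Hx.
have Sx : (\sum_(0 <= k <oo) F k x < +oo)%E by rewrite ltey_eq Hx.
have cF : F k x @[k --> \oo] --> 0%E.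
  have tc := nneseries_tail_cvg Sx (fun k _ => F0 k x).
  apply: (squeeze_cvge _ (cvg_cst _) tc).
  apply: nearW => k /=; rewrite F0/=.
  by have := @nneseries_lim_ge R (fun j => F j x) xpredT k k.+1; rewrite big_nat1; apply.
have [m _ Cmx] : (\bigcup_m C m) x by rewrite CT.
apply: cvg_trans cF; apply: near_eq_cvg; exists m => // k /= mk.
by rewrite /F patchE mem_set//; exact: (ndC m).
Unshelve. all: by end_near. Qed.

(** If convergence failed, a subsequence would stay above some positive [eps], and so would all of
    its subsequences. *)
Lemma subsubseq_cvg0 (a : nat -> \bar R) : (forall k, (0 <= a k)%E) ->
  (forall s : nat -> nat, (forall i j, (i < j)%N -> (s i < s j)%N) ->
    exists t : nat -> nat, (forall i j, (i < j)%N -> (t i < t j)%N) /\ a (s (t k)) @[k --> \oo] --> 0%E) ->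
  a k @[k --> \oo] --> 0%E.
Proof.
move=> a0 H; suff Hev : forall eps : R, 0 < eps -> exists m, forall j, (m <= j)%N -> (a j < eps%:E)%E.
  apply/fine_cvgP; split.
    have [m Hm] := Hev 1 ltr01; exists m => // j /= mj.
    by rewrite ge0_fin_numE//; exact: lt_trans (Hm j mj) (ltry _).
  apply/cvgrPdist_lt => eps eps0; have [m Hm] := Hev eps eps0; exists m => // j /= mj.
  have aj : (a j < +oo)%E by exact: lt_trans (Hm j mj) (ltry _).
  rewrite sub0r normrN ger0_norm ?fine_ge0// -lte_fin fineK ?ge0_fin_numE//.
  exact: Hm.
move=> eps eps0; apply: contrapT => /forallNP N.
have [s [sinc sP]] : exists s : nat -> nat, (forall i j, (i < j)%N -> (s i < s j)%N) /\
    forall k, (eps%:E <= a (s k))%E.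
  have {}N m : exists j, (m <= j)%N /\ (eps%:E <= a j)%E.
    have /existsNP[j /not_implyP[mj /negP]] := N m; rewrite -leNgt => h.
    by exists j.
  have [m mP] := choice N.
  pose s := fix s k := if k is k'.+1 then m (s k').+1 else m 0%N.
  have sS k : (s k < s k.+1)%N by rewrite /=; have [] := mP (s k).+1.
  exists s; split.
    move=> i j; elim: j => // j IH; rewrite ltnS leq_eqVlt => /predU1P[->//|/IH/ltn_trans]; exact.
  by case=> [|k] /=; [have [] := mP 0%N|have [] := mP (s k).+1].
have [t [tinc /fine_cvgP[F c]]] := H s sinc.
have : \forall k \near \oo, False.
  near=> k; have Fk : a (s (t k)) \is a fin_num by near: k.
  have := sP (t k); rewrite -(fineK Fk) lee_fin leNgt => /negP; apply.
  by near: k; exact: (cvgr_lt _ c).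
by move=> [k _ /(_ k)/=]; rewrite leqnn; apply.
Unshelve. all: by end_near. Qed.

End convergence.

(** * Composition with a merely measurable function under weak convergence *)

Section weak_continuity.
Context {R : realType} {n : nat}.
Local Notation V := 'rV[R]_n.
Local Notation mu := (@borel_lebesgue R n).
Local Notation mu1 := (@lebesgue_measure R).
Local Notation E i := (delta_mx ord0 i : V).

Lemma cvg_exchange (a : nat -> nat -> R) (b e B : nat -> R) (b0 : R) :
  (forall m, a m j @[j --> \oo] --> b m) -> (forall m j, `|a m j - B j| <= e m) ->
  (forall m, `|b m - b0| <= e m) -> e m @[m --> \oo] --> (0 : R) -> B j @[j --> \oo] --> b0.
Proof.
move=> ab aB bb e0; apply/cvgrPdist_le => eps eps0.
have e30 : 0 < eps / 3 by rewrite divr_gt0.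
have [m _ Hm] : \forall m \near \oo, e m <= eps / 3 by exact: (cvgr_le _ e0).
have em := Hm m (leqnn m).
near=> j.
have H : `|b m - a m j| <= eps / 3 by near: j; have /cvgrPdist_le/(_ _ e30) := ab m.
have -> : b0 - B j = - (b m - b0) + (b m - a m j) + (a m j - B j) by ring.
apply: le_trans (ler_normD _ _) _; apply: le_trans (lerD (ler_normD _ _) (lexx _)) _.
rewrite normrN; have := bb m; have := aB m j; lra.
Unshelve. all: by end_near. Qed.

Lemma cvgD_perturb (a b c : nat -> R) (l : R) : (forall k, c k = a k + b k) ->
  a k @[k --> \oo] --> l -> b k @[k --> \oo] --> (0 : R) -> c k @[k --> \oo] --> l.
Proof.
by move=> cab al b0; rewrite (_ : c = a \+ b); [rewrite -[l]addr0; exact: cvgD|exact/funext].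
Qed.

Lemma oint_lipschitz (h : R -> R) (M x y : R) : measurable_fun setT h -> (forall t, `|h t| <= M) ->
  `|oint h x y| <= M * `|y - x|.
Proof.
move=> mh hM; wlog xy : x y / x <= y => [H|].
  by have [/H//|/ltW/H] := leP x y; rewrite ointC normrN (distrC y).
rewrite oint_le// [X in _ <= _ * X]ger0_norm ?subr_ge0//.
have := @Rintegral_itv_approx R h M M 0 x y mh hM xy; rewrite mul0r subr0; apply=> t _.
by rewrite subr0.
Qed.

Variables (u : V -> R) (G : V -> V) (u_ : nat -> V -> R) (G_ : nat -> V -> V).
Hypothesis wu : bweak u G.
Hypothesis wu_ : forall k, bweak (u_ k) (G_ k).
Hypothesis ucvg : forall r : R, \int[mu]_(x in rV_cube r) `|u_ k x - u x| @[k --> \oo] --> (0 : R).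
Hypothesis Gcvg : forall (r : R) i, \int[mu]_(x in rV_cube r) `|G_ k x ord0 i - G x ord0 i| @[k --> \oo] --> (0 : R).

Let mu_ : measurable_fun setT u. Proof. by case: wu => [[]]. Qed.
Let mu_k k : measurable_fun setT (u_ k). Proof. by case: (wu_ k) => [[]]. Qed.
Let lG i : locint (fun x => G x ord0 i). Proof. by case: wu. Qed.
Let lG_ k i : locint (fun x => G_ k x ord0 i). Proof. by case: (wu_ k). Qed.

Lemma integral_test_diff (v w psi : V -> R) (M r : R) : locint v -> locint w -> measurable_fun setT psi ->
  (forall x, `|psi x| <= M) -> (forall x, ~ rV_cube r x -> psi x = 0) ->
  `|\int[mu]_x (v x * psi x) - \int[mu]_x (w x * psi x)| <= M * \int[mu]_(x in rV_cube r) `|v x - w x|.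
Proof.
move=> lv lw mp pM p0; have [mv iv] := lv; have [mw iw] := lw.
have i1 := locint_test lv mp pM p0; have i2 := locint_test lw mp pM p0.
have mc : measurable (rV_cube r : set V) by exact: measurable_rV_cube.
have id0 : mu.-integrable (rV_cube r) (EFin \o (fun x => `|v x - w x|)).
  exact: (integrable_abse (integrableB mc (iv r) (iw r))).
have iB : mu.-integrable setT (EFin \o (fun x => v x * psi x - w x * psi x)).
  exact: (integrableB measurableT i1 i2).
rewrite -RintegralB//; apply: (le_trans (le_normr_Rintegral measurableT iB)).
rewrite -RintegralZl// [leRHS]Rintegral_indic; apply: le_Rintegral => //.
- exact: (integrable_abse iB).
- exact: (proj1 (integrable_mul_indic mu (fun x => M * `|v x - w x|) mc) (integrableZl mc M id0)).
move=> x _; rewrite -mulrBl normrM indicE; have [/set_mem xr|/negP xr] := boolP (x \in rV_cube r).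
  by rewrite mulr1 mulrC ler_wpM2r.
by rewrite p0 ?normr0 ?mulr0// => H; apply: xr; exact/mem_set.
Qed.

Section test.
Variables (h : R -> R) (M : R).
Hypothesis mh : measurable_fun setT h.
Hypothesis hM : forall t, `|h t| <= M.

Let M0 : 0 <= M. Proof. exact: le_trans (hM 0). Qed.

Let mhu (v : V -> R) : measurable_fun setT v -> measurable_fun setT (h \o v).
Proof. by move=> mv; exact: measurableT_comp. Qed.

Let lhG (v : V -> R) (H : V -> V) i : measurable_fun setT v -> locint (fun x => H x ord0 i) ->
  locint (fun x => h (v x) * H x ord0 i).
Proof.
move=> mv lH; have := locint_mul_bounded lH (mhu mv) (M := M) (fun x => hM (v x)).
by under eq_fun do rewrite mulrC.
Qed.

Let lF (v : V -> R) : locint v -> locint (oint h 0 \o v).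
Proof.
move=> [mv iv]; have mF : measurable_fun setT (oint h 0).
  apply: continuous_measurable_fun => x; apply/cvgrPdist_le => eps eps0.
  have M1 : 0 < M + 1 by rewrite ltr_wpDl.
  near=> y; have -> : oint h 0 x - oint h 0 y = - oint h x y.
    by rewrite (@ointD _ h M 0 x y mh hM) opprD addNKr.
  rewrite normrN; apply: le_trans (oint_lipschitz _ _ mh hM) _.
  apply: (@le_trans _ _ ((M + 1) * `|y - x|)); first by rewrite ler_wpM2r// lerDl.
  rewrite mulrC -ler_pdivlMr// distrC; near: y; apply: cvgr_dist_le; last exact: divr_gt0.
  exact: cvg_id.
split; first exact: measurableT_comp.
move=> r; have mc : measurable (rV_cube r : set V) by exact: measurable_rV_cube.
apply: (@le_integrable _ _ _ mu _ mc _ (EFin \o (fun x => M * v x))).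
- by apply/measurable_EFinP; apply: measurable_funTS; exact: measurableT_comp.
- move=> x _; rewrite /= lee_fin normrM [leRHS](_ : _ = M * `|v x - 0|); last by rewrite ger0_norm// subr0.
  exact: oint_lipschitz.
- exact: (integrableZl mc M (iv r)).
Unshelve. all: by end_near. Qed.

Let wF (v : V -> R) H : bweak v H -> bweak (oint h 0 \o v) (fun x => h (v x) *: H x).
Proof.
move=> wv; have [lv lH _] := wv; apply: bweak_chain => //.
- by move=> K; exists M => t _.
- by move=> a b; rewrite (@ointD _ h M 0 a b mh hM) addrAC subrr add0r.
- exact: lF.
- by move=> i; apply: lhG => //; case: lv.
Qed.

(** [h (u_k) G_k] is the weak gradient of [oint h 0 \o u_k]. As [oint h 0] is Lipschitz, this
    composition converges in local L1, so the weak identity passes to the limit although [h] may be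
    discontinuous. *)
Lemma weak_test_cvg phi i : test_function phi ->
  \int[mu]_x (h (u_ k x) * G x ord0 i * phi x) @[k --> \oo] --> \int[mu]_x (h (u x) * G x ord0 i * phi x).
Proof.
move=> tphi; have tD := test_partial i tphi.
have [r r0 pr] := test_supp tphi; have [B B0 pB] := test_bounded tphi.
have [r' r'0 pr'] := test_supp tD; have [B' B'0 pB'] := test_bounded tD.
have lu : locint u by case: wu.
have lu_ k : locint (u_ k) by case: (wu_ k).
have E0 (v : V -> R) H : bweak v H -> \int[mu]_x (h (v x) * H x ord0 i * phi x) =
    - \int[mu]_x ((oint h 0 \o v) x * 'D_(E i) phi x).
  move=> wv; have [_ _ /(_ phi i tphi) ->] := wF wv; rewrite opprK.
  by apply: eq_Rintegral => x _; rewrite mxE.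
have c1 : - (\int[mu]_x ((oint h 0 \o u_ k) x * 'D_(E i) phi x)) @[k --> \oo] -->
    - (\int[mu]_x ((oint h 0 \o u) x * 'D_(E i) phi x)).
  apply: cvgN; apply/cvgrPdist_le => eps eps0.
  have B1 : 0 < B' * M + 1 by rewrite ltr_wpDl// mulr_ge0.
  near=> k.
  rewrite distrC; apply: le_trans (integral_test_diff (lF (lu_ k)) (lF lu) (test_measurable tD) pB' pr') _.
  have mc : measurable (rV_cube r' : set V) by exact: measurable_rV_cube.
  have iuk : mu.-integrable (rV_cube r') (EFin \o (fun x => `|u_ k x - u x|)).
    exact: (integrable_abse (integrableB mc (proj2 (lu_ k) r') (proj2 lu r'))).
  have iF : mu.-integrable (rV_cube r') (EFin \o (fun x => `|oint h 0 (u_ k x) - oint h 0 (u x)|)).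
    exact: (integrable_abse (integrableB mc (proj2 (lF (lu_ k)) r') (proj2 (lF lu) r'))).
  apply: (@le_trans _ _ (B' * (M * \int[mu]_(x in rV_cube r') `|u_ k x - u x|))).
    apply: ler_wpM2l => //; rewrite -RintegralZl//; apply: le_Rintegral => //.
      exact: (integrableZl mc M iuk).
    move=> x _ /=; rewrite (@ointD _ h M 0 (u x) (u_ k x) mh hM) addrAC subrr add0r.
    exact: oint_lipschitz.
  rewrite mulrA; apply: (@le_trans _ _ ((B' * M + 1) * \int[mu]_(x in rV_cube r') `|u_ k x - u x|)).
    by rewrite ler_wpM2r ?lerDl//; apply: Rintegral_ge0 => x _; exact: normr_ge0.
  rewrite mulrC -ler_pdivlMr//; near: k; apply: (cvgr_le _ (ucvg r')); exact: divr_gt0.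
(* Replacing [G_k] by [G] costs at most [B * M] times a local L1 distance that tends to 0. *)
have c2 : (\int[mu]_x (h (u_ k x) * G x ord0 i * phi x) -
    \int[mu]_x (h (u_ k x) * G_ k x ord0 i * phi x)) @[k --> \oo] --> (0 : R).
  apply/cvgrPdist_le => eps eps0.
  have B1 : 0 < B * M + 1 by rewrite ltr_wpDl// mulr_ge0.
  near=> k; rewrite sub0r normrN.
  apply: le_trans (integral_test_diff (lhG (mu_k k) (lG i)) (lhG (mu_k k) (lG_ k i)) (test_measurable tphi) pB pr) _.
  have mc : measurable (rV_cube r : set V) by exact: measurable_rV_cube.
  have iG : mu.-integrable (rV_cube r) (EFin \o (fun x => `|G_ k x ord0 i - G x ord0 i|)).
    exact: (integrable_abse (integrableB mc (proj2 (lG_ k i) r) (proj2 (lG i) r))).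
  have iF : mu.-integrable (rV_cube r) (EFin \o (fun x => `|h (u_ k x) * G x ord0 i - h (u_ k x) * G_ k x ord0 i|)).
    exact: (integrable_abse (integrableB mc (proj2 (lhG (mu_k k) (lG i)) r) (proj2 (lhG (mu_k k) (lG_ k i)) r))).
  apply: (@le_trans _ _ (B * (M * \int[mu]_(x in rV_cube r) `|G_ k x ord0 i - G x ord0 i|))).
    apply: ler_wpM2l => //; rewrite -RintegralZl//; apply: le_Rintegral => //.
      exact: (integrableZl mc M iG).
    by move=> x _; rewrite -mulrBr normrM distrC ler_wpM2r.
  rewrite mulrA; apply: (@le_trans _ _ ((B * M + 1) * \int[mu]_(x in rV_cube r) `|G_ k x ord0 i - G x ord0 i|)).
    by rewrite ler_wpM2r ?lerDl//; apply: Rintegral_ge0 => x _; exact: normr_ge0.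
  rewrite mulrC -ler_pdivlMr//; near: k; apply: (cvgr_le _ (Gcvg r i)); exact: divr_gt0.
apply: (cvgD_perturb _ (eq_ind_r (fun l : R => _ @ \oo --> l) c1 (E0 _ _ wu)) c2) => k.
by rewrite -(E0 _ _ (wu_ k)) addrC subrK.
Unshelve. all: by end_near. Qed.

Let D (k : nat) : set V := rV_box (const_mx (- k%:R)) (const_mx k%:R).
Let mD k : measurable (D k). Proof. exact: measurable_rV_box. Qed.
Let iD k i : mu.-integrable (D k) (EFin \o (fun x => G x ord0 i)).
Proof.
have DS : D k `<=` rV_cube k%:R.
  by move=> x Dx j; have := Dx j; rewrite !mxE => /andP[/ltW -> /ltW ->].
exact: (integrableS (measurable_rV_cube _) (mD k) DS (proj2 (lG i) _)).
Qed.
Let mG i : measurable_fun setT (fun x => G x ord0 i). Proof. by case: (lG i). Qed.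

Let ihG k i (v psi : V -> R) (B : R) : measurable_fun setT v -> measurable_fun setT psi -> (forall x, `|psi x| <= B) ->
  mu.-integrable (D k) (EFin \o (fun x => h (v x) * G x ord0 i * psi x)).
Proof.
move=> mv mpsi pB; have -> : (fun x => h (v x) * G x ord0 i * psi x) = (fun x => G x ord0 i * (h (v x) * psi x)).
  by apply/funext => x; ring.
apply: (integrable_mul_bounded (M := M * B) (mD k) (iD k i)).
  by apply: measurable_funTS; apply: measurable_funM => //; exact: mhu.
by move=> x _; rewrite normrM ler_pM.
Qed.

Let ihG_diff k i (v psi psi' : V -> R) (B : R) : measurable_fun setT v -> measurable_fun setT psi ->
  measurable_fun setT psi' -> (forall x, `|psi x| <= B) -> (forall x, `|psi' x| <= B) ->
  `|\int[mu]_(x in D k) (h (v x) * G x ord0 i * psi x) - \int[mu]_(x in D k) (h (v x) * G x ord0 i * psi' x)| <=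
  M * \int[mu]_(x in D k) `|G x ord0 i * (psi x - psi' x)|.
Proof.
move=> mv mp mp' pB p'B; have i1 := ihG k i mv mp pB; have i2 := ihG k i mv mp' p'B.
have i3 : mu.-integrable (D k) (EFin \o (fun x => `|G x ord0 i * (psi x - psi' x)|)).
  have i0 : mu.-integrable (D k) (EFin \o (fun x => G x ord0 i * (psi x - psi' x))).
    apply: (integrable_mul_bounded (M := B + B) (mD k) (iD k i)).
      by apply: measurable_funTS; exact: measurable_funB.
    by move=> x _; apply: le_trans (ler_normB _ _) _; exact: lerD.
  exact: (integrable_abse i0).
have iB : mu.-integrable (D k) (EFin \o (fun x => h (v x) * G x ord0 i * psi x - h (v x) * G x ord0 i * psi' x)).
  exact: (integrableB (mD k) i1 i2).
rewrite -RintegralB//; apply: (le_trans (le_normr_Rintegral (mD k) iB)).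
rewrite -RintegralZl//; apply: le_Rintegral => //.
- exact: (integrable_abse iB).
- exact: (integrableZl (mD k) M i3).
move=> x _; rewrite -mulrBr -mulrA normrM; apply: ler_wpM2r => //; exact: hM.
Qed.

Let ihG_lim k i (B : R) (psi_ : nat -> V -> R) (psi : V -> R) : (forall m, measurable_fun setT (psi_ m)) ->
  measurable_fun setT psi -> (forall m x, `|psi_ m x| <= B) -> (forall x, `|psi x| <= B) ->
  (forall x, psi_ m x @[m --> \oo] --> psi x) ->
  (forall m, \int[mu]_(x in D k) (h (u_ j x) * G x ord0 i * psi_ m x) @[j --> \oo] -->
     \int[mu]_(x in D k) (h (u x) * G x ord0 i * psi_ m x)) ->
  \int[mu]_(x in D k) (h (u_ j x) * G x ord0 i * psi x) @[j --> \oo] -->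
     \int[mu]_(x in D k) (h (u x) * G x ord0 i * psi x).
Proof.
move=> mp_ mp p_B pB pp H.
apply: (cvg_exchange (e := fun m => M * \int[mu]_(x in D k) `|G x ord0 i * (psi_ m x - psi x)|) H).
- by move=> m j; exact: ihG_diff.
- by move=> m; exact: ihG_diff.
rewrite -[X in _ --> X](mulr0 M); apply: cvgMr.
have <- : \int[mu]_(x in D k) (cst 0 : V -> R) x = 0 by rewrite Rintegral_cst// mul0r.
have B0 : 0 <= B by exact: le_trans (pB 0).
apply: (@Rintegral_dominated_cvg _ _ _ _ _ _ _ (fun x => `|G x ord0 i| * (B + B))) => //.
- move=> m; apply: measurable_funTS; apply: measurableT_comp => //; apply: measurable_funM => //.
  exact: measurable_funB.
- move=> x _; have -> : cst 0 x = `|G x ord0 i * (psi x - psi x)| by rewrite subrr mulr0 normr0.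
  apply: cvg_norm; apply: cvgMr; apply: cvgB => //; exact: cvg_cst.
- exact: (integrableZr (mD k) (B + B) (integrable_abse (iD k i))).
- move=> m x _; rewrite normr_id normrM ler_wpM2l//.
  by apply: le_trans (ler_normB _ _) _; exact: lerD.
Qed.

(** Boxes, hence bounded Borel functions, are reached by a monotone class argument. Limits in [psi]
    and in [j] may be exchanged because the error from changing [psi] is uniform in [j], by the
    bound on [h]. *)
Lemma weak_bounded_cvg k i (psi : V -> R) (B : R) : measurable_fun setT psi -> (forall x, `|psi x| <= B) ->
  \int[mu]_(x in D k) (h (u_ j x) * G x ord0 i * psi x) @[j --> \oo] -->
  \int[mu]_(x in D k) (h (u x) * G x ord0 i * psi x).
Proof.
have box0 a b : rV_box a b `<=` D k ->
    \int[mu]_(x in D k) (h (u_ j x) * G x ord0 i * \1_(rV_box a b) x) @[j --> \oo] -->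
    \int[mu]_(x in D k) (h (u x) * G x ord0 i * \1_(rV_box a b) x).
  move=> abk; apply: (ihG_lim (B := 1) (psi_ := box_bump a b)).
  - by move=> m; exact: test_measurable (box_bump_test a b m).
  - by apply: measurable_indic; exact: measurable_rV_box.
  - by move=> m x; rewrite ger0_norm ?box_bump_ge0//; exact: box_bump_le1.
  - by move=> x; rewrite indicE normr_nat lern1 leq_b1.
  - by move=> x; exact: box_bump_cvg.
  - move=> m; have EI (f : V -> R) : \int[mu]_(x in D k) (f x * box_bump a b m x) = \int[mu]_x (f x * box_bump a b m x).
      rewrite [LHS]Rintegral_indic; apply: eq_Rintegral => x _; rewrite indicE.
      have [xr|/negP xr] := boolP (x \in _); first by rewrite mulr1.
      rewrite mulr0 box_bump_supp ?mulr0// => /abk Dx; apply: xr; exact/mem_set.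
    rewrite EI; under eq_fun do rewrite EI.
    by apply: weak_test_cvg; exact: box_bump_test.
move=> mpsi pB; move: psi B mpsi pB.
apply: (bounded_measurable_ind setI_closed_rV_boxes measurable_rV_boxes).
- move=> A GA; have [c [d AE]] : rV_boxes (A `&` D k).
    by apply: setI_closed_rV_boxes => //; do 2 eexists.
  have EA (f : V -> R) : \int[mu]_(x in D k) (f x * \1_A x) = \int[mu]_(x in D k) (f x * \1_(rV_box c d) x).
    rewrite -AE; apply: eq_Rintegral => x /set_mem Dx.
    by rewrite !indicE in_setI (mem_set Dx) andbT.
  rewrite EA; under eq_fun do rewrite EA.
  by apply: box0; rewrite -AE; exact: subIsetr.
- have E1 (f : V -> R) : \int[mu]_(x in D k) (f x * cst 1 x) = \int[mu]_(x in D k) (f x * \1_(D k) x).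
    by apply: eq_Rintegral => x xD; rewrite indicE xD.
  rewrite E1; under eq_fun do rewrite E1.
  exact: box0.
- move=> a f0 g0 mf mg [Mf fM] [Mg gM] Pf Pg.
  have EL (v : V -> R) : measurable_fun setT v -> \int[mu]_(x in D k) (h (v x) * G x ord0 i * (a * f0 x + g0 x)) =
      a * \int[mu]_(x in D k) (h (v x) * G x ord0 i * f0 x) + \int[mu]_(x in D k) (h (v x) * G x ord0 i * g0 x).
    move=> mv; have If := ihG k i mv mf fM; have Ig := ihG k i mv mg gM.
    rewrite -RintegralZl// -RintegralD//; last exact: (integrableZl (mD k) a If).
    by apply: eq_Rintegral => x _; ring.
  rewrite EL//; under eq_fun do rewrite EL//.
  by apply: cvgD => //; exact: cvgMr.
- move=> f_ f0 M' mf_ mf fM Pf_ ff; apply: (ihG_lim (B := M') mf_ mf fM _ ff Pf_).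
  move=> x; have c : `|f_ m x| @[m --> \oo] --> `|f0 x| by apply: cvg_norm; exact: ff.
  rewrite -(cvg_lim _ c)//; apply: limr_le; first by apply/cvg_ex; exists `|f0 x|.
  by apply: nearW => m; exact: fM.
Qed.

End test.

(* Expand the square: [g (u_ j) * G_ j] is, up to [o(1)], the weak gradient of a
   Lipschitz function of [u_ j], so each term passes to the limit without any
   continuity of [g]. *)
Lemma weak_square_cvg (g : R -> R) k i : measurable_fun setT g -> (forall t, `|g t| <= 1) ->
  \int[mu]_(x in rV_box (const_mx (- k%:R)) (const_mx k%:R)) ((g (u_ j x) - g (u x)) ^+ 2 * `|G x ord0 i|)
    @[j --> \oo] --> (0 : R).
Proof.
move=> mg g1; set D : set V := rV_box _ _.
pose sg x := Num.sg (G x ord0 i).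
have [mG _] := lG i.
have msg : measurable_fun setT sg by apply: measurableT_comp => //; exact: measurable_sg.
have sg1 x : `|sg x| <= 1 by rewrite normr_sg lern1 leq_b1.
have mgv (v : V -> R) : measurable_fun setT v -> measurable_fun setT (g \o v).
  by move=> mv; exact: measurableT_comp.
have m2 : measurable_fun setT (fun t => g t ^+ 2) by exact: measurable_funX.
have g2 t : `|g t ^+ 2| <= 1 by rewrite normrX exprn_ile1.
(* The square term has [h = g ^+ 2], tested with the sign of [G_i]. The cross term [c2] has [h = g],
   tested with [g \o u] times that sign. *)
have c1 := @weak_bounded_cvg _ 1 m2 g2 k i _ 1 msg sg1.
have mgs : measurable_fun setT ((g \o u) \* sg) by apply: measurable_funM => //; exact: mgv.
have gs1 x : `|((g \o u) \* sg) x| <= 1.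
  by rewrite normrM; apply: mulr_ile1 => //; exact: g1.
have c2 := @weak_bounded_cvg _ 1 mg g1 k i _ 1 mgs gs1.
have iG : mu.-integrable D (EFin \o (fun x => G x ord0 i)).
  have DS : D `<=` rV_cube k%:R.
    by move=> x Dx j; have := Dx j; rewrite !mxE => /andP[/ltW -> /ltW ->].
  exact: (integrableS (measurable_rV_cube _) (measurable_rV_box _ _) DS (proj2 (lG i) _)).
have mDD : measurable D by exact: measurable_rV_box.
have ig (f : V -> R) : measurable_fun setT f -> (forall x, `|f x| <= 1) -> mu.-integrable D (EFin \o (fun x => G x ord0 i * f x)).
  by move=> mf f1; apply: (integrable_mul_bounded (M := 1) mDD iG) => //; exact: measurable_funTS.
have msq (v : V -> R) : measurable_fun setT v -> mu.-integrable D (EFin \o (fun x => g (v x) ^+ 2 * G x ord0 i * sg x)).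
  move=> mv; have := ig (fun x => g (v x) ^+ 2 * sg x).
  have -> : (fun x => G x ord0 i * (g (v x) ^+ 2 * sg x)) = (fun x => g (v x) ^+ 2 * G x ord0 i * sg x).
    by apply/funext => x; ring.
  apply; first by apply: measurable_funM => //; exact: (measurableT_comp m2 mv).
  by move=> x; rewrite normrM; apply: mulr_ile1 => //; exact: g2.
have mpr (v : V -> R) : measurable_fun setT v -> mu.-integrable D (EFin \o (fun x => g (v x) * G x ord0 i * ((g \o u) \* sg) x)).
  move=> mv; have := ig (fun x => g (v x) * ((g \o u) \* sg) x).
  have -> : (fun x => G x ord0 i * (g (v x) * ((g \o u) \* sg) x)) = (fun x => g (v x) * G x ord0 i * ((g \o u) \* sg) x).
    by apply/funext => x; ring.
  apply; first by apply: measurable_funM => //; exact: mgv.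
  by move=> x; rewrite normrM; apply: mulr_ile1 => //; exact: g1.
have Ek j : \int[mu]_(x in D) ((g (u_ j x) - g (u x)) ^+ 2 * `|G x ord0 i|) =
   \int[mu]_(x in D) (g (u_ j x) ^+ 2 * G x ord0 i * sg x) -
   2 * \int[mu]_(x in D) (g (u_ j x) * G x ord0 i * ((g \o u) \* sg) x) +
   \int[mu]_(x in D) (g (u x) ^+ 2 * G x ord0 i * sg x).
  have i1 := msq _ (mu_k j); have i2 := mpr _ (mu_k j); have i3 := msq _ mu_.
  have i2' := integrableZ_fun 2 mDD i2.
  have i12 : mu.-integrable D (EFin \o (fun x => g (u_ j x) ^+ 2 * G x ord0 i * sg x -
      2 * (g (u_ j x) * G x ord0 i * ((g \o u) \* sg) x))).
    exact: (integrableB mDD i1 i2').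
  rewrite -RintegralZl// -RintegralB// -RintegralD//.
  by apply: eq_Rintegral => x _ /=; rewrite normrEsg /sg; ring.
have -> : (0 : R) = \int[mu]_(x in D) (g (u x) ^+ 2 * G x ord0 i * sg x) -
   2 * \int[mu]_(x in D) (g (u x) * G x ord0 i * ((g \o u) \* sg) x) +
   \int[mu]_(x in D) (g (u x) ^+ 2 * G x ord0 i * sg x).
  have -> : \int[mu]_(x in D) (g (u x) * G x ord0 i * ((g \o u) \* sg) x) = \int[mu]_(x in D) (g (u x) ^+ 2 * G x ord0 i * sg x).
    by apply: eq_Rintegral => x _ /=; ring.
  ring.
under eq_fun do rewrite Ek.
apply: cvgD; last exact: cvg_cst.
by apply: cvgB => //; exact: cvgMr.
Qed.

End weak_continuity.

(** * Convergence to zero of vectors and of Young functions *)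

Section young_limits.
Context {R : realType} {n : nat}.
Local Notation V := 'rV[R]_n.
Local Notation mu := (@borel_lebesgue R n).
Local Notation mu1 := (@lebesgue_measure R).
Local Notation R1 := (measurableTypeR R).

Lemma coord_le_norm (x : V) i : `|x ord0 i| <= `|x|.
Proof. by rewrite ler_norml; exact: rV_cube_norm. Qed.

Lemma young_abs_le (Psi : V -> \bar R) (a b : R) xi : young_rV Psi -> `|a| <= b ->
  (Psi (a *: xi) <= Psi (b *: xi))%E.
Proof.
move=> yP ab; have b0 : 0 <= b by exact: le_trans ab.
have [b00|bn] := eqVneq b 0.
  by move: ab; rewrite b00 normr_le0 => /eqP ->.
have bp : 0 < b by rewrite lt_neqAle eq_sym bn.
have -> : Psi (a *: xi) = Psi ((`|a| / b) *: (b *: xi)).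
  rewrite scalerA divfK//; case: (ger0P a) => // _.
  by rewrite scaleNr (young_rV_even yP).
have q01 : 0 <= `|a| / b <= 1 by rewrite divr_ge0//= ler_pdivrMr// mul1r.
exact: le_trans (young_rV_scale _ yP q01) (mule_le1 q01 (young_rV_ge0 yP _)).
Qed.

(** [Psi] is bounded on a cube around 0, and [Psi (t *: x) <= t * Psi x] makes it small on smaller
    cubes. *)
Lemma young_rV_cvg0 (Psi : V -> \bar R) (y : nat -> V) : young_rV Psi ->
  (forall i, y k ord0 i @[k --> \oo] --> (0 : R)) -> Psi (y k) @[k --> \oo] --> 0%E.
Proof.
move=> yP y0; have [r [M [r0 M0 H]]] := young_rV_bounded_near0 yP.
have Hsmall (eps : R) : 0 < eps -> \forall k \near \oo, (Psi (y k) <= eps%:E)%E.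
  move=> eps0; pose t := Num.min 1 (eps / M).
  have t0 : 0 < t by rewrite lt_min ltr01 divr_gt0.
  have t01 : 0 <= t <= 1 by rewrite ltW//= ge_min lexx.
  have : \forall k \near \oo, forall i, `|y k ord0 i| <= t * r.
    have [m Hm] : exists m : nat, forall k, (m <= k)%N -> forall i, `|y k ord0 i| <= t * r.
      have /choice[m Hm] i : exists m : nat, forall k, (m <= k)%N -> `|y k ord0 i| <= t * r.
        have tr : 0 < t * r by rewrite mulr_gt0.
        have /cvgrPdist_le/(_ _ tr)[m _ Hm] := y0 i.
        by exists m => k mk; have := Hm k mk; rewrite sub0r normrN.
      exists (\max_i m i)%N => k mk i; apply: Hm; apply: leq_trans mk; exact: leq_bigmax.
    by exists m.
  apply: filterS => k Hk.
  have -> : y k = t *: (t^-1 *: y k) by rewrite scalerA mulfV ?scale1r// gt_eqF.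
  apply: le_trans (young_rV_scale _ yP t01) _.
  apply: (@le_trans _ _ (t%:E * M%:E)%E).
    apply: lee_wpmul2l; first by rewrite lee_fin ltW.
    apply: H => i; rewrite mxE normrM gtr0_norm ?invr_gt0// ler_pdivrMl//; exact: Hk.
  by rewrite -EFinM lee_fin -ler_pdivlMr// ge_min lexx orbT.
apply/fine_cvgP; split.
  have := Hsmall 1 ltr01; apply: filterS => k Hk.
  by rewrite ge0_fin_numE ?(young_rV_ge0 yP)//; exact: le_lt_trans Hk (ltry _).
apply/cvgrPdist_le => eps eps0; have := Hsmall eps eps0; apply: filterS => k Hk.
have P0 := young_rV_ge0 yP (y k).
rewrite sub0r normrN ger0_norm ?fine_ge0// -lee_fin fineK//.
by rewrite ge0_fin_numE//; exact: le_lt_trans Hk (ltry _).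
Qed.

(* On the sphere of radius [eps] the lower semicontinuous function [Phi] is
   bounded below by some [d > 0]; convexity propagates the bound outside. *)
Lemma nondegenerate_lower_bound (Phi : V -> \bar R) (eps : R) : young_rV Phi -> nondegenerate_young Phi ->
  0 < eps -> exists2 d : R, 0 < d & forall y, (Phi y < d%:E)%E -> `|y| < eps.
Proof.
move=> yP nd eps0; pose K := rV_cube eps `&` [set z : V | `|z| = eps].
have cK : compact K.
  apply: compact_closedI; first exact: compact_rV_cube.
  rewrite (_ : [set z | _] = (@Num.norm _ V) @^-1` [set eps])//.
  by apply: closed_comp; [move=> x _; exact: norm_continuous|exact: closed_eq].
move/compact_near_coveringP : cK => /(_ R (0 : R)^'+ (fun d z => (d%:E < Phi z)%E) _).
have H : forall z, K z -> \forall z' \near z & d \near (0 : R)^'+, (d%:E < Phi z')%E.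
  move=> z [_ /= ze].
  have z0 : z != 0 by rewrite -normr_gt0 ze.
  have [a a0 az] : exists2 a : R, 0 < a & (a%:E < Phi z)%E.
    have := nd z z0; case: (Phi z) => [x| |]//; last by exists 1 => //; exact: ltry.
    by rewrite lte_fin => x0; exists (x / 2); rewrite ?divr_gt0// lte_fin ltr_pdivrMr// ltr_pMr// ltr1n.
  have [W nW HW] := young_rV_lsc yP az.
  exists (W, [set d : R | d < a]).
    by split => //=; exact: nbhs_right_lt.
  by move=> [z' d] /= [Wz da]; apply: lt_trans (HW z' Wz); rewrite lte_fin.
move=> /(_ H) Hn.
have [d [d0 Hd]] : exists d : R, 0 < d /\ forall z, K z -> (d%:E < Phi z)%E.
  near (0 : R)^'+ => d; exists d; split; first by near: d; exact: nbhs_right_gt.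
  by near: d; exact: Hn.
exists d => // y Py; rewrite ltNge; apply/negP => ey.
have y0 : 0 < `|y| by exact: lt_le_trans ey.
have t01 : 0 <= eps / `|y| <= 1 by rewrite divr_ge0 ?(ltW eps0)//= ler_pdivrMr// mul1r.
have Ky : K ((eps / `|y|) *: y).
  have e1 : `|(eps / `|y|) *: y| = eps.
    by rewrite normrZ normrM normfV normr_id (gtr0_norm eps0) divfK// gt_eqF.
  by split => //= i; rewrite -ler_norml -[leRHS]e1; exact: coord_le_norm.
have := Hd _ Ky; rewrite ltNge => /negP; apply.
apply: le_trans (young_rV_scale _ yP t01) _.
apply: le_trans (mule_le1 t01 (young_rV_ge0 yP _)) _; exact: ltW.
Unshelve. all: by end_near. Qed.

Lemma nondegenerate_cvg0 (Phi : V -> \bar R) (y : nat -> V) : young_rV Phi -> nondegenerate_young Phi ->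
  Phi (y k) @[k --> \oo] --> 0%E -> forall i, y k ord0 i @[k --> \oo] --> (0 : R).
Proof.
move=> yP nd /fine_cvgP[F c] i; apply/cvgrPdist_lt => eps eps0.
have [d d0 Hd] := nondegenerate_lower_bound yP nd eps0.
near=> k; rewrite sub0r normrN; apply: le_lt_trans (coord_le_norm _ _) _; apply: Hd.
have Fk : Phi (y k) \is a fin_num by near: k.
by rewrite -(fineK Fk) lte_fin; near: k; exact: (cvgr_lt _ c).
Unshelve. all: by end_near. Qed.

Lemma oint_growth (phi : R -> R) (B : R -> R) (t : R) : measurable_fun setT phi ->
  (forall s, `|phi s| <= B `|s|) -> (forall s t, 0 <= s -> s <= t -> B s <= B t) ->
  `|oint phi 0 t| <= B `|t| * `|t|.
Proof.
move=> mphi phiB Bhomo; pose psi := phi \_ `[- `|t|, `|t|]%classic.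
have mpsi : measurable_fun setT psi.
  by apply/(measurable_restrictT _ (measurable_itvR _)); exact: measurable_funR.
have B0 : 0 <= B `|t|.
  apply: (@le_trans _ _ (B `|0|)); last by rewrite normr0; exact: Bhomo.
  exact: le_trans (phiB 0).
have psiB s : `|psi s| <= B `|t|.
  rewrite /psi patchE; case: ifPn => [/set_mem|_]; last by rewrite normr0.
  by rewrite /= in_itv/= -ler_norml => st; apply: le_trans (phiB s) _; exact: Bhomo.
have -> : oint phi 0 t = oint psi 0 t.
  have h := ler_norm t; have h' := ler_norm (- t); rewrite normrN in h'.
  rewrite /oint; congr (_ - _); apply: eq_Rintegral => s /set_mem; rewrite /= in_itv/= => /andP[s1 s2];
    rewrite /psi patchE mem_set//= in_itv/=; lra.
by have := oint_lipschitz 0 t mpsi psiB; rewrite subr0.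
Qed.

Lemma bweakZ (u : V -> R) G (a : R) : bweak u G -> bweak (fun x => a * u x) (fun x => a *: G x).
Proof.
move=> wu; have w0 : bweak (fun _ : V => 0) (fun _ => 0).
  have := bweakZD (-1) wu wu.
  rewrite (_ : (fun x => -1 * u x + u x) = (fun _ => 0)); last by apply/funext => x; rewrite mulN1r addNr.
  by rewrite (_ : (fun x => -1 *: G x + G x) = (fun _ => 0))//; apply/funext => x; rewrite scaleN1r addNr.
have := bweakZD a wu w0.
rewrite (_ : (fun x => a * u x + 0) = (fun x => a * u x)); last by apply/funext => x; rewrite addr0.
by rewrite (_ : (fun x => a *: G x + 0) = (fun x => a *: G x))//; apply/funext => x; rewrite addr0.
Qed.

Lemma locint_ae (u v : V -> R) : locint u -> measurable_fun setT v -> {ae mu, forall x, u x = v x} -> locint v.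
Proof.
move=> [mu_ iu] mv uv; split => // r; have mc : measurable (rV_cube r : set V) by exact: measurable_rV_cube.
have /integrableP[_ H] := iu r; apply/integrableP; split.
  by apply/measurable_EFinP; exact: measurable_funTS.
rewrite -(@ge0_ae_eq_integral _ _ _ mu _ (fun x => `|(EFin \o u) x|%E) _ mc)//.
- by apply/measurableT_comp => //; apply/measurable_EFinP; exact: measurable_funTS.
- by apply/measurableT_comp => //; apply/measurable_EFinP; exact: measurable_funTS.
- by apply: filterS uv => x uvx _; rewrite /= uvx.
Qed.

Lemma bweak_ae (u v : V -> R) G H : bweak u G -> measurable_fun setT v -> measurable_fun setT H ->
  {ae mu, forall x, u x = v x} -> {ae mu, forall x, G x = H x} -> bweak v H.
Proof.
move=> [lu lG w] mv mH uv GH.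
have mHi i : measurable_fun setT (fun x => H x ord0 i) by exact: measurable_fun_coord.
have GHi i : {ae mu, forall x, G x ord0 i = H x ord0 i} by apply: filterS GH => x ->.
split; first exact: locint_ae uv.
  by move=> i; apply: locint_ae (lG i) _ _.
move=> phi i tphi; have mphi := test_measurable tphi; have mD := test_measurable (test_partial i tphi).
have [mu_ _] := lu; have [mGi _] := lG i.
rewrite -(@ae_Rintegral _ _ _ mu _ (fun x => u x * 'D_(delta_mx ord0 i) phi x)) ?w//; last 3 first.
- exact: measurable_funM.
- exact: measurable_funM.
- by apply: filterS uv => x ->.
congr (- _); apply: ae_Rintegral => //.
- exact: measurable_funM.
- exact: measurable_funM.
- by apply: filterS (GHi i) => x ->.
Qed.

End young_limits.

(** * The composition operator *)

Lemma cvg_subseq (T : topologicalType) (a : nat -> T) (l : T) (s : nat -> nat) :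
  (forall i j, (i < j)%N -> (s i < s j)%N) -> a k @[k --> \oo] --> l -> a (s k) @[k --> \oo] --> l.
Proof.
move=> sinc al; have sk k : (k <= s k)%N by elim: k => // k IH; apply: leq_ltn_trans IH (sinc _ _ (ltnSn k)).
apply: (cvg_comp _ _ _ al) => P [m _ mP]; exists m => // k /= mk; apply: mP => /=.
exact: leq_trans mk (sk k).
Qed.

Section composition.
Context {R : realType} {n : nat}.
Local Notation V := 'rV[R]_n.
Local Notation mu := (@borel_lebesgue R n).
Local Notation mu1 := (@lebesgue_measure R).
Variables (Omega : set V) (Phi Psi Phi1 : V -> \bar R) (A1 : R -> \bar R).
Variables (E f phi : R -> R) (kappa c Cg : R).
Hypothesis n2 : (2 <= n)%N.
Hypothesis mOmega : measurable Omega.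
Hypothesis yPhi : young_rV Phi.
Hypothesis yPsi : young_rV Psi.
Hypothesis nondeg : nondegenerate_young Phi.
Hypothesis yPhi1 : young_rV Phi1.
Hypothesis AP1 : young_symmetral Phi1 A1.
Hypothesis conv1 : converges_at_0 n A1.
Hypothesis div1 : diverges_at_infty n A1.
Local Notation N := (sobolev_conjugate n A1).
Hypothesis c0 : 0 <= c.
Hypothesis cOmega : (c%:E * mu Omega < +oo)%E.
Hypothesis half : forall x, (Phi1 (2^-1 *: x) <= c%:E + Phi x)%E.
Hypothesis dom : forall (t : R) xi, 0 <= t -> (Psi (E t *: xi) <= c%:E + Phi xi + N t)%E.
Hypothesis Cg0 : 0 < Cg.
Hypothesis grow : forall t : R, 0 <= t -> ((t * E t)%:E <= Cg%:E * (1 + N t))%E.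
Hypothesis E_ge0 : forall t : R, 0 <= t -> 0 <= E t.
Hypothesis E_homo : forall s t : R, 0 <= s -> s <= t -> E s <= E t.
Hypothesis E_neq0 : exists2 t : R, 0 <= t & E t != 0.
Hypothesis kappa0 : 0 < kappa.
Hypothesis mf : measurable_fun setT f.
Hypothesis mphi : measurable_fun setT phi.
Hypothesis phiE : forall t, `|phi t| <= kappa * E (kappa * `|t|).
Hypothesis fphi : forall a b, f b - f a = oint phi a b.
Hypothesis f0 : f 0 = 0.

Let yA1 : young A1. Proof. by case: AP1. Qed.
Let finA1 (t : R) : 0 <= t -> (A1 t < +oo)%E.
Proof. by exact: (@young_fin R n A1 t n2 yA1 div1). Qed.
Let N_ge0 (t : R) : (0 <= N t)%E.
Proof. exact: (sobolev_conjugate_ge0 n2 yA1 conv1 finA1 div1). Qed.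
Let N_homo (s t : R) : s <= t -> (N s <= N t)%E.
Proof. exact: (sobolev_conjugate_homo n2 yA1 conv1 finA1 div1). Qed.
Let mN (v : V -> R) : measurable_fun setT v -> measurable_fun setT (fun x => N (v x)).
Proof. exact: (measurable_sobolev_conjugate_comp n2 AP1 conv1 div1). Qed.
Let P_ge0 x : (0 <= Phi x)%E. Proof. exact: young_rV_ge0. Qed.
Let Ps_ge0 x : (0 <= Psi x)%E. Proof. exact: young_rV_ge0. Qed.
Let mP (H : V -> V) : measurable_fun setT H -> measurable_fun setT (fun x => Phi (H x)).
Proof. by move=> mH; exact: measurableT_comp (measurable_young_rV yPhi) mH. Qed.

(** Gradients vanish off [Omega], so the additive constant of the growth conditions is needed there
    only. This function is integrable both if [Omega] has finite measure and if [c = 0]. *)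
Let cO (x : V) : \bar R := (c * \1_Omega x)%:E.
Let cO_ge0 x : (0 <= cO x)%E. Proof. by rewrite lee_fin mulr_ge0. Qed.
Let mcO : measurable_fun setT cO.
Proof. by apply/measurable_EFinP; apply: measurable_funM => //; exact: measurable_indic. Qed.
Let IcO : (\int[mu]_x cO x < +oo)%E.
Proof.
rewrite /cO; under eq_integral do rewrite EFinM.
rewrite ge0_integralZl//; last by apply/measurable_EFinP; exact: measurable_indic.
by rewrite integral_indic// setIT.
Qed.

Let supported (H : V -> V) := forall x, ~ Omega x -> H x = 0.
Let levels (u : V -> R) := forall t : R, 0 < t -> (mu [set x | (t < `|u x|)%R] < +oo)%E.

Let Psi_dom (a t : R) (H : V -> V) x : supported H -> 0 <= t -> `|a| <= E t ->
  (Psi (a *: H x) <= cO x + Phi (H x) + N t)%E.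
Proof.
move=> sH t0 aE; have [Ox|Ox] := pselect (Omega x).
  rewrite /cO indicE mem_set// mulr1; apply: le_trans (dom _ t0); exact: young_abs_le.
by rewrite (sH x Ox) scaler0 (young_rV_0 yPsi) !adde_ge0.
Qed.

Let Phi1_dom (H : V -> V) x : supported H -> (Phi1 (2^-1 *: H x) <= cO x + Phi (H x))%E.
Proof.
move=> sH; have [Ox|Ox] := pselect (Omega x).
  by rewrite /cO indicE mem_set// mulr1.
by rewrite (sH x Ox) scaler0 (young_rV_0 yPhi1) adde_ge0.
Qed.

Let levelsZ (u : V -> R) (a : R) : 0 < a -> levels u -> levels (fun x => a * u x).
Proof.
move=> a0 lu t t0; rewrite (_ : [set x | _] = [set x | t / a < `|u x|]); first by apply: lu; rewrite divr_gt0.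
by apply/seteqP; split => x /=; rewrite normrM gtr0_norm// ltr_pdivrMr// mulrC.
Qed.

(** Apply the modular inequality to [u / (2 lam)] with the constant [2 lam kappa']. The extra 2 is
    the one that compares [Phi1] with [Phi]; enlarging the constant is harmless since any constant
    is allowed. *)
Lemma sobolev_modular_comp_fin (u : V -> R) G (lam kappa' : R) : bweak u G -> supported G -> levels u ->
  0 < lam -> 0 < kappa' -> (\int[mu]_x Phi (lam^-1 *: G x)%R < +oo)%E ->
  (\int[mu]_x N (kappa' * `|u x|)%R < +oo)%E.
Proof.
move=> wu sG lu lam0 k'0 IG.
have [[mu_ _] lG _] := wu; have mG := measurable_gradient lG.
have l0 : 0 < (2 * lam)^-1 by rewrite invr_gt0 mulr_gt0.
have sl : supported (fun x => lam^-1 *: G x) by move=> x Ox; rewrite (sG x Ox) scaler0.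
have H := @sobolev_modular_fin R n Phi1 A1 n2 yPhi1 AP1 conv1 div1 (kappa' * (2 * lam)) _ _
  (mulr_gt0 k'0 (mulr_gt0 (ltr0n _ 2) lam0)) (bweakZ (2 * lam)^-1 wu) (levelsZ l0 lu).
have -> : (\int[mu]_x N (kappa' * `|u x|)%R = \int[mu]_x N (kappa' * (2 * lam) * `|(2 * lam)^-1 * u x|)%R)%E.
  apply: eq_integral => x _; congr (N _).
  by rewrite normrM (gtr0_norm l0) -mulrA mulVKf// gt_eqF// mulr_gt0.
apply: H.
apply: (@le_lt_trans _ _ (\int[mu]_x (cO x + Phi (lam^-1 *: G x)%R))%E).
  apply: ge0_le_integral => //.
  - by move=> x _; exact: young_rV_ge0.
  - apply: measurableT_comp (measurable_young_rV yPhi1) _.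
    exact: (measurableT_comp (measurable_scalerV _) mG).
  - apply: emeasurable_funD => //; apply: mP; exact: (measurableT_comp (measurable_scalerV _) mG).
  - move=> x _; have := Phi1_dom x sl; rewrite scalerA invfM; exact.
rewrite ge0_integralD//; last by apply: mP; exact: (measurableT_comp (measurable_scalerV _) mG).
by rewrite lte_add_pinfty.
Qed.

Let f_bound (t : R) : (`|f t|%:E <= Cg%:E * (1 + N (kappa * `|t|)%R))%E.
Proof.
have -> : f t = oint phi 0 t by rewrite -fphi f0 subr0.
have kt : 0 <= kappa * `|t| by rewrite mulr_ge0// ltW.
apply: le_trans (grow kt); rewrite lee_fin.
have := @oint_growth R phi (fun s => kappa * E (kappa * s)) t mphi phiE.
rewrite [kappa * `|t| * _]mulrC mulrCA mulrA; apply=> s r s0 sr.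
by rewrite ler_pM2l// E_homo ?mulr_ge0 ?(ltW kappa0)// ler_pM2l.
Qed.

Let vec_bound : exists2 C : R, 0 < C & forall (x : V) i, (`|x ord0 i|%:E <= C%:E * (1 + Psi x))%E.
Proof.
have [C C0 H] := young_rV_coercive yPsi; exists C => // x i; apply: le_trans (H x).
by rewrite lee_fin; exact: coord_le_enorm.
Qed.

(** [phi (u x) / kappa] is bounded by [E] at [kappa * |u x|]; the domination is used at that [t]
    with the vector [G x / lam]. *)
Let phiPsi (u : V -> R) G (lam : R) x : supported G -> 0 < lam ->
  (Psi ((kappa * lam)^-1 *: (phi (u x) *: G x)) <= cO x + Phi (lam^-1 *: G x)%R + N (kappa * `|u x|)%R)%E.
Proof.
move=> sG lam0; have sl : supported (fun x => lam^-1 *: G x) by move=> y Oy; rewrite (sG y Oy) scaler0.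
have -> : (kappa * lam)^-1 *: (phi (u x) *: G x) = (kappa^-1 * phi (u x)) *: (lam^-1 *: G x).
  by rewrite !scalerA invfM; congr (_ *: _); ring.
apply: (Psi_dom _ sl); first by rewrite mulr_ge0// ltW.
by rewrite normrM gtr0_norm ?invr_gt0// ler_pdivrMl.
Qed.

Let cube_integrable (w : V -> R) (g : V -> \bar R) (C r : R) : measurable_fun setT w -> measurable_fun setT g ->
  0 < C -> (forall x, 0 <= g x)%E -> (\int[mu]_x g x < +oo)%E ->
  (forall x, (`|w x|%:E <= C%:E * (1 + g x))%E) -> mu.-integrable (rV_cube r) (EFin \o w).
Proof.
move=> mw mg C0 g0 Ig wg; have mc : measurable (rV_cube r : set V) by exact: measurable_rV_cube.
apply/integrableP; split; first by apply: measurable_funTS; exact/measurable_EFinP.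
apply: (@le_lt_trans _ _ (\int[mu]_(x in rV_cube r) (C%:E * (1 + g x)))%E).
  apply: ge0_le_integral => //.
  - by apply: measurable_funTS; apply: measurableT_comp => //; exact/measurable_EFinP.
  - by apply: measurable_funTS; apply: measurable_funeM; exact: emeasurable_funD.
  - by move=> x _; exact: wg.
rewrite ge0_integralZl//; last 3 first.
- by apply: measurable_funTS; exact: emeasurable_funD.
- by move=> x _; rewrite adde_ge0.
- by rewrite lee_fin ltW.
rewrite ge0_integralD//; last exact: measurable_funTS.
rewrite lte_mul_pinfty// ?lee_fin ?(ltW C0)//.
rewrite lte_add_pinfty//; first by rewrite integral_cst// mul1e borel_lebesgue_cube_lty.
by apply: le_lt_trans Ig; apply: ge0_subset_integral.
Qed.

(** The hypotheses of the chain rule that are not automatic are the local integrability of [f \o u],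
    which comes from [grow], and that of the product gradient, which comes from the integrability of
    [Psi] and coercivity. *)
Lemma bweak_composition (u : V -> R) G (lam : R) : bweak u G -> supported G -> levels u ->
  0 < lam -> (\int[mu]_x Phi (lam^-1 *: G x)%R < +oo)%E ->
  bweak (f \o u) (fun x => phi (u x) *: G x) /\
  (\int[mu]_x Psi ((kappa * lam)^-1 *: (phi (u x) *: G x))%R < +oo)%E.
Proof.
move=> wu sG lu lam0 IG; have [[mu_ _] lG _] := wu; have mG := measurable_gradient lG.
have IN := sobolev_modular_comp_fin wu sG lu lam0 kappa0 IG.
have mNu : measurable_fun setT (fun x => N (kappa * `|u x|)%R).
  by apply: mN; apply: measurable_funM => //; exact: measurableT_comp.
have mPG : measurable_fun setT (fun x => Phi (lam^-1 *: G x)).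
  by apply: mP; exact: (measurableT_comp (measurable_scalerV _) mG).
have mpu : measurable_fun setT (fun x => phi (u x)) by exact: measurableT_comp.
have mpG : measurable_fun setT (fun x => phi (u x) *: G x) by exact: measurable_funZ_rV.
pose g x := (cO x + Phi (lam^-1 *: G x)%R + N (kappa * `|u x|)%R)%E.
have mg : measurable_fun setT g by apply: emeasurable_funD => //; exact: emeasurable_funD.
have g0 x : (0 <= g x)%E by rewrite !adde_ge0.
have Ig : (\int[mu]_x g x < +oo)%E.
  rewrite ge0_integralD//; last 2 first.
  - by move=> x _; rewrite adde_ge0.
  - exact: emeasurable_funD.
  rewrite lte_add_pinfty// ge0_integralD//.
  by rewrite lte_add_pinfty.
have Pg x := @phiPsi u G lam x sG lam0.
split; last first.
  apply: le_lt_trans Ig; apply: ge0_le_integral => //.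
    apply: measurableT_comp (measurable_young_rV yPsi) _.
    exact: (measurableT_comp (measurable_scalerV _) mpG).
  by move=> x _; exact: Pg.
apply: bweak_chain => //.
- move=> M; exists (kappa * E (kappa * `|M|)) => t tM; apply: le_trans (phiE t) _.
  rewrite ler_pM2l//; apply: E_homo; rewrite ?mulr_ge0 ?(ltW kappa0)//.
  by rewrite ler_pM2l//; apply: le_trans tM (ler_norm _).
- split; first exact: measurableT_comp.
  move=> r; apply: (@cube_integrable (f \o u) (fun x => N (kappa * `|u x|)%R) Cg r _ mNu Cg0 _ IN) => [|//|x].
    exact: measurableT_comp.
  exact: f_bound.
- move=> i; split; first by apply: measurable_funM => //; case: (lG i).
  have [C C0 HC] := vec_bound.
  move=> r; apply: (cube_integrable (g := g) (C := kappa * lam * C)) => //.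
  + by apply: measurable_funM => //; case: (lG i).
  + by rewrite !mulr_gt0.
  move=> x; have kl : 0 < kappa * lam by rewrite mulr_gt0.
  have -> : `|phi (u x) * G x ord0 i| = kappa * lam * `|((kappa * lam)^-1 *: (phi (u x) *: G x)) ord0 i|.
    by rewrite !mxE [in RHS]normrM (gtr0_norm (_ : 0 < (kappa * lam)^-1)) ?invr_gt0// mulVKf// gt_eqF.
  rewrite EFinM [in leRHS]EFinM -muleA; apply: lee_wpmul2l; first by rewrite lee_fin ltW.
  apply: le_trans (HC _ i) _; apply: lee_wpmul2l; first by rewrite lee_fin ltW.
  by apply: leeD2l; exact: Pg.
Qed.

(** Past a point [t0] with [E t0 > 0] the function [E] is bounded below, so the bound on [t * E t]
    becomes one on [t]. It makes convergence of [N |u_k - u|] control the local L1 distance. *)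
Let young_linear : exists2 C : R, 0 < C & forall t : R, 0 <= t -> (t%:E <= C%:E * (1 + N (kappa * t)%R))%E.
Proof.
have [t0 t00 Et0] := E_neq0.
have E0 : 0 < E t0 by rewrite lt_neqAle eq_sym Et0 E_ge0.
have C20 : 0 < Cg / (kappa * E t0) by rewrite divr_gt0// mulr_gt0.
have C10 : 0 <= t0 / kappa by rewrite divr_ge0// ltW.
exists (t0 / kappa + Cg / (kappa * E t0)) => [|t tp]; first by rewrite ltr_wpDl.
have kt : 0 <= kappa * t by rewrite mulr_ge0// ltW.
rewrite EFinD ge0_muleDl ?lee_fin ?(ltW C20)//.
have [tt0|t0t] := leP (kappa * t) t0.
  apply: (@le_trans _ _ (t0 / kappa)%:E); first by rewrite lee_fin ler_pdivlMr// mulrC.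
  rewrite ge0_muleDr// mule1 -addeA leeDl// adde_ge0// mule_ge0 ?lee_fin ?(ltW C20)// adde_ge0//.
apply: (@le_trans _ _ ((Cg / (kappa * E t0))%:E * (1 + N (kappa * t)%R))%E); last first.
  by rewrite leeDr// mule_ge0 ?lee_fin// adde_ge0.
have kE : 0 < kappa * E t0 by rewrite mulr_gt0.
have -> : t%:E = ((kappa * E t0)^-1%:E * (kappa * t * E t0)%:E)%E.
  by rewrite -EFinM; congr EFin; field; rewrite !gt_eqF.
rewrite (_ : (Cg / (kappa * E t0))%:E = ((kappa * E t0)^-1%:E * Cg%:E)%E); last by rewrite -EFinM mulrC.
rewrite -muleA; apply: lee_wpmul2l.
  by rewrite lee_fin invr_ge0 ltW.
apply: le_trans (grow kt); rewrite lee_fin; apply: ler_wpM2l => //; apply: E_homo => //; exact: ltW.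
Qed.

Let cvg0_sub (h_ : nat -> V -> \bar R) (C : R) (D : set V) : 0 <= C -> measurable D ->
  (forall k, measurable_fun setT (h_ k)) -> (forall k x, (0 <= h_ k x)%E) ->
  (\int[mu]_x h_ k x)%E @[k --> \oo] --> 0%E ->
  (\int[mu]_(x in D) (C%:E * h_ k x))%E @[k --> \oo] --> 0%E.
Proof.
move=> C0 mD mh h0 ih.
have c1 : (C%:E * \int[mu]_x h_ k x)%E @[k --> \oo] --> 0%E.
  by rewrite -(mule0 C%:E); apply: cvgeZl.
apply: (squeeze_cvge _ (cvg_cst _) c1); apply: nearW => k.
rewrite integral_ge0//=; last by move=> x _; rewrite mule_ge0.
rewrite ge0_integralZl//; last exact: measurable_funTS.
by apply: lee_wpmul2l => //; apply: ge0_subset_integral.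
Qed.

Let L1_cvg (w : nat -> V -> R) (h_ : nat -> V -> \bar R) (C r : R) : 0 <= C ->
  (forall k, measurable_fun setT (w k)) ->
  (forall k, measurable_fun setT (h_ k)) -> (forall k x, (0 <= h_ k x)%E) ->
  (\int[mu]_x h_ k x)%E @[k --> \oo] --> 0%E ->
  (forall k x, (`|w k x|%:E <= C%:E * (1 + h_ k x))%E) ->
  {ae mu, forall x, w k x @[k --> \oo] --> (0 : R)} ->
  \int[mu]_(x in rV_cube r) `|w k x| @[k --> \oo] --> (0 : R).
Proof.
move=> C0 mw mh h0 ih wh w0; have mc : measurable (rV_cube r : set V) by exact: measurable_rV_cube.
have mabs k : measurable_fun (rV_cube r) (fun x => `|w k x|%:E).
  by apply: measurable_funTS; apply/measurable_EFinP; exact: measurableT_comp.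
have := @dominated_cvg0 _ _ _ mu (rV_cube r) (fun k x => `|w k x|%:E) (fun k x => C%:E * h_ k x)%E (cst C%:E) mc mabs.
move=> /(_ _ _ _ _ _ _ _ _ _)/fine_cvg; apply => //.
- by move=> k; apply: measurable_funTS; exact: measurable_funeM.
- by move=> k x; rewrite mule_ge0.
- by move=> k x _; have := wh k x; rewrite ge0_muleDr// mule1.
- by rewrite integral_cst// lte_mul_pinfty ?lee_fin// borel_lebesgue_cube_lty.
- exact: cvg0_sub.
- apply: filterS w0 => x Hx _; apply: cvg_EFin; first exact: nearW.
  by rewrite -(normr0 R); apply: cvg_norm.
Qed.

Section continuity.
Variables (u : V -> R) (G : V -> V) (lam : R).
Hypothesis wu : bweak u G.
Hypothesis sG : supported G.
Hypothesis lu : levels u.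
Hypothesis lam0 : 0 < lam.
Hypothesis IG : (\int[mu]_x Phi (lam^-1 *: G x)%R < +oo)%E.

Let mu_ : measurable_fun setT u. Proof. by case: wu => [[]]. Qed.
Let mG : measurable_fun setT G. Proof. by case: wu => _ lG _; exact: measurable_gradient. Qed.

Let diff_modular (G_ : nat -> V -> V) :=
  (\int[mu]_x Phi (lam^-1 *: (G_ k x - G x))%R)%E @[k --> \oo] --> 0%E.

Let image_modular (u_ : nat -> V -> R) (G_ : nat -> V -> V) (k : nat) : \bar R :=
  (\int[mu]_x Psi ((4 * kappa * lam)^-1 *: (phi (u_ k x) *: G_ k x - phi (u x) *: G x))%R)%E.

(* A bounded homeomorphic change of variable, since [phi] itself is only locally
   bounded. *)
Let compress (x : R) : R := x / (1 + `|x|).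

Let compress_cvg (y : nat -> R) (l : R) : compress (y k) @[k --> \oo] --> compress l -> y k @[k --> \oo] --> l.
Proof.
have E0 (x : R) : x = compress x / (1 - `|compress x|).
  have x1 : 0 < 1 + `|x| by rewrite ltr_pwDl.
  rewrite /compress normrM normfV (gtr0_norm x1).
  have x2 : 1 + `|x| - `|x| != 0 by rewrite addrK oner_neq0.
  by field; rewrite ?x2 ?gt_eqF.
move=> cc; rewrite (E0 l); rewrite (_ : y = fun k => compress (y k) / (1 - `|compress (y k)|)); last first.
  by apply/funext => k; exact: E0.
apply: cvgM => //; apply: cvgV.
  have x1 : 0 < 1 + `|l| by rewrite ltr_pwDl.
  rewrite /compress normrM normfV (gtr0_norm x1) gt_eqF// subr_gt0 ltr_pdivrMr// mul1r; lra.
by apply: cvgB; [exact: cvg_cst|exact: cvg_norm].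
Qed.

Section sequence.
Variables (u_ : nat -> V -> R) (G_ : nat -> V -> V).
Hypothesis wu_ : forall k, bweak (u_ k) (G_ k).
Hypothesis sG_ : forall k, supported (G_ k).
Hypothesis lw : forall k, levels (fun x => u_ k x - u x).
Hypothesis Phi_cvg : diff_modular G_.

Let muk k : measurable_fun setT (u_ k). Proof. by case: (wu_ k) => [[]]. Qed.
Let mGk k : measurable_fun setT (G_ k). Proof. by case: (wu_ k) => _ lG _; exact: measurable_gradient. Qed.
Let mw k : measurable_fun setT (fun x => u_ k x - u x). Proof. exact: measurable_funB. Qed.
Let mD k : measurable_fun setT (fun x => G_ k x - G x).
Proof.
apply: measurable_funD_rV => //; have := measurableT_comp (measurable_scalerV (-1)) mG.
by under eq_fun do rewrite /= scaleN1r.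
Qed.
Let mlD (a : R) k : measurable_fun setT (fun x => a *: (G_ k x - G x)).
Proof. exact: (measurableT_comp (measurable_scalerV a) (mD k)). Qed.
Let wD k : bweak (fun x => u_ k x - u x) (fun x => G_ k x - G x).
Proof.
have := bweakZD (-1) wu (wu_ k).
rewrite (_ : (fun x => -1 * u x + u_ k x) = (fun x => u_ k x - u x)); last by apply/funext => x; rewrite mulN1r addrC.
by rewrite (_ : (fun x => -1 *: G x + G_ k x) = (fun x => G_ k x - G x))//; apply/funext => x; rewrite scaleN1r addrC.
Qed.
Let sD (a : R) k : supported (fun x => a *: (G_ k x - G x)).
Proof. by move=> x Ox; rewrite (sG Ox) (sG_ k Ox) subr0 scaler0. Qed.
Let mNk (a : R) k : measurable_fun setT (fun x => N (a * `|u_ k x - u x|)).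
Proof. by apply: mN; apply: measurable_funM => //; exact: measurableT_comp. Qed.

(** The integral of [Phi1] of the halved differences tends to 0 by domination: the fixed part is
    [cO], the vanishing part is [Phi] of the differences. It eventually lies below the threshold of
    the modular inequality. *)
Lemma sobolev_modular_cvg (kappa' : R) : 0 < kappa' ->
  {ae mu, forall x, forall i, (lam^-1 *: (G_ k x - G x)) ord0 i @[k --> \oo] --> (0 : R)} ->
  (\int[mu]_x N (kappa' * `|u_ k x - u x|)%R)%E @[k --> \oo] --> 0%E.
Proof.
move=> k'0 aeG; have l0 : 0 < (2 * lam)^-1 by rewrite invr_gt0 mulr_gt0.
have hE x k : (2 * lam)^-1 *: (G_ k x - G x) = 2^-1 *: (lam^-1 *: (G_ k x - G x)) by rewrite scalerA invfM.
have mP1 k : measurable_fun setT (fun x => Phi1 ((2 * lam)^-1 *: (G_ k x - G x))).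
  exact: measurableT_comp (measurable_young_rV yPhi1) (mlD _ k).
have P1c : (\int[mu]_x Phi1 ((2 * lam)^-1 *: (G_ k x - G x))%R)%E @[k --> \oo] --> 0%E.
  apply: (@dominated_cvg0 _ _ _ mu setT _ (fun k x => Phi (lam^-1 *: (G_ k x - G x))) cO) => //.
  - by move=> k; apply: mP.
  - by move=> k x; exact: young_rV_ge0.
  - by move=> k x _; rewrite hE; exact: (@Phi1_dom (fun x => lam^-1 *: (G_ k x - G x)) x (@sD _ k)).
  - apply: filterS aeG => x Hx _; apply: young_rV_cvg0 => // i.
    under eq_fun do rewrite hE mxE.
    by rewrite -(mulr0 (2^-1 : R)); apply: cvgMr; exact: Hx.
have [eta eta0 He] := @sobolev_modular_le R n Phi1 A1 n2 yPhi1 AP1 conv1 div1 (kappa' * (2 * lam))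
  (mulr_gt0 k'0 (mulr_gt0 (ltr0n _ 2) lam0)).
have c4 : (4%:E * \int[mu]_x Phi1 ((2 * lam)^-1 *: (G_ k x - G x))%R)%E @[k --> \oo] --> 0%E.
  by rewrite -(mule0 4%:E); apply: cvgeZl.
apply: (squeeze_cvge _ (cvg_cst _) c4).
have /fine_cvgP[F H] := P1c.
near=> k; rewrite integral_ge0//=.
have -> : (\int[mu]_x N (kappa' * `|u_ k x - u x|)%R = \int[mu]_x N (kappa' * (2 * lam) * `|(2 * lam)^-1 * (u_ k x - u x)|)%R)%E.
  apply: eq_integral => x _; congr (N _).
  by rewrite normrM (gtr0_norm l0) -mulrA mulVKf// gt_eqF// mulr_gt0.
apply: (He _ _ (bweakZ _ (wD k)) (levelsZ l0 (@lw k))).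
have Fk : (\int[mu]_x Phi1 ((2 * lam)^-1 *: (G_ k x - G x))%R)%E \is a fin_num by near: k.
by rewrite -(fineK Fk) lee_fin; near: k; exact: (cvgr_le _ H).
Unshelve. all: by end_near. Qed.

Let cvg0_bounded (a b : nat -> R) (B : R) : (\forall k \near \oo, `|a k| <= B) ->
  b k @[k --> \oo] --> (0 : R) -> a k * b k @[k --> \oo] --> (0 : R).
Proof.
move=> aB b0; apply/cvgrPdist_le => eps eps0.
have B0 : 0 < `|B| + 1 by rewrite ltr_pwDr.
have e0 : 0 < eps / (`|B| + 1) by rewrite divr_gt0.
near=> k; rewrite sub0r normrN normrM.
have bk : `|b k| <= eps / (`|B| + 1).
  rewrite -normrN -sub0r; near: k; by have /cvgrPdist_le/(_ _ e0) := b0.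
have ak : `|a k| <= `|B| + 1.
  apply: (@le_trans _ _ B); first by near: k.
  by apply: le_trans (ler_norm B) _; rewrite lerDl.
by apply: le_trans (ler_pM _ _ ak bk) _ => //; rewrite mulrC divfK// gt_eqF.
Unshelve. all: by end_near. Qed.

Let square_cvg0 (a : nat -> R) (b : R) : b != 0 -> (a k ^+ 2 * `|b|) @[k --> \oo] --> (0 : R) ->
  a k @[k --> \oo] --> (0 : R).
Proof.
move=> b0 H; have bp : 0 < `|b| by rewrite normr_gt0.
apply/cvgrPdist_lt => eps eps0.
have e0 : 0 < eps ^+ 2 * `|b| by rewrite mulr_gt0// exprn_gt0.
near=> k.
have : a k ^+ 2 * `|b| < eps ^+ 2 * `|b| by near: k; exact: (cvgr_lt _ H).
rewrite ltr_pM2r// sub0r normrN -[a k ^+ 2]real_normK ?num_real//.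
by rewrite ltr_pXn2r ?nnegrE// ltW.
Unshelve. all: by end_near. Qed.

Let adde_rearrange (z p q r s : \bar R) :
  (z + p + (s + r) + (z + q + (s + r)) = z + z + q + s + s + (p + r + r))%E.
Proof. by rewrite !addeA (ACl (1*5*6*3*7*2*4*8))/=. Qed.

(** Split the difference into [phi (u_k) (G_k - G)] and [(phi (u_k) - phi u) G]. In
    [4 * kappa * lam], one 2 is the convex combination of the two terms, the other the two values of
    [phi] in the second. The first bracket is fixed and integrable; the second tends to 0 in
    integral. *)
Let image_dom k x : (Psi ((4 * kappa * lam)^-1 *: (phi (u_ k x) *: G_ k x - phi (u x) *: G x)) <=
  (cO x + cO x + Phi (lam^-1 *: G x)%R + N (2 * kappa * `|u x|)%R + N (2 * kappa * `|u x|)%R) +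
  (Phi (lam^-1 *: (G_ k x - G x))%R + N (2 * kappa * `|u_ k x - u x|)%R + N (2 * kappa * `|u_ k x - u x|)%R))%E.
Proof.
pose a := phi (u_ k x) / (2 * kappa); pose b := (phi (u_ k x) - phi (u x)) / (2 * kappa).
have k2 : 0 < 2 * kappa by rewrite mulr_gt0.
have -> : (4 * kappa * lam)^-1 *: (phi (u_ k x) *: G_ k x - phi (u x) *: G x) =
    2^-1 *: (a *: (lam^-1 *: (G_ k x - G x))) + (1 - 2^-1) *: (b *: (lam^-1 *: G x)).
  by apply/rowP => i; rewrite !mxE /a /b; field; rewrite !gt_eqF.
have h01 : 0 <= (2^-1 : R) <= 1 by exact: half01.
have h01' : 0 <= (1 - 2^-1 : R) <= 1 by lra.
apply: le_trans (young_rV_convex yPsi _ _ h01) _.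
apply: le_trans (leeD (mule_le1 h01 (Ps_ge0 _)) (mule_le1 h01' (Ps_ge0 _))) _.
(* A maximum rather than a sum: [N] at a maximum is at most the sum of the two values, whereas [N]
   at a sum has no such bound. Since [|u_k| <= 2 m], the scale is doubled in [T]. *)
pose m := Num.max `|u x| `|u_ k x - u x|; pose T := 2 * kappa * m.
have m0 : 0 <= m by rewrite le_max normr_ge0.
have T0 : 0 <= T by rewrite mulr_ge0// ltW.
have um : `|u x| <= m by rewrite le_max lexx.
have ukm : `|u_ k x| <= 2 * m.
  rewrite -[u_ k x](subrK (u x)); apply: le_trans (ler_normD _ _) _.
  have : `|u_ k x - u x| <= m by rewrite le_max lexx orbT.
  lra.
have NT : (N T <= N (2 * kappa * `|u x|)%R + N (2 * kappa * `|u_ k x - u x|)%R)%E.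
  by rewrite /T /m; case: (leP `|u x| `|u_ k x - u x|) => _; [rewrite leeDr|rewrite leeDl].
have E1 : E (kappa * `|u_ k x|) <= E T.
  apply: E_homo; first by rewrite mulr_ge0// ltW.
  by rewrite /T [2 * kappa]mulrC -mulrA ler_pM2l.
have E2 : E (kappa * `|u x|) <= E T.
  apply: E_homo; first by rewrite mulr_ge0// ltW.
  rewrite /T [2 * kappa]mulrC -mulrA ler_pM2l//; apply: le_trans um _; lra.
have ET := E_ge0 T0.
have p1 := phiE (u_ k x); have p2 := phiE (u x).
have q1 : `|phi (u_ k x)| <= kappa * E T by apply: le_trans p1 _; rewrite ler_pM2l.
have q2 : `|phi (u x)| <= kappa * E T by apply: le_trans p2 _; rewrite ler_pM2l.
have kET : 0 <= kappa * E T by rewrite mulr_ge0// ltW.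
have aE : `|a| <= E T.
  rewrite /a normrM normfV (gtr0_norm k2) ler_pdivrMr// [E T * _]mulrC -mulrA; apply: le_trans q1 _; lra.
have bE : `|b| <= E T.
  rewrite /b normrM normfV (gtr0_norm k2) ler_pdivrMr// [E T * _]mulrC -mulrA.
  by apply: le_trans (ler_normB _ _) _; lra.
have D1 := @Psi_dom a T (fun x => lam^-1 *: (G_ k x - G x)) x (@sD _ k) T0 aE.
have sl : supported (fun x => lam^-1 *: G x) by move=> y Oy; rewrite (sG Oy) scaler0.
have D2 := @Psi_dom b T (fun x => lam^-1 *: G x) x sl T0 bE.
apply: le_trans (leeD D1 D2) _.
by rewrite -adde_rearrange; apply: leeD; apply: leeD2l.
Qed.

Let mcompress : measurable_fun setT compress.
Proof.
apply: measurable_funM => //.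
apply: continuous_measurable_fun => x; apply: cvgV; first by rewrite gt_eqF// ltr_pwDl.
by apply: cvgD; [exact: cvg_cst|apply: cvg_norm; exact: cvg_id].
Qed.

Let IN2 : (\int[mu]_x N (2 * kappa * `|u x|)%R < +oo)%E.
Proof. by apply: (sobolev_modular_comp_fin wu sG lu lam0) => //; rewrite mulr_gt0. Qed.

(** Domination leaves only pointwise convergence to prove. A further subsequence gives [phi (u_k)]
    converging to [phi u] wherever the corresponding component of [G] is nonzero, which is all that
    the product needs. *)
Lemma image_subseq_ae :
  {ae mu, forall x, forall i, (lam^-1 *: (G_ k x - G x)) ord0 i @[k --> \oo] --> (0 : R)} ->
  {ae mu, forall x, u_ k x - u x @[k --> \oo] --> (0 : R)} ->
  exists s : nat -> nat, (forall i j, (i < j)%N -> (s i < s j)%N) /\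
    image_modular u_ G_ (s k) @[k --> \oo] --> 0%E.
Proof.
move=> aeG aeu.
have cN (k' : R) (k'0 : 0 < k') := sobolev_modular_cvg k'0 aeG.
have [C1 C10 H1] := young_linear.
have [C2 C20 H2] := young_rV_coercive yPhi.
have ucvg r : \int[mu]_(x in rV_cube r) `|u_ k x - u x| @[k --> \oo] --> (0 : R).
  apply: (@L1_cvg (fun k x => u_ k x - u x) (fun k x => N (kappa * `|u_ k x - u x|)%R) C1) => //.
  - exact: ltW.
  - exact: cN.
  - by move=> k x; exact: H1.
have Gcvg r i : \int[mu]_(x in rV_cube r) `|G_ k x ord0 i - G x ord0 i| @[k --> \oo] --> (0 : R).
  apply: (@L1_cvg (fun k x => G_ k x ord0 i - G x ord0 i) (fun k x => Phi (lam^-1 *: (G_ k x - G x))%R) (lam * C2)) => //.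
  - by rewrite mulr_ge0// ltW.
  - by move=> k; apply: measurable_funB; exact: measurable_fun_coord.
  - by move=> k; exact: mP.
  - move=> k x; have -> : G_ k x ord0 i - G x ord0 i = lam * (lam^-1 *: (G_ k x - G x)) ord0 i.
      by rewrite !mxE mulVKf// gt_eqF.
    rewrite normrM (gtr0_norm lam0) !EFinM -muleA; apply: lee_wpmul2l; first by rewrite lee_fin ltW.
    by apply: le_trans (H2 _); rewrite lee_fin; exact: coord_le_enorm.
  - apply: filterS aeG => x /(_ i) Hx.
    have -> : (fun k => G_ k x ord0 i - G x ord0 i) = (fun k => lam * (lam^-1 *: (G_ k x - G x)) ord0 i).
      by apply/funext => k; rewrite !mxE mulVKf// gt_eqF.
    by rewrite -(mulr0 lam); exact: cvgMr.
(* [weak_square_cvg] needs a function bounded by 1; convergence of [phi (u_k)] is recovered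
   afterwards by [compress_cvg]. *)
pose g t := compress (phi t).
have g1 t : `|g t| <= 1.
  have x1 : 0 < 1 + `|phi t| by rewrite ltr_pwDl.
  by rewrite /g /compress normrM normfV (gtr0_norm x1) ler_pdivrMr// mul1r; lra.
have mg : measurable_fun setT g.
  exact: measurableT_comp mcompress mphi.
pose D (k : nat) : set V := rV_box (const_mx (- k%:R)) (const_mx k%:R).
pose F i k x : \bar R := ((g (u_ k x) - g (u x)) ^+ 2 * `|G x ord0 i|)%:E.
have [s [sinc sP]] : exists s : nat -> nat, (forall i j, (i < j)%N -> (s i < s j)%N) /\
    forall i, {ae mu, forall x, F i (s k) x @[k --> \oo] --> 0%E}.
  apply: (@integral_cvg0_subseq _ _ _ mu _ D F).
  - by move=> m; exact: measurable_rV_box.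
  - move=> i j ij x Dx l; have := Dx l; rewrite !mxE => /andP[h1 h2].
    have : (i%:R : R) <= j%:R by rewrite ler_nat.
    lra.
  - apply/seteqP; split => // x _; have [k kx] := rV_cube_exhaust x; exists k.+1 => // i.
    rewrite !mxE; have := kx i; rewrite -[k.+1]addn1 natrD; lra.
  - move=> i k; apply/measurable_EFinP; apply: measurable_funM.
      by apply: measurable_funX; apply: measurable_funB; exact: measurableT_comp.
    by apply: measurableT_comp => //; exact: measurable_fun_coord.
  - by move=> i k x; rewrite lee_fin mulr_ge0// sqr_ge0.
  - move=> i m; have W := @weak_square_cvg R n u G u_ G_ wu wu_ ucvg Gcvg g m i mg g1.
    have mDm : measurable (D m) by exact: measurable_rV_box.
    have -> : (fun k => \int[mu]_(x in D m) F i k x)%E =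
        (fun k => (\int[mu]_(x in D m) ((g (u_ k x) - g (u x)) ^+ 2 * `|G x ord0 i|))%:E).
      apply/funext => k; rewrite /Rintegral fineK//; apply: integrable_fin_num => //.
      have [_ lG _] := wu; have [_ iG] := lG i.
      have DS : D m `<=` rV_cube m%:R.
        by move=> x Dx j; have := Dx j; rewrite !mxE => /andP[/ltW -> /ltW ->].
      have iGD := integrableS (measurable_rV_cube _) mDm DS (iG _).
      rewrite (_ : (fun x => _) = (EFin \o (fun x => `|G x ord0 i| * (g (u_ k x) - g (u x)) ^+ 2))); last first.
        by apply/funext => x /=; rewrite mulrC.
      apply: (integrable_mul_bounded (M := 4) mDm); first exact: (integrable_abse iGD).
        by apply: measurable_funTS; apply: measurable_funX; apply: measurable_funB; exact: measurableT_comp.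
      move=> x _; rewrite normrX (_ : 4 = 2 ^+ 2); last by ring.
      rewrite lerXn2r ?nnegrE//; apply: le_trans (ler_normB _ _) _.
      by have := g1 (u_ k x); have := g1 (u x); lra.
    by apply: cvg_EFin; [exact: nearW|exact: W].
exists s; split => //.
have mpG (v : V -> R) (H : V -> V) : measurable_fun setT v -> measurable_fun setT H ->
    measurable_fun setT (fun x => phi (v x) *: H x).
  by move=> mv mH; apply: measurable_funZ_rV => //; exact: measurableT_comp.
have mPl (H : V -> V) : measurable_fun setT H -> measurable_fun setT (fun x => Phi (lam^-1 *: H x)).
  by move=> mH; apply: mP; exact: (measurableT_comp (measurable_scalerV _) mH).
have mN2 (v : V -> R) : measurable_fun setT v -> measurable_fun setT (fun x => N (2 * kappa * `|v x|)).
  by move=> mv; apply: mN; apply: measurable_funM => //; exact: measurableT_comp.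
have k2 : 0 < 2 * kappa by rewrite mulr_gt0.
have scvg (a : nat -> \bar R) (l : \bar R) : a k @[k --> \oo] --> l -> a (s k) @[k --> \oo] --> l.
  exact: (cvg_subseq sinc).
pose h_ k x := (Phi (lam^-1 *: (G_ (s k) x - G x))%R + N (2 * kappa * `|u_ (s k) x - u x|)%R +
  N (2 * kappa * `|u_ (s k) x - u x|)%R)%E.
pose gg x := (cO x + cO x + Phi (lam^-1 *: G x)%R + N (2 * kappa * `|u x|)%R + N (2 * kappa * `|u x|)%R)%E.
apply: (@dominated_cvg0 _ _ _ mu setT _ h_ gg) => //.
- move=> k; apply: measurableT_comp (measurable_young_rV yPsi) _.
  apply: (measurableT_comp (measurable_scalerV _)); apply: measurable_funD_rV; first exact: mpG.
  under eq_fun do rewrite -scaleN1r; exact: (measurableT_comp (measurable_scalerV _) (mpG _ _ mu_ mG)).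
- by move=> k; do 2 (apply: emeasurable_funD; last exact: mN2); exact: mPl.
- by do 2 (apply: emeasurable_funD; last exact: mN2); apply: emeasurable_funD; [exact: emeasurable_funD|exact: mPl].
- by move=> k x; rewrite !adde_ge0.
- by move=> x; rewrite !adde_ge0.
- have mPG := mPl _ mG; have mNu := mN2 _ mu_.
  rewrite ge0_integralD//; last 2 first.
  + by move=> x _; rewrite !adde_ge0.
  + by apply: emeasurable_funD => //; apply: emeasurable_funD => //; exact: emeasurable_funD.
  rewrite lte_add_pinfty// ge0_integralD//; last 2 first.
  + by move=> x _; rewrite !adde_ge0.
  + by apply: emeasurable_funD => //; exact: emeasurable_funD.
  rewrite lte_add_pinfty// ge0_integralD//; last 2 first.
  + by move=> x _; rewrite !adde_ge0.
  + exact: emeasurable_funD.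
  by rewrite lte_add_pinfty// ge0_integralD// lte_add_pinfty.
- have c1 := scvg _ _ Phi_cvg; have c2 := scvg _ _ (cN _ k2).
  have -> : (fun k => \int[mu]_x h_ k x)%E = (fun k => \int[mu]_x Phi (lam^-1 *: (G_ (s k) x - G x))%R +
      \int[mu]_x N (2 * kappa * `|u_ (s k) x - u x|)%R + \int[mu]_x N (2 * kappa * `|u_ (s k) x - u x|)%R)%E.
    apply/funext => k; rewrite /h_; have mm := mP (mlD lam^-1 (s k)).
    have mn := @mNk (2 * kappa) (s k).
    rewrite ge0_integralD//; last 2 first.
    + by move=> x _; rewrite adde_ge0.
    + exact: emeasurable_funD.
    by rewrite ge0_integralD.
  have ad : @adde_def R 0%E 0%E by [].
  have e0 : (0%E : \bar R) = (0 + 0)%E by rewrite adde0.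
  have c12 : (\int[mu]_x Phi (lam^-1 *: (G_ (s k) x - G x))%R + \int[mu]_x N (2 * kappa * `|u_ (s k) x - u x|)%R)%E
      @[k --> \oo] --> 0%E by rewrite [X in _ --> X]e0; exact: cvgeD.
  by rewrite [X in _ --> X]e0; exact: cvgeD.
have aeP : {ae mu, forall x, forall i, F i (s k) x @[k --> \oo] --> 0%E} by exact: ae_forall_ord.
move: aeG aeu aeP; apply: filterS3 => x aeGx aeux Px _.
apply: young_rV_cvg0 => // i.
have -> : (fun k => ((4 * kappa * lam)^-1 *: (phi (u_ (s k) x) *: G_ (s k) x - phi (u x) *: G x)) ord0 i) =
    (fun k => (4 * kappa)^-1 * (phi (u_ (s k) x) * (lam^-1 *: (G_ (s k) x - G x)) ord0 i) +
      (4 * kappa * lam)^-1 * ((phi (u_ (s k) x) - phi (u x)) * G x ord0 i)).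
  by apply/funext => k; rewrite !mxE; field; rewrite !gt_eqF.
rewrite -[X in _ --> X](addr0 0); apply: cvgD.
  rewrite -[X in _ --> X](mulr0 (4 * kappa)^-1); apply: cvgMr.
  apply: (cvg0_bounded (B := kappa * E (kappa * (`|u x| + 1)))); last first.
    exact: (cvg_subseq sinc (aeGx i)).
  have : \forall k \near \oo, `|u_ (s k) x - u x| <= 1.
    have /cvgrPdist_le/(_ _ ltr01) := cvg_subseq sinc aeux.
    by apply: filterS => k; rewrite sub0r normrN.
  apply: filterS => k uk; apply: le_trans (phiE _) _; rewrite ler_pM2l//.
  apply: E_homo; first by rewrite mulr_ge0// ltW.
  rewrite ler_pM2l// -[u_ (s k) x](subrK (u x)) addrC; apply: le_trans (ler_normD _ _) _.
  by rewrite lerD2l.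
rewrite -[X in _ --> X](mulr0 (4 * kappa * lam)^-1); apply: cvgMr.
(* A zero component annihilates the factor whose convergence is unknown; at a nonzero one the
   weighted squares force [g (u_k)] to converge. *)
have [->|Gx] := eqVneq (G x ord0 i) 0; first by under eq_fun do rewrite mulr0; exact: cvg_cst.
rewrite -[X in _ --> X](mul0r (G x ord0 i)); apply: cvgMl.
rewrite -[X in _ --> X](subrr (phi (u x))); apply: cvgB; last exact: cvg_cst.
apply: compress_cvg.
have sq : g (u_ (s k) x) - g (u x) @[k --> \oo] --> (0 : R).
  by apply: (square_cvg0 Gx); have /fine_cvg := Px i.
rewrite -[X in _ --> X](add0r (g (u x))).
rewrite (_ : (fun k => compress _) = (fun k => g (u_ (s k) x) - g (u x) + g (u x))); last first.
  by apply/funext => k; rewrite subrK.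
by apply: cvgD => //; exact: cvg_cst.
Qed.

End sequence.

(** Three nested extractions: almost everywhere convergence of the gradients by nondegeneracy, then
    of the functions by the modular inequality and positivity of [N], then of the images. *)
Let image_subseq u_ G_ : (forall k, bweak (u_ k) (G_ k)) -> (forall k, supported (G_ k)) ->
  (forall k, levels (fun x => u_ k x - u x)) -> diff_modular G_ ->
  exists s : nat -> nat, (forall i j, (i < j)%N -> (s i < s j)%N) /\
    image_modular u_ G_ (s k) @[k --> \oo] --> 0%E.
Proof.
move=> wu_ sG_ lw Pc.
have bigT : \bigcup_(m : nat) (setT : set V) = setT by apply/seteqP; split => // x _; exists 0%N.
have mP_ (s : nat -> nat) k : measurable_fun setT (fun x => Phi (lam^-1 *: (G_ (s k) x - G x))).
  apply: mP; apply: (measurableT_comp (measurable_scalerV _)); apply: measurable_funD_rV.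
    by case: (wu_ (s k)) => _ lG _; exact: measurable_gradient.
  by under eq_fun do rewrite -scaleN1r; exact: (measurableT_comp (measurable_scalerV _) mG).
have mw_ (s : nat -> nat) k : measurable_fun setT (fun x => u_ (s k) x - u x).
  by apply: measurable_funB => //; case: (wu_ (s k)) => [[]].
have [s1 [s1i s1P]] := @integral_cvg0_subseq _ _ _ mu 'I_1 (fun=> setT)
  (fun _ k x => Phi (lam^-1 *: (G_ k x - G x))) (fun=> measurableT) (fun i j _ => @subset_refl _ setT) bigT
  (fun _ => mP_ id) (fun _ k x => P_ge0 _) (fun _ _ => Pc).
have aeG : {ae mu, forall x, forall i, (lam^-1 *: (G_ (s1 k) x - G x)) ord0 i @[k --> \oo] --> (0 : R)}.
  by apply: filterS (s1P ord0) => x; exact: nondegenerate_cvg0.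
have Nc := @sobolev_modular_cvg (u_ \o s1) (G_ \o s1) (fun k => wu_ _) (fun k => sG_ _) (fun k => lw _)
  (cvg_subseq s1i Pc) 1 ltr01 aeG.
have mN1 k : measurable_fun setT (fun x => N (1 * `|u_ (s1 k) x - u x|)).
  by apply: mN; apply: measurable_funM => //; exact: (measurableT_comp _ (mw_ s1 k)).
have [s2 [s2i s2P]] := @integral_cvg0_subseq _ _ _ mu 'I_1 (fun=> setT)
  (fun _ k x => N (1 * `|u_ (s1 k) x - u x|)) (fun=> measurableT) (fun i j _ => @subset_refl _ setT) bigT
  (fun _ => mN1) (fun _ k x => N_ge0 _) (fun _ _ => Nc).
have aeu : {ae mu, forall x, u_ (s1 (s2 k)) x - u x @[k --> \oo] --> (0 : R)}.
  apply: filterS (s2P ord0) => x /fine_cvgP[F H]; apply/cvgrPdist_lt => eps eps0.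
  (* Monotonicity of [N] turns smallness of [N |u_k - u|] below this positive value into
     [|u_k - u| < eps]. *)
  have Ne : (0 < N eps)%E by exact: (sobolev_conjugate_gt0 n2 yA1 conv1 finA1 div1).
  have [e e0 eN] : exists2 e : R, 0 < e & (e%:E <= N eps)%E.
    move: Ne; case: (N eps) => [r|_|]//; last by exists 1; rewrite ?leey.
    by rewrite lte_fin => r0; exists r.
  near=> k; rewrite sub0r normrN.
  have Fk : N (1 * `|u_ (s1 (s2 k)) x - u x|) \is a fin_num by near: k.
  have : (N (1 * `|u_ (s1 (s2 k)) x - u x|)%R < e%:E)%E.
    by rewrite -(fineK Fk) lte_fin; near: k; exact: (cvgr_lt _ H).
  move/lt_le_trans => /(_ _ eN); rewrite mul1r !ltNge; apply: contra; exact: N_homo.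
have [s3 [s3i s3P]] := @image_subseq_ae (u_ \o (s1 \o s2)) (G_ \o (s1 \o s2)) (fun k => wu_ _) (fun k => sG_ _)
  (fun k => lw _) (cvg_subseq s2i (cvg_subseq s1i Pc))
  (filterS (fun x (Hx : forall i, _) i => cvg_subseq s2i (Hx i)) aeG) aeu.
exists (s1 \o s2 \o s3); split => // i j ij; exact/s1i/s2i/s3i.
Unshelve. all: by end_near. Qed.

Lemma image_modular_cvg u_ G_ : (forall k, bweak (u_ k) (G_ k)) -> (forall k, supported (G_ k)) ->
  (forall k, levels (fun x => u_ k x - u x)) -> diff_modular G_ ->
  image_modular u_ G_ k @[k --> \oo] --> 0%E.
Proof.
move=> wu_ sG_ lw Pc; apply: subsubseq_cvg0 => [k|s sinc].
  by apply: integral_ge0 => x _; exact: young_rV_ge0.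
exact: (@image_subseq (u_ \o s) (G_ \o s) (fun k => wu_ _) (fun k => sG_ _) (fun k => lw _) (cvg_subseq sinc Pc)).
Qed.

End continuity.
End composition.

(** * The operator on Lebesgue measurable functions *)

Section operator.
Context {R : realType} {n : nat}.
Local Notation V := 'rV[R]_n.
Local Notation mu := (@borel_lebesgue R n).
Local Notation lam := (lebesgue_rV R n).
Variables (Omega : set V) (Phi Psi : V -> \bar R) (f phi : R -> R) (kappa : R).
Hypothesis mOmega : measurable Omega.
Hypothesis yPhi : young_rV Phi.
Hypothesis yPsi : young_rV Psi.
Hypothesis kappa0 : 0 < kappa.
Hypothesis cf : continuous f.
Hypothesis f0 : f 0 = 0.
Hypothesis mphi : measurable_fun setT phi.

Let supported (H : V -> V) := forall x, ~ Omega x -> H x = 0.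
Let levels (u : V -> R) := forall t : R, 0 < t -> (mu [set x | (t < `|u x|)%R] < +oo)%E.

Hypothesis composition : forall (u : V -> R) G (l : R), bweak u G -> supported G -> levels u -> 0 < l ->
  (\int[mu]_x Phi (l^-1 *: G x)%R < +oo)%E ->
  bweak (f \o u) (fun x => phi (u x) *: G x) /\
  (\int[mu]_x Psi ((kappa * l)^-1 *: (phi (u x) *: G x))%R < +oo)%E.

Hypothesis continuity : forall (u : V -> R) G (l : R), bweak u G -> supported G -> levels u -> 0 < l ->
  (\int[mu]_x Phi (l^-1 *: G x)%R < +oo)%E ->
  forall u_ G_, (forall k, bweak (u_ k) (G_ k)) -> (forall k, supported (G_ k)) ->
  (forall k, levels (fun x => u_ k x - u x)) ->
  (\int[mu]_x Phi (l^-1 *: (G_ k x - G x))%R)%E @[k --> \oo] --> 0%E ->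
  (\int[mu]_x Psi ((4 * kappa * l)^-1 *: (phi (u_ k x) *: G_ k x - phi (u x) *: G x))%R)%E @[k --> \oo] --> 0%E.

Let mf : measurable_fun setT f. Proof. exact: continuous_measurable_fun. Qed.

Let mgrad (u : V -> R) G : bweak u G -> measurable_fun setT G.
Proof. by case=> _ lG _; exact: measurable_gradient. Qed.

Let mfun (u : V -> R) G : bweak u G -> measurable_fun setT u.
Proof. by case=> [[]]. Qed.

Let mscale (a : R) (H : V -> V) : measurable_fun setT H -> measurable_fun setT (fun x => a *: H x).
Proof. exact: (measurableT_comp (measurable_scalerV a)). Qed.

Let msub (H K : V -> V) : measurable_fun setT H -> measurable_fun setT K ->
  measurable_fun setT (fun x => H x - K x).
Proof.
move=> mH mK; apply: measurable_funD_rV => //.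
by under eq_fun do rewrite -scaleN1r; exact: mscale.
Qed.

Let integral_supported (P : V -> \bar R) (H : V -> V) : young_rV P -> supported H ->
  (\int[mu]_(x in Omega) P (H x) = \int[mu]_x P (H x))%E.
Proof.
move=> yP sH; rewrite integral_mkcond; congr (integral _ _ _); apply/funext => x.
rewrite patchE; case: ifPn => // /negP xO; rewrite sH ?(young_rV_0 yP)//.
by move=> Ox; apply: xO; rewrite inE.
Qed.

(** The extension by 0 vanishes off [Omega], and by [bweak_null] its gradient is 0 almost everywhere
    on its zero set. The gradient can thus be redefined as 0 off [Omega], whatever the boundary
    looks like. *)
Lemma supported_version (v : V -> R) G : weak_gradient (v \_ Omega) G -> exists v' G',
  [/\ bweak v' G', {ae mu, forall x, (v \_ Omega) x = v' x}, {ae mu, forall x, G x = G' x} & supported G'].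
Proof.
move=> /weak_gradient_bweak[v1 [G1 [w1 vv GG]]].
have n0 : {ae mu, forall x, [set 0 : R] (v1 x) -> G1 x = 0}.
  by apply: (bweak_null w1); [exact: measurable_set1|exact: lebesgue_measure_set1].
have m1 : measurable_fun setT (\1_Omega : V -> R) by exact: measurable_indic.
have GE : {ae mu, forall x, G1 x = \1_Omega x *: G1 x}.
  move: vv n0; apply: filterS2 => x vx Nx; rewrite indicE; case: (boolP (x \in Omega)) => xO.
    by rewrite scale1r.
  by rewrite scale0r; apply: Nx; rewrite /= -vx patchE (negbTE xO).
have mG1 := mgrad w1; have mH : measurable_fun setT (fun x => \1_Omega x *: G1 x) by exact: measurable_funZ_rV.
exists v1, (fun x => \1_Omega x *: G1 x); split => //.
- by apply: (bweak_ae w1 (mfun w1) mH _ GE); exact: aeW.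
- by move: GG GE; apply: filterS2 => x -> <-.
- by move=> x xO; rewrite indicE memNset// scale0r.
Qed.

(** Membership provides some gradient with finite modular, perhaps not the given one; almost
    everywhere uniqueness carries the finiteness over. *)
Lemma V10_version u G : V10 Phi Omega u -> weak_gradient (u \_ Omega) G -> exists u' G',
  [/\ bweak u' G', {ae mu, forall x, (u \_ Omega) x = u' x}, {ae mu, forall x, G x = G' x}, supported G' &
   levels u' /\ exists2 l : R, 0 < l & (\int[mu]_x Phi (l^-1 *: G' x)%R < +oo)%E].
Proof.
move=> [_ [H wH [_ [l l0 IH]]] lu] wG.
have [u' [G' [w' uu GG sG]]] := supported_version wG.
have [u2 [H' [w2 uu2 HH sH]]] := supported_version wH.
exists u', G'; split => //; split.
  by move=> t t0; apply: le_lt_trans (ae_volume_le _ (mfun w') uu) (lu t t0).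
exists l => //; apply: le_lt_trans IH.
have w3 : bweak u' H'.
  by apply: (bweak_ae w2 (mfun w') (mgrad w2)); [move: uu uu2; apply: filterS2 => x -> <-|exact: aeW].
rewrite -(@modular_integral_ae _ _ Phi setT (fun x => l^-1 *: H x) (fun x => l^-1 *: G' x))//.
- by apply: mscale; exact: mgrad w'.
- by move: HH (bweak_unique w' w3); apply: filterS2 => x -> ->.
Qed.

Let restrict_comp u x : ((f \o u) \_ Omega) x = f ((u \_ Omega) x).
Proof. by rewrite !patchE; case: ifP. Qed.

Let image_gradient u u' G' : bweak (f \o u') (fun x => phi (u' x) *: G' x) ->
  {ae mu, forall x, (u \_ Omega) x = u' x} -> weak_gradient ((f \o u) \_ Omega) (fun x => phi (u' x) *: G' x).
Proof.
move=> w uu; apply: (bweak_weak_gradient w).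
by apply: filterS uu => x ux; rewrite restrict_comp ux.
Qed.

Lemma composition_maps_bweak : composition_maps Omega Phi Psi f.
Proof.
move=> u Vu; have [mu_ [G wG _] lu] := Vu.
have [u' [G' [w' uu GG sG [lu' [l l0 IG]]]]] := V10_version Vu wG.
have [wc IP] := composition w' sG lu' l0 IG.
split.
- exact: measurableT_comp mf mu_.
- exists (fun x => phi (u' x) *: G' x); first exact: image_gradient wc uu.
  split; first by apply: measurable_borel_lebesgueT; exact: mgrad wc.
  exists (kappa * l); first by rewrite mulr_gt0.
  rewrite (@modular_integral_ae _ _ Psi setT _ (fun x => (kappa * l)^-1 *: (phi (u' x) *: G' x)))//.
    by apply: mscale; exact: mgrad wc.
  exact: aeW.
move=> t t0.
(* Continuity at 0 with [f 0 = 0] puts [{|f u| > t}] inside [{|u| > d}], which has finite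
   measure. *)
have [d d0 fd] : exists2 d : R, 0 < d & forall s : R, `|s| <= d -> `|f s| <= t.
  have cf0 : f x @[x --> (0 : R)] --> f 0 by exact: cf.
  have /cvgrPdist_le/(_ _ t0)/nbhs_ballP[e /= e0 He] := cf0.
  exists (e / 2); first by rewrite divr_gt0.
  move=> s se; have := He s; rewrite f0 sub0r normrN; apply.
  by rewrite /ball/= sub0r normrN; apply: le_lt_trans se _; rewrite ltr_pdivrMr// ltr_pMr// ltr1n.
apply: le_lt_trans (lu d d0); apply: le_outer_measure => x /=.
by rewrite restrict_comp !ltNge; apply: contra; exact: fd.
Qed.

Lemma composition_continuous_bweak : composition_modular_continuous Omega Phi Psi f.
Proof.
move=> u_ u Vu_ Vu [G_ [G [wG_ wG [l1 l10 c1]]]].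
have [u' [G' [w' uu GG sG [lu' [l2 l20 IG]]]]] := V10_version Vu wG.
have [u'_ H_] := choice (fun k => V10_version (Vu_ k) (wG_ k)).
have {H_}[G'_ H_] := choice H_.
have w'_ k : bweak (u'_ k) (G'_ k) by case: (H_ k).
have uu_ k : {ae mu, forall x, (u_ k \_ Omega) x = u'_ k x} by case: (H_ k).
have GG_ k : {ae mu, forall x, G_ k x = G'_ k x} by case: (H_ k).
have sG_ k : supported (G'_ k) by case: (H_ k).
have lu_ k : levels (u'_ k) by case: (H_ k) => _ _ _ _ [].
(* Modular convergence and finiteness of the modular of [G'] are given at different scales; both
   persist at the larger one. *)
pose l := Num.max l1 l2; have l0 : 0 < l by rewrite lt_max l10.
have invl (l' : R) : 0 < l' -> l' <= l -> `|l^-1| <= l'^-1.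
  by move=> h hl; rewrite gtr0_norm ?invr_gt0// lef_pV2.
have mP (a : R) (H : V -> V) : measurable_fun setT H -> measurable_fun setT (fun x => Phi (a *: H x)).
  by move=> mH; apply: measurableT_comp (measurable_young_rV yPhi) (mscale a mH).
have IGl : (\int[mu]_x Phi (l^-1 *: G' x)%R < +oo)%E.
  apply: le_lt_trans IG; apply: ge0_le_integral => //.
  - by move=> x _; exact: young_rV_ge0.
  - by apply: mP; exact: mgrad w'.
  - by apply: mP; exact: mgrad w'.
  - by move=> x _; apply: young_abs_le => //; apply: invl => //; rewrite le_max lexx orbT.
have mD k : measurable_fun setT (fun x => G'_ k x - G' x).
  by apply: msub; [exact: mgrad (w'_ k)|exact: mgrad w'].
have cl : (\int[mu]_x Phi (l^-1 *: (G'_ k x - G' x))%R)%E @[k --> \oo] --> 0%E.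
  apply: (squeeze_cvge _ (cvg_cst _) c1); apply: nearW => k.
  rewrite integral_ge0//=; last by move=> x _; exact: young_rV_ge0.
  rewrite (@modular_integral_ae _ _ Phi Omega _ (fun x => l1^-1 *: (G'_ k x - G' x)))//; last 2 first.
  - exact: mscale.
  - by move: (GG_ k) GG; apply: filterS2 => x -> ->.
  rewrite integral_supported//; last by move=> x Ox; rewrite (sG_ k x Ox) (sG x Ox) subr0 scaler0.
  apply: ge0_le_integral => //.
  - by move=> x _; exact: young_rV_ge0.
  - exact: mP.
  - exact: mP.
  - by move=> x _; apply: young_abs_le => //; apply: invl => //; rewrite le_max lexx.
have ld k : levels (fun x => u'_ k x - u' x).
  move=> t t0; have t2 : 0 < t / 2 by rewrite divr_gt0.
  have mA (v : V -> R) : measurable_fun setT v -> measurable [set x | t / 2 < `|v x|].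
    by move=> mv; apply: (@measurable_gt _ _ (fun x => `|v x|)); exact: measurableT_comp.
  have m1 := mA _ (mfun (w'_ k)); have m2 := mA _ (mfun w').
  apply: (@le_lt_trans _ _ (mu ([set x | t / 2 < `|u'_ k x|] `|` [set x | t / 2 < `|u' x|]))); last first.
    apply: le_lt_trans (measureU2 _ m1 m2) _; apply: lte_add_pinfty; [exact: lu_|exact: lu'].
  apply: le_measure; rewrite ?inE.
  - apply: (@measurable_gt _ _ (fun x => `|u'_ k x - u' x|)); apply: measurableT_comp => //.
    by apply: measurable_funB; [exact: mfun (w'_ k)|exact: mfun w'].
  - exact: measurableU.
  move=> x /= tx; have [h|h] := ltP (t / 2) `|u'_ k x|; [by left|right].
  have := ler_normB (u'_ k x) (u' x); lra.
have lk k : exists2 l' : R, 0 < l' & (\int[mu]_x Phi (l'^-1 *: G'_ k x)%R < +oo)%E by case: (H_ k) => _ _ _ _ [].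
have cimg := continuity w' sG lu' l0 IGl w'_ sG_ ld cl.
have [wc _] := composition w' sG lu' l0 IGl.
have wck k : bweak (f \o u'_ k) (fun x => phi (u'_ k x) *: G'_ k x).
  by have [l' l'0 Il'] := lk k; case: (composition (w'_ k) (sG_ k) (lu_ k) l'0 Il').
exists (fun k x => phi (u'_ k x) *: G'_ k x), (fun x => phi (u' x) *: G' x); split.
- by move=> k; exact: image_gradient (wck k) (uu_ k).
- exact: image_gradient wc uu.
exists (4 * kappa * l); first by rewrite !mulr_gt0.
rewrite (_ : (fun k => _) = (fun k => \int[mu]_x Psi ((4 * kappa * l)^-1 *: (phi (u'_ k x) *: G'_ k x - phi (u' x) *: G' x))%R)%E)//.
apply/funext => k.
rewrite (@modular_integral_ae _ _ Psi Omega _ (fun x => (4 * kappa * l)^-1 *: (phi (u'_ k x) *: G'_ k x - phi (u' x) *: G' x)))//.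
- by apply: integral_supported => // x Ox; rewrite (sG_ k x Ox) (sG x Ox) !scaler0 subr0 scaler0.
- by apply: mscale; apply: msub; [exact: mgrad (wck k)|exact: mgrad wc].
- exact: aeW.
Qed.

End operator.

(** Both parts of the theorem are instances: a positive constant with [Omega] of finite measure, or
    the constant 0, for which [cOmega] holds because 0 times infinity is 0. *)
Lemma composition_operator_core (R : realType) (n : nat) (n2 : (2 <= n)%N)
    (Omega : set 'rV[R]_n) (openOmega : open Omega)
    (Phi Psi : 'rV[R]_n -> \bar R)
    (yPhi : young_rV Phi) (yPsi : young_rV Psi)
    (nondegPhi : nondegenerate_young Phi)
    (f : R -> R) (lipf : [locally [lipschitz f x | x in setT]]) (f0 : f 0 = 0)
    (kappa : R) (kappa0 : 0 < kappa)
    (E : R -> R) (E_ge0 : forall t : R, 0 <= t -> 0 <= E t)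
    (E_homo : forall s t : R, 0 <= s -> s <= t -> E s <= E t)
    (E_neq0 : exists2 t : R, 0 <= t & E t != 0)
    (f'_le : {ae lebesgue_measure, forall t : R,
      derivable f t 1 /\ `|derive1 f t| <= kappa * E (kappa * `|t|)})
    (Phi1 : 'rV[R]_n -> \bar R) (A1 : R -> \bar R) (yPhi1 : young_rV Phi1) (AP1 : young_symmetral Phi1 A1)
    (conv1 : converges_at_0 n A1) (div1 : diverges_at_infty n A1)
    (r : R) (Pr : forall x, r < enorm x -> Phi1 x = Phi x)
    (theta : 'rV[R]_n -> R)
    (thetaP : implicit_theta Phi (sobolev_conjugate n A1) E theta)
    (c : R) (c0 : 0 <= c) (cOmega : (c%:E * lebesgue_rV R n Omega < +oo)%E)
    (half : forall x, (Phi1 (2^-1 *: x) <= c%:E + Phi x)%E)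
    (Psi_le : forall x, (Psi x <= c%:E + young_quotient Phi x (E (theta x)))%E) :
  composition_maps Omega Phi Psi f /\ composition_modular_continuous Omega Phi Psi f.
Proof.
have mOmega : measurable Omega by exact: open_measurable_rV.
have cO : (c%:E * @borel_lebesgue R n Omega < +oo)%E by rewrite -lebesgue_rVE.
have B0 (t : R) : 0 <= kappa * E (kappa * `|t|).
  by rewrite mulr_ge0 ?(ltW kappa0)// E_ge0// mulr_ge0// ltW.
have [phi [mphi phiE fphi]] := lipschitz_derivative lipf B0 f'_le.
have cf : continuous f.
  move=> x; have [L L0 HL] := locally_lipschitz_itv (`|x| + 1) lipf.
  apply/cvgrPdist_le => eps eps0.
  near=> y; have xy : `|x - y| <= Num.min 1 (eps / L).
    near: y; apply: cvgr_dist_le; last by rewrite lt_min ltr01 divr_gt0.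
    exact: cvg_id.
  move: xy; rewrite le_min => /andP[xy1 xy2].
  apply: le_trans (HL _ _ _ _) _; first by rewrite lerDl.
    rewrite -[y](subrK x) addrC; apply: le_trans (ler_normD _ _) _.
    by rewrite lerD2l distrC.
  by rewrite mulrC -ler_pdivlMr.
have mf : measurable_fun setT f by exact: continuous_measurable_fun.
have [Cg Cg0 grow] := growth_bound n2 yPhi yPsi yPhi1 AP1 conv1 div1 E_ge0 E_homo c0 thetaP Psi_le Pr.
have dom := young_domination n2 yPhi yPsi AP1 conv1 div1 E_ge0 E_homo c0 thetaP Psi_le.
have comp := @bweak_composition R n Omega Phi Psi Phi1 A1 E f phi kappa c Cg n2 mOmega yPhi yPsi yPhi1 AP1 conv1
  div1 c0 cO half dom Cg0 grow E_homo kappa0 mf mphi phiE fphi f0.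
split; first by apply: (@composition_maps_bweak _ _ _ _ _ _ phi kappa).
apply: (@composition_continuous_bweak _ _ _ _ _ _ phi kappa) => //.
move=> u G l wu sG lu l0 IG u_ G_ wu_ sG_ lw Pc.
exact: (image_modular_cvg n2 mOmega yPhi yPsi nondegPhi yPhi1 AP1 conv1 div1 c0 cO half dom Cg0 grow E_ge0 E_homo
  E_neq0 kappa0 mphi phiE wu sG lu l0 IG wu_ sG_ lw Pc).
Unshelve. all: by end_near. Qed.

Theorem theorem4p2 (R : realType) (n : nat) (n_ge2 : (2 <= n)%N)
    (Omega : set 'rV[R]_n) (openOmega : open Omega)
    (Phi Psi : 'rV[R]_n -> \bar R)
    (youngPhi : young_rV Phi) (youngPsi : young_rV Psi)
    (nondegPhi : nondegenerate_young Phi)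
    (Phio : R -> \bar R) (PhioP : young_symmetral Phi Phio)
    (divPhi : diverges_at_infty n Phio)
    (f : R -> R) (lipf : [locally [lipschitz f x | x in setT]]) (f0 : f 0 = 0)
    (kappa : R) (kappa_gt0 : 0 < kappa)
    (E : R -> R) (E_ge0 : forall t : R, 0 <= t -> 0 <= E t)
    (E_homo : forall s t : R, 0 <= s -> s <= t -> E s <= E t)
    (E_cont : {within `[0, +oo[, continuous E})
    (E_neq0 : exists2 t : R, 0 <= t & E t != 0)
    (f'_le : {ae lebesgue_measure, forall t : R,
      derivable f t 1 /\ `|derive1 f t| <= kappa * E (kappa * `|t|)})
    (Phi1 : 'rV[R]_n -> \bar R) (Phi1o : R -> \bar R)
    (Phi1P : regular_at_0 Phi Phio Phi1 Phi1o)
    (theta : 'rV[R]_n -> R)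
    (thetaP : implicit_theta Phi (sobolev_conjugate n Phi1o) E theta) :
  ((lebesgue_rV R n Omega < +oo)%E ->
   (exists2 c : R, 0 < c & forall x,
      (Psi x <= c%:E + young_quotient Phi x (E (theta x)))%E) ->
   composition_maps Omega Phi Psi f /\
   composition_modular_continuous Omega Phi Psi f)
  /\
  (converges_at_0 n Phio ->
   (forall x, (Psi x <= young_quotient Phi x (E (theta x)))%E) ->
   composition_maps Omega Phi Psi f /\
   composition_modular_continuous Omega Phi Psi f).
Proof.
have [yPhi1 AP1 conv1 [r Pr] _] := Phi1P.
have [div1 [c1 c10 [half c1E]]] := regular_at_0_modification n_ge2 youngPhi PhioP divPhi Phi1P.
split=> [Ofin [c c0 Psi_le]|conv Psi_le].
  (* One constant serves both the growth condition on [Psi] and the comparison of [Phi1] with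
     [Phi]. *)
  have cm : 0 <= Num.max c c1 by rewrite le_max c10 orbT.
  apply: (composition_operator_core (c := Num.max c c1) (theta := theta) n_ge2 openOmega youngPhi youngPsi nondegPhi lipf f0
    kappa_gt0 E_ge0 E_homo E_neq0 f'_le yPhi1 AP1 conv1 div1 Pr thetaP cm).
  - by rewrite lte_mul_pinfty// lee_fin.
  - by move=> x; apply: le_trans (half x) _; rewrite leeD2r// lee_fin le_max lexx orbT.
  - by move=> x; apply: le_trans (Psi_le x) _; rewrite leeD2r// lee_fin le_max lexx.
apply: (composition_operator_core (c := 0) (theta := theta) n_ge2 openOmega youngPhi youngPsi nondegPhi lipf f0
  kappa_gt0 E_ge0 E_homo E_neq0 f'_le yPhi1 AP1 conv1 div1 Pr thetaP (lexx 0)).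
- by rewrite mul0e.
- by move=> x; rewrite -(c1E conv).
- by move=> x; rewrite add0e.
Qed.
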